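(* For every $k\ge 2$ the pair $(NL_k,G_k)$ is (locally) dual; that is: (i) the tangent algebra of every local analytic loop from the variety $G_k$ belongs to the variety $NL_k$; and (ii) every finite-dimensional $\mathbb{R}$-algebra from the variety $NL_k$ is the tangent algebra of some local analytic loop from the variety $G_k$.
   Context: A loop is a set with a binary operation having a neutral element $e$ such that the equations $ax=b$ and $ya=b$ have unique solutions. A Moufang loop is a loop satisfying $(xy)(zx)=x(yz)x$; it is diassociative (any two elements generate a subgroup). Its commutator is $[x,y]=x^{-1}y^{-1}xy$ and its associator is $(a,b,c)=((ab)c)(a(bc))^{-1}$. Let $F$ be a free Moufang loop on infinitely many generators, $F^1=F$, and let $F^k$ be the normal subloop generated by all $[F^i,F^{k-i}]$, $1\le i\le k-1$. $G_k$ is the variety of Moufang loops defined by all identities $(w,x,y)=1$ with $w\in F^k$. A local analytic loop is a neighbourhood of $e$ in a finite-dimensional real analytic manifold with loop operations defined analytically near $e$; it belongs to a variety if the defining identities hold near $e$. Its tangent algebra is the tangent space at $e$ with the bracket given, in analytic coordinates centred at $e$ in which $x\cdot y=x+y+B(x,y)+\cdots$ up to second order ($B$ bilinear), by $[x,y]=B(x,y)-B(y,x)$. By theorems of Malcev and Kuzmin, the tangent algebras of local analytic Moufang loops are exactly the finite-dimensional real Malcev algebras. A Malcev algebra is an algebra with $[x,x]=0$ and $[J(x,y,z),x]=J(x,y,[x,z])$, where $J(x,y,z)=[[x,y],z]+[[y,z],x]+[[z,x],y]$. $NL_k$ is the variety of Malcev algebras (over $\mathbb{R}$) defined by the identities $J([x_1,\dots,x_k],y,z)=0$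 for all distributions of parentheses in $[x_1,\dots,x_k]$. *)

(* Defs.v *)
(* The field of real numbers is an arbitrary R : realType. *)
From HB Require Import structures.
From mathcomp Require Import all_boot all_order all_algebra.
From mathcomp Require Import all_classical all_reals all_analysis.

Set Implicit Arguments.
Unset Strict Implicit.
Unset Printing Implicit Defensive.

Import Order.TTheory GRing.Theory Num.Theory.
Import numFieldNormedType.Exports.

Local Open Scope classical_set_scope.
Local Open Scope ring_scope.

(* [ldiv a b] is a \ b and [rdiv b a] is b / a. *)
Record loop_ops (T : Type) := LoopOps {
  mul : T -> T -> T;
  ldiv : T -> T -> T;
  rdiv : T -> T -> T;
  one : T }.

Record loop := Loop {
  loop_sort :> Type;
  lops : loop_ops loop_sort;
  one_mul : forall x, mul lops (one lops) x = x;
  mul_one : forall x, mul lops x (one lops) = x;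
  ldivP : forall a b x, mul lops a x = b <-> x = ldiv lops a b;
  rdivP : forall a b y, mul lops y a = b <-> y = rdiv lops b a }.

(* Parentheses in a product x^-1 y^-1 x y are immaterial in a diassociative
   loop; likewise the left and right inverses agree there. *)
Section Operations.
Variables (T : Type) (o : loop_ops T).
Definition inv x := ldiv o x (one o).
Definition commutator x y := mul o (mul o (mul o (inv x) (inv y)) x) y.
Definition associator a b c :=
  mul o (mul o (mul o a b) c) (inv (mul o a (mul o b c))).
End Operations.

Definition is_moufang (L : loop) := forall x y z : L,
  let m := mul (lops L) in m (m x y) (m z x) = m (m x (m y z)) x.

Inductive word :=
  | WVar of nat
  | WOne
  | WMul of word & word
  | WLdiv of word & word
  | WRdiv of word & word.

HB.instance Definition _ := gen_eqMixin word.
HB.instance Definition _ := gen_choiceMixin word.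

Definition word_ops : loop_ops word := LoopOps WMul WLdiv WRdiv WOne.

Fixpoint eval T (o : loop_ops T) (rho : nat -> T) (w : word) : T :=
  match w with
  | WVar i => rho i
  | WOne => one o
  | WMul u v => mul o (eval o rho u) (eval o rho v)
  | WLdiv u v => ldiv o (eval o rho u) (eval o rho v)
  | WRdiv u v => rdiv o (eval o rho u) (eval o rho v)
  end.

(* An identity is a pair of words, a set of identities a relation. *)
Inductive loop_law : word -> word -> Prop :=
  | Law1x : loop_law (WMul WOne (WVar 0)) (WVar 0)
  | Lawx1 : loop_law (WMul (WVar 0) WOne) (WVar 0)
  | LawMl : loop_law (WMul (WVar 0) (WLdiv (WVar 0) (WVar 1))) (WVar 1)
  | LawlM : loop_law (WLdiv (WVar 0) (WMul (WVar 0) (WVar 1))) (WVar 1)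
  | LawrM : loop_law (WMul (WRdiv (WVar 1) (WVar 0)) (WVar 0)) (WVar 1)
  | LawMr : loop_law (WRdiv (WMul (WVar 1) (WVar 0)) (WVar 0)) (WVar 1).

Inductive moufang_law : word -> word -> Prop :=
  | LawMoufang : let x := WVar 0 in let y := WVar 1 in let z := WVar 2 in
      moufang_law (WMul (WMul x y) (WMul z x)) (WMul (WMul x (WMul y z)) x).

(* The free Moufang loop on the generators [free_gen i], i : nat, is the set
   of words modulo the equational consequences of the Moufang loop axioms;
   [eval word_ops s] is substitution. See [free_moufang_universal]. *)
Inductive moufang_eq : word -> word -> Prop :=
  | MeqLoop s u v : loop_law u v ->
      moufang_eq (eval word_ops s u) (eval word_ops s v)
  | MeqMoufang s u v : moufang_law u v ->
      moufang_eq (eval word_ops s u) (eval word_ops s v)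
  | MeqRefl u : moufang_eq u u
  | MeqSym u v : moufang_eq u v -> moufang_eq v u
  | MeqTrans u v w : moufang_eq u v -> moufang_eq v w -> moufang_eq u w
  | MeqMul u v u' v' : moufang_eq u u' -> moufang_eq v v' ->
      moufang_eq (WMul u v) (WMul u' v')
  | MeqLdiv u v u' v' : moufang_eq u u' -> moufang_eq v v' ->
      moufang_eq (WLdiv u v) (WLdiv u' v')
  | MeqRdiv u v u' v' : moufang_eq u u' -> moufang_eq v v' ->
      moufang_eq (WRdiv u v) (WRdiv u' v').

Definition moufang_eqb (u v : word) : bool := `[< moufang_eq u v >].

Lemma moufang_eqb_refl : reflexive moufang_eqb.
Proof. by move=> u; apply/asboolP; apply: MeqRefl. Qed.

Lemma moufang_eqb_sym : symmetric moufang_eqb.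
Proof. by move=> u v; apply/asboolP/asboolP; apply: MeqSym. Qed.

Lemma moufang_eqb_trans : transitive moufang_eqb.
Proof. move=> v u w /asboolP uv /asboolP vw; apply/asboolP; exact: MeqTrans vw. Qed.

Canonical moufang_equiv :=
  EquivRel moufang_eqb moufang_eqb_refl moufang_eqb_sym moufang_eqb_trans.

Definition free_sort := {eq_quot moufang_equiv}%qT.

Definition free_cl (u : word) : free_sort := (\pi_free_sort u)%qT.

Lemma free_clP u v : free_cl u = free_cl v <-> moufang_eq u v.
Proof.
split=> [/eqquotP /asboolP //|uv].
by apply/eqquotP; apply/asboolP.
Qed.

Lemma free_clK (a : free_sort) : free_cl (repr a) = a.
Proof. exact: reprK. Qed.

Definition free_op (op : word -> word -> word) (a b : free_sort) : free_sort :=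
  free_cl (op (repr a) (repr b)).

Definition free_ops : loop_ops free_sort :=
  LoopOps (free_op WMul) (free_op WLdiv) (free_op WRdiv) (free_cl WOne).

Definition free_gen (i : nat) : free_sort := free_cl (WVar i).

Lemma repr_cl u : moufang_eq (repr (free_cl u)) u.
Proof. by apply/free_clP; rewrite free_clK. Qed.

Lemma free_mulE u v : mul free_ops (free_cl u) (free_cl v) = free_cl (WMul u v).
Proof. by apply/free_clP; apply: MeqMul; apply: repr_cl. Qed.

Lemma free_ldivE u v :
  ldiv free_ops (free_cl u) (free_cl v) = free_cl (WLdiv u v).
Proof. by apply/free_clP; apply: MeqLdiv; apply: repr_cl. Qed.

Lemma free_rdivE u v :
  rdiv free_ops (free_cl u) (free_cl v) = free_cl (WRdiv u v).
Proof. by apply/free_clP; apply: MeqRdiv; apply: repr_cl. Qed.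

Definition subst2 (u v : word) (i : nat) : word := if i is 0%N then u else v.

Lemma free_one_mul x : mul free_ops (one free_ops) x = x.
Proof.
rewrite -(free_clK x) [one _]/(free_cl WOne) free_mulE; apply/free_clP.
exact: (MeqLoop (subst2 (repr x) (repr x)) Law1x).
Qed.

Lemma free_mul_one x : mul free_ops x (one free_ops) = x.
Proof.
rewrite -(free_clK x) [one _]/(free_cl WOne) free_mulE; apply/free_clP.
exact: (MeqLoop (subst2 (repr x) (repr x)) Lawx1).
Qed.

Lemma free_ldivP a b x : mul free_ops a x = b <-> x = ldiv free_ops a b.
Proof.
rewrite -(free_clK a); split=> [<-|->].
  rewrite -(free_clK x) free_mulE free_ldivE; apply/free_clP/MeqSym.
  exact: (MeqLoop (subst2 (repr a) (repr x)) LawlM).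
rewrite -(free_clK b) free_ldivE free_mulE; apply/free_clP.
exact: (MeqLoop (subst2 (repr a) (repr b)) LawMl).
Qed.

Lemma free_rdivP a b y : mul free_ops y a = b <-> y = rdiv free_ops b a.
Proof.
rewrite -(free_clK a); split=> [<-|->].
  rewrite -(free_clK y) free_mulE free_rdivE; apply/free_clP/MeqSym.
  exact: (MeqLoop (subst2 (repr a) (repr y)) LawMr).
rewrite -(free_clK b) free_rdivE free_mulE; apply/free_clP.
exact: (MeqLoop (subst2 (repr a) (repr b)) LawrM).
Qed.

Definition free_moufang : loop :=
  Loop free_one_mul free_mul_one free_ldivP free_rdivP.

Lemma free_moufangP : is_moufang free_moufang.
Proof.
move=> x y z; cbv zeta; change (lops free_moufang) with free_ops.
rewrite -(free_clK x) -(free_clK y) -(free_clK z).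
move: (repr x) (repr y) (repr z) => u v w.
rewrite (free_mulE u v) (free_mulE w u) (free_mulE v w).
rewrite (free_mulE _ (WMul w u)) (free_mulE u (WMul v w)) (free_mulE _ u).
apply/free_clP.
exact: (MeqMoufang (fun i => if i is i'.+1 then subst2 v w i' else u)
          LawMoufang).
Qed.

Lemma eval_free_gen w : eval free_ops free_gen w = free_cl w.
Proof.
elim: w => //= u -> v ->;
  [exact: free_mulE|exact: free_ldivE|exact: free_rdivE].
Qed.

Lemma free_moufang_universal (L : loop) (f : nat -> L) : is_moufang L ->
  exists! h : free_moufang -> L,
    (forall x y, h (mul free_ops x y) = mul (lops L) (h x) (h y)) /\
    (forall i, h (free_gen i) = f i).
Proof.
move=> mL; set o := lops L.
have evS s w : eval o f (eval word_ops s w) = eval o (eval o f \o s) w.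
  by elim: w => //= u -> v ->.
have evE u v : moufang_eq u v -> eval o f u = eval o f v.
  elim=> {u v} //= [s u v luv|s u v|u v w _ -> _ ->|u v u' v' _ -> _ ->|
    u v u' v' _ -> _ ->|u v u' v' _ -> _ ->] //.
    rewrite !evS; case: luv => /=; rewrite /o ?one_mul ?mul_one //.
    - exact/ldivP.
    - by apply/esym/ldivP.
    - exact/rdivP.
    - by apply/esym/rdivP.
  by rewrite !evS => -[] /=; apply: mL.
pose h (a : free_moufang) : L := eval o f (repr a).
have hE w : h (free_cl w) = eval o f w by apply: evE; apply: repr_cl.
exists h; split.
  split=> [x y|i]; last exact: hE.
  by rewrite -{1}(free_clK x) -{1}(free_clK y) free_mulE hE.
move=> g [gM gX]; apply/funext => a; rewrite -(free_clK a) hE.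
have gld x y : g (ldiv free_ops x y) = ldiv o (g x) (g y).
  by apply/(ldivP (l := L)); rewrite -gM; congr g; apply/(ldivP (l := free_moufang)).
have grd x y : g (rdiv free_ops x y) = rdiv o (g x) (g y).
  by apply/(rdivP (l := L)); rewrite -gM; congr g; apply/(rdivP (l := free_moufang)).
elim: (repr a) => //= [i||u IHu v IHv|u IHu v IHv|u IHu v IHv].
- exact/esym/gX.
- have : mul o (g (free_cl WOne)) (g (free_cl WOne)) = g (free_cl WOne).
    by rewrite -gM; congr g; apply: free_one_mul.
  move=> /(ldivP (l := L)) ->; apply/(ldivP (l := L)); exact: mul_one.
- by rewrite IHu IHv -gM free_mulE.
- by rewrite IHu IHv -gld free_ldivE.
- by rewrite IHu IHv -grd free_rdivE.
Qed.

Section Series.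
Variable L : loop.
Local Notation m := (mul (lops L)).

Definition subloop (N : set L) := [/\ N (one (lops L)),
  forall x y, N x -> N y -> N (m x y),
  forall x y, N x -> N y -> N (ldiv (lops L) x y) &
  forall x y, N x -> N y -> N (rdiv (lops L) x y)].

Definition normal_subloop (N : set L) := subloop N /\ forall x y,
  [/\ m x @` N = m^~ x @` N,
      m x @` (m y @` N) = m (m x y) @` N &
      m^~ y @` (m^~ x @` N) = m^~ (m x y) @` N].

Definition normal_closure (S : set L) : set L :=
  [set x | forall N, normal_subloop N -> S `<=` N -> N x].

Definition commutators (A B : set L) : set L :=
  [set commutator (lops L) a b | a in A & b in B].

(* [series k] is L^k for k >= 1; the recursion is on the auxiliary argument
   [d], any d >= k giving the same set, see [seriesE]. *)
Fixpoint series_rec (d k : nat) : set L :=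
  if d is d'.+1 then
    if (k <= 1)%N then setT else
    normal_closure (\bigcup_(i in [set i | (1 <= i <= k.-1)%N])
      commutators (series_rec d' i) (series_rec d' (k - i)))
  else setT.
Definition series (k : nat) : set L := series_rec k k.

Lemma series_rec_stable d k : (k <= d)%N -> series_rec d k = series k.
Proof.
rewrite /series; elim/ltn_ind: k d => -[|k] IH [|d] //= kd.
case: ifP => // _; congr normal_closure.
apply: eq_bigcupr => i /= /andP[i0 ik].
have ki : (k.+1 - i <= k)%N by rewrite leq_subLR addnC -addn1 leq_add2l.
rewrite !(IH i) ?ltnS // ?(leq_trans ik) //.
by rewrite !(IH (k.+1 - i)%N) ?ltnS // (leq_trans ki).
Qed.

Lemma series1 : series 1 = setT. Proof. by []. Qed.

Lemma seriesE k : (2 <= k)%N ->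
  series k = normal_closure (\bigcup_(i in [set i | (1 <= i <= k.-1)%N])
    commutators (series i) (series (k - i))).
Proof.
case: k => // k k2; rewrite [LHS]/series [LHS]/= leqNgt k2; congr normal_closure.
apply: eq_bigcupr => i /= /andP[i0 ik].
by rewrite !series_rec_stable // leq_subLR addnC -addn1 leq_add2l.
Qed.

End Series.
Arguments series : clear implicits.

Inductive G_law (k : nat) : word -> word -> Prop :=
  | G_moufang u v : moufang_law u v -> G_law k u v
  | G_assoc w i j : series free_moufang k (eval free_ops free_gen w) ->
      G_law k (associator word_ops w (WVar i) (WVar j)) WOne.

Section Manifolds.
Variable R : realType.

(* Sum of the terms of degree < N in each variable of a power series. *)
Definition psum m (N : nat) (c : {ffun 'I_m -> nat} -> R) (v : 'rV[R]_m) : R :=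
  \sum_(a : {ffun 'I_m -> 'I_N})
    c [ffun i => a i : nat] * \prod_i v 0 i ^+ a i.

(* The coefficients [c] are indexed by exponent vectors; near [a] each
   coordinate of [f] is the sum of a power series converging absolutely on a
   polydisc ([`|_|] is the sup norm on row vectors). *)
Definition analytic_at m n (f : 'rV[R]_m -> 'rV[R]_n) (a : 'rV[R]_m) :=
  forall j : 'I_n, exists c : {ffun 'I_m -> nat} -> R, exists2 r : R, 0 < r &
    (exists C, forall N, psum N (fun e => `|c e|) (const_mx r) <= C) /\
    (forall v : 'rV[R]_m, `|v| < r ->
       (fun N => psum N c v) @ \oo --> f (a + v) 0 j).

(* [fwd] and [bwd] are only meaningful on [dom] and [cod]. *)
Record chart (M : topologicalType) (n : nat) := Chart {
  dom : set M;
  cod : set 'rV[R]_n;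
  fwd : M -> 'rV[R]_n;
  bwd : 'rV[R]_n -> M;
  dom_open : open dom;
  cod_open : open cod;
  fwd_cod : forall x, dom x -> cod (fwd x);
  bwd_dom : forall v, cod v -> dom (bwd v);
  fwdK : forall x, dom x -> bwd (fwd x) = x;
  bwdK : forall v, cod v -> fwd (bwd v) = v;
  fwd_cont : forall x, dom x -> {for x, continuous fwd};
  bwd_cont : forall v, cod v -> {for v, continuous bwd} }.

Definition analytic_transition (M : topologicalType) n (c d : chart M n) :=
  forall x, dom c x -> dom d x -> analytic_at (fwd d \o bwd c) (fwd c x).

Record manifold (n : nat) := Manifold {
  pt :> topologicalType;
  pt_hausdorff : hausdorff_space pt;
  pt_second_countable : @second_countable pt;
  atlas : set (chart pt n);
  atlas_cover : forall x, exists2 c, atlas c & dom c x;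
  atlas_compat : forall c d, atlas c -> atlas d -> analytic_transition c d }.

Definition analytic_chart n (M : manifold n) (c : chart M n) :=
  forall d, atlas d -> analytic_transition c d /\ analytic_transition d c.

Definition coord_op (M : topologicalType) n (c1 c2 c : chart M n)
    (op : M -> M -> M) (x y : 'rV[R]_n) : 'rV[R]_n :=
  fwd c (op (bwd c1 x) (bwd c2 y)).

Definition analytic_op_at n (M : manifold n) (op : M -> M -> M) (x y : M) :=
  exists c1 c2 c : chart M n,
    [/\ [/\ atlas c1, atlas c2 & atlas c], dom c1 x /\ dom c2 y,
        (\forall p \near (x, y), dom c (op p.1 p.2)) &
        analytic_at (fun v : 'rV[R]_(n + n) =>
            coord_op c1 c2 c op (lsubmx v) (rsubmx v))
          (row_mx (fwd c1 x) (fwd c2 y))].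

Definition holds_near (M : topologicalType) (o : loop_ops M) (u v : word) :=
  exists2 U, nbhs (one o) U &
    forall rho : nat -> M, (forall i, U (rho i)) -> eval o rho u = eval o rho v.

(* The neighbourhood of e is a manifold in its own right. The operations are
   total functions standing for their germs at (e, e): nothing is required of
   them away from e. *)
Record local_loop := LocalLoop {
  ldim : nat;
  lman : manifold ldim;
  llops : loop_ops lman;
  llops_analytic : forall op, op = mul llops \/ op = ldiv llops \/
      op = rdiv llops ->
    \forall x \near one llops & y \near one llops, analytic_op_at op x y;
  llops_law : forall u v, loop_law u v -> holds_near llops u v }.

Definition in_G (k : nat) (L : local_loop) :=
  forall u v, G_law k u v -> holds_near (llops L) u v.

Definition is_algebra (V : lmodType R) (br : V -> V -> V) :=
  (forall x, linear (br x)) /\ (forall y, linear (br^~ y)).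

(* f(x, y) = x + y + B(x, y) + O(3); on pairs [`|_|] is the sup norm. *)
Definition second_order n (f B : 'rV[R]_n -> 'rV[R]_n -> 'rV[R]_n) :=
  is_algebra B /\ exists C : R,
    \forall p \near ((0, 0) : 'rV[R]_n * 'rV[R]_n),
      `|f p.1 p.2 - (p.1 + p.2 + B p.1 p.2)| <= C * `|p| ^+ 3.

(* The finite-dimensional algebra (A, br) is, up to isomorphism, the tangent
   algebra of L, computed in some analytic coordinates centred at e. *)
Definition is_tangent_algebra (L : local_loop) (A : vectType R)
    (br : A -> A -> A) :=
  let n := ldim L in let e := one (llops L) in
  exists (c : chart (lman L) n) (B : 'rV[R]_n -> 'rV[R]_n -> 'rV[R]_n)
      (T : {linear A -> 'rV[R]_n}),
    [/\ [/\ analytic_chart c, dom c e & fwd c e = 0],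
        second_order (coord_op c c c (mul (llops L))) B,
        bijective T &
        forall x y, T (br x y) = B (T x) (T y) - B (T y) (T x)].

Section Malcev.
Variables (V : lmodType R) (br : V -> V -> V).

Definition jac x y z := br (br x y) z + br (br y z) x + br (br z x) y.

Definition is_malcev := [/\ is_algebra br, forall x, br x x = 0 &
  forall x y z, br (jac x y z) x = jac x y (br x z)].
End Malcev.

Inductive bracketing := Leaf | Node of bracketing & bracketing.

Fixpoint leaves t := if t is Node l r then (leaves l + leaves r)%N else 1%N.

(* The product of x 0, x 1, and so on up to x (leaves t - 1), in this order,
   with the parentheses given by [t]. *)
Fixpoint bracket (V : Type) (br : V -> V -> V) t (x : nat -> V) : V :=
  if t is Node l r
  then br (bracket br l x) (bracket br r (fun i => x (leaves l + i)%N))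
  else x 0%N.

Definition in_NL (k : nat) (V : lmodType R) (br : V -> V -> V) :=
  is_malcev br /\ forall t, leaves t = k ->
    forall (x : nat -> V) y z, jac br (bracket br t x) y z = 0.

End Manifolds.

(* Submission.v *)
From HB Require Import structures.
From mathcomp Require Import all_boot all_order all_algebra.
From mathcomp Require Import all_classical all_reals all_analysis.
From mathcomp Require Import ring lra zify.
From Pilot Require Import Defs.

Set Implicit Arguments.
Unset Strict Implicit.
Unset Printing Implicit Defensive.

Import Order.TTheory GRing.Theory Num.Theory.
Import numFieldNormedType.Exports.

Local Open Scope classical_set_scope.
Local Open Scope ring_scope.


(** Part (ii) goes through Lie algebras with triality. For a Malcev algebra A, the space [tri] = Der
    A + A_+ + A_- carries a Lie bracket [tb] and an action of S_3 generated by [rho] and [sig]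
    ([tb_lie], [rho_hom], [sig_hom]); it exists because D_{a,b} = [ad a, ad b] + ad [a,b] is a
    derivation ([Dab_facts]). Let x_1, x_2, x_3 be the images of x in A_- under 1, [rho], [rho]^2;
    they commute and add up to 0. In the local group that the Baker-Campbell-Hausdorff (BCH) series
    defines on [tri], the word x_3^-1 y_1 x_2^-1 is inverted by [sig], hence equals z_1 for a unique
    z, and z is the product xy on A near 0. The same element is y_2^-1 x_1 y_3^-1 ([mulF2]), after
    which the Moufang identity is a cancellation of words ([moufangA]). The second-order term of xy
    is [x,y]/2 ([ac_second]), so the tangent algebra is A.

    This loop lies in G_k. Let A^m be the span of the brackets of m factors ([Pow]). Congruence
    modulo A^m respects the loop operations, and commutators of A^i with A^j fall into A^(i+j), so
    elements of F^k take values in A^k on small arguments ([series_rel]). If J(A^k,A,A) = 0 and a is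
    in A^k, then a_2 commutes with z_3, and a_3 with z_2, modulo an ideal [inJ] of [tri] without A_-
    component; comparing words gives (ay)z = a(yz) ([nuclearA]).

    The BCH series Z of x and y is characterised by exp(ad Z) D = exp(ad x) exp(ad y) D, where D is
    the degree derivation. Since Z is determined by exp(ad Z) D, associativity holds formally
    ([starA]); it survives evaluation thanks to a numerical majorant ([majz_bound], [bchA]).

    Part (i) compares leading terms. In coordinates at e, an analytic expression that vanishes as
    soon as one of its p arguments does has a p-linear leading term, with an error of one order more
    along curves ([leading_term], [LTex]). Let [A] be the trilinear leading term of (xy)z - x(yz).
    The Moufang identity makes this difference cyclic up to order 5 ([dd_cyc]) and [A] alternating;
    together with a pentagon relation this yields the Malcev identity for [A] ([bb_A]), and J = 6
    [A] ([jac_A]). A commutator word with k leaves lies in F^k and has the corresponding bracket as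
    leading term ([O_Wc]), so the vanishing of its associators forces J to vanish on that bracket
    ([A_NL]). *)

(** * Unconditional summation of families of real numbers *)

Section Summation.
Context {R : realType}.
Implicit Types I J : choiceType.

(* Unconditional summation: convergence along the net of finite sets of indices. *)
Definition hasum I (a : I -> R) (s : R) := forall e, 0 < e ->
  exists s0 : seq I, forall t : seq I, uniq t -> {subset s0 <= t} ->
    `|\sum_(i <- t) a i - s| <= e.

(** Absolute summability together with an explicit bound, so that estimates travel with
    convergence. *)
Definition absum I (a : I -> R) (K : R) :=
  forall t : seq I, uniq t -> \sum_(i <- t) `|a i| <= K.

Lemma sum_subset I (f : I -> R) (s t : seq I) : uniq s -> uniq t ->
  {subset s <= t} ->
  \sum_(i <- t) f i = \sum_(i <- s) f i + \sum_(i <- t | i \notin s) f i.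
Proof.
move=> us ut st; rewrite (bigID (mem s)) /= -[X in X + _]big_filter.
congr (_ + _); apply: perm_big; apply: uniq_perm => //; first exact: filter_uniq.
by move=> x; rewrite mem_filter; case: (boolP (x \in s)) => //= /st ->.
Qed.

Lemma absum_ge0 I (a : I -> R) K : absum a K -> 0 <= K.
Proof. by move=> /(_ [::] isT); rewrite big_nil. Qed.

Lemma absum_le I (a b : I -> R) K L : (forall i, `|a i| <= `|b i|) -> K <= L ->
  absum b K -> absum a L.
Proof.
move=> ab KL bK t ut; apply: le_trans (le_trans (bK t ut) KL).
by apply: ler_sum => i _; apply: ab.
Qed.

Lemma hasum_uniq I (a : I -> R) s t : hasum a s -> hasum a t -> s = t.
Proof.
move=> as_ at_; apply/eqP; rewrite -subr_eq0 -normr_le0; apply/ler_addgt0Pl => e e0.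
have e20 : 0 < e / 2 by rewrite divr_gt0.
have [s0 h0] := as_ _ e20; have [t0 h1] := at_ _ e20.
have {}h0 := h0 (undup (s0 ++ t0)) (undup_uniq _).
have {}h1 := h1 (undup (s0 ++ t0)) (undup_uniq _).
have {}h0 : `|\sum_(i <- undup (s0 ++ t0)) a i - s| <= e / 2.
  by apply: h0 => x xs; rewrite mem_undup mem_cat xs.
have {}h1 : `|\sum_(i <- undup (s0 ++ t0)) a i - t| <= e / 2.
  by apply: h1 => x xs; rewrite mem_undup mem_cat xs orbT.
move: h0 h1; set S := \sum_(i <- _) _ => h0 h1.
have -> : s - t = (S - t) - (S - s) by ring.
rewrite addr0 (le_trans (ler_normB _ _))// (le_trans (lerD h1 h0))//; lra.
Qed.

Lemma hasumD I (a b : I -> R) s t : hasum a s -> hasum b t ->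
  hasum (fun i => a i + b i) (s + t).
Proof.
move=> as_ bt e e0; have e20 : 0 < e / 2 by rewrite divr_gt0.
have [s0 h0] := as_ _ e20; have [t0 h1] := bt _ e20.
exists (s0 ++ t0) => u uu su; rewrite big_split /=.
have -> : forall x y, x + y - (s + t) = (x - s) + (y - t) :> R by move=> *; ring.
have {}h0 : `|\sum_(i <- u) a i - s| <= e / 2.
  by apply: h0 => // x xs; apply: su; rewrite mem_cat xs.
have {}h1 : `|\sum_(i <- u) b i - t| <= e / 2.
  by apply: h1 => // x xs; apply: su; rewrite mem_cat xs orbT.
by rewrite (le_trans (ler_normD _ _))// [leRHS]splitr lerD.
Qed.

Lemma hasumZ I (a : I -> R) s c : hasum a s -> hasum (fun i => c * a i) (c * s).
Proof.
move=> as_ e e0; have [|s0 h0] := as_ (e / (`|c| + 1)).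
  by rewrite divr_gt0// ltr_wpDl.
exists s0 => u uu su; rewrite -mulr_sumr -mulrBr normrM.
have {}h0 := h0 u uu su.
apply: (le_trans (ler_wpM2l (normr_ge0 c) h0)).
rewrite mulrCA ger_pMr// ler_pdivrMr ?mul1r ?lerDl// ltr_wpDl.
Qed.

Lemma hasumB I (a b : I -> R) s t : hasum a s -> hasum b t ->
  hasum (fun i => a i - b i) (s - t).
Proof.
move=> as_ bt; have := hasumD as_ (hasumZ (-1) bt).
rewrite mulN1r; congr (hasum _ _); apply/funext => i; by rewrite mulN1r.
Qed.

Lemma eq_hasum I (a b : I -> R) s t : a =1 b -> s = t -> hasum a s -> hasum b t.
Proof. by move=> /funext -> ->. Qed.

Lemma hasum_finite I (a : I -> R) (s : seq I) : uniq s ->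
  (forall i, i \notin s -> a i = 0) -> hasum a (\sum_(i <- s) a i).
Proof.
move=> us a0 e e0; exists s => t ut st.
rewrite (sum_subset _ us ut st) [X in _ + X - _]big1 ?addr0 => [|i /a0 //].
by rewrite subrr normr0 ltW.
Qed.

Lemma hasum0 I (a : I -> R) : (forall i, a i = 0) -> hasum a 0.
Proof. by move=> a0; have := @hasum_finite _ a [::] isT (fun i _ => a0 i); rewrite big_nil. Qed.

Lemma hasum_one I (a : I -> R) i0 : (forall i, i != i0 -> a i = 0) -> hasum a (a i0).
Proof.
move=> a0; have := @hasum_finite _ a [:: i0] isT; rewrite big_seq1; apply => i.
by rewrite inE => /a0.
Qed.

Lemma hasum_le I (a : I -> R) s K : hasum a s -> absum a K -> `|s| <= K.
Proof.
move=> as_ aK; apply/ler_addgt0Pl => e e0; have [s0 h0] := as_ _ e0.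
have {}h0 : `|\sum_(i <- undup s0) a i - s| <= e.
  by apply: h0 => [|x]; rewrite ?undup_uniq ?mem_undup.
have -> : s = \sum_(i <- undup s0) a i - (\sum_(i <- undup s0) a i - s) by ring.
rewrite (le_trans (ler_normB _ _))// addrC lerD//.
by rewrite (le_trans (ler_norm_sum _ _ _))// aK ?undup_uniq.
Qed.

(** Finite sums of nonnegative terms increase with the index set, so their supremum is the sum. *)
Lemma hasum_pos_ex I (a : I -> R) K : (forall i, 0 <= a i) -> absum a K ->
  exists s, hasum a s.
Proof.
move=> a0 aK; pose E := [set \sum_(i <- t) a i | t in [set t : seq I | uniq t]].
have Eub : ubound E K.
  move=> _ [t ut <-]; apply: le_trans (aK t ut).
  by apply: ler_sum => i _; exact: ler_norm.
have Esup : has_sup E by split; [exists 0, [::]; rewrite ?big_nil|exists K].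
exists (sup E) => e e0.
have [_ [s0 us0 <-] h] := sup_adherent e0 Esup.
exists s0 => t ut st; rewrite distrC ger0_norm ?subr_ge0; last first.
  by apply: (ub_le_sup (Esup.2)); exists t.
rewrite lerBlDr -lerBlDl (le_trans (ltW h))//.
by rewrite (sum_subset _ us0 ut st) lerDl sumr_ge0.
Qed.

(** The positive and the negative parts are summed separately. *)
Lemma hasum_ex I (a : I -> R) K : absum a K -> exists s, hasum a s.
Proof.
move=> aK.
have [||p hp] := @hasum_pos_ex _ (fun i => Num.max (a i) 0) K.
- by move=> i; rewrite le_max lexx orbT.
- apply: absum_le aK => // i; rewrite ger0_norm ?le_max ?lexx ?orbT//.
  by rewrite ge_max ler_norm normr_ge0.
have [||q hq] := @hasum_pos_ex _ (fun i => Num.max (- a i) 0) K.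
- by move=> i; rewrite le_max lexx orbT.
- apply: absum_le aK => // i; rewrite ger0_norm ?le_max ?lexx ?orbT//.
  by rewrite ge_max -normrN ler_norm normr_ge0.
exists (p - q); apply: eq_hasum (hasumB hp hq) => // i.
have [a0|a0] := leP 0 (a i).
  by rewrite (max_idPr _) ?subr0// oppr_le0.
by rewrite (max_idPl _) ?sub0r ?opprK// oppr_ge0 ltW.
Qed.

(** Over a large finite set of rows, each row is cut to a finite piece that approximates its sum and
    contains the prescribed indices; the union of the pieces is admissible for the double sum. *)
Lemma hasum_fubini I J (a : I * J -> R) b s : hasum a s ->
  (forall i, hasum (fun j => a (i, j)) (b i)) -> hasum b s.
Proof.
move=> as_ hb e e0; have e20 : 0 < e / 2 by rewrite divr_gt0.
have [s0 h0] := as_ _ e20.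
exists (map fst s0) => p up sp.
(* The error e / 2 is shared among the rows; the [+ 1] covers an empty [p]. *)
have n0 : 0 < e / 2 / ((size p)%:R + 1) by rewrite divr_gt0// ltr_wpDl.
have /choice[t ht] i : exists t : seq J, [/\ uniq t,
    {subset [seq x.2 | x <- s0 & x.1 == i] <= t} &
    `|\sum_(j <- t) a (i, j) - b i| <= e / 2 / ((size p)%:R + 1)].
  have [t0 ht0] := hb i _ n0.
  exists (undup (t0 ++ [seq x.2 | x <- s0 & x.1 == i])); split.
  - exact: undup_uniq.
  - by move=> x xs; rewrite mem_undup mem_cat xs orbT.
  - by apply: ht0 => [|x xs]; rewrite ?undup_uniq// mem_undup mem_cat xs.
pose T := [seq (i, j) | i <- p, j <- t i].
have uT : uniq T.
  by apply: allpairs_uniq_dep => // [i _|[? ?] [? ?] _ _ [-> ->]//]; have [] := ht i.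
have := h0 T uT; rewrite big_allpairs_dep /= => {}h0.
have {}h0 : `|\sum_(i <- p) \sum_(j <- t i) a (i, j) - s| <= e / 2.
  apply: h0 => -[i j] ijs; apply/allpairsPdep; exists i, j; split => //.
    by apply: sp; apply/mapP; exists (i, j).
  have [_ /(_ j) h _] := ht i; apply: h; apply/mapP; exists (i, j) => //.
  by rewrite mem_filter eqxx.
have -> : \sum_(i <- p) b i - s = (\sum_(i <- p) \sum_(j <- t i) a (i, j) - s)
    - (\sum_(i <- p) (\sum_(j <- t i) a (i, j) - b i)).
  by rewrite sumrB; ring.
rewrite (le_trans (ler_normB _ _))// [leRHS]splitr lerD// .
rewrite (le_trans (ler_norm_sum _ _ _))//.
rewrite (@le_trans _ _ (\sum_(i <- p) (e / 2 / ((size p)%:R + 1))))//.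
  by apply: ler_sum => i _; have [] := ht i.
rewrite big_const_seq count_predT iter_addr_0 -[leLHS]mulr_natr -mulrA ger_pMr//.
by rewrite mulrC ler_pdivrMr ?ltr_wpDl// mul1r lerDl.
Qed.

Lemma absum_sigma I J (a : I * J -> R) k K :
  (forall i, absum (fun j => a (i, j)) (k i)) -> absum k K -> absum a K.
Proof.
move=> ak kK t ut.
pose p := undup (map fst t); pose q := undup (map snd t).
apply: (@le_trans _ _ (\sum_(x <- [seq (i, j) | i <- p, j <- q]) `|a x|)).
  have sub : {subset t <= [seq (i, j) | i <- p, j <- q]}.
    move=> [i j] ijt; apply/allpairsP; exists (i, j); split => //=;
      rewrite mem_undup; apply/mapP; by exists (i, j).
  have uT : uniq [seq (i, j) | i <- p, j <- q].
    by apply: allpairs_uniq; rewrite ?undup_uniq// => -[? ?] [? ?].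
  by rewrite (sum_subset _ ut uT sub) lerDl sumr_ge0.
rewrite big_allpairs; apply: le_trans (kK p (undup_uniq _)).
apply: ler_sum => i _; apply: le_trans (ler_norm _).
exact: ak (undup_uniq _).
Qed.

Lemma absumM I J (a : I -> R) (b : J -> R) K L : absum a K -> absum b L ->
  absum (fun x : I * J => a x.1 * b x.2) (K * L).
Proof.
move=> aK bL; apply: (@absum_sigma _ _ _ (fun i => `|a i| * L)).
  move=> i t ut /=; under eq_bigr do rewrite normrM.
  by rewrite -mulr_sumr ler_wpM2l// bL.
move=> t ut; under eq_bigr do rewrite normrM normr_id (ger0_norm (absum_ge0 bL)).
by rewrite -mulr_suml ler_wpM2r ?aK// (absum_ge0 bL).
Qed.

(** The double family is summable by [absumM]; its row sums are [a i * t], and Fubini with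
    uniqueness of sums identifies the total. *)
Lemma hasumM I J (a : I -> R) (b : J -> R) s t K L : absum a K -> absum b L ->
  hasum a s -> hasum b t -> hasum (fun x : I * J => a x.1 * b x.2) (s * t).
Proof.
move=> aK bL as_ bt; have [u hu] := hasum_ex (absumM aK bL).
suff -> : s * t = u by [].
have : hasum (fun i => a i * t) u.
  apply: (hasum_fubini hu) => i /=; exact: hasumZ.
apply: hasum_uniq; apply: eq_hasum (hasumZ t as_); last by rewrite mulrC.
by move=> i; rewrite mulrC.
Qed.

(* Reindexing along an injection [h] with partial inverse [g]; the family [b]
   vanishes off the image of [h]. *)
Lemma hasum_inj I J (h : I -> J) (a : I -> R) (b : J -> R) s : injective h ->
  (forall i, b (h i) = a i) -> (forall j, (forall i, h i != j) -> b j = 0) ->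
  hasum a s <-> hasum b s.
Proof.
move=> hi ba b0.
pose im j := `[< exists i, h i = j >].
have sumE (t : seq J) (u : seq I) : uniq t -> uniq u ->
    (forall i, (i \in u) = (h i \in t)) -> \sum_(j <- t) b j = \sum_(i <- u) a i.
  move=> ut uu tu; rewrite (bigID im) /= [X in _ + X]big1 ?addr0; last first.
    move=> j /asboolPn nj; apply: b0 => i; apply/eqP => hij; apply: nj; by exists i.
  rewrite -big_filter; under [RHS]eq_bigr do rewrite -ba.
  rewrite -(big_map h xpredT b); apply: perm_big; apply: uniq_perm.
  - exact: filter_uniq.
  - by rewrite map_inj_uniq.
  - move=> j; rewrite mem_filter; apply/andP/mapP => [[/asboolP[i <-]] hit|[i iu ->]].
      by exists i; rewrite ?tu.
    by rewrite -tu iu; split => //; apply/asboolP; exists i.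
have pre (t : seq J) : exists u : seq I, uniq u /\ forall i, (i \in u) = (h i \in t).
  elim: t => [|j t [u [uu hu]]]; first by exists [::].
  have [/cid[i hij]|nj] := pselect (exists i, h i = j).
    exists (undup (i :: u)); split; first exact: undup_uniq.
    by move=> i'; rewrite mem_undup !inE hu -hij (inj_eq hi).
  exists u; split => // i; rewrite inE -hu; case: eqP => // hij.
  by case: nj; exists i.
split=> H e e0; have [s0 h0] := H e e0.
  exists (map h s0) => t ut st; have [u [uu hu]] := pre t.
  rewrite (sumE t u)//; apply: h0 => // i is0; rewrite hu; apply: st.
  exact: map_f.
have [u0 [uu0 hu0]] := pre s0; exists u0 => u uu su.
pose t := undup (s0 ++ map h u).
rewrite -(sumE t u) ?undup_uniq//.
  by apply: h0; rewrite ?undup_uniq// => x xs; rewrite mem_undup mem_cat xs.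
move=> i; rewrite mem_undup mem_cat (mem_map hi).
by case: (boolP (h i \in s0)) => //=; rewrite -hu0 => /su ->.
Qed.

Lemma absum_inj I J (h : I -> J) (a : I -> R) (b : J -> R) K : injective h ->
  (forall i, b (h i) = a i) -> absum b K -> absum a K.
Proof.
move=> hi ba bK t ut; under eq_bigr do rewrite -ba.
by rewrite -(big_map h xpredT (fun j => `|b j|)) bK// map_inj_uniq.
Qed.

Lemma absum_img I J (h : I -> J) (a : I -> R) (b : J -> R) K : injective h ->
  (forall i, b (h i) = a i) -> (forall j, (forall i, h i != j) -> b j = 0) ->
  absum a K -> absum b K.
Proof.
move=> hi ba b0 aK t ut.
have [s hs] : exists s, hasum (fun i => `|a i|) s.
  by apply: (@hasum_ex _ _ K); apply: absum_le aK => // i; rewrite normr_id.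
have hb : hasum (fun j => `|b j|) s.
  refine (iffLR (@hasum_inj _ _ h (fun i => `|a i|) _ s hi _ _) hs) => [i|j hj].
    by rewrite ba.
  by rewrite b0// normr0.
have sK : s <= K.
  by apply: le_trans (ler_norm _) (hasum_le hs _); apply: absum_le aK => // i; rewrite normr_id.
apply: le_trans sK; apply/ler_addgt0Pl => e e0; have [s0 h0] := hb e e0.
have := h0 (undup (s0 ++ t)) (undup_uniq _); set S := \sum_(i <- undup _) _ => {}h0.
have : `|S - s| <= e by apply: h0 => x xs; rewrite mem_undup mem_cat xs.
rewrite ler_distl => /andP[_]; rewrite addrC; apply: le_trans.
rewrite /S (sum_subset _ ut (undup_uniq _)) ?lerDl ?sumr_ge0// => x xt.
by rewrite mem_undup mem_cat xt orbT.
Qed.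

(* Summation by fibres of [h]. *)
Lemma hasum_fibre I J (h : I -> J) (a : I -> R) (b : J -> R) s : hasum a s ->
  (forall j, hasum (fun i => if h i == j then a i else 0) (b j)) -> hasum b s.
Proof.
move=> as_ hb.
apply: (@hasum_fubini _ _ (fun x : J * I => if h x.2 == x.1 then a x.2 else 0)) => //.
refine (iffLR (@hasum_inj _ _ (fun i => (h i, i)) a _ s _ _ _) as_) => [i i' [] //|i|[j i] /= hj].
  by rewrite eqxx.
by case: eqP => // hij; have := hj i; rewrite hij eqxx.
Qed.

(** Links the net of finite sets with sequential limits; it is applied to the cubes of exponents of
    [psum]. *)
Lemma hasum_cofinal I (a : I -> R) s (t : nat -> seq I) : hasum a s ->
  (forall n, uniq (t n)) -> (forall n, {subset t n <= t n.+1}) ->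
  (forall i, exists n, i \in t n) ->
  (fun n => \sum_(i <- t n) a i) @ \oo --> s.
Proof.
move=> as_ ut st ct; apply/cvgrPdist_le => e e0.
have [s0 h0] := as_ e e0.
have mono n m : (n <= m)%N -> {subset t n <= t m}.
  move=> /subnK <-; elim: (m - n)%N => // k IH i /IH; rewrite addSn; exact: st.
have [N hN] : exists N, {subset s0 <= t N}.
  elim: s0 {h0} => [|i s0 [N hN]]; first by exists 0%N.
  have [n it] := ct i; exists (maxn n N) => j; rewrite inE => /predU1P[->|/hN].
    by apply: mono it; exact: leq_maxl.
  by apply: mono; exact: leq_maxr.
exists N => // n /= Nn; rewrite distrC; apply: h0 => // i /hN; exact: mono.
Qed.

End Summation.

(** * Power series on polydiscs, controlled by a weighted l^1 norm *)

Section PowerSeries.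
Context {R : realType}.

Definition mon (X : finType) (v : X -> R) (w : seq X) : R := \prod_(x <- w) v x.

(* [Hs r f K]: on the closed polydisc of radius [r], [f] is the sum of a power
   series of weighted l^1 norm at most [K]; a monomial is a list of variables. *)
Definition Hs (X : finType) (r : R) (f : (X -> R) -> R) (K : R) :=
  exists (c : nat -> R) (w : nat -> seq X),
    absum (fun i => c i * r ^+ size (w i)) K /\
    forall v, (forall x, `|v x| <= r) -> hasum (fun i => c i * mon v (w i)) (f v).

Section OneSpace.
Variables (X : finType) (r : R).
Hypothesis r0 : 0 <= r.
Implicit Types (f g : (X -> R) -> R) (v : X -> R).

Lemma mon_le v w : (forall x, `|v x| <= r) -> `|mon v w| <= r ^+ size w.
Proof.
move=> vr; rewrite /mon; elim: w => [|x w IH]; first by rewrite big_nil normr1 expr0.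
by rewrite big_cons normrM exprS ler_pM.
Qed.

Lemma mon_cat v w1 w2 : mon v (w1 ++ w2) = mon v w1 * mon v w2.
Proof. by rewrite /mon big_cat. Qed.

Lemma absum_mon (I : choiceType) (c : I -> R) (w : I -> seq X) K v :
  absum (fun i => c i * r ^+ size (w i)) K -> (forall x, `|v x| <= r) ->
  absum (fun i => c i * mon v (w i)) K.
Proof.
move=> cK vr; apply: absum_le cK => // i; rewrite !normrM ler_wpM2l//.
by rewrite (le_trans (mon_le _ vr))// normrX ger0_norm.
Qed.

(** Any countable index set may be used: it is transported to nat by [pickle], and numbers that are
    not codes get the coefficient 0. *)
Lemma Hs_intro (I : countType) (c : I -> R) (w : I -> seq X) K f :
  absum (fun i => c i * r ^+ size (w i)) K ->
  (forall v, (forall x, `|v x| <= r) -> hasum (fun i => c i * mon v (w i)) (f v)) ->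
  Hs r f K.
Proof.
move=> cK cf; pose up n : option I := pickle_inv n.
have upK i : up (pickle i) = Some i by exact: pickleK_inv.
have pI : injective (@pickle I) by exact: (pcan_inj pickleK).
have upN n : (forall i : I, pickle i != n) -> up n = None.
  move=> h; rewrite /up; case E : (pickle_inv n) => [i|//].
  have := h i; have := @pickle_invK I n; rewrite /oapp E /= => ->; by rewrite eqxx.
pose c' n := if up n is Some i then c i else 0.
pose w' n := if up n is Some i then w i else [::].
exists c', w'; split=> [|v vr].
  apply: (absum_img pI _ _ cK) => [i|n /upN h]; rewrite /c' /w' ?upK//.
  by rewrite h mul0r.
refine (iffLR (@hasum_inj _ _ _ pickle _ _ _ pI _ _) (cf v vr)) => [i|n /upN h].
  by rewrite /c' /w' upK.
by rewrite /c' /w' h mul0r.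
Qed.

Lemma Hs_ge0 f K : Hs r f K -> 0 <= K.
Proof. by move=> [c [w [/absum_ge0]]]. Qed.

Lemma Hs_bound f K v : Hs r f K -> (forall x, `|v x| <= r) -> `|f v| <= K.
Proof. by move=> [c [w [cK cf]]] vr; apply: hasum_le (cf v vr) (absum_mon cK vr). Qed.

Lemma Hs_ext f g K : (forall v, (forall x, `|v x| <= r) -> f v = g v) ->
  Hs r f K -> Hs r g K.
Proof.
by move=> fg [c [w [cK cf]]]; exists c, w; split => // v vr; rewrite -fg//; exact: cf.
Qed.

Lemma Hs_mono f K L : K <= L -> Hs r f K -> Hs r f L.
Proof.
move=> KL [c [w [cK cf]]]; exists c, w; split => //.
exact: absum_le cK.
Qed.

Lemma absum_unit (a : unit -> R) K : `|a tt| <= K -> absum a K.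
Proof.
move=> aK [|[] [|[] t]] //= ; rewrite ?big_nil ?big_seq1// => _.
exact: le_trans aK.
Qed.

Lemma Hs_mono1 (c : R) (w : seq X) : Hs r (fun v => c * mon v w) (`|c| * r ^+ size w).
Proof.
apply: (@Hs_intro unit (fun=> c) (fun=> w)) => [|v vr].
  by apply: absum_unit; rewrite normrM normrX (ger0_norm r0).
by apply: (@hasum_one _ _ _ tt) => -[].
Qed.

Lemma Hs_const (c : R) : Hs r (fun _ : X -> R => c) `|c|.
Proof.
have := Hs_mono1 c [::]; rewrite expr0 mulr1; apply: Hs_ext => v _.
by rewrite /mon big_nil mulr1.
Qed.

Lemma Hs_var x : Hs r (fun v : X -> R => v x) r.
Proof.
have := Hs_mono1 1 [:: x]; rewrite expr1 normr1 mul1r; apply: Hs_ext => v _.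
by rewrite /mon big_seq1 mul1r.
Qed.

(** The countably many power series are merged into one indexed by pairs, and their norms add up. *)
Lemma Hs_sum (f : nat -> (X -> R) -> R) k K F :
  (forall n, Hs r (f n) (k n)) -> absum k K ->
  (forall v, (forall x, `|v x| <= r) -> hasum (fun n => f n v) (F v)) ->
  Hs r F K.
Proof.
move=> fk kK fF.
have /choice[c /choice[w cw]] := fk.
apply: (@Hs_intro (nat * nat)%type (fun x => c x.1 x.2) (fun x => w x.1 x.2)).
  apply: absum_sigma kK => n; exact: (cw n).1.
move=> v vr.
have [s hs] : exists s, hasum (fun x : nat * nat => c x.1 x.2 * mon v (w x.1 x.2)) s.
  apply: (@hasum_ex _ _ _ K); apply: absum_sigma kK => n /=.
  exact: absum_mon (cw n).1 vr.
suff -> : F v = s by [].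
apply: hasum_uniq (fF v vr) _; apply: (hasum_fubini hs) => n /=.
exact: (cw n).2.
Qed.

Lemma HsM f g K L : Hs r f K -> Hs r g L -> Hs r (fun v => f v * g v) (K * L).
Proof.
move=> [c [w [cK cf]]] [d [u [dL dg]]].
apply: (@Hs_intro (nat * nat)%type (fun x => c x.1 * d x.2) (fun x => w x.1 ++ u x.2)).
  apply: absum_le (lexx _) (absumM cK dL) => -[i j] /=.
  by rewrite size_cat exprD mulrACA.
move=> v vr; apply: eq_hasum (erefl _) (hasumM (absum_mon cK vr) (absum_mon dL vr)
  (cf v vr) (dg v vr)) => -[i j] /=.
by rewrite mon_cat mulrACA.
Qed.

Lemma HsZ (c : R) f K : Hs r f K -> Hs r (fun v => c * f v) (`|c| * K).
Proof. by move=> fK; apply: HsM fK; exact: Hs_const. Qed.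

Lemma HsD f g K L : Hs r f K -> Hs r g L -> Hs r (fun v => f v + g v) (K + L).
Proof.
move=> fK gL.
pose h n v := if n is 0%N then f v else if n is 1%N then g v else 0.
pose k (n : nat) := if n is 0%N then K else if n is 1%N then L else 0.
apply: (@Hs_sum h k) => [[|[|n]]//||v vr].
- by have := Hs_const 0; rewrite normr0.
- move=> t ut; rewrite -[K + L]addr0.
  have -> : K + L + 0 = \sum_(i <- [:: 0%N; 1%N]) `|k i|.
    by rewrite big_cons big_seq1 /= !ger0_norm ?(Hs_ge0 gL) ?(Hs_ge0 fK)// addr0.
  have [uu tu] : uniq (undup (t ++ [:: 0%N; 1%N])) /\ {subset t <= undup (t ++ [:: 0%N; 1%N])}.
    by split => [|x xt]; rewrite ?undup_uniq// mem_undup mem_cat xt.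
  apply: (@le_trans _ _ (\sum_(i <- undup (t ++ [:: 0%N; 1%N])) `|k i|)).
    by rewrite (sum_subset _ ut uu tu) lerDl sumr_ge0.
  rewrite (@sum_subset _ _ _ [:: 0%N; 1%N] _ isT uu) => [|x xt]; last first.
    by rewrite mem_undup mem_cat xt orbT.
  rewrite [X in _ + X]big1 ?addr0// => -[|[|i]]//= _; exact: normr0.
- have := @hasum_finite _ _ (fun n => h n v) [:: 0%N; 1%N] isT.
  by rewrite big_cons big_seq1; apply => -[|[|i]].
Qed.

Lemma HsB f g K L : Hs r f K -> Hs r g L -> Hs r (fun v => f v - g v) (K + L).
Proof.
move=> fK gL; have := HsD fK (HsZ (-1) gL); rewrite normrN1 mul1r.
by apply: Hs_ext => v _; rewrite mulN1r.
Qed.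

Lemma Hs_bigsum (I : Type) (t : seq I) (P : pred I) (f : I -> (X -> R) -> R) (k : I -> R) :
  (forall i, P i -> Hs r (f i) (k i)) ->
  Hs r (fun v => \sum_(i <- t | P i) f i v) (\sum_(i <- t | P i) k i).
Proof.
move=> fk; elim: t => [|i t IH].
  rewrite big_nil; have := Hs_const 0; rewrite normr0; apply: Hs_ext => v _.
  by rewrite big_nil.
rewrite big_cons; case: ifP => Pi.
  by apply: Hs_ext (HsD (fk i Pi) IH) => v _; rewrite big_cons Pi.
by apply: Hs_ext IH => v _; rewrite big_cons Pi.
Qed.

Lemma Hs_shrink r' f K : 0 <= r' -> r' <= r -> Hs r f K -> Hs r' f K.
Proof.
move=> r'0 r'r [c [w [cK cf]]]; exists c, w; split=> [|v vr].
  apply: absum_le cK => // i; rewrite !normrM ler_wpM2l// !normrX.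
  by rewrite lerXn2r ?nnegrE ?ger0_norm.
by apply: cf => x; apply: le_trans (vr x) _.
Qed.

(** Without constant term every monomial has degree at least one, so shrinking the polydisc gains
    the factor r' / r. This makes norms as small as desired. *)
Lemma Hs_shrink0 r' f K : 0 < r -> 0 <= r' -> r' <= r -> f (fun=> 0) = 0 -> Hs r f K ->
  Hs r' f (K * (r' / r)).
Proof.
move=> rp r'0 r'r f0 [c [w [cK cf]]].
have q1 : r' / r <= 1 by rewrite ler_pdivrMr ?mul1r.
have q0 : 0 <= r' / r by rewrite divr_ge0// ltW.
exists (fun i => if w i is [::] then 0 else c i), w; split=> [|v vr].
  apply: (@absum_le _ _ _ (fun i => (r' / r) * (c i * r ^+ size (w i)))) (lexx _) _; last first.
    move=> t ut; under eq_bigr do rewrite normrM.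
    by rewrite -mulr_sumr (ger0_norm q0) mulrC ler_wpM2r// cK.
  move=> i; case: (w i) => [|x u]; first by rewrite mul0r normr0.
  have -> : r' / r * (c i * r ^+ size (x :: u)) = c i * (r' * r ^+ size u).
    by rewrite /= exprS; field; rewrite gt_eqF.
  rewrite (normrM (c i)) [leRHS]normrM ler_wpM2l// /= exprS !normrM ler_wpM2l//.
  by rewrite !normrX !ger0_norm// lerXn2r.
have vr' x : `|v x| <= r by apply: le_trans (vr x) _.
have z0 : hasum (fun i => c i * mon (fun=> 0) (w i)) 0.
  by rewrite -[X in hasum _ X]f0; apply: cf => x; rewrite normr0.
have := hasumB (cf v vr') z0; rewrite subr0; apply: eq_hasum => // i.
rewrite /mon; case: (w i) => [|x u]; first by rewrite !big_nil subrr mul0r.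
by rewrite [in X in _ - X]big_cons mul0r mulr0 subr0.
Qed.

Lemma Hs_mon (Y : finType) s (phi : Y -> (X -> R) -> R) (w : seq Y) : 0 <= s ->
  (forall y, Hs r (phi y) s) -> Hs r (fun v => mon (fun y => phi y v) w) (s ^+ size w).
Proof.
move=> s0 ps; rewrite /mon; elim: w => [|y w IH].
  have := Hs_const 1; rewrite normr1 expr0; apply: Hs_ext => v _; by rewrite big_nil.
by rewrite exprS; apply: Hs_ext (HsM (ps y) IH) => v _; rewrite big_cons.
Qed.

End OneSpace.

(** The inner functions are bounded by [s] in norm and not just in value, so a substituted monomial
    of length l has norm at most s^l and the norm of [g] bounds the whole. *)
Lemma Hs_comp (X Y : finType) (r s : R) (g : (Y -> R) -> R)
    (phi : Y -> (X -> R) -> R) K : 0 <= r -> 0 <= s ->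
  Hs s g K -> (forall y, Hs r (phi y) s) ->
  Hs r (fun v => g (fun y => phi y v)) K.
Proof.
move=> r0 s0 [c [w [cK cg]]] ps.
apply: (@Hs_sum _ _ r0 (fun i v => c i * mon (fun y => phi y v) (w i))
  (fun i => `|c i| * s ^+ size (w i))).
- by move=> n; apply: HsZ => //; exact: Hs_mon.
- by apply: absum_le cK => // i; rewrite !normrM normr_id.
- by move=> v vr; apply: cg => y; exact: Hs_bound (ps y) vr.
Qed.

End PowerSeries.

Section RowNorm.
Context {R : realType}.

Lemma rv_norm_le m (v : 'rV[R]_m) e : 0 <= e ->
  `|v| <= e <-> forall i, `|v 0 i| <= e.
Proof.
move=> e0; rewrite [`|v|]/Num.Def.normr /= mx_normrE; split=> [ve i|ve].
  by apply: le_trans ve; apply/bigmax_geP; right; exists (0, i).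
by apply/bigmax_leP; split => // -[i j] _ /=; rewrite (ord1 i).
Qed.

Lemma rv_norm_lt m (v : 'rV[R]_m) e : 0 < e ->
  `|v| < e <-> forall i, `|v 0 i| < e.
Proof.
move=> e0; rewrite [`|v|]/Num.Def.normr /= mx_normrE; split=> [ve i|ve].
  by apply: le_lt_trans ve; apply/bigmax_geP; right; exists (0, i).
by apply/bigmax_ltP; split => // -[i j] _ /=; rewrite (ord1 i).
Qed.

Lemma rv_coord_le m (v : 'rV[R]_m) i : `|v 0 i| <= `|v|.
Proof. by move: i; apply/rv_norm_le. Qed.

End RowNorm.

(** * Equivalence of these power series with [analytic_at] *)

Section Analytic.
Context {R : realType}.

Lemma hasum_bigsum (I : choiceType) (J : Type) (t : seq J) (a : J -> I -> R) (s : J -> R) :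
  (forall j, hasum (a j) (s j)) ->
  hasum (fun i => \sum_(j <- t) a j i) (\sum_(j <- t) s j).
Proof.
move=> h; elim: t => [|j t IH].
  by rewrite big_nil; apply: hasum0 => i; rewrite big_nil.
rewrite big_cons; apply: eq_hasum (hasumD (h j) IH) => // i.
by rewrite big_cons.
Qed.

(** Multiplying [b j] by its sign turns the sum of absolute values into the sum of a single family
    dominated by [a]. *)
Lemma absum_fibre (I J : choiceType) (h : I -> J) (a : I -> R) (b : J -> R) K :
  absum a K ->
  (forall j, hasum (fun i => if h i == j then a i else 0) (b j)) -> absum b K.
Proof.
move=> aK hb t ut.
have -> : \sum_(j <- t) `|b j| = \sum_(j <- t) (Num.sg (b j) * b j).
  by apply: eq_bigr => j _; rewrite -normrEsg.
apply: le_trans (ler_norm _) _.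
apply: (hasum_le (hasum_bigsum t (fun j => hasumZ (Num.sg (b j)) (hb j)))).
apply: absum_le aK => // i.
have [hit|hit] := boolP (h i \in t); last first.
  rewrite big1_seq ?normr0// => j /andP[_ jt]; case: eqP => [hj|]; last by rewrite mulr0.
  by rewrite hj jt in hit.
rewrite (bigD1_seq (h i))//= eqxx big1 ?addr0 => [|j].
  rewrite normrM; apply: ler_piMl => //.
  by rewrite normr_sg; case: (_ != _); rewrite ?lexx ?ler01.
by rewrite eq_sym => /negPf ->; rewrite mulr0.
Qed.

Section Exponents.
Variable m : nat.
Notation exps := {ffun 'I_m -> nat}.
Implicit Types (e : exps) (v : 'I_m -> R).

Definition monE v e := \prod_i v i ^+ e i.
Definition cnt (w : seq 'I_m) : exps := [ffun i => count_mem i w].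
Definition expw (e : exps) : seq 'I_m := flatten [seq nseq (e i) i | i <- enum 'I_m].
Definition cube N : seq exps := [seq [ffun i => a i : nat] | a : {ffun 'I_m -> 'I_N}].

Lemma mon_cnt v w : mon v w = monE v (cnt w).
Proof.
rewrite /monE; elim: w => [|x w IH].
  by rewrite /mon big_nil big1// => i _; rewrite ffunE.
rewrite /mon big_cons -/(mon v w) IH (bigD1 x)// [RHS](bigD1 x)//= mulrA.
congr (_ * _); first by rewrite !ffunE /= eqxx exprS.
by apply: eq_bigr => i ix; rewrite !ffunE /= eq_sym (negPf ix).
Qed.

Lemma mon_expw v e : mon v (expw e) = monE v e.
Proof.
rewrite /mon /expw big_flatten big_map /monE big_enum /=; apply: eq_bigr => i _.
by elim: (e i) => [|k IH]; rewrite ?big_nil ?big_cons//= IH exprS.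
Qed.

Lemma size_cnt w r : (r : R) ^+ size w = monE (fun=> r) (cnt w).
Proof.
by rewrite -mon_cnt /mon; elim: w => [|x w IH]; rewrite ?big_nil ?big_cons//= exprS IH.
Qed.

Lemma size_expw e r : (r : R) ^+ size (expw e) = monE (fun=> r) e.
Proof. by rewrite size_cnt -mon_cnt mon_expw. Qed.

Lemma psumE N (c : exps -> R) (v : 'rV[R]_m) :
  psum N c v = \sum_(e <- cube N) c e * monE (fun i => v 0 i) e.
Proof.
rewrite /cube big_map big_enum /=; apply: eq_bigr => a _; congr (_ * _).
by apply: eq_bigr => i _; rewrite ffunE.
Qed.

Lemma cube_uniq N : uniq (cube N).
Proof.
rewrite map_inj_uniq ?enum_uniq// => a b /ffunP ab; apply/ffunP => i.
by apply: val_inj; have := ab i; rewrite !ffunE.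
Qed.

Lemma mem_cube N e : (e \in cube N) = [forall i, (e i < N)%N].
Proof.
apply/mapP/forallP => [[a _ ->] i|eN]; first by rewrite ffunE.
exists [ffun i => Ordinal (eN i)]; first by rewrite mem_enum.
by apply/ffunP => i; rewrite !ffunE.
Qed.

Lemma cubeS N : {subset cube N <= cube N.+1}.
Proof. by move=> e; rewrite !mem_cube => /forallP h; apply/forallP => i; apply: leqW. Qed.

Lemma mem_cube_ex e : exists N, e \in cube N.
Proof.
exists (\sum_i e i).+1; rewrite mem_cube; apply/forallP => i.
by rewrite ltnS (bigD1 i)//= leq_addr.
Qed.

Lemma sub_cube (t : seq exps) : exists N, {subset t <= cube N}.
Proof.
elim: t => [|e t [N tN]]; first by exists 0%N.
have [M eM] := mem_cube_ex e; exists (maxn M N) => f; rewrite inE => /predU1P[->|/tN].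
  by move: eM; rewrite !mem_cube => /forallP h; apply/forallP => i; rewrite leq_max h.
by rewrite !mem_cube => /forallP h; apply/forallP => i; rewrite leq_max h orbT.
Qed.

End Exponents.

(** Lists of variables with the same exponent vector are collected: the coefficient of [e] is the
    sum over the fibre of [cnt] above [e]. *)
Lemma Hs_analytic m n (f : 'rV[R]_m -> 'rV[R]_n) a r : 0 < r ->
  (forall j, exists K, Hs r (fun v : 'I_m -> R => f (a + \row_i v i) 0 j) K) ->
  analytic_at f a.
Proof.
move=> r0 fH j; have [K [c [w [cK cf]]]] := fH j.
have /choice[C CP] (e : {ffun 'I_m -> nat}) :
    exists s, hasum (fun i => if cnt (w i) == e then c i else 0) s.
  apply: (@hasum_ex _ _ _ (K / monE (fun=> r) e)) => t ut.
  rewrite ler_pdivlMr ?prodr_gt0// => [|i _]; last exact: exprn_gt0.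
  apply: le_trans (cK t ut); rewrite mulr_suml; apply: ler_sum => i _.
  case: eqP => [<-|_]; last by rewrite normr0 mul0r.
  by rewrite normrM -size_cnt normrX (ger0_norm (ltW r0)).
have CfibreE v : (forall e, hasum (fun i => if cnt (w i) == e then c i * mon v (w i) else 0)
     (C e * monE v e)).
  move=> e; apply: eq_hasum (hasumZ (monE v e) (CP e)); last by rewrite mulrC.
  by move=> i /=; case: eqP => [<-|]; rewrite ?mulr0// mon_cnt mulrC.
exists C, r => //; split.
  exists K => N; rewrite psumE.
  have : absum (fun e => C e * monE (fun=> r) e) K.
    apply: (absum_fibre (h := fun i => cnt (w i)) (a := fun i => c i * mon (fun=> r) (w i))).
      by apply: absum_le cK => // i; rewrite size_cnt mon_cnt.
    exact: CfibreE.
  move=> /(_ _ (cube_uniq m N)); apply: le_trans; rewrite le_eqVlt; apply/orP; left.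
  apply/eqP; apply: eq_bigr => e _; rewrite normrM; congr (_ * _).
  rewrite ger0_norm ?prodr_ge0// => [|i _]; last by rewrite exprn_ge0// ltW.
  by apply: eq_bigr => i _; rewrite mxE.
move=> v vr.
have vr' i : `|v 0 i| <= r by apply: le_trans (rv_coord_le v i) (ltW vr).
have := cf (fun i => v 0 i) vr'; have -> : \row_i v 0 i = v by apply/rowP => i; rewrite mxE.
move=> hs; under eq_fun do rewrite psumE.
apply: hasum_cofinal (@cube_uniq m) (@cubeS m) (@mem_cube_ex m).
apply: (hasum_fibre (h := fun i => cnt (w i)) hs); exact: CfibreE.
Qed.

Lemma analytic_Hs m n (f : 'rV[R]_m -> 'rV[R]_n) a : analytic_at f a ->
  exists2 r, 0 < r & exists K, forall j,
    Hs r (fun v : 'I_m -> R => f (a + \row_i v i) 0 j) K.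
Proof.
move=> fa.
have /choice[s sP] j : exists s : R * R, 0 < s.1 /\
    Hs s.1 (fun v : 'I_m -> R => f (a + \row_i v i) 0 j) s.2.
  have [c [r r0 [[C cC] cf]]] := fa j.
  (* [analytic_at] gives the sum on the open polydisc only, while [Hs] asks for a closed one. *)
  exists (r / 2, C) => /=; have r20 : 0 < r / 2 by rewrite divr_gt0.
  split => //; have absr : absum (fun e => c e * r ^+ size (expw e)) C.
    move=> t ut; have [N tN] := sub_cube t.
    apply: le_trans (cC N); rewrite psumE.
    rewrite (sum_subset _ ut (cube_uniq _ _) tN).
    apply: (@le_trans _ _ (\sum_(i <- t) (`|c i| * monE (fun i => (const_mx r : 'rV[R]_m) 0 i) i))).
      rewrite le_eqVlt; apply/orP; left; apply/eqP; apply: eq_bigr => e _.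
      rewrite normrM size_expw; congr (_ * _).
      rewrite ger0_norm; last by apply: prodr_ge0 => i _; rewrite exprn_ge0// ltW.
      by apply: eq_bigr => i _; rewrite mxE.
    rewrite lerDl sumr_ge0// => e _; apply: mulr_ge0 => //; apply: prodr_ge0 => i _.
    by rewrite mxE exprn_ge0// ltW.
  have abs2 : absum (fun e => c e * (r / 2) ^+ size (expw e)) C.
    apply: absum_le absr => // e; rewrite !normrM ler_wpM2l// !normrX.
    by rewrite lerXn2r ?nnegrE// !ger0_norm ?ltW// ltr_pdivrMr// mulr_natr mulr2n ltrDl.
  apply: (Hs_intro (c := c) (w := @expw m)) => [|v vr]; first exact: abs2.
  have [u hu] := hasum_ex (absum_mon (ltW r20) abs2 vr).
  suff -> : f (a + \row_i v i) 0 j = u by [].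
  have vr' : `|\row_i v i| < r.
    apply/rv_norm_lt => // i; rewrite mxE; apply: le_lt_trans (vr i) _.
    by rewrite ltr_pdivrMr// mulr_natr mulr2n ltrDl.
  have h1 := cf _ vr'.
  have h2 := hasum_cofinal hu (@cube_uniq m) (@cubeS m) (@mem_cube_ex m).
  have h3 : (fun N => psum N c (\row_i v i)) @ \oo --> u.
    apply: cvg_trans h2; apply: near_eq_cvg; near=> N.
    rewrite psumE; apply: eq_bigr => e _; rewrite mon_expw.
    by congr (_ * _); apply: eq_bigr => i _; rewrite mxE.
  exact: cvg_unique h1 h3.
(* A radius common to all coordinates; the default 1 serves the case without coordinates. *)
pose r := \big[Num.min/1]_j (s j).1.
have r0 : 0 < r by apply: lt_bigmin => // j _; exact: (sP j).1.
exists r => //; exists (\sum_j (s j).2) => j.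
apply: (@Hs_mono _ _ _ _ (s j).2).
  rewrite (bigD1 j)//= lerDl sumr_ge0// => i _.
  exact: (Hs_ge0 (sP i).2).
apply: (Hs_shrink (ltW (sP j).1) (ltW r0) _ (sP j).2).
exact: bigmin_le_cond.
Unshelve. all: by end_near. Qed.

End Analytic.

(* A reflexive decision procedure [lmod] for linear identities in modules: both
   sides are reduced to their coefficients on the atoms. *)
Inductive mexp (K : Type) :=
  | MA of nat | MO | MAdd of mexp K & mexp K | MOpp of mexp K
  | MSc of K & mexp K | MMuln of mexp K & nat.
Arguments MA {K}.
Arguments MO {K}.

Section LinearReflection.
Variables (K : pzRingType) (V : lmodType K).

Fixpoint mden (env : seq V) (e : mexp K) : V :=
  match e with
  | MA i => nth 0 env i | MO => 0 | MAdd a b => mden env a + mden env b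
  | MOpp a => - mden env a | MSc k a => k *: mden env a
  | MMuln a n => mden env a *+ n
  end.

Fixpoint mcoef (e : mexp K) (i : nat) : K :=
  match e with
  | MA j => if eqn i j then 1 else 0 | MO => 0 | MAdd a b => mcoef a i + mcoef b i
  | MOpp a => - mcoef a i | MSc k a => k * mcoef a i
  | MMuln a n => n%:R * mcoef a i
  end.

Lemma mdenE env e : mden env e = \sum_(i < size env) mcoef e i *: nth 0 env i.
Proof.
have E i j : eqn i j = (i == j) by [].
elim: e => [j||a IHa b IHb|a IHa|k a IHa|a IHa n] /=.
- have [jn|jn] := ltnP j (size env).
    rewrite (bigD1 (Ordinal jn))//= E eqxx scale1r big1 ?addr0// => i.
    by rewrite -val_eqE /= E => /negPf ->; rewrite scale0r.
  rewrite nth_default// big1// => i _; rewrite E.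
  by rewrite ltn_eqF ?scale0r// (leq_trans (ltn_ord i)).
- by rewrite big1// => i _; rewrite scale0r.
- by rewrite IHa IHb -big_split; apply: eq_bigr => i _; rewrite scalerDl.
- by rewrite IHa -sumrN; apply: eq_bigr => i _; rewrite scaleNr.
- by rewrite IHa scaler_sumr; apply: eq_bigr => i _; rewrite scalerA.
- rewrite IHa -sumrMnl; apply: eq_bigr => i _.
  by rewrite -scaler_nat scalerA.
Qed.

Fixpoint meq n (a b : mexp K) : Prop :=
  if n is n'.+1 then mcoef a n' = mcoef b n' /\ meq n' a b else True.

Lemma lmodP env a b : meq (size env) a b -> mden env a = mden env b.
Proof.
move=> h; rewrite !mdenE; apply: eq_bigr => i _; congr (_ *: _).
have : forall n, meq n a b -> forall j, (j < n)%N -> mcoef a j = mcoef b j.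
  elim=> //= n IH [hn /IH hb] j; rewrite ltnS leq_eqVlt => /predU1P[->//|].
  exact: hb.
by move=> /(_ _ h); apply.
Qed.

End LinearReflection.

Ltac lmod_index x l :=
  match l with
  | ?y :: ?l' => match l with
     | _ => let _ := match goal with _ => first [constr_eq x y | unify x y] end in constr:(O)
     | _ => let n := lmod_index x l' in constr:(S n)
     end
  end.
Ltac lmod_mem x l :=
  match l with
  | ?y :: ?l' => match l with
     | _ => let _ := match goal with _ => first [constr_eq x y | unify x y] end in constr:(true)
     | _ => lmod_mem x l'
     end
  | _ => constr:(false)
  end.
Ltac lmod_atoms V l e :=
  match e with
  | 0%R => l
  | (?a + ?b)%R => let l' := lmod_atoms V l a in lmod_atoms V l' b
  | (- ?a)%R => lmod_atoms V l a
  | (?k *: ?a)%R => lmod_atoms V l a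
  | (?a *+ ?n)%R => lmod_atoms V l a
  | _ => match lmod_mem e l with
         | true => l
         | false => constr:(@cons V e l)
         end
  end.
Ltac lmod_reify K l e :=
  match e with
  | 0%R => constr:(@MO K)
  | (?a + ?b)%R => let a' := lmod_reify K l a in let b' := lmod_reify K l b in
      constr:(@MAdd K a' b')
  | (- ?a)%R => let a' := lmod_reify K l a in constr:(@MOpp K a')
  | (?k *: ?a)%R => let a' := lmod_reify K l a in constr:(@MSc K k a')
  | (?a *+ ?n)%R => let a' := lmod_reify K l a in constr:(@MMuln K a' n)
  | _ => let i := lmod_index e l in constr:(@MA K i)
  end.
Ltac lmod_over K V :=
  match goal with
  | |- ?a = ?b =>
    let T := type of a in
    let l0 := constr:(@nil T) in
    let l1 := lmod_atoms T l0 a in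
    let l := lmod_atoms T l1 b in
    let a' := lmod_reify (GRing.PzRing.sort K) l a in
    let b' := lmod_reify (GRing.PzRing.sort K) l b in
    refine (@lmodP K V l a' b' _);
    cbn [meq mcoef size eqn]; repeat split; try by [ring|field|lra]
  end.

Section Test.
Variables (R : realType) (V : lmodType R) (x y z : V) (a b : R).
Goal a *: (x + 2 *: y - z) + b *: x = (a + b) *: x + (2 * a) *: y - a *: z.
Proof. lmod_over R V. Qed.
Goal 2^-1 *: (x + 2 *: y - z) + x *+ 2 - x = (3/2) *: x + y - 2^-1 *: z.
Proof. lmod_over R V. Qed.
End Test.

(** * Bilinear algebras and formal power series over them *)

Section BilinearAlgebras.
Variable R : realType.

Section Bilinear.
Variables (V : lmodType R) (br : V -> V -> V).
Hypothesis bil : is_algebra br.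

Lemma brDl x y z : br (x + y) z = br x z + br y z.
Proof. by have := bil.2 z 1 x y; rewrite !scale1r. Qed.
Lemma brDr x y z : br x (y + z) = br x y + br x z.
Proof. by have := bil.1 x 1 y z; rewrite !scale1r. Qed.
Lemma br0l z : br 0 z = 0.
Proof. by apply: (addrI (br 0 z)); rewrite -brDl !addr0. Qed.
Lemma br0r z : br z 0 = 0.
Proof. by apply: (addrI (br z 0)); rewrite -brDr !addr0. Qed.
Lemma brZl a x z : br (a *: x) z = a *: br x z.
Proof. by have := bil.2 z a x 0; rewrite !addr0 br0l addr0. Qed.
Lemma brZr a x z : br x (a *: z) = a *: br x z.
Proof. by have := bil.1 x a z 0; rewrite !addr0 br0r addr0. Qed.
Lemma brNl x z : br (- x) z = - br x z.
Proof. by rewrite -scaleN1r brZl scaleN1r. Qed.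
Lemma brNr x z : br x (- z) = - br x z.
Proof. by rewrite -scaleN1r brZr scaleN1r. Qed.
Lemma br_suml I (s : seq I) (P : pred I) (F : I -> V) z :
  br (\sum_(i <- s | P i) F i) z = \sum_(i <- s | P i) br (F i) z.
Proof. by elim/big_ind2 : _ => [|u u' w w' <- <-|//]; rewrite ?br0l ?brDl. Qed.
Lemma br_sumr I (s : seq I) (P : pred I) (F : I -> V) z :
  br z (\sum_(i <- s | P i) F i) = \sum_(i <- s | P i) br z (F i).
Proof. by elim/big_ind2 : _ => [|u u' w w' <- <-|//]; rewrite ?br0r ?brDr. Qed.
Definition br_lin := (brDl, brDr, br0l, br0r, brZl, brZr, brNl, brNr).

End Bilinear.

Lemma mk_algebra (V : lmodType R) (br : V -> V -> V) :
  (forall x y z, br (x + y) z = br x z + br y z) ->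
  (forall x y z, br x (y + z) = br x y + br x z) ->
  (forall a x z, br (a *: x) z = a *: br x z) ->
  (forall a x z, br x (a *: z) = a *: br x z) -> is_algebra br.
Proof.
move=> Dl Dr Zl Zr; split=> x a y z; first by rewrite Dr Zr.
by rewrite Dl Zl.
Qed.

Definition is_lie (V : lmodType R) (br : V -> V -> V) :=
  [/\ is_algebra br, forall x y, br x y = - br y x &
      forall x y z, br x (br y z) = br (br x y) z + br y (br x z)].

(* Formal power series with coefficients in an algebra, as functions [nat -> V]. *)
Section Series.
Variables (V : lmodType R) (br : V -> V -> V).
Implicit Types X Y Z : nat -> V.

(** The Cauchy product; [Dq] is the derivation t d/dt. *)
Definition cv X Y : nat -> V := fun n => \sum_(i < n.+1) br (X i) (Y (n - i)%N).
Definition Dq X : nat -> V := fun n => n%:R *: X n.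

Hypothesis bil : is_algebra br.

Lemma cvDl X Y Z : cv (X + Y) Z = cv X Z + cv Y Z.
Proof.
apply/funext => n; rewrite /cv -[RHS]/(cv X Z n + cv Y Z n) -big_split.
by apply: eq_bigr => i _; rewrite brDl.
Qed.
Lemma cvDr X Y Z : cv X (Y + Z) = cv X Y + cv X Z.
Proof.
apply/funext => n; rewrite /cv -[RHS]/(cv X Y n + cv X Z n) -big_split.
by apply: eq_bigr => i _; rewrite brDr.
Qed.
Lemma cvZl a X Z : cv (a *: X) Z = a *: cv X Z.
Proof.
apply/funext => n; rewrite /cv -[RHS]/(a *: cv X Z n) scaler_sumr.
by apply: eq_bigr => i _; rewrite brZl.
Qed.
Lemma cvZr a X Z : cv X (a *: Z) = a *: cv X Z.
Proof.
apply/funext => n; rewrite /cv -[RHS]/(a *: cv X Z n) scaler_sumr.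
by apply: eq_bigr => i _; rewrite brZr.
Qed.
Lemma cv_bil : is_algebra cv.
Proof. exact: mk_algebra cvDl cvDr cvZl cvZr. Qed.

Lemma DqD X Y : Dq (X + Y) = Dq X + Dq Y.
Proof. by apply/funext => n; rewrite /Dq -[LHS]/(n%:R *: (X n + Y n)) scalerDr. Qed.
Lemma DqZ a X : Dq (a *: X) = a *: Dq X.
Proof.
apply/funext => n; rewrite /Dq -[LHS]/(n%:R *: (a *: X n)) -[RHS]/(a *: (n%:R *: X n)).
by rewrite !scalerA mulrC.
Qed.
Lemma Dq0 : Dq 0 = 0.
Proof. by rewrite -(scale0r (0 : nat -> V)) DqZ !scale0r. Qed.
Lemma DqN X : Dq (- X) = - Dq X.
Proof. by rewrite -scaleN1r DqZ scaleN1r. Qed.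

Lemma Dq_cv X Y : Dq (cv X Y) = cv (Dq X) Y + cv X (Dq Y).
Proof.
apply/funext => n; rewrite /Dq /cv -[RHS]/(cv (Dq X) Y n + cv X (Dq Y) n) -big_split.
rewrite scaler_sumr; apply: eq_bigr => i _.
by rewrite /Dq /= brZl// brZr// -scalerDl -natrD subnKC// -ltnS.
Qed.

(** With [cv3l], both ways of nesting become sums over i + j + k = n, so the Leibniz identity passes
    to series term by term. *)
Lemma cv3r X Y Z n : cv X (cv Y Z) n =
  \sum_(i < n.+1) \sum_(j < n.+1) \sum_(k < n.+1 | (i + j + k == n)%N)
     br (X i) (br (Y j) (Z k)).
Proof.
apply: eq_bigr => i _; rewrite /cv br_sumr//.
rewrite (big_ord_widen n.+1 (fun j => br (X i) (br (Y j) (Z (n - i - j)%N)))) ?ltnS ?leq_subr//.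
rewrite big_mkcond; apply: eq_bigr => j _ /=.
case: ifP => jn.
  have kn : (n - i - j < n.+1)%N by rewrite ltnS -subnDA leq_subr.
  rewrite (big_pred1 (Ordinal kn))// => k; rewrite /= -val_eqE /=; have := ltn_ord i; lia.
by rewrite big_pred0// => k; have := ltn_ord i; lia.
Qed.

Lemma cv3l X Y Z n : cv (cv X Y) Z n =
  \sum_(i < n.+1) \sum_(j < n.+1) \sum_(k < n.+1 | (i + j + k == n)%N)
     br (br (X i) (Y j)) (Z k).
Proof.
transitivity (\sum_(k < n.+1) \sum_(i < n.+1) \sum_(j < n.+1 | (i + j + k == n)%N)
     br (br (X i) (Y j)) (Z k)); last first.
  rewrite exchange_big; apply: eq_bigr => i _ /=.
  rewrite (exchange_big_dep predT)//=; apply: eq_bigr => j _.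
rewrite /cv (reindex_inj rev_ord_inj) /=; apply: eq_bigr => k _.
have kn : (k <= n)%N by rewrite -ltnS.
rewrite br_suml// subSS.
rewrite (big_ord_widen n.+1 (fun i => br (br (X i) (Y (n - k - i)%N)) (Z (n - (n - k))%N))) ?ltnS ?leq_subr//.
rewrite big_mkcond; apply: eq_bigr => i _ /=.
case: ifP => jn.
  have kn' : (n - k - i < n.+1)%N by rewrite ltnS -subnDA leq_subr.
  rewrite (big_pred1 (Ordinal kn')) /= ?subKn// => j; rewrite /= -val_eqE /=; lia.
by rewrite big_pred0// => j; lia.
Qed.

Lemma cv_anti X Y : (forall x y, br x y = - br y x) -> cv X Y = - cv Y X.
Proof.
move=> anti; apply/funext => n; rewrite /cv -[RHS]/(- cv Y X n) (reindex_inj rev_ord_inj) -sumrN.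
apply: eq_bigr => i _ /=; rewrite subSS anti subKn// -ltnS//.
Qed.

Lemma cv_leib X Y Z :
  (forall x y z, br x (br y z) = br (br x y) z + br y (br x z)) ->
  cv X (cv Y Z) = cv (cv X Y) Z + cv Y (cv X Z).
Proof.
move=> leib; apply/funext => n.
rewrite -[RHS]/(cv (cv X Y) Z n + cv Y (cv X Z) n) !cv3r cv3l.
rewrite [X in _ = _ + X]exchange_big -big_split; apply: eq_bigr => i _ /=.
rewrite -big_split; apply: eq_bigr => j _ /=.
under [X in _ = _ + X]eq_bigl => k do rewrite (addnC j i).
by rewrite -big_split; apply: eq_bigr => k _; exact: leib.
Qed.

End Series.

Lemma cv_lie (V : lmodType R) (br : V -> V -> V) : is_lie br -> is_lie (cv br).
Proof.
move=> [bil anti leib]; split; first exact: cv_bil.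
- by move=> X Y; exact: cv_anti.
- by move=> X Y Z; exact: cv_leib.
Qed.

(* The semidirect product of the Lie algebra of formal power series with the
   derivation t d/dt, which is the element (0, 1). *)
Section Semidirect.
Variables (V : lmodType R) (br : V -> V -> V).

Definition SD := ((nat -> V) * R^o)%type.
Definition sb (u v : SD) : SD :=
  (cv br u.1 v.1 + (u.2 : R) *: Dq v.1 - (v.2 : R) *: Dq u.1, 0).

Hypothesis lie : is_lie br.
Let bil : is_algebra br. Proof. by case: lie. Qed.
Let W := (nat -> V).

Lemma sb_bil : is_algebra sb.
Proof.
apply: mk_algebra.
- move=> [x a] [y b] [z c]; congr (_, _); rewrite /= ?addr0// cvDl// DqD.
  lmod_over R W.
- move=> [x a] [y b] [z c]; congr (_, _); rewrite /= ?addr0// cvDr// DqD.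
  lmod_over R W.
- move=> k [x a] [z c]; congr (_, _); rewrite /= ?scaler0// cvZl// DqZ -[k *: a]/(k * (a : R)).
  lmod_over R W.
- move=> k [x a] [z c]; congr (_, _); rewrite /= ?scaler0// cvZr// DqZ -[k *: c]/(k * (c : R)).
  lmod_over R W.
Qed.

Lemma sb_lie : is_lie sb.
Proof.
have [_ anti leib] := lie; split; first exact: sb_bil.
  move=> [x a] [y b]; congr (_, _); rewrite /= ?oppr0//.
  rewrite (cv_anti _ _ anti); lmod_over R W.
move=> [x a] [y b] [z c]; congr (_, _); rewrite /= ?addr0//.
have b2 := cv_bil bil.
rewrite !(br_lin b2) !scale0r !(DqD, DqN, DqZ, Dq_cv bil) (cv_leib bil _ _ _ leib).
rewrite (cv_anti (Dq x) y anti).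
lmod_over R W.
Qed.

End Semidirect.
End BilinearAlgebras.

(** * The Baker-Campbell-Hausdorff series by recursion on the degree *)

Section BCHRecursion.
Variable R : realType.

Section Recursion.
Variables (V : lmodType R) (br : V -> V -> V) (c : nat -> R) (w : nat -> V).

(** Degree n of the equation sum_k (ad Z)^k (DZ) / (k+1)! = w, solved for Z_n when c k = - 1 /
    (k+1)!; the term k = 0 is n Z_n. Since the inverse of 0 is 0, degree 0 of the result is 0. *)
Definition Phi (Z : nat -> V) : nat -> V := fun n =>
  n%:R^-1 *: (w n + \sum_(1 <= k < n) c k *: iter k (cv br Z) (Dq Z) n).

(** Degree n no longer changes after n iterations ([iterPhi_stable]), so the diagonal is a fixed
    point. *)
Definition solz (n : nat) : V := iter n Phi (fun=> 0) n.

Hypothesis bil : is_algebra br.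

(** All k + 1 factors have positive degree. This justifies cutting the sum in [Phi] at k < n. *)
Lemma itcv_low Z k n : Z 0%N = 0 -> (n <= k)%N -> iter k (cv br Z) (Dq Z) n = 0.
Proof.
move=> Z0; elim: k n => [|k IH] n nk /=.
  by move: nk; rewrite leqn0 => /eqP ->; rewrite /Dq scale0r.
rewrite /cv big1// => -[[|i] /= ilt] _; first by rewrite Z0 br0l.
by rewrite IH ?br0r//; lia.
Qed.

(** For k > 0 every factor is accompanied by another one of positive degree, so degree n depends on
    lower degrees only; hence the gain [(0 < k)%N]. *)
Lemma itcv_causal X Y n : X 0%N = 0 -> Y 0%N = 0 -> (forall i, (i < n)%N -> X i = Y i) ->
  forall k m, (m < n + (0 < k)%N)%N ->
  iter k (cv br X) (Dq X) m = iter k (cv br Y) (Dq Y) m.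
Proof.
move=> X0 Y0 XY; elim=> [|k IH] m.
  by rewrite addn0 => mn; rewrite /= /Dq XY.
rewrite /= addn1 ltnS => mn; apply: eq_bigr => -[i /= im] _.
have [->|i0] := posnP i; first by rewrite X0 Y0 !br0l.
have [im'|im'] := eqVneq i m.
  by rewrite im' subnn !itcv_low ?br0r.
rewrite XY ?IH//; move: im im' i0 mn => /=; rewrite ltnS; lia.
Qed.

Lemma Phi_causal X Y n : X 0%N = 0 -> Y 0%N = 0 -> (forall i, (i < n)%N -> X i = Y i) ->
  Phi X n = Phi Y n.
Proof.
move=> X0 Y0 XY; congr (_ *: (_ + _)); apply: eq_big_nat => k /andP[k1 kn].
by rewrite (itcv_causal X0 Y0 XY)// k1; lia.
Qed.

Lemma Phi0 X : Phi X 0%N = 0.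
Proof. by rewrite /Phi invr0 scale0r. Qed.

Lemma iterPhi0 j : iter j Phi (fun=> 0) 0%N = 0.
Proof. by case: j => // j; rewrite iterS Phi0. Qed.

Lemma iterPhi_stable n j j' : (n <= j)%N -> (n <= j')%N ->
  iter j Phi (fun=> 0) n = iter j' Phi (fun=> 0) n.
Proof.
elim/ltn_ind: n j j' => -[|n] IH j j'; first by rewrite !iterPhi0.
case: j => // j; case: j' => // j'; rewrite !ltnS => nj nj' /=.
apply: Phi_causal; rewrite ?iterPhi0// => i ilt.
by apply: IH => //; lia.
Qed.

Lemma solz0 : solz 0%N = 0. Proof. by []. Qed.

Lemma solzE n : solz n = Phi solz n.
Proof.
rewrite /solz (@iterPhi_stable n n n.+1)// iterS.
apply: Phi_causal => // [|i ilt]; first exact: iterPhi0.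
by apply: iterPhi_stable => //; exact: ltnW.
Qed.

Lemma Phi_uniq X Y : X 0%N = 0 -> Y 0%N = 0 ->
  (forall n, X n = Phi X n) -> (forall n, Y n = Phi Y n) -> X = Y.
Proof.
move=> X0 Y0 hX hY; apply/funext => n; elim/ltn_ind: n => n IH.
by rewrite hX hY; exact: Phi_causal.
Qed.

End Recursion.

(* Parametricity of the recursion with respect to a graded relation; all
   naturality, congruence and norm statements on its solution are instances. *)
Section Parametricity.
Variables (V V' : lmodType R) (br : V -> V -> V) (br' : V' -> V' -> V').
Variables (c c' : nat -> R) (w : nat -> V) (w' : nat -> V').
Variable S : nat -> V -> V' -> Prop.
Hypotheses (S0 : forall n, S n 0 0)
  (SD : forall n u v u' v', S n u u' -> S n v v' -> S n (u + v) (u' + v'))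
  (SZ : forall n a u u', 0 <= a -> S n u u' -> S n (a *: u) (a *: u'))
  (Sc : forall n k u u', S n u u' -> S n (c k *: u) (c' k *: u'))
  (Sbr : forall m n u u' v v', S m u u' -> S n v v' -> S (m + n)%N (br u v) (br' u' v'))
  (Sw : forall n, S n (w n) (w' n)).

Let SS (X : nat -> V) (X' : nat -> V') := forall n, S n (X n) (X' n).

Lemma S_sum n (I : Type) (s : seq I) (P : pred I) (F : I -> V) (F' : I -> V') :
  (forall i, P i -> S n (F i) (F' i)) ->
  S n (\sum_(i <- s | P i) F i) (\sum_(i <- s | P i) F' i).
Proof.
move=> h; elim: s => [|i s IH]; first by rewrite !big_nil.
by rewrite !big_cons; case: ifP => // Pi; apply: SD => //; exact: h.
Qed.

Lemma SS_cv X X' Y Y' : SS X X' -> SS Y Y' -> SS (cv br X Y) (cv br' X' Y').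
Proof.
move=> hX hY n; apply: S_sum => -[i /= ilt] _.
by have := Sbr (hX i) (hY (n - i)%N); rewrite subnKC// -ltnS.
Qed.

Lemma SS_Dq X X' : SS X X' -> SS (Dq X) (Dq X').
Proof. by move=> hX n; apply: SZ. Qed.

Lemma SS_Phi X X' : SS X X' -> SS (Phi br c w X) (Phi br' c' w' X').
Proof.
move=> hX n; apply: SZ; first by rewrite invr_ge0.
apply: SD; first exact: Sw.
apply: S_sum => k _; apply: Sc.
have : SS (iter k (cv br X) (Dq X)) (iter k (cv br' X') (Dq X')).
  elim: k => [|k IH]; [exact: SS_Dq|exact: SS_cv].
exact.
Qed.

Lemma S_solz n : S n (solz br c w n) (solz br' c' w' n).
Proof.
suff : SS (iter n (Phi br c w) (fun=> 0)) (iter n (Phi br' c' w') (fun=> 0)) by exact.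
elim: n => [|k IH]; [by move=> m; exact: S0|exact: SS_Phi].
Qed.

End Parametricity.

(** The components of x + exp(ad x) y, with x and y placed in degree one. *)
Definition wser (V : lmodType R) (br : V -> V -> V) (x y : V) (n : nat) : V :=
  if n is k.+1 then (k`!%:R)^-1 *: iter k (br x) y + (if k == 0%N then x else 0) else 0.

Definition cbch (k : nat) : R := - (k.+1`!%:R)^-1.

(* [bchz x y n] is the component of degree [n] of the Baker-Campbell-Hausdorff
   series Z = log(exp x exp y), computed from
   sum_k (ad Z)^k (DZ) / (k+1)! = x + exp(ad x) y, D being the degree derivation. *)
Definition bchz (V : lmodType R) (br : V -> V -> V) (x y : V) : nat -> V :=
  solz br cbch (wser br x y).

Lemma S_wser (V V' : lmodType R) (br : V -> V -> V) (br' : V' -> V' -> V')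
    (S : nat -> V -> V' -> Prop) x y x' y' :
  (forall n, S n 0 0) ->
  (forall n u v u' v', S n u u' -> S n v v' -> S n (u + v) (u' + v')) ->
  (forall n a u u', 0 <= a -> S n u u' -> S n (a *: u) (a *: u')) ->
  (forall m n u u' v v', S m u u' -> S n v v' -> S (m + n)%N (br u v) (br' u' v')) ->
  S 1%N x x' -> S 1%N y y' -> forall n, S n (wser br x y n) (wser br' x' y' n).
Proof.
move=> S0 SD SZ Sbr Sx Sy [|k] /=; first exact: S0.
apply: SD.
  apply: SZ; first by rewrite invr_ge0.
  elim: k => [|k IH] //=; rewrite -add1n; exact: Sbr.
by case: k => [|k] /=.
Qed.

(* Linear graded relations. *)
Lemma S_bchz (V V' : lmodType R) (br : V -> V -> V) (br' : V' -> V' -> V')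
    (S : nat -> V -> V' -> Prop) x y x' y' :
  (forall n, S n 0 0) ->
  (forall n u v u' v', S n u u' -> S n v v' -> S n (u + v) (u' + v')) ->
  (forall n a u u', S n u u' -> S n (a *: u) (a *: u')) ->
  (forall m n u u' v v', S m u u' -> S n v v' -> S (m + n)%N (br u v) (br' u' v')) ->
  S 1%N x x' -> S 1%N y y' -> forall n, S n (bchz br x y n) (bchz br' x' y' n).
Proof.
move=> S0 SD SZ Sbr Sx Sy n; apply: S_solz => //.
- by move=> ? ? ? ? _; exact: SZ.
- by move=> ? ? ? ?; exact: SZ.
- by apply: S_wser => // ? ? ? ? _; exact: SZ.
Qed.

End BCHRecursion.

(** * Formal exponentials of inner derivations *)

Section FormalGroup.
Variable R : realType.

(** Turns a truncated Cauchy product into a product of truncations, once terms of total degree at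
    least N vanish. *)
Lemma tri_square (V : nmodType) (a : nat -> nat -> V) N :
  (forall i j, (N <= i + j)%N -> a i j = 0) ->
  \sum_(k < N) \sum_(i < k.+1) a i (k - i)%N = \sum_(i < N) \sum_(j < N) a i j.
Proof.
move=> a0.
transitivity (\sum_(k < N) \sum_(i < N | (i <= k)%N) a i (k - i)%N).
  apply: eq_bigr => k _; rewrite (big_ord_widen N (fun i => a i (k - i)%N))//.
rewrite (exchange_big_dep predT)//=; apply: eq_bigr => i _.
transitivity (\sum_(i <= k < N) a i (k - i)%N).
  by rewrite big_geq_mkord; apply: eq_bigl => k.
rewrite -{1}[i : nat]add0n big_addn big_mkord.
transitivity (\sum_(j < N - i) a i j).
  by apply: eq_bigr => j _; rewrite addnK.
rewrite (big_ord_widen N (fun j => a i j)) ?leq_subr// [RHS](bigID (fun j : 'I_N => (j < N - i)%N)) /=.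
rewrite [X in _ + X]big1 ?addr0// => j jN; apply: a0; lia.
Qed.

Section Exponential.
Variables (V : lmodType R) (br : V -> V -> V).
Hypothesis lie : is_lie br.
Let bil : is_algebra br. Proof. by case: lie. Qed.
Notation L := (SD V).
Notation sb := (sb br).
Let sbil : is_algebra sb. Proof. exact: sb_bil. Qed.

(** The filtration by order of vanishing; the degree derivation itself counts as order 0. *)
Definition Fil (n : nat) (u : L) :=
  ((0 < n)%N -> u.2 = 0) /\ forall i, (i < n)%N -> u.1 i = 0.

Lemma Fil0 u : Fil 0 u. Proof. by []. Qed.

Lemma FilE n u i : Fil n u -> (i < n)%N -> u.1 i = 0. Proof. by case=> _; apply. Qed.

Lemma Fil_sb m n u v : Fil m u -> Fil n v -> Fil (m + n) (sb u v).
Proof.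
case: u => X a; case: v => Y b [/= a0 X0] [/= b0 Y0]; split=> // i imn /=.
rewrite -[LHS]/(cv br X Y i + (a : R) *: Dq Y i - (b : R) *: Dq X i).
have -> : cv br X Y i = 0.
  rewrite /cv big1// => -[j /= jlt] _; have [jm|jm] := ltnP j m; first by rewrite X0// br0l.
  by rewrite Y0 ?br0r//; lia.
have -> : (a : R) *: Dq Y i = 0.
  case: m a0 X0 imn => [|m] a0 X0 imn; first by rewrite /Dq Y0// !scaler0.
  by rewrite a0// scale0r.
have -> : (b : R) *: Dq X i = 0.
  case: n b0 Y0 imn => [|n] b0 Y0 imn; last by rewrite b0// scale0r.
  by rewrite /Dq X0 ?scaler0//; lia.
by rewrite addr0 subrr.
Qed.

Lemma Fil_le m n u : (m <= n)%N -> Fil n u -> Fil m u.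
Proof.
move=> mn [u2 u1]; split=> [m0|i im]; first by apply: u2; lia.
by apply: u1; lia.
Qed.

Lemma Fil_iter u v k : Fil 1 u -> Fil k (iter k (sb u) v).
Proof. by move=> u1; elim: k => [//|k IH] /=; rewrite -add1n; exact: Fil_sb. Qed.

Lemma Fil_lin n a u v : Fil n u -> Fil n v -> Fil n (a *: u + v).
Proof.
case: u => X x; case: v => Y y [/= x0 X0] [/= y0 Y0]; split=> /= [n0|i ilt].
  by rewrite x0// y0// scaler0 addr0.
by rewrite -[LHS]/(a *: X i + Y i) X0// Y0// scaler0 addr0.
Qed.

Lemma sb_trunc u v u' v' n : u.2 = u'.2 -> v.2 = v'.2 ->
  (forall i, (i <= n)%N -> u.1 i = u'.1 i) -> (forall i, (i <= n)%N -> v.1 i = v'.1 i) ->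
  (sb u v).1 n = (sb u' v').1 n.
Proof.
case: u u' => [X a] [X' a']; case: v v' => [Y b] [Y' b'] /= <- <- XX YY.
congr (_ + _ - _); last by rewrite -[LHS]/((b : R) *: (n%:R *: X n)) XX.
  by apply: eq_bigr => -[i ilt] _ /=; rewrite XX ?YY ?leq_subr.
by rewrite -[LHS]/((a : R) *: (n%:R *: Y n)) YY.
Qed.

(** The action exp(ad u) v. For u of positive order the k-th term has order at least k, so stopping
    at k = n is exact in degree n. *)
Definition Ex (u v : L) : L :=
  ((fun n => \sum_(k < n.+1) (k`!%:R)^-1 *: (iter k (sb u) v).1 n), v.2).
Definition ExN N (u v : L) : L := \sum_(k < N) (k`!%:R)^-1 *: iter k (sb u) v.

Lemma fst_sum (I : Type) (s : seq I) (P : pred I) (F : I -> L) n :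
  (\sum_(i <- s | P i) F i).1 n = \sum_(i <- s | P i) (F i).1 n.
Proof. by elim/big_rec2 : _ => // i x y _ <-. Qed.
Lemma snd_sum (I : Type) (s : seq I) (P : pred I) (F : I -> L) :
  (\sum_(i <- s | P i) F i).2 = \sum_(i <- s | P i) (F i).2.
Proof. by elim/big_rec2 : _ => // i x y _ <-. Qed.

Lemma Ex_trunc u v n N : Fil 1 u -> (n < N)%N -> (Ex u v).1 n = (ExN N u v).1 n.
Proof.
move=> u1 nN; rewrite fst_sum /= (big_ord_widen N (fun k => (k`!%:R)^-1 *: (iter k (sb u) v).1 n))//.
rewrite [RHS](bigID (fun k : 'I_N => (k < n.+1)%N)) /= [X in _ = _ + X]big1 ?addr0// => k.
rewrite -leqNgt => nk; rewrite -[LHS]/((k`!%:R)^-1 *: (iter k (sb u) v).1 n).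
by rewrite (FilE (Fil_iter v k u1)) ?scaler0.
Qed.

Lemma Ex_trunc2 u v N : Fil 1 u -> (0 < N)%N -> (Ex u v).2 = (ExN N u v).2.
Proof.
move=> u1; case: N => // N _; rewrite snd_sum big_ord_recl /= invr1 scale1r.
by rewrite big1 ?addr0// => i _; rewrite /= scaler0.
Qed.

Lemma natrS_unit n : (n.+1%:R : R) != 0. Proof. by rewrite pnatr_eq0. Qed.
Lemma factS_inv k : k.+1%:R * ((k.+1)`!%:R)^-1 = (k`!%:R)^-1 :> R.
Proof. by rewrite factS natrM invfM mulrA mulfV ?mul1r// natrS_unit. Qed.

Definition dpow u k v : L := (k`!%:R)^-1 *: iter k (sb u) v.

Lemma dpowS u k v : k.+1%:R *: dpow u k.+1 v = sb u (dpow u k v).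
Proof. by rewrite /dpow scalerA factS_inv brZr. Qed.

Lemma Fil_dpow u k v : Fil 1 u -> Fil k (dpow u k v).
Proof.
by move=> u1; rewrite /dpow -[X in Fil _ X]addr0; apply: Fil_lin => //; exact: Fil_iter.
Qed.

(** The Leibniz rule for the divided powers of the derivation ad u, by induction on k after
    multiplying by k + 1. *)
Lemma dpow_leib u k v w :
  dpow u k (sb v w) = \sum_(i < k.+1) sb (dpow u i v) (dpow u (k - i)%N w).
Proof.
have [_ _ leib] := sb_lie lie.
elim: k => [|k IH]; first by rewrite big_ord1 /dpow /= !invr1 !scale1r.
apply: (@scalerI _ _ k.+1%:R); first exact: natrS_unit.
rewrite dpowS IH br_sumr// scaler_sumr.
transitivity (\sum_(i < k.+1) (i.+1%:R *: sb (dpow u i.+1 v) (dpow u (k - i)%N w)) +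
  \sum_(i < k.+1) ((k - i).+1%:R *: sb (dpow u i v) (dpow u (k - i).+1 w))).
  rewrite -big_split; apply: eq_bigr => i _ /=.
  by rewrite leib -!dpowS (brZl sbil) (brZr sbil (k - i).+1%:R).
transitivity (\sum_(i < k.+2) (i%:R *: sb (dpow u i v) (dpow u (k.+1 - i)%N w)) +
  \sum_(i < k.+2) ((k.+1 - i)%:R *: sb (dpow u i v) (dpow u (k.+1 - i)%N w))); last first.
  rewrite -big_split; apply: eq_bigr => i _ /=.
  by rewrite -scalerDl -natrD subnKC// -ltnS.
congr (_ + _).
  by rewrite [RHS]big_ord_recl scale0r add0r; apply: eq_bigr => i _; rewrite subSS.
rewrite [RHS]big_ord_recr /= subnn scale0r addr0; apply: eq_bigr => -[i ilt] _ /=.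
by rewrite subSn.
Qed.

(** The exponential of a derivation is an automorphism: [dpow_leib] summed over k, with truncations
    that are exact in each degree. *)
Lemma Ex_sb u v w : Fil 1 u -> Ex u (sb v w) = sb (Ex u v) (Ex u w).
Proof.
move=> u1; congr pair; apply/funext => n.
rewrite [LHS](Ex_trunc _ u1 (ltnSn n)) [RHS](@sb_trunc _ _ (ExN n.+1 u v) (ExN n.+1 u w)).
- rewrite /ExN br_suml// !fst_sum.
  transitivity (\sum_(k < n.+1) \sum_(i < k.+1) (sb (dpow u i v) (dpow u (k - i)%N w)).1 n).
    by apply: eq_bigr => k _; rewrite -fst_sum -dpow_leib.
  rewrite (@tri_square _ (fun i j => (sb (dpow u i v) (dpow u j w)).1 n)).
    by apply: eq_bigr => i _; rewrite br_sumr// fst_sum.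
  move=> i j nij; apply: (@FilE (i + j)) => //; apply: Fil_sb; exact: Fil_dpow.
- exact: Ex_trunc2.
- exact: Ex_trunc2.
- by move=> i ilt; apply: Ex_trunc.
- by move=> i ilt; apply: Ex_trunc.
Qed.

Lemma iter_lin u k a v w : iter k (sb u) (a *: v + w) = a *: iter k (sb u) v + iter k (sb u) w.
Proof. by elim: k => //= k ->; rewrite brDr// brZr. Qed.

Lemma Ex_lin u a v w : Ex u (a *: v + w) = a *: Ex u v + Ex u w.
Proof.
congr pair; apply/funext => n.
rewrite -[RHS]/(a *: (Ex u v).1 n + (Ex u w).1 n) /= scaler_sumr -big_split.
apply: eq_bigr => k _; rewrite iter_lin /=.
rewrite -[X in _ *: X]/(a *: (iter k (sb u) v).1 n + (iter k (sb u) w).1 n).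
by rewrite scalerDr !scalerA mulrC.
Qed.

Lemma Ex_0r u : Ex u 0 = 0.
Proof.
congr pair; apply/funext => n /=; rewrite big1// => k _.
have -> : iter k (sb u) 0 = 0 by elim: (k : nat) => //= m ->; rewrite br0r.
by rewrite scaler0.
Qed.

Lemma iter_sb_ser (Z U : nat -> V) k :
  iter k (sb (Z, 0)) (U, 0) = (iter k (cv br Z) U, 0).
Proof.
by elim: k => //= k ->; congr pair; rewrite /= !scale0r addr0 subr0.
Qed.

End Exponential.
End FormalGroup.

(** * The BCH identity for formal exponentials *)

Section FormalBCH.
Variable R : realType.

Definition single (V : lmodType R) (x : V) : nat -> V := fun n => if n == 1%N then x else 0.
Definition const0 (V : lmodType R) (x : V) : nat -> V := fun n => if n == 0%N then x else 0.

Section Identity.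
Variables (V : lmodType R) (br : V -> V -> V).
Hypothesis lie : is_lie br.
Let bil : is_algebra br. Proof. by case: lie. Qed.
Notation L := (SD V).
Notation sb := (sb br).
Notation Ex := (Ex br).
Let sbil : is_algebra sb. Proof. exact: sb_bil. Qed.
Definition Dd : L := (0, 1).

Lemma Fil1 (Z : nat -> V) : Z 0%N = 0 -> Fil 1 ((Z, 0) : L).
Proof. by move=> Z0; split=> // -[]. Qed.

Lemma Ex_Dd_coef (Z : nat -> V) n : (Ex (Z, 0) Dd).1 n =
  - (\sum_(k < n) (k.+1`!%:R)^-1 *: iter k (cv br Z) (Dq Z) n).
Proof.
rewrite -[LHS]/(\sum_(k < n.+1) (k`!%:R)^-1 *: (iter k (sb (Z, 0)) Dd).1 n).
rewrite big_ord_recl -[X in _ *: X + _]/(0 : V) scaler0 add0r -sumrN.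
apply: eq_bigr => k _; rewrite -[RHS]scalerN lift0; congr (_ *: _).
have -> : iter k.+1 (sb (Z, 0)) Dd = iter k (sb (Z, 0)) (- Dq Z, 0).
  rewrite iterSr; congr (iter _ _ (_, _)).
  by rewrite /= (br0r (cv_bil bil)) scale0r scale1r !add0r.
rewrite iter_sb_ser /=; have -> : - Dq Z = (-1) *: Dq Z by rewrite scaleN1r.
have -> : iter k (cv br Z) (-1 *: Dq Z) = (-1) *: iter k (cv br Z) (Dq Z).
  by elim: (k : nat) => //= m ->; rewrite (brZr (cv_bil bil)).
by rewrite -[LHS]/(-1 *: iter k (cv br Z) (Dq Z) n) scaleN1r.
Qed.

(** As [Z, D] = - DZ, the equation exp(ad Z) D = D - w reads sum_k (ad Z)^k (DZ) / (k+1)! = w, which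
    is the fixed-point equation of [Phi]. *)
Lemma Ex_Dd_Phi (Z w : nat -> V) : Z 0%N = 0 -> w 0%N = 0 ->
  (forall n, Z n = Phi br (cbch R) w Z n) <-> Ex (Z, 0) Dd = (- w, 1).
Proof.
move=> Z0 w0.
have E n : (Ex (Z, 0) Dd).1 n.+1 = - w n.+1 <->
    n.+1%:R *: Z n.+1 = w n.+1 + \sum_(1 <= k < n.+1) cbch R k *: iter k (cv br Z) (Dq Z) n.+1.
  rewrite Ex_Dd_coef big_ord_recl /= invr1 scale1r -[Dq Z n.+1]/(n.+1%:R *: Z n.+1).
  rewrite big_add1 /= big_mkord.
  have -> : \sum_(i < n) (bump 0 i).+1`!%:R^-1 *: cv br Z (iter i (cv br Z) (Dq Z)) n.+1 =
     - \sum_(i < n) cbch R i.+1 *: cv br Z (iter i (cv br Z) (Dq Z)) n.+1.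
    rewrite -sumrN; apply: eq_bigr => i _.
    by rewrite /cbch scaleNr opprK /bump /= add1n.
  split=> [/oppr_inj <-|->]; first by rewrite subrK.
  by rewrite addrK.
split=> [h|h].
  congr pair; apply/funext => -[|n].
    by rewrite -[LHS]/((Ex (Z, 0) Dd).1 0%N) Ex_Dd_coef big_ord0 -[RHS]/(- w 0%N) w0.
  by apply/E; rewrite {1}h /Phi scalerA mulfV ?natrS_unit// scale1r.
case=> [|n]; first by rewrite Phi0.
have /E En : (Ex (Z, 0) Dd).1 n.+1 = - w n.+1 by rewrite h.
by rewrite /Phi -En scalerA mulVf ?scale1r// natrS_unit.
Qed.

Lemma cv_single_single (y : V) : cv br (single y) (single y) = 0.
Proof.
have [_ anti _] := lie.
have yy : br y y = 0.
  apply: (@scalerI _ _ (2 : R)); first by rewrite pnatr_eq0.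
  by rewrite scaler0 scaler_nat mulr2n {1}anti addNr.
apply/funext => n; rewrite /cv big1// => i _; rewrite /single.
by case: ifP => _; case: ifP => _; rewrite ?br0l ?br0r.
Qed.

Lemma iter_single (x y : V) k :
  iter k (cv br (single x)) (single y) = fun n => if n == k.+1 then iter k (br x) y else 0.
Proof.
elim: k => [|k IH] //; apply/funext => n; rewrite iterS IH /cv.
case: n => [|n]; first by rewrite big_ord1 /single br0l.
rewrite big_ord_recl {1}/single br0l// add0r big_ord_recl /= subSS subn0 big1 ?addr0.
  by rewrite /single /= !eqSS; case: eqP => //; rewrite br0r.
by move=> i _; rewrite /single /= br0l.
Qed.

Lemma Ex_single_Dd (y : V) : Ex (single y, 0) Dd = (- single y, 1).
Proof.
apply/Ex_Dd_Phi => // n; rewrite /Phi.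
have D1 : Dq (single y) = single y.
  apply/funext => m; rewrite /Dq /single; case: eqP => [->|]; rewrite ?scaler0 ?scale1r//.
rewrite D1 big1_seq ?addr0 => [|k /andP[_]].
  by rewrite /single; case: eqP => [->|]; rewrite ?scaler0 ?invr1 ?scale1r.
rewrite mem_index_iota => /andP[k1 _].
have -> : iter k (cv br (single y)) (single y) = 0.
  elim: k k1 => // -[_ _|k IH _] /=; first exact: cv_single_single.
  by rewrite -iterS IH// (br0r (cv_bil bil)).
by rewrite -[X in _ *: X]/(0 : V) scaler0.
Qed.

Lemma Ex_single2_Dd (x y : V) :
  Ex (single x, 0) (Ex (single y, 0) Dd) = (- wser br x y, 1).
Proof.
rewrite Ex_single_Dd.
have -> : (- single y, 1) = (-1) *: ((single y, 0) : L) + Dd.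
  by congr pair; rewrite /= ?scaler0 ?add0r// addr0 scaleN1r.
rewrite Ex_lin// Ex_single_Dd; congr pair; last by rewrite /= scaler0 add0r.
apply/funext => n.
rewrite -[LHS]/(-1 *: (Ex (single x, 0) (single y, 0)).1 n + - single x n).
rewrite -[RHS]/(- wser br x y n) scaleN1r -opprD; congr (- _).
rewrite /=; under eq_bigr do rewrite iter_sb_ser iter_single /=.
case: n => [|n]; first by rewrite big_ord1 /single /= scaler0 addr0.
rewrite (bigD1 (inord n)) //= !inordK// eqxx big1 ?addr0.
  by rewrite /single eqSS.
move=> i /eqP ni; rewrite eqSS; case: eqP => [e|]; last by rewrite scaler0.
by case: ni; apply/val_inj; rewrite /= inordK// e.
Qed.

Lemma bchz0 x y : bchz br x y 0%N = 0. Proof. by []. Qed.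

Lemma Ex_bchz_Dd (x y : V) :
  Ex (bchz br x y, 0) Dd = Ex (single x, 0) (Ex (single y, 0) Dd).
Proof.
rewrite Ex_single2_Dd; apply/Ex_Dd_Phi => // n; exact: solzE.
Qed.

(* Both sides solve DE = [w, E] with the same initial value. *)
Lemma Ex_bchz (x y v : V) :
  Ex (bchz br x y, 0) (const0 v, 0) = Ex (single x, 0) (Ex (single y, 0) (const0 v, 0)).
Proof.
set E1 := Ex _ _; set E2 := Ex (single x, 0) _.
have kill : sb Dd (const0 v, 0) = 0.
  congr pair; rewrite /= (br0l (cv_bil bil)) scale1r scale0r add0r subr0.
  by apply/funext => n; rewrite /Dq /const0; case: eqP => [->|]; rewrite ?scale0r ?scaler0.
have F1x : Fil 1 ((single x, 0) : L) by exact: Fil1.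
have F1y : Fil 1 ((single y, 0) : L) by exact: Fil1.
have F1z : Fil 1 ((bchz br x y, 0) : L) by exact: Fil1.
have h1 : sb (- wser br x y, 1) E1 = 0.
  by rewrite -Ex_single2_Dd -Ex_bchz_Dd -Ex_sb// kill Ex_0r.
have h2 : sb (- wser br x y, 1) E2 = 0.
  by rewrite -Ex_single2_Dd -!Ex_sb// kill !Ex_0r.
have rec E : E.2 = 0 -> sb (- wser br x y, 1) E = 0 ->
    forall n, n%:R *: E.1 n = cv br (wser br x y) E.1 n.
  move=> E20 h n; have /(congr1 (fun u : L => u.1 n)) := h.
  rewrite /= E20 scale0r subr0 scale1r (brNl (cv_bil bil)).
  rewrite -[X in X = _ -> _]/(- cv br (wser br x y) E.1 n + n%:R *: E.1 n).
  by move/eqP; rewrite addrC subr_eq0 => /eqP.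
have e0 u (U : L) : (Ex u U).1 0%N = U.1 0%N by rewrite /= big_ord1 /= invr1 scale1r.
congr pair; apply/funext => n; rewrite -[LHS]/(E1.1 n) -[RHS]/(E2.1 n).
elim/ltn_ind: n => -[|n] IH; first by rewrite !e0.
apply: (@scalerI _ _ (n.+1%:R : R)); first exact: natrS_unit.
rewrite !rec//; rewrite /cv [LHS]big_ord_recl [RHS]big_ord_recl.
congr (_ + _); first by rewrite !br0l.
by apply: eq_bigr => i _; rewrite IH// lift0 subSS ltnS leq_subr.
Qed.

(** Both series are fixed points of [Phi] for the same w, and such a fixed point is unique. The
    derivation D detects even central elements, so the adjoint action of [SD V] loses nothing. *)
Lemma Ex_inj (X Y : nat -> V) : X 0%N = 0 -> Y 0%N = 0 ->
  Ex (X, 0) Dd = Ex (Y, 0) Dd -> X = Y.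
Proof.
move=> X0 Y0 XY; pose w := - (Ex (X, 0) Dd).1.
have w0 : w 0%N = 0.
  by rewrite /w -[LHS]/(- (Ex (X, 0) Dd).1 0%N) Ex_Dd_coef big_ord0 !oppr0.
apply: (@Phi_uniq _ _ br (cbch R) w) => //; apply/Ex_Dd_Phi => //;
  by rewrite /w opprK ?XY.
Qed.

End Identity.

(* Setting the degree parameter of a series in [SD V] to 1. *)
Section Specialization.
Variables (V : lmodType R) (br : V -> V -> V).
Hypothesis lie : is_lie br.
Let bil : is_algebra br. Proof. by case: lie. Qed.
Notation L := (SD V).
Notation sb := (sb br).
Let sbil : is_algebra sb. Proof. exact: sb_bil. Qed.
Let slie : is_lie sb. Proof. exact: sb_lie. Qed.

Definition spec (W : nat -> L) : L :=
  ((fun n => \sum_(k < n.+1) (W k).1 n), (W 0%N).2).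
(** Ensures that only finitely many terms of [W] contribute to each degree of [spec W]. *)
Definition FilS (W : nat -> L) := forall k, Fil k (W k).

Lemma FilS_cv W U : FilS W -> FilS U -> FilS (cv sb W U).
Proof.
move=> hW hU n; rewrite /cv; elim/big_ind : _ => [|u v hu hv|[i /= ilt] _].
- by split.
- by have := Fil_lin 1 hu hv; rewrite scale1r.
- by have := Fil_sb lie (hW i) (hU (n - i)%N); rewrite subnKC// -ltnS.
Qed.

Lemma spec_trunc W n N : FilS W -> (n < N)%N ->
  (spec W).1 n = (\sum_(k < N) W k).1 n.
Proof.
move=> hW nN; rewrite fst_sum /= (big_ord_widen N (fun k => (W k).1 n))//.
rewrite [RHS](bigID (fun k : 'I_N => (k < n.+1)%N)) /= [X in _ = _ + X]big1 ?addr0// => k.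
by rewrite -leqNgt => nk; rewrite (FilE (hW k)).
Qed.

Lemma spec_trunc2 W N : FilS W -> (0 < N)%N -> (spec W).2 = (\sum_(k < N) W k).2.
Proof.
move=> hW; case: N => // N _; rewrite snd_sum big_ord_recl big1 ?addr0// => i _.
exact: (hW (lift ord0 i)).1.
Qed.

Lemma spec_cv W U : FilS W -> FilS U -> spec (cv sb W U) = sb (spec W) (spec U).
Proof.
move=> hW hU; congr pair; last by rewrite /= /cv big_ord1.
apply/funext => n; rewrite [RHS](@sb_trunc _ _ _ _ _ (\sum_(k < n.+1) W k) (\sum_(k < n.+1) U k)).
- rewrite br_suml// fst_sum.
  transitivity (\sum_(k < n.+1) \sum_(i < k.+1) (sb (W i) (U (k - i)%N)).1 n).
    by apply: eq_bigr => k _; rewrite fst_sum.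
  rewrite (@tri_square _ (fun i j => (sb (W i) (U j)).1 n)).
    by apply: eq_bigr => i _; rewrite br_sumr// fst_sum.
  by move=> i j nij; apply: (@FilE _ _ (i + j)) => //; apply: Fil_sb.
- exact: spec_trunc2.
- exact: spec_trunc2.
- by move=> i ilt; apply: spec_trunc.
- by move=> i ilt; apply: spec_trunc.
Qed.

Lemma FilS_iter Z U k : FilS Z -> FilS U -> FilS (iter k (cv sb Z) U).
Proof. by move=> hZ hU; elim: k => //= k; exact: FilS_cv. Qed.

Lemma spec_iter Z U k : FilS Z -> FilS U ->
  spec (iter k (cv sb Z) U) = iter k (sb (spec Z)) (spec U).
Proof.
by move=> hZ hU; elim: k => //= k <-; rewrite spec_cv//; exact: FilS_iter.
Qed.

Lemma iter_cv_low Z U k n : Z 0%N = 0 -> (n < k)%N -> iter k (cv sb Z) U n = 0.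
Proof.
move=> Z0; elim: k n => // k IH n nk; rewrite iterS /cv big1// => -[[|i] /= ilt] _.
  by rewrite Z0 br0l.
by rewrite IH ?br0r//; lia.
Qed.

Lemma FilS_Ex Z U : FilS Z -> FilS U -> FilS (Ex sb (Z, 0) (U, 0)).1.
Proof.
move=> hZ hU n; rewrite /=; elim/big_ind : _ => [|u v hu hv|k _]; first by split.
  by have := Fil_lin 1 hu hv; rewrite scale1r.
rewrite iter_sb_ser /= -[X in Fil _ X]addr0; apply: Fil_lin; last by split.
exact: FilS_iter.
Qed.

Lemma spec_Ex Z U : FilS Z -> FilS U -> Z 0%N = 0 ->
  spec (Ex sb (Z, 0) (U, 0)).1 = Ex br (spec Z) (spec U).
Proof.
move=> hZ hU Z0; congr pair; last by rewrite /= big_ord1 /= invr1 scale1r.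
apply/funext => n /=.
transitivity (\sum_(N < n.+1) \sum_(k < n.+1) (k`!%:R)^-1 *: (iter k (cv sb Z) U N).1 n).
  apply: eq_bigr => N _; rewrite fst_sum.
  rewrite (big_ord_widen n.+1 (fun k => ((k`!%:R)^-1 *: (iter k (Pilot.Submission.sb sb (Z, 0)) (U, 0)).1 N).1 n))//.
  rewrite [RHS](bigID (fun k : 'I_n.+1 => (k < N.+1)%N)) /= [X in _ = _ + X]big1 ?addr0.
    by apply: eq_bigr => k _; rewrite iter_sb_ser.
  by move=> k; rewrite -leqNgt => Nk; rewrite iter_cv_low// scaler0.
rewrite exchange_big; apply: eq_bigr => k _ /=.
by rewrite -spec_iter// -scaler_sumr.
Qed.

End Specialization.
End FormalBCH.

Section Delta.
Variable R : realType.
Variables (V : lmodType R) (br : V -> V -> V).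
Hypothesis bil : is_algebra br.

Definition delta k (x : V) : nat -> V := fun n => if n == k then x else 0.

Lemma cv_delta i j (x y : V) : cv br (delta i x) (delta j y) = delta (i + j) (br x y).
Proof.
apply/funext => n; rewrite /cv /delta.
case: eqP => [->|nij].
  have ilt : (i < (i + j).+1)%N by rewrite ltnS leq_addr.
  rewrite (bigD1 (Ordinal ilt))//= eqxx addKn eqxx big1 ?addr0// => k.
  by rewrite -val_eqE /= => /negPf ->; rewrite br0l.
rewrite big1// => k _; case: eqP => [ki|]; last by rewrite br0l.
case: eqP => [nk|]; last by rewrite br0r.
by case: nij; have := ltn_ord k; lia.
Qed.

Lemma deltaD k x y : delta k (x + y) = delta k x + delta k y.
Proof.
apply/funext => n; rewrite -[RHS]/(delta k x n + delta k y n) /delta.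
by case: eqP; rewrite ?addr0.
Qed.
Lemma deltaZ k a x : delta k (a *: x) = a *: delta k x.
Proof.
apply/funext => n; rewrite -[RHS]/(a *: delta k x n) /delta.
by case: eqP; rewrite ?scaler0.
Qed.
Lemma delta0 k : delta k 0 = 0.
Proof. by apply/funext => n; rewrite /delta; case: eqP. Qed.

End Delta.

(** * The formal group law and its associativity *)

Section Star.
Variable R : realType.
Variables (V : lmodType R) (br : V -> V -> V).
Hypothesis lie : is_lie br.
Let bil : is_algebra br. Proof. by case: lie. Qed.
Notation L := (SD V).
Notation sb := (sb br).
Let sbil : is_algebra sb. Proof. exact: sb_bil. Qed.
Let slie : is_lie sb. Proof. exact: sb_lie. Qed.

(* The group law on formal power series without constant term. *)
Definition star (X Y : nat -> V) : nat -> V :=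
  fun n => \sum_(k < n.+1) bchz (cv br) X Y k n.

Lemma bchz_sb X Y k : bchz sb (X, 0) (Y, 0) k = (bchz (cv br) X Y k, 0).
Proof.
move: k; apply: (@S_bchz _ _ _ _ _ (fun _ (u : L) (U : nat -> V) => u = (U, 0))) => //.
- by move=> n u v U U' -> ->; congr pair; rewrite /= addr0.
- by move=> n a u U ->; congr pair; rewrite /= scaler0.
- by move=> m n u U v U' -> ->; congr pair; rewrite /= !scale0r subr0 addr0.
Qed.

Lemma FilS_bchz (u v : L) : Fil 1 u -> Fil 1 v -> FilS (bchz sb u v).
Proof.
move=> u1 v1; apply: (@S_bchz _ _ _ _ sb (fun n (x : L) (_ : L) => Fil n x) _ _ u v) => //.
- by move=> n x y _ _ hx hy; have := Fil_lin 1 hx hy; rewrite scale1r.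
- by move=> n a x _ hx; rewrite -[X in Fil _ X]addr0; apply: Fil_lin => //; split.
- by move=> m n x _ y _; exact: Fil_sb.
Qed.

Lemma star_spec X Y : (star X Y, 0) = spec (bchz sb (X, 0) (Y, 0)).
Proof.
congr pair; apply/funext => n; apply: eq_bigr => k _.
by rewrite bchz_sb.
Qed.

Lemma star0 X Y : star X Y 0%N = 0.
Proof. by rewrite /star big_ord1. Qed.

Lemma bchz_low X Y k n : X 0%N = 0 -> Y 0%N = 0 -> (n < k)%N -> bchz (cv br) X Y k n = 0.
Proof.
move=> X0 Y0 nk; have := FilE (FilS_bchz (Fil1 X0) (Fil1 Y0) k) nk.
by rewrite bchz_sb.
Qed.

(** [Ex_bchz] is applied over the Lie algebra [SD V] instead of [V], which introduces a second
    degree parameter; [spec] then sets that parameter to 1. *)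
Lemma star_Ex X Y v : X 0%N = 0 -> Y 0%N = 0 ->
  Ex br (star X Y, 0) v = Ex br (X, 0) (Ex br (Y, 0) v).
Proof.
move=> X0 Y0; rewrite star_spec.
have sp (u : L) : Fil 1 u -> spec (single u) = u.
  move=> [u2 u1]; rewrite [RHS]surjective_pairing u2//; congr pair; apply/funext => -[|n].
    by rewrite big_ord1 u1.
  rewrite big_ord_recl [X in _ + X]big_ord_recl big1 => [|i _]; last by [].
  by rewrite -[X in X + _]/(0 : V) add0r addr0 lift0 /single eqxx.
have sc (u : L) : spec (const0 u) = u.
  rewrite [RHS]surjective_pairing; congr pair; apply/funext => n.
  by rewrite big_ord_recl big1 ?addr0.
have Fs (u : L) : Fil 1 u -> FilS (single u).
  by move=> hu [|[|k]]; [split|exact: hu|split].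
have Fc (u : L) : FilS (const0 u) by move=> [|k]; split.
have FX := Fil1 X0 : Fil 1 ((X, 0) : L); have FY := Fil1 Y0 : Fil 1 ((Y, 0) : L).
(* In the second parameter [v] sits in degree 0, while X and Y sit in degree 1. *)
rewrite -[in LHS](sc v) -spec_Ex//; last exact: FilS_bchz.
rewrite Ex_bchz//.
rewrite -[X in (single (X, 0), 0)]/(X) [X in Ex _ _ X](_ : _ = ((Ex (Pilot.Submission.sb br) (single (Y, 0), 0) (const0 v, 0)).1, 0)); last first.
  by congr pair.
rewrite spec_Ex//; [|exact: Fs|by apply: FilS_Ex => //; exact: Fs].
by rewrite spec_Ex//; [rewrite !sp// sc|exact: Fs].
Qed.

(** Both sides act on the degree derivation as the composite of the three exponentials, and [Ex_inj]
    recovers a series from that action. *)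
Lemma starA X Y W : X 0%N = 0 -> Y 0%N = 0 -> W 0%N = 0 ->
  star (star X Y) W = star X (star Y W).
Proof.
move=> X0 Y0 W0; apply: (Ex_inj lie); rewrite ?star0//.
by rewrite !star_Ex// star0.
Qed.

Lemma bchz_delta (x y : V) k : bchz (cv br) (single x) (single y) k = delta k (bchz br x y k).
Proof.
move: k; apply: (@S_bchz _ _ _ _ _ (fun k (X : nat -> V) (x : V) => X = delta k x)) => //.
- by move=> n; rewrite delta0.
- by move=> n X Y u v -> ->; rewrite deltaD.
- by move=> n a X u ->; rewrite deltaZ.
- by move=> m n X u Y v -> ->; rewrite cv_delta.
Qed.

Lemma star_single (x y : V) : star (single x) (single y) = bchz br x y.
Proof.
apply/funext => n; rewrite /star; under eq_bigr do rewrite bchz_delta.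
rewrite big_ord_recr /= big1 ?add0r; first by rewrite /delta eqxx.
by move=> i _; rewrite /delta gtn_eqF.
Qed.

Lemma bchz1 x y : bchz br x y 1%N = x + y.
Proof.
by rewrite /bchz solzE// /Phi big_geq// addr0 /wser /= !invr1 !scale1r addrC.
Qed.

Lemma br_self x : br x x = 0.
Proof.
have [_ anti _] := lie; apply: (@scalerI _ _ (2 : R)); first by rewrite pnatr_eq0.
by rewrite scaler0 scaler_nat mulr2n {1}anti addNr.
Qed.

Lemma bchz2 x y : bchz br x y 2%N = 2^-1 *: br x y.
Proof.
rewrite /bchz solzE// /Phi big_nat1 -[iter 1 _ _]/(cv br _ _).
have -> : cv br (solz br (cbch R) (wser br x y)) (Dq (solz br (cbch R) (wser br x y))) 2%N = 0.
  rewrite -/(bchz br x y) /cv !big_ord_recl big_ord0 addr0 /Dq.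
  have -> : bchz br x y (@ord0 2) = 0 by [].
  rewrite br0l// add0r scale0r br0r// addr0 lift0 -[(2 - _)%N]/1%N.
  by rewrite scale1r br_self.
by rewrite scaler0 addr0 /wser /= invr1 scale1r addr0.
Qed.

End Star.

(* If [x,y] commutes with x and y then the series stops in degree 2. *)
Lemma bchz_2step (R : realType) (V : lmodType R) (br : V -> V -> V) x y :
  is_algebra br -> (forall u v, br u v = - br v u) ->
  br x (br x y) = 0 -> br y (br x y) = 0 -> forall n, bchz br x y n =
    if n == 1%N then x + y else if n == 2%N then 2^-1 *: br x y else 0.
Proof.
move=> bil anti xc yc; pose c := br x y.
have selfb u : br u u = 0.
  apply: (@scalerI _ _ (2 : R)); first by rewrite pnatr_eq0.
  by rewrite scaler0 scaler_nat mulr2n {1}anti addNr.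
pose Z : nat -> V := delta 1 (x + y) + 2^-1 *: delta 2 c.
have DZ : Dq Z = delta 1 (x + y) + delta 2 c.
  apply/funext => n; rewrite /Dq /Z.
  rewrite -[LHS]/(n%:R *: (delta 1 (x + y) n + 2^-1 *: delta 2 c n)).
  rewrite -[RHS]/(delta 1 (x + y) n + delta 2 c n) /delta.
  case: eqP => [->|_]; first by rewrite /= scaler0 !addr0 scale1r.
  case: eqP => [->|_]; last by rewrite scaler0 !addr0 scaler0.
  by rewrite !add0r scalerA mulfV ?scale1r// pnatr_eq0.
have uc : br (x + y) c = 0 by rewrite brDl// xc yc addr0.
have cu : br c (x + y) = 0 by rewrite anti uc oppr0.
have ZDZ : cv br Z (Dq Z) = 0.
  rewrite DZ /Z; have b2 := cv_bil bil.
  rewrite !(brDl b2) !(brDr b2) !(brZl b2) !cv_delta// !selfb uc cu !delta0.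
  by rewrite !scaler0 !addr0.
have itx k : (1 < k)%N -> iter k (br x) y = 0.
  case: k => [|[|k]] // _; rewrite !iterSr.
  by elim: k => //= k ->; rewrite br0r.
suff -> : bchz br x y = Z.
  move=> n; rewrite /Z -[LHS]/(delta 1 (x + y) n + 2^-1 *: delta 2 c n) /delta.
  case: n => [|[|[|n]]] /=; rewrite ?scaler0 ?addr0 ?add0r//.
apply: (@Phi_uniq _ _ br (cbch R) (wser br x y)) => //.
- by rewrite /Z -[LHS]/(delta 1 (x + y) 0%N + 2^-1 *: delta 2 c 0%N) /delta /= scaler0 addr0.
- by move=> n; exact: solzE.
- move=> n; rewrite /Phi big1_seq ?addr0 => [|k /andP[_]]; last first.
    rewrite mem_index_iota => /andP[k1 _].
    have -> : iter k (cv br Z) (Dq Z) = 0.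
      elim: k k1 => // -[_ _|k IH _] /=; first exact: ZDZ.
      by rewrite -iterS IH// (br0r (cv_bil bil)).
    by rewrite -[X in _ *: X]/(0 : V) scaler0.
  rewrite /Z -[LHS]/(delta 1 (x + y) n + 2^-1 *: delta 2 c n) /delta.
  case: n => [|[|[|n]]] /=.
  + by rewrite scaler0 addr0 invr0 scale0r.
  + by rewrite scaler0 addr0 !invr1 !scale1r addrC.
  + by rewrite invr1 scale1r addr0 add0r.
  + by rewrite -iterS -iterS itx// !scaler0 !addr0 scaler0.
Qed.

(** * A numerical majorant for the BCH series *)

Section Majorant.
Variable R : realType.

Definition rmul (x y : R^o) : R^o := (x : R) * y.

Lemma rmul_bil : is_algebra rmul.
Proof.
apply: mk_algebra => [x y z|x y z|a x z|a x z]; rewrite /rmul.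
- by rewrite mulrDl.
- by rewrite mulrDr.
- by rewrite -[a *: x]/(a * x) -mulrA.
- by rewrite -[a *: z]/(a * z) mulrCA.
Qed.

(** The BCH recursion with the bracket replaced by the product of reals and the coefficients by
    their absolute values. *)
Definition majz (a b : R) (n : nat) : R :=
  solz rmul (fun k => (k.+1`!%:R)^-1) (wser rmul (a : R^o) b) n.

Lemma le_geom (q : R) N : 0 <= q -> q < 1 -> \sum_(k < N) q ^+ k <= (1 - q)^-1.
Proof.
move=> q0 q1; have q2 : 0 < 1 - q by rewrite subr_gt0.
rewrite -[leRHS]mul1r ler_pdivlMr//.
have -> : (\sum_(k < N) q ^+ k) * (1 - q) = 1 - q ^+ N.
  elim: N => [|N IH]; first by rewrite big_ord0 mul0r expr0 subrr.
  by rewrite big_ord_recr mulrDl IH /= exprS; ring.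
by rewrite gerBl exprn_ge0.
Qed.

Lemma majz_ge0 a b n : 0 <= a -> 0 <= b -> 0 <= majz a b n.
Proof.
move=> a0 b0.
have h0 (k : nat) : 0 <= (k`!%:R)^-1 :> R by rewrite invr_ge0.
apply: (@S_solz R R^o R^o rmul rmul _ (fun=> 0) _ (fun=> 0) (fun _ (u : R^o) (_ : R^o) => 0 <= (u : R)))
  => //; try by [].
- by move=> *; exact: addr_ge0.
- by move=> *; exact: mulr_ge0.
- by move=> *; apply: mulr_ge0.
- by move=> *; exact: mulr_ge0.
- move=> k; apply: (@S_wser R R^o R^o rmul rmul (fun _ (u : R^o) (_ : R^o) => 0 <= (u : R)) _ _ 0 0)
   => // *; [exact: addr_ge0|exact: mulr_ge0|exact: mulr_ge0].
Qed.

Lemma majz0 a b : majz a b 0%N = 0. Proof. by []. Qed.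

Let P (M : nat) (f : nat -> R^o) : R := \sum_(n < M) (f n : R).

Let P_mono M N f : (forall n, 0 <= (f n : R)) -> (M <= N)%N -> P M f <= P N f.
Proof.
move=> f0 MN; rewrite /P (big_ord_widen N (fun n => f n : R))//.
rewrite [leRHS](bigID (fun i : 'I_N => (i < M)%N)) /= lerDl.
exact: sumr_ge0.
Qed.

(** Without constant terms, a product of degree at most N involves factors of degree below N only.
    This shift by one closes the induction in [majz_bound]. *)
Let P_cv N f g : (forall n, 0 <= (f n : R)) -> (forall n, 0 <= (g n : R)) ->
  (f 0%N : R) = 0 -> (g 0%N : R) = 0 -> P N.+1 (cv rmul f g) <= P N f * P N g.
Proof.
move=> f0 g0 fz gz; rewrite /P big_distrlr /=.
pose a i j : R := if (i + j < N.+1)%N then (f i : R) * g j else 0.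
have -> : \sum_(n < N.+1) (cv rmul f g n : R) =
    \sum_(k < N.+1) \sum_(i < k.+1) a i (k - i)%N.
  apply: eq_bigr => k _; apply: eq_bigr => i _; rewrite /a subnKC ?ltn_ord//.
  by rewrite -ltnS.
rewrite tri_square => [|i j ij]; last by rewrite /a ltnNge ij.
rewrite big_ord_recr /= [X in _ + X]big1 ?addr0 => [|j _]; last first.
  rewrite /a; case: ifP => // h; have -> : (j : nat) = 0%N by lia.
  by rewrite gz mulr0.
apply: ler_sum => i _; rewrite big_ord_recr /= [X in _ + X](_ : _ = 0) ?addr0.
  by apply: ler_sum => j _; rewrite /a; case: ifP => // _; rewrite mulr_ge0.
rewrite /a; case: ifP => // h; have -> : (i : nat) = 0%N by lia.
by rewrite fz mul0r.
Qed.

Section Bound.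
Variables a b : R.
Hypotheses (a0 : 0 <= a) (a1 : a <= 2^-1) (b0 : 0 <= b) (ab : a + 2 * b <= 8^-1).
Let z := majz a b : nat -> R^o.
Let z0 n : 0 <= (z n : R). Proof. exact: majz_ge0. Qed.
Let Dz0 n : 0 <= (Dq z n : R). Proof. exact: mulr_ge0. Qed.
Let it k := iter k (cv rmul z) (Dq z).

Let it_ge0 k n : 0 <= (it k n : R).
Proof.
elim: k n => [//|k IH] n; rewrite /it /= /cv; apply: sumr_ge0 => i _.
by apply: mulr_ge0; [exact: z0|exact: IH].
Qed.

Let it_0 k : (it k 0%N : R) = 0.
Proof.
case: k => [|k]; first by rewrite /it /= /Dq scale0r.
by rewrite /it iterS /cv big_ord1 /rmul -[z (@ord0 0)]/(0 : R) mul0r.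
Qed.

Let it_bound N k : P N.+1 (it k.+1) <= P N z ^+ k.+1 * P N (Dq z).
Proof.
elim: k => [|k IH]; first by rewrite expr1; apply: P_cv => //; exact: (it_0 0).
apply: le_trans (@P_cv N z (it k.+1) z0 (it_ge0 k.+1) erefl (it_0 k.+1)) _.
rewrite exprS -mulrA ler_wpM2l// ?sumr_ge0//.
by apply: le_trans IH; apply: P_mono.
Qed.

Let wser_bound N : \sum_(n < N) (wser rmul (a : R^o) b n : R) <= a + 2 * b.
Proof.
have ha k : iter k (rmul a) b = a ^+ k * b.
  by elim: k => [|k IH]; rewrite ?expr0 ?mul1r// iterS IH /rmul exprS mulrA.
case: N => [|N]; first by rewrite big_ord0 addr_ge0// mulr_ge0.
rewrite big_ord_recl add0r; under eq_bigr do rewrite lift0 /= ha.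
rewrite big_split /= addrC lerD//.
  case: N => [|N]; first by rewrite big_ord0.
  by rewrite big_ord_recl big1 ?addr0.
apply: (@le_trans _ _ ((\sum_(i < N) a ^+ i) * b)).
  rewrite mulr_suml; apply: ler_sum => i _; rewrite -[_ *: _]/(_ * _).
  rewrite ler_piMl ?mulr_ge0 ?exprn_ge0// invf_le1 ?ltr0n ?fact_gt0//.
  by rewrite ler1n fact_gt0.
rewrite ler_wpM2r//; have a2 : a < 1 by move: a1; lra.
apply: le_trans (le_geom N a0 a2) _.
rewrite -[leLHS]mul1r ler_pdivrMr ?subr_gt0//; move: a1; lra.
Qed.

(** Let d = a + 2b, which bounds the partial sums of w. If the partial sum of Dz is at most 2d <=
    1/4, so is that of z, and the geometric series bounds the next partial sum of Dz by d +
    (1/4)(4/3)(2d) <= 2d. *)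
Lemma majz_bound N : \sum_(n < N) n%:R * majz a b n <= 2 * (a + 2 * b).
Proof.
set d := a + 2 * b; have dab : d <= 8^-1 := ab; have d0 : 0 <= d by rewrite addr_ge0// mulr_ge0.
change (P N (Dq z) <= 2 * d); elim: N => [|N IH]; first by rewrite /P big_ord0 mulr_ge0.
have zP : P N z <= 4^-1.
  apply: (@le_trans _ _ (P N (Dq z))).
    apply: ler_sum => -[[|i] /= ilt] _; first by rewrite /Dq scale0r.
    by rewrite /Dq -[_ *: _]/(_ * _) ler_peMl ?z0// ler1n.
  by apply: le_trans IH _; lra.
have zP0 : 0 <= P N z by apply: sumr_ge0.
have -> : P N.+1 (Dq z) = \sum_(n < N.+1) (wser rmul (a : R^o) b n : R) +
    \sum_(n < N.+1) \sum_(1 <= k < n) (k.+1`!%:R)^-1 * (it k n : R).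
  rewrite -big_split; apply: eq_bigr => -[[|n] nlt] _ /=.
    by rewrite /Dq scale0r big_geq// addr0.
  rewrite /Dq {1}/z /majz solzE; last exact: rmul_bil.
  rewrite /Phi scalerA mulfV ?scale1r// natrS_unit//.
apply: (@le_trans _ _ (d + \sum_(n < N.+1) \sum_(k < N) (it k.+1 n : R))).
  rewrite lerD ?wser_bound//; apply: ler_sum => n _.
  have nN : (n.-1 <= N)%N by have := ltn_ord n; lia.
  rewrite big_add1 big_mkord (big_ord_widen N (fun k => (k.+2`!%:R)^-1 * (it k.+1 n : R)))//.
  rewrite [leRHS](bigID (fun i : 'I_N => (i < n.-1)%N)) /= -[leLHS]addr0; apply: lerD.
    apply: ler_sum => k _; apply: ler_piMl; first exact: (it_ge0 k.+1 n).
    by rewrite invf_le1 ?ltr0n ?fact_gt0// ler1n fact_gt0.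
  by apply: sumr_ge0 => k _; exact: (it_ge0 k.+1 n).
rewrite exchange_big /=.
apply: (@le_trans _ _ (d + \sum_(k < N) 4^-1 ^+ k.+1 * (2 * d))).
  rewrite lerD2l; apply: ler_sum => k _; apply: le_trans (it_bound N k) _.
  apply: ler_pM; [exact: exprn_ge0| |by rewrite lerXn2r ?nnegrE ?invr_ge0|exact: IH].
  by apply: sumr_ge0 => i _; exact: Dz0.
rewrite -mulr_suml; under eq_bigr do rewrite exprS.
rewrite -mulr_sumr; have := @le_geom 4^-1 N; set S := \sum_(k < N) _ => hS.
have e43 : (1 - 4^-1 : R)^-1 = 4 / 3 by field.
have {}hS : S <= 4 / 3 by rewrite -e43; apply: hS; lra.
have : 4^-1 * S * (2 * d) <= 4^-1 * (4 / 3) * (2 * d).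
  by rewrite ler_wpM2r ?mulr_ge0// ler_wpM2l.
lra.
Qed.

End Bound.

Lemma absum_nat (f : nat -> R) K : (forall n, 0 <= f n) ->
  (forall N, \sum_(n < N) f n <= K) -> absum f K.
Proof.
move=> f0 fK t ut.
have [N tN] : exists N, {subset t <= iota 0 N}.
  exists (\max_(i <- t) i).+1 => i it; rewrite mem_iota /= add0n ltnS.
  by rewrite (bigD1_seq i)//= leq_maxl.
apply: le_trans (fK N); rewrite -(big_mkord xpredT f) /index_iota subn0.
rewrite (sum_subset _ ut (iota_uniq 0 N) tN) -[leLHS]addr0 lerD ?sumr_ge0//.
by apply: ler_sum => i _; rewrite ger0_norm.
Qed.

Lemma majz_absum a b : 0 <= a -> a <= 2^-1 -> 0 <= b -> a + 2 * b <= 8^-1 ->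
  absum (majz a b) (2 * (a + 2 * b)).
Proof.
move=> a0 a1 b0 ab; apply: absum_nat => [n|N]; first exact: majz_ge0.
apply: le_trans (majz_bound a0 a1 b0 ab N); apply: ler_sum => -[[|n] nlt] _ /=.
  by rewrite majz0 mulr0.
by rewrite ler_peMl ?majz_ge0// ler1n.
Qed.

(** Parametricity for the relation u = s^n v. It is the source of the cubic factor in
    [bch_second_order]. *)
Lemma majz_hom s a b n : 0 <= s -> majz (s * a) (s * b) n = s ^+ n * majz a b n.
Proof.
move=> s0; pose S (n : nat) (u v : R^o) := u = (s ^+ n * v :> R).
have S0 m : S m 0 0 by rewrite /S mulr0.
have SD m u v u' v' : S m u u' -> S m v v' -> S m (u + v) (u' + v').
  by rewrite /S => -> ->; rewrite mulrDr.
have SZ m k u u' : S m u u' -> S m (k *: u) (k *: u').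
  by rewrite /S => ->; rewrite -[k *: _]/(k * _) mulrCA.
have Sbr m p u u' v v' : S m u u' -> S p v v' -> S (m + p)%N (rmul u v) (rmul u' v').
  by rewrite /S /rmul => -> ->; rewrite exprD mulrACA.
apply: (@S_solz R R^o R^o rmul rmul _ _ _ _ S) => //.
- by move=> *; exact: SZ.
- by move=> *; exact: SZ.
- by apply: S_wser => // *; exact: SZ.
Qed.

End Majorant.

Import VectorInternalTheory.

Section NormRelation.
Variable R : realType.

(** Any submultiplicative bound is carried along by the recursion. It is used with [N] the norm [gn]
    of an algebra, the norm [NS] of summable series, and the norm [NH] of analytic maps. *)
Lemma N_bchz (V : lmodType R) (br : V -> V -> V) (N : V -> R -> Prop) x y a b n :
  N 0 0 -> (forall u v K M, N u K -> N v M -> N (u + v) (K + M)) ->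
  (forall k u K, N u K -> N (k *: u) (`|k| * K)) ->
  (forall u v K M, N u K -> N v M -> N (br u v) (K * M)) ->
  N x a -> N y b -> N (bchz br x y n) (majz a b n).
Proof.
move=> N0 ND NZ Nbr Nx Ny.
have NZ' (m : nat) k u (K : R^o) : 0 <= k -> N u K -> N (k *: u) (k *: K).
  by move=> k0 /(NZ k); rewrite ger0_norm.
apply: (@S_solz R V R^o br (@rmul R) _ _ _ _ (fun _ u (K : R^o) => N u K)) => //.
- by move=> m k u K; rewrite /cbch => /(NZ (- k.+1`!%:R^-1)); rewrite normrN ger0_norm// invr_ge0.
- by move=> m p u K v M hu hv; exact: (Nbr _ _ _ _ hu hv).
- apply: (@S_wser R V R^o br (@rmul R) (fun _ u (K : R^o) => N u K)) => //.
  by move=> m p u K v M hu hv; exact: (Nbr _ _ _ _ hu hv).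
Qed.

Lemma bchz_fun (T : Type) (V : lmodType R) (br : V -> V -> V) (X Y : T -> V) n t :
  bchz (fun f h t => br (f t) (h t)) X Y n t = bchz br (X t) (Y t) n.
Proof.
move: n; apply: (@S_bchz R (T -> V) V _ _ (fun _ (F : T -> V) (u : V) => F t = u)) => //.
- by move=> n F G u v <- <-.
- by move=> n a F u <-.
- by move=> m n F G u v <- <-.
Qed.

Lemma hasum_fibre_add (f h : nat -> R) n :
  hasum (fun x : nat * nat => if (x.1 + x.2 == n)%N then f x.1 * h x.2 else 0)
    (\sum_(i < n.+1) f i * h (n - i)%N).
Proof.
rewrite -(big_mkord xpredT (fun i => f i * h (n - i)%N)) /index_iota subn0.
have -> : \sum_(i <- iota 0 n.+1) f i * h (n - i)%N =
    \sum_(x <- [seq (i, (n - i)%N) | i <- iota 0 n.+1])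
      (if (x.1 + x.2 == n)%N then f x.1 * h x.2 else 0).
  rewrite big_map !big_seq; apply: eq_bigr => i; rewrite mem_iota /= => ilt.
  by rewrite subnKC ?eqxx//; lia.
apply: hasum_finite; first by rewrite map_inj_uniq ?iota_uniq// => i j [].
move=> [i j] nin; case: eqP => // ij; have {}ij : (i + j = n)%N by [].
have /negP[] := nin; have -> : (i, j) = (i, (n - i)%N) by congr pair; lia.
by apply: (map_f (fun i => (i, (n - i)%N))); rewrite mem_iota; lia.
Qed.

Lemma absum_conv (f h : nat -> R) K L : absum f K -> absum h L ->
  absum (fun n => \sum_(i < n.+1) f i * h (n - i)%N) (K * L).
Proof.
move=> fK hL; apply: (absum_fibre (h := fun x : nat * nat => (x.1 + x.2)%N) (absumM fK hL)).
exact: hasum_fibre_add.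
Qed.

Lemma hasum_conv (f h : nat -> R) K L s t : absum f K -> absum h L ->
  hasum f s -> hasum h t ->
  hasum (fun n => \sum_(i < n.+1) f i * h (n - i)%N) (s * t).
Proof.
move=> fK hL fs ht.
apply: (hasum_fibre (h := fun x : nat * nat => (x.1 + x.2)%N) (hasumM fK hL fs ht)).
exact: hasum_fibre_add.
Qed.

End NormRelation.

(** * The convergent BCH series on a finite-dimensional Lie algebra *)

Section Coordinates.
Variables (R : realType) (g : vectType R).
Implicit Types u v w p q : g.
Notation d := (dim g).

Definition crd (i : 'I_d) u : R := v2r u 0 i.
Definition ei (i : 'I_d) : g := r2v (delta_mx 0 i).

Lemma crdD i u v : crd i (u + v) = crd i u + crd i v.
Proof. by rewrite /crd linearD mxE. Qed.
Lemma crdZ i k u : crd i (k *: u) = k * crd i u.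
Proof. by rewrite /crd linearZ mxE. Qed.
Lemma crdN i u : crd i (- u) = - crd i u.
Proof. by rewrite /crd linearN mxE. Qed.
Lemma crdB i u v : crd i (u - v) = crd i u - crd i v.
Proof. by rewrite crdD crdN. Qed.
Lemma crd0 i : crd i 0 = 0.
Proof. by rewrite /crd linear0 mxE. Qed.
Lemma crd_sum i (I : Type) (s : seq I) (P : pred I) (F : I -> g) :
  crd i (\sum_(k <- s | P k) F k) = \sum_(k <- s | P k) crd i (F k).
Proof. by elim/big_rec2 : _ => [|k x y _ <-]; rewrite ?crd0 ?crdD. Qed.
Lemma crd_inj u v : (forall i, crd i u = crd i v) -> u = v.
Proof. by move=> h; apply: (can_inj v2rK); apply/rowP => i; exact: h. Qed.
Lemma crd_ei u : u = \sum_i crd i u *: ei i.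
Proof.
apply: crd_inj => j; rewrite crd_sum (bigD1 j)//= big1 => [|i ij].
  by rewrite crdZ /crd /ei r2vK mxE !eqxx mulr1 addr0.
by rewrite crdZ {2}/crd /ei r2vK mxE eq_sym (negPf ij) andbF mulr0.
Qed.
Lemma crd_r2v i (x : 'rV[R]_d) : crd i (r2v x) = x 0 i.
Proof. by rewrite /crd r2vK. Qed.

Definition hasumv (I : choiceType) (F : I -> g) p :=
  forall i, hasum (fun k => crd i (F k)) (crd i p).
(** Total by convention: a coordinate whose family has no sum is set to 0. *)
Definition sumv (I : choiceType) (F : I -> g) : g :=
  r2v (\row_i xget 0 [set s | hasum (fun k => crd i (F k)) s]).

Lemma hasumv_uniq (I : choiceType) (F : I -> g) p q : hasumv F p -> hasumv F q -> p = q.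
Proof. by move=> hp hq; apply: crd_inj => i; exact: hasum_uniq (hp i) (hq i). Qed.

Lemma hasumv_sumv (I : choiceType) (F : I -> g) :
  (forall i, exists s, hasum (fun k => crd i (F k)) s) -> hasumv F (sumv F).
Proof.
move=> h i; rewrite /sumv crd_r2v mxE.
by case: xgetP => [s _ //|no]; have [s hs] := h i; case: (no s).
Qed.

Lemma sumvP (I : choiceType) (F : I -> g) p : hasumv F p -> sumv F = p.
Proof.
move=> hp; apply: hasumv_uniq (hp); apply: hasumv_sumv => i; by exists (crd i p).
Qed.

Lemma hasumv_linear (h : vectType R) (f : {linear g -> h}) (I : choiceType) (F : I -> g) p :
  hasumv F p -> forall i : 'I_(dim h), hasum (fun k => v2r (f (F k)) 0 i) (v2r (f p) 0 i).
Proof.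
move=> hp i.
have E u : v2r (f u) 0 i = \sum_j v2r (f (ei j)) 0 i * crd j u.
  rewrite {1}(crd_ei u) !linear_sum summxE; apply: eq_bigr => j _.
  by rewrite !linearZ mxE mulrC.
rewrite E; under eq_fun do rewrite E.
by apply: hasum_bigsum => j; apply: hasumZ; exact: hp.
Qed.

End Coordinates.

Section BCH.
Variables (R : realType) (g : vectType R) (br : g -> g -> g).
Hypothesis lie : is_lie br.
Let bil : is_algebra br. Proof. by case: lie. Qed.
Notation d := (dim g).
Notation ei := (@ei R g).
Implicit Types u v w x y p q : g.

Definition sc i j k : R := crd k (br (ei i) (ei j)).
Definition C0 : R := 1 + \sum_k \sum_i \sum_j `|sc i j k|.

Lemma C0_ge1 : 1 <= C0.
Proof. by rewrite /C0 lerDl; do 3![apply: sumr_ge0 => ? _]. Qed.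
Lemma C0_ge0 : 0 <= C0. Proof. by apply: le_trans C0_ge1. Qed.
Lemma C0_gt0 : 0 < C0. Proof. by apply: lt_le_trans C0_ge1. Qed.

Lemma crd_br k u v : crd k (br u v) = \sum_i \sum_j sc i j k * (crd i u * crd j v).
Proof.
rewrite {1}(crd_ei u) {1}(crd_ei v) br_suml// crd_sum; apply: eq_bigr => i _.
rewrite br_sumr// crd_sum; apply: eq_bigr => j _.
by rewrite brZl// brZr// !crdZ mulrA mulrC.
Qed.

(* A submultiplicative norm. *)
Definition gn u : R := C0 * \sum_i `|crd i u|.

Lemma gn_ge0 u : 0 <= gn u.
Proof. by rewrite mulr_ge0 ?C0_ge0// sumr_ge0. Qed.
Lemma gn0 : gn 0 = 0.
Proof. by rewrite /gn big1 ?mulr0// => i _; rewrite crd0 normr0. Qed.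
Lemma gnD u v : gn (u + v) <= gn u + gn v.
Proof.
rewrite /gn -mulrDr ler_wpM2l ?C0_ge0// -big_split ler_sum// => i _.
by rewrite crdD ler_normD.
Qed.
Lemma gnZ k u : gn (k *: u) = `|k| * gn u.
Proof.
rewrite /gn mulrCA; congr (_ * _); rewrite mulr_sumr; apply: eq_bigr => i _.
by rewrite crdZ normrM.
Qed.
Lemma gnN u : gn (- u) = gn u.
Proof. by rewrite -scaleN1r gnZ normrN1 mul1r. Qed.
Lemma gnB u v : gn (u - v) <= gn u + gn v.
Proof. by rewrite -(gnN v) gnD. Qed.
Lemma crd_gn i u : `|crd i u| <= gn u.
Proof.
rewrite /gn; apply: (@le_trans _ _ (\sum_i `|crd i u|)).
  by rewrite (bigD1 i)//= lerDl sumr_ge0.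
by rewrite ler_peMl ?C0_ge1// sumr_ge0.
Qed.
Lemma gn_sum (I : Type) (s : seq I) (P : pred I) (F : I -> g) :
  gn (\sum_(k <- s | P k) F k) <= \sum_(k <- s | P k) gn (F k).
Proof.
elim/big_rec2 : _ => [|k x y _ h]; first by rewrite gn0.
by apply: le_trans (gnD _ _) _; rewrite lerD2l.
Qed.

Lemma sc_bound (a b : 'I_d -> R) : (forall i, 0 <= a i) -> (forall i, 0 <= b i) ->
  C0 * \sum_k \sum_i \sum_j `|sc i j k| * (a i * b j) <=
  (C0 * \sum_i a i) * (C0 * \sum_j b j).
Proof.
move=> a0 b0; rewrite mulrACA -mulrA ler_wpM2l ?C0_ge0//.
set M := (\sum_i a i) * _.
have ab i j : a i * b j <= M.
  have le1 (f : 'I_d -> R) k : (forall i, 0 <= f i) -> f k <= \sum_i f i.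
    by move=> f0; rewrite (bigD1 k)//= lerDl sumr_ge0.
  by apply: ler_pM => //; exact: le1.
have M0 : 0 <= M by rewrite mulr_ge0// sumr_ge0.
apply: (@le_trans _ _ (\sum_k \sum_i \sum_j `|sc i j k| * M)).
  by do 3![apply: ler_sum => ? _]; rewrite ler_wpM2l.
under eq_bigr => k _ do (under eq_bigr => i _ do rewrite -mulr_suml; rewrite -mulr_suml).
by rewrite -mulr_suml ler_wpM2r// /C0 lerDr.
Qed.

Lemma gn_br u v : gn (br u v) <= gn u * gn v.
Proof.
apply: le_trans (sc_bound (a := fun i => `|crd i u|) (b := fun i => `|crd i v|) _ _) => //.
rewrite /gn ler_wpM2l ?C0_ge0//; apply: ler_sum => k _; rewrite crd_br.
apply: le_trans (ler_norm_sum _ _ _) _; apply: ler_sum => i _.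
apply: le_trans (ler_norm_sum _ _ _) _; apply: ler_sum => j _.
by rewrite !normrM.
Qed.

Lemma gn_hasumv (I : choiceType) (F : I -> g) p (m : I -> R) K : hasumv F p ->
  (forall k, gn (F k) <= m k) -> absum m K -> gn p <= K.
Proof.
move=> hp Fm mK.
have -> : gn p = \sum_i (C0 * Num.sg (crd i p)) * crd i p.
  by rewrite /gn mulr_sumr; apply: eq_bigr => i _; rewrite -mulrA -normrEsg.
apply: le_trans (ler_norm _) _.
apply: (hasum_le (hasum_bigsum _ (fun i => hasumZ (C0 * Num.sg (crd i p)) (hp i)))).
apply: absum_le mK => // k; apply: le_trans (le_trans (Fm k) (ler_norm _)).
rewrite /gn mulr_sumr; apply: le_trans (ler_norm_sum _ _ _) _; apply: ler_sum => i _.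
rewrite !normrM (ger0_norm C0_ge0) ler_wpM2r// ler_piMr ?C0_ge0//.
by rewrite normr_sg; case: (_ != _); rewrite ?lexx ?ler01.
Qed.

Lemma hasumv_gn (I : choiceType) (F : I -> g) (m : I -> R) K :
  (forall k, gn (F k) <= m k) -> absum m K -> hasumv F (sumv F).
Proof.
move=> Fm mK; apply: hasumv_sumv => i; apply: (@hasum_ex _ _ _ K).
apply: absum_le mK => // k; apply: le_trans (crd_gn i (F k)) _.
exact: le_trans (Fm k) (ler_norm _).
Qed.

Lemma gn_bchz x y n : gn (bchz br x y n) <= majz (gn x) (gn y) n.
Proof.
apply: (@N_bchz _ _ br (fun u K => gn u <= K)) => //.
- by rewrite gn0.
- by move=> u v K M hu hv; apply: le_trans (gnD _ _) _; exact: lerD.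
- by move=> k u K hu; rewrite gnZ ler_wpM2l.
- move=> u v K M hu hv; apply: le_trans (gn_br _ _) _.
  by apply: ler_pM => //; exact: gn_ge0.
Qed.

(* The convergence domain of the Baker-Campbell-Hausdorff series used below. *)
Definition small (a b : R) := a <= 2^-1 /\ a + 2 * b <= 8^-1.

Definition bch x y : g := sumv (bchz br x y).

Lemma small_absum x y : small (gn x) (gn y) ->
  absum (majz (gn x) (gn y)) (2 * (gn x + 2 * gn y)).
Proof. by move=> [h1 h2]; apply: majz_absum => //; exact: gn_ge0. Qed.

Lemma hasumv_bch x y : small (gn x) (gn y) -> hasumv (bchz br x y) (bch x y).
Proof. by move=> /small_absum; apply: hasumv_gn => n; exact: gn_bchz. Qed.

Lemma gn_bch x y : small (gn x) (gn y) -> gn (bch x y) <= 2 * (gn x + 2 * gn y).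
Proof.
move=> s; apply: gn_hasumv (hasumv_bch s) _ (small_absum s) => n; exact: gn_bchz.
Qed.

Definition NS (X : nat -> g) K := absum (fun n => gn (X n)) K.

Lemma NS_cv X Y K L : NS X K -> NS Y L -> NS (cv br X Y) (K * L).
Proof.
move=> hX hY; apply: absum_le (lexx _) (absum_conv hX hY) => n.
rewrite (ger0_norm (gn_ge0 _)); apply: le_trans (gn_sum _ _ _) (le_trans _ (ler_norm _)).
by apply: ler_sum => i _; exact: gn_br.
Qed.

Lemma NS_add X Y K L : NS X K -> NS Y L -> NS (X + Y) (K + L).
Proof.
move=> hX hY t ut; apply: (@le_trans _ _ (\sum_(i <- t) (`|gn (X i)| + `|gn (Y i)|))).
  by apply: ler_sum => i _; rewrite !ger0_norm ?gn_ge0// gnD.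
by rewrite big_split lerD// ?hX ?hY.
Qed.

Lemma NS_scale X k K : NS X K -> NS (k *: X) (`|k| * K).
Proof.
move=> hX t ut; apply: (@le_trans _ _ (\sum_(i <- t) (`|k| * `|gn (X i)|))).
  by apply: ler_sum => i _; rewrite !(ger0_norm (gn_ge0 _)) -gnZ.
by rewrite -mulr_sumr ler_wpM2l// hX.
Qed.

Lemma NS_0 : NS 0 0.
Proof. by move=> t ut; rewrite big1// => i _; rewrite [X in gn X](_ : _ = 0)// gn0 normr0. Qed.

Lemma NS_bchz X Y a b k : NS X a -> NS Y b -> NS (bchz (cv br) X Y k) (majz a b k).
Proof.
by move=> hX hY; apply: (@N_bchz R _ (cv br) NS) => // *;
  [exact: NS_0|exact: NS_add|exact: NS_scale|exact: NS_cv].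
Qed.

Lemma absum_crd X K i : NS X K -> absum (fun n => crd i (X n)) K.
Proof.
by apply: absum_le => // n; rewrite (ger0_norm (gn_ge0 _)); exact: crd_gn.
Qed.

(** Summing the coefficients is a Lie homomorphism on absolutely summable series, so it commutes
    with each component of the BCH series; this is parametricity for the relation
    [is summable with sum u]. *)
Lemma hasumv_bchz X Y a b p q k : NS X a -> NS Y b -> hasumv X p -> hasumv Y q ->
  hasumv (bchz (cv br) X Y k) (bchz br p q k).
Proof.
move=> Xa Yb Xp Yq.
suff : (exists K, NS (bchz (cv br) X Y k) K) /\ hasumv (bchz (cv br) X Y k) (bchz br p q k).
  by case.
move: k; apply: (@S_bchz _ _ _ _ _ (fun _ (U : nat -> g) (u : g) => (exists K, NS U K) /\ hasumv U u)).
- move=> _; split; first by exists 0; exact: NS_0.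
  by move=> i; apply: (eq_hasum (a := fun _ : nat => 0) (s := 0)) => [n||]; rewrite ?crd0//; exact: hasum0.
- move=> _ U W u w [[K hU] Uu] [[M hW] Ww]; split; first by exists (K + M); exact: NS_add.
  by move=> i; apply: eq_hasum (hasumD (Uu i) (Ww i)) => [n|]; exact/esym/crdD.
- move=> _ c U u [[K hU] Uu]; split; first by exists (`|c| * K); exact: NS_scale.
  by move=> i; apply: eq_hasum (hasumZ c (Uu i)) => [n|]; exact/esym/crdZ.
- move=> _ _ U u W w [[K hU] Uu] [[M hW] Ww]; split; first by exists (K * M); exact: NS_cv.
  move=> l; rewrite crd_br.
  apply: eq_hasum (erefl _) (hasum_bigsum _ (fun i => hasum_bigsum _ (fun j =>
    hasumZ (sc i j l) (hasum_conv (absum_crd i hU) (absum_crd j hW) (Uu i) (Ww j))))).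
  move=> n; rewrite /cv crd_sum; under [RHS]eq_bigr do rewrite crd_br.
  rewrite [RHS]exchange_big; apply: eq_bigr => i _.
  rewrite [RHS]exchange_big; apply: eq_bigr => j _.
  by rewrite mulr_sumr.
- by split; [exists a|].
- by split; [exists b|].
Qed.

(** The double family indexed by the BCH degree k and the series degree n is absolutely summable by
    the majorant. Summing over n first gives the BCH components of p and q; summing over k first
    gives the coefficients of [star]. *)
Lemma star_eval X Y a b p q : X 0%N = 0 -> Y 0%N = 0 -> small a b ->
  NS X a -> NS Y b -> hasumv X p -> hasumv Y q ->
  hasumv (star br X Y) (sumv (bchz br p q)) /\ NS (star br X Y) (2 * (a + 2 * b)).
Proof.
move=> X0 Y0 [a1 ab] Xa Yb Xp Yq.
have a0 : 0 <= a := absum_ge0 Xa; have b0 : 0 <= b := absum_ge0 Yb.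
have mK := majz_absum a0 a1 b0 ab.
have NZ k := NS_bchz k Xa Yb.
have joint : absum (fun x : nat * nat => gn (bchz (cv br) X Y x.1 x.2)) (2 * (a + 2 * b)).
  by apply: absum_sigma mK => k; exact: NZ.
have zero n k : (n < k)%N -> bchz (cv br) X Y k n = 0 by exact: bchz_low.
have cut (V : nmodType) (f : g -> V) n : f 0 = 0 ->
    forall k, k \notin iota 0 n.+1 -> f (bchz (cv br) X Y k n) = 0.
  by move=> f0 k; rewrite mem_iota add0n /= -leqNgt => nk; rewrite zero.
split; last first.
  apply: (@absum_le _ _ _ (fun n => \sum_(k <- iota 0 n.+1) gn (bchz (cv br) X Y k n))) (lexx _) _.
    move=> n; rewrite (ger0_norm (gn_ge0 _)); apply: le_trans (le_trans _ (ler_norm _)).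
      by rewrite /star -(big_mkord xpredT (fun k => bchz (cv br) X Y k n)); exact: gn_sum.
    by rewrite /index_iota subn0.
  apply: (absum_fibre (h := fun x : nat * nat => x.2) joint) => n.
  apply: (iffLR (@hasum_inj _ _ _ (fun k => (k, n)) (fun k => gn (bchz (cv br) X Y k n)) _ _ _ _ _)).
  - by move=> i j [].
  - by move=> k /=; rewrite eqxx.
  - move=> [k m] /= hkm; case: eqP => // mn; by have := hkm k; rewrite mn eqxx.
  - by apply: hasum_finite (iota_uniq _ _) _; apply: (cut _ gn); exact: gn0.
have swap : forall i, exists s, hasum (fun x : nat * nat => crd i (bchz (cv br) X Y x.1 x.2)) s.
  move=> i; apply: (@hasum_ex _ _ _ (2 * (a + 2 * b))); apply: absum_le joint => // x.
  by rewrite (ger0_norm (gn_ge0 _)); exact: crd_gn.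
have outer i s : hasum (fun x : nat * nat => crd i (bchz (cv br) X Y x.1 x.2)) s ->
    hasum (fun k => crd i (bchz br p q k)) s.
  by move=> hs; apply: (hasum_fubini hs) => k /=; exact: (hasumv_bchz k Xa Yb Xp Yq).
have hv : hasumv (bchz br p q) (sumv (bchz br p q)).
  by apply: hasumv_sumv => i; have [s /outer] := swap i; exists s.
move=> i; have [s hs] := swap i; rewrite (hasum_uniq (hv i) (outer i s hs)).
have hs' : hasum (fun x : nat * nat => crd i (bchz (cv br) X Y x.2 x.1)) s.
  refine (iffLR (@hasum_inj _ _ _ (fun x : nat * nat => (x.2, x.1)) _ _ s _ _ _) hs).
  - by move=> [? ?] [? ?] [-> ->].
  - by [].
  - by move=> [m n] /(_ (n, m)); rewrite eqxx.
apply: (hasum_fubini hs') => n /=.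
rewrite /star crd_sum -(big_mkord xpredT (fun k => crd i (bchz (cv br) X Y k n))) /index_iota subn0.
by apply: hasum_finite (iota_uniq _ _) _; apply: (cut _ (crd i)); exact: crd0.
Qed.

Lemma single_eval x : NS (single x) (gn x) /\ hasumv (single x) x.
Proof.
split.
  have h : hasum (fun n => gn (single x n)) (gn (single x 1%N)).
    apply: (@hasum_one _ _ _ 1%N) => n n1; by rewrite /single (negPf n1) gn0.
  apply: absum_nat => [n|N]; first exact: gn_ge0.
  case: N => [|[|N]]; rewrite ?big_ord0 ?gn_ge0//.
    by rewrite big_ord1 /single /= gn0 gn_ge0.
  by rewrite 2!big_ord_recl /single /= gn0 add0r big1 ?addr0// => i _; rewrite gn0.
move=> i; apply: (@hasum_one _ _ (fun n => crd i (single x n)) 1%N) => n n1.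
by rewrite /single (negPf n1) crd0.
Qed.

(** The formal law [starA] for series concentrated in degree one, evaluated on both sides; the bound
    1/1000 keeps all four products within [small]. *)
Lemma bchA x y w : gn x <= 1000%:R^-1 -> gn y <= 1000%:R^-1 -> gn w <= 1000%:R^-1 ->
  bch (bch x y) w = bch x (bch y w).
Proof.
move=> xs ys ws.
have [x0 y0 w0] := And3 (gn_ge0 x) (gn_ge0 y) (gn_ge0 w).
have [Nx hx] := single_eval x; have [Ny hy] := single_eval y.
have [Nw hw] := single_eval w.
have [h1 N1] : hasumv (star br (single x) (single y)) (bch x y) /\
    NS (star br (single x) (single y)) (2 * (gn x + 2 * gn y)).
  by apply: star_eval => //; split; lra.
have [h2 N2] : hasumv (star br (single y) (single w)) (bch y w) /\
    NS (star br (single y) (single w)) (2 * (gn y + 2 * gn w)).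
  by apply: star_eval => //; split; lra.
have [h3 _] : hasumv (star br (star br (single x) (single y)) (single w)) (bch (bch x y) w) /\
    NS (star br (star br (single x) (single y)) (single w))
      (2 * (2 * (gn x + 2 * gn y) + 2 * gn w)).
  by apply: star_eval => //; [exact: star0|split; lra].
have [h4 _] : hasumv (star br (single x) (star br (single y) (single w))) (bch x (bch y w)) /\
    NS (star br (single x) (star br (single y) (single w)))
      (2 * (gn x + 2 * (2 * (gn y + 2 * gn w)))).
  by apply: star_eval => //; [exact: star0|split; lra].
by apply: hasumv_uniq h3 _; rewrite starA.
Qed.

End BCH.

(** * Naturality, ideals, second-order expansion and analyticity of the local group law *)

Section BCHProperties.
Variables (R : realType) (g : vectType R) (br : g -> g -> g).
Hypothesis lie : is_lie br.
Let bil : is_algebra br. Proof. by case: lie. Qed.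
Notation d := (dim g).
Notation gn := (gn br).
Notation C0 := (C0 br).
Notation bch := (bch br).
Implicit Types u x y p q : g.

Lemma bch_morph (h : vectType R) (brh : h -> h -> h) (f : {linear g -> h}) x y :
  (forall u v, f (br u v) = brh (f u) (f v)) -> small (gn x) (gn y) ->
  f (bch x y) = Submission.bch brh (f x) (f y).
Proof.
move=> fbr s; apply/esym/sumvP => i.
have zz n : f (bchz br x y n) = bchz brh (f x) (f y) n.
  apply: (@S_bchz R g h br brh (fun _ u fu => f u = fu) x y (f x) (f y) _ _ _ _ _ _ n) => //.
  - by move=> m; rewrite linear0.
  - by move=> m u v u' v' <- <-; rewrite linearD.
  - by move=> m a u u' <-; rewrite linearZ.
  - by move=> m p u u' v v' <- <-.
by apply: eq_hasum (erefl _) (hasumv_linear f (hasumv_bch lie s) i) => n; rewrite zz.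
Qed.

Lemma bch_2step_eq x y : br x (br x y) = 0 -> br y (br x y) = 0 ->
  bch x y = x + y + 2^-1 *: br x y.
Proof.
have [_ anti _] := lie; move=> xc yc; apply: sumvP => i.
have hz := bchz_2step bil anti xc yc.
have := @hasum_finite _ _ (fun n => crd i (bchz br x y n)) [:: 1%N; 2%N] isT.
rewrite big_cons big_seq1 !hz /= -crdD; apply => n; rewrite !inE negb_or => /andP[n1 n2].
by rewrite hz (negPf n1) (negPf n2) crd0.
Qed.

Lemma bch_comm x y : br x y = 0 -> bch x y = x + y.
Proof. move=> xy; have c z : br z (br x y) = 0 by rewrite xy br0r.
by rewrite (bch_2step_eq (c x) (c y)) xy scaler0 addr0. Qed.

Lemma bchx0 x : bch x 0 = x.
Proof. by rewrite (bch_comm (br0r bil x)) addr0. Qed.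
Lemma bch0x x : bch 0 x = x.
Proof. by rewrite (bch_comm (br0l bil x)) add0r. Qed.
Lemma bchxN x : bch x (- x) = 0.
Proof. by rewrite bch_comm ?subrr// (brNr bil) (br_self lie) oppr0. Qed.
Lemma bchNx x : bch (- x) x = 0.
Proof. by rewrite bch_comm ?addNr// (brNl bil) (br_self lie) oppr0. Qed.

Section ModIdeal.
Variable pi : {linear g -> g}.
Hypotheses (pil : forall u v, pi u = 0 -> pi (br u v) = 0).

Let pir u v : pi v = 0 -> pi (br u v) = 0.
Proof. by have [_ anti _] := lie; move=> /(pil u) h; rewrite anti linearN h oppr0. Qed.

Let pibr u u' v v' : pi u = pi u' -> pi v = pi v' -> pi (br u v) = pi (br u' v').
Proof.
move=> uu vv; apply/eqP; rewrite -subr_eq0 -linearB.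
have -> : br u v - br u' v' = br (u - u') v + br u' (v - v').
  by rewrite !(br_lin bil); lmod_over R g.
rewrite linearD pil ?pir ?addr0// linearB ?uu ?vv subrr//.
Qed.

(** The ideal is the kernel of [pi], which replaces a quotient algebra; congruence modulo it goes
    through each degree of the recursion. *)
Lemma bch_congr x y x' y' : pi x = pi x' -> pi y = pi y' ->
  small (gn x) (gn y) -> small (gn x') (gn y') -> pi (bch x y) = pi (bch x' y').
Proof.
move=> xx yy s s'; apply: (can_inj v2rK); apply/rowP => i.
apply: hasum_uniq (hasumv_linear pi (hasumv_bch lie s) i) _.
have zz n : pi (bchz br x y n) = pi (bchz br x' y' n).
  apply: (@S_bchz R g g br br (fun _ u w => pi u = pi w) x y x' y' _ _ _ _ _ _ n) => //.
  - by move=> m u v u' v' h1 h2; rewrite !linearD h1 h2.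
  - by move=> m a u u' h; rewrite !linearZ h.
by apply: eq_hasum (erefl _) (hasumv_linear pi (hasumv_bch lie s') i) => n; rewrite zz.
Qed.

Hypothesis pi2 : forall u, pi (pi u) = pi u.

(** [bchz_2step] asks only for a bilinear antisymmetric bracket, so it can be applied to [pi]
    composed with [br], which agrees with [br] modulo the ideal. *)
Lemma bch_2step x y : pi (br x (br x y)) = 0 -> pi (br y (br x y)) = 0 ->
  small (gn x) (gn y) -> pi (bch x y) = pi (x + y + 2^-1 *: br x y).
Proof.
move=> xc yc s; have [_ anti _] := lie.
pose br' u v := pi (br u v).
have bil' : is_algebra br'.
  by apply: mk_algebra => *; rewrite /br' (br_lin bil) ?linearD ?linearZ.
have anti' u v : br' u v = - br' v u by rewrite /br' anti linearN.
have pc u v : pi (br u (pi v)) = pi (br u v) by apply: pibr => //; exact: pi2.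
have hz := @bchz_2step R g br' x y bil' anti' (etrans (pc _ _) xc) (etrans (pc _ _) yc).
have zz n : pi (bchz br x y n) = pi (bchz br' x y n).
  apply: (@S_bchz R g g br br' (fun _ u w => pi u = pi w) x y x y _ _ _ _ _ _ n) => //.
  - by move=> m u v u' v' h1 h2; rewrite !linearD h1 h2.
  - by move=> m a u u' h; rewrite !linearZ h.
  - by move=> m p u u' v v' h1 h2; rewrite /br' pi2; exact: pibr.
apply: (can_inj v2rK); apply/rowP => i.
apply: hasum_uniq (hasumv_linear pi (hasumv_bch lie s) i) _.
have := @hasum_finite _ _ (fun n => v2r (pi (bchz br x y n)) 0 i) [:: 1%N; 2%N] isT.
rewrite big_cons big_seq1 !zz !hz /= !linearZ /br' pi2.
have -> : v2r (pi (x + y)) 0 i + (2^-1 *: v2r (pi (br x y))) 0 i =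
    v2r (pi (x + y + 2^-1 *: br x y)) 0 i.
  by move: (x + y) => z; rewrite linearD linearZ linearD linearZ [RHS]mxE.
apply => n; rewrite !inE negb_or => /andP[n1 n2].
by rewrite zz hz (negPf n1) (negPf n2) !linear0 mxE.
Qed.

Lemma bch_comm_mod x y : pi (br x y) = 0 -> small (gn x) (gn y) ->
  pi (bch x y) = pi (x + y).
Proof.
move=> xy s; have c z : pi (br z (br x y)) = 0 by exact: pir.
by rewrite (bch_2step (c x) (c y) s) linearD linearZZ xy scaler0 addr0.
Qed.

End ModIdeal.

(** Components of degree at least 3 are dominated by t^3 times a convergent majorant, after
    rescaling the arguments by t. *)
Lemma bch_second_order x y : gn x + 2 * gn y <= 8^-1 ->
  gn (bch x y - (x + y + 2^-1 *: br x y)) <= 128%:R * (gn x + 2 * gn y) ^+ 3.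
Proof.
move=> dle; have gx := gn_ge0 br x; have gy := gn_ge0 br y.
set D := gn x + 2 * gn y in dle *.
have [D0|D0] := leP D 0.
  have zero u : gn u <= 0 -> u = 0.
    move=> h; apply: crd_inj => i; rewrite crd0; apply/eqP; rewrite -normr_le0.
    by apply: le_trans h; exact: crd_gn.
  have -> : x = 0 by apply: zero; rewrite /D in D0; lra.
  have -> : y = 0 by apply: zero; rewrite /D in D0; lra.
  rewrite bchx0 (br0l bil) scaler0 !addr0 subrr gn0 mulr_ge0// exprn_ge0//.
  by rewrite /D; lra.
(* This scale puts the majorant at the edge a + 2b = 1/8 of its domain; its sum there is at most
   1/4, and 8^3 / 4 = 128. *)
pose t := 8 * D; have t0 : 0 < t by rewrite mulr_gt0.
have t1 : t <= 1 by rewrite /t; lra.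
pose a := gn x / t; pose b := gn y / t.
have ax : gn x = t * a by rewrite /a mulrC mulfVK ?gt_eqF.
have by_ : gn y = t * b by rewrite /b mulrC mulfVK ?gt_eqF.
have a0 : 0 <= a by rewrite divr_ge0// ltW.
have b0 : 0 <= b by rewrite divr_ge0// ltW.
have ab : a + 2 * b = 8^-1.
  by rewrite /a /b mulrA -mulrDl -/D /t; field; rewrite gt_eqF.
have s : small (gn x) (gn y) by split; rewrite /D in dle; lra.
pose F n : g := if (n < 3)%N then 0 else bchz br x y n.
have hF : hasumv F (bch x y - (x + y + 2^-1 *: br x y)).
  move=> i; pose G n : g := if (n < 3)%N then bchz br x y n else 0.
  have hG : hasum (fun n => crd i (G n)) (crd i (x + y + 2^-1 *: br x y)).
    have := @hasum_finite _ _ (fun n => crd i (G n)) [:: 0%N; 1%N; 2%N] isT.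
    rewrite !big_cons big_nil addr0 /G /= [bchz br x y 0%N](_ : _ = 0)// crd0 add0r.
    rewrite (bchz1 lie) (bchz2 lie) -crdD; apply => -[|[|[|n]]]//= _.
    by rewrite crd0.
  rewrite crdB; apply: eq_hasum (erefl _) (hasumB (hasumv_bch lie s i) hG) => n.
  by rewrite /F /G; case: ifP => _; rewrite ?subrr ?crd0// subr0.
have maj0 := majz_absum a0 (_ : a <= 2^-1) b0 (_ : a + 2 * b <= 8^-1).
apply: le_trans (gn_hasumv hF (m := fun n => t ^+ 3 * majz a b n) _ _) (_ : t ^+ 3 * (2 * (a + 2 * b)) <= _).
- move=> n; rewrite /F; case: ltnP => n3.
    by rewrite gn0 mulr_ge0 ?exprn_ge0 ?majz_ge0// ltW.
  apply: le_trans (gn_bchz lie x y n) _; rewrite ax by_ (majz_hom a b n (ltW t0)).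
  apply: ler_wpM2r; first exact: majz_ge0.
  rewrite -(subnKC n3) exprD; apply: ler_piMr; first by rewrite exprn_ge0// ltW.
  by rewrite exprn_ile1// ltW.
- move=> u uu; under eq_bigr do rewrite normrM (ger0_norm (exprn_ge0 3 (ltW t0))).
  rewrite -mulr_sumr; apply: ler_wpM2l; first by rewrite exprn_ge0// ltW.
  by apply: maj0 => //; lra.
- rewrite ab /t exprMn; lra.
Qed.

Lemma small_le (a b a' b' : R) : small a b -> a' <= a -> b' <= b -> small a' b'.
Proof. by move=> [h1 h2] h3 h4; split; lra. Qed.

Section Analyticity.
Variables (X : finType) (r : R).
Hypothesis r0 : 0 <= r.

(** The norm [gn] with the coordinates replaced by power series norms; the factor [C0] makes it
    submultiplicative for the pointwise bracket. *)
Definition NH (f : (X -> R) -> g) K := exists k : 'I_d -> R,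
  (forall i, Hs r (fun v => crd i (f v)) (k i)) /\ C0 * \sum_i k i <= K.

Lemma NH_crd f K i : NH f K -> Hs r (fun v => crd i (f v)) K.
Proof.
move=> [k [fk kK]]; apply: Hs_mono (fk i); apply: le_trans kK.
have k0 j : 0 <= k j by exact: Hs_ge0 (fk j).
apply: (@le_trans _ _ (\sum_i k i)); first by rewrite (bigD1 i)//= lerDl sumr_ge0.
by rewrite ler_peMl ?C0_ge1// sumr_ge0.
Qed.

Lemma NH_gn f K v : NH f K -> (forall j, `|v j| <= r) -> gn (f v) <= K.
Proof.
move=> [k [fk kK]] vr; apply: le_trans kK; rewrite /Submission.gn ler_wpM2l ?C0_ge0//.
by apply: ler_sum => i _; exact: (Hs_bound r0 (fk i) vr).
Qed.

Lemma NH_of f (K : R) : (forall i, Hs r (fun v => crd i (f v)) K) -> NH f (C0 * (K *+ d)).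
Proof.
by move=> h; exists (fun=> K); split=> //; rewrite sumr_const card_ord.
Qed.

Lemma NH_mono f K L : K <= L -> NH f K -> NH f L.
Proof. by move=> KL [k [fk kK]]; exists k; split=> //; exact: le_trans KL. Qed.

Lemma NH_bchz f h a b n : NH f a -> NH h b ->
  NH (bchz (fun f h v => br (f v) (h v)) f h n) (majz a b n).
Proof.
move=> fa hb; apply: (@N_bchz R _ _ NH) => //.
- exists (fun=> 0); split=> [i|]; last by rewrite big1 ?mulr0.
  have := @Hs_const _ X _ r0 0; rewrite normr0; apply: Hs_ext => v _.
  by rewrite -[X in _ = crd i X]/(0 : g) crd0.
- move=> u v K M [k [uk kK]] [m [vm mM]]; exists (fun i => k i + m i); split=> [i|].
    by apply: Hs_ext (HsD r0 (uk i) (vm i)) => w _; rewrite -crdD.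
  by rewrite big_split mulrDr lerD.
- move=> c u K [k [uk kK]]; exists (fun i => `|c| * k i); split=> [i|].
    by apply: Hs_ext (HsZ r0 c (uk i)) => w _; rewrite -crdZ.
  by rewrite -mulr_sumr mulrCA ler_wpM2l.
- move=> u v K M [k [uk kK]] [m [vm mM]].
  have k0 i : 0 <= k i by exact: Hs_ge0 (uk i).
  have m0 i : 0 <= m i by exact: Hs_ge0 (vm i).
  exists (fun l => \sum_i \sum_j `|sc br i j l| * (k i * m j)); split=> [l|].
    have hh := Hs_bigsum r0 (index_enum _) (P := xpredT) (fun i _ =>
      Hs_bigsum r0 (index_enum _) (P := xpredT) (fun j _ =>
        HsZ r0 (sc br i j l) (HsM r0 (uk i) (vm j)))).
    by apply: Hs_ext hh => w _; rewrite (crd_br lie).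
  apply: le_trans (sc_bound br k0 m0) _; apply: ler_pM => //;
    by rewrite mulr_ge0 ?C0_ge0// sumr_ge0.
Qed.

Lemma Hs_bch f h a b i : NH f a -> NH h b -> small a b ->
  Hs r (fun v => crd i (bch (f v) (h v))) (2 * (a + 2 * b)).
Proof.
move=> fa hb s.
have z0 (j : X) : `|(0 : R)| <= r by rewrite normr0.
have a0 : 0 <= a by apply: le_trans (gn_ge0 _ _) (NH_gn (v := fun=> 0) fa z0).
have b0 : 0 <= b by apply: le_trans (gn_ge0 _ _) (NH_gn (v := fun=> 0) hb z0).
have mK := majz_absum a0 s.1 b0 s.2.
apply: (Hs_sum r0 (f := fun n v => crd i (bchz br (f v) (h v) n)) _ mK) => [n|v vr].
  by apply: Hs_ext (NH_crd i (NH_bchz n fa hb)) => v _; rewrite bchz_fun.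
apply: hasumv_bch => //; apply: small_le s _ _; exact: NH_gn.
Qed.

End Analyticity.
End BCHProperties.

(** * Derivations of a Malcev algebra *)

Section Malcev.
Variables (R : realType) (A : vectType R) (br : A -> A -> A).
Hypothesis mal : is_malcev br.
Let bil : is_algebra br. Proof. by case: mal. Qed.
Implicit Types a b c u v x y z w : A.

Lemma mal_anti x y : br x y = - br y x.
Proof.
have [_ alt _] := mal; apply/eqP; rewrite -subr_eq0 opprK; apply/eqP.
have := alt (x + y); rewrite (brDl bil) !(brDr bil) !alt add0r addr0.
by [].
Qed.

Lemma mal_alt x : br x x = 0. Proof. by have [_ alt _] := mal. Qed.

(** The Malcev identity polarised in x, stated for coordinates so that linear arithmetic over the
    reals can combine its instances. *)
Lemma mal_lin i x w y z :
  crd i (br (jac br x y z) w + br (jac br w y z) x) =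
  crd i (jac br x y (br w z) + jac br w y (br x z)).
Proof.
have [_ _ M] := mal.
have := congr1 (crd i) (M (x + w) y z).
have := congr1 (crd i) (M x y z); have := congr1 (crd i) (M w y z).
rewrite /jac !(br_lin bil) !crdD; lra.
Qed.

(* The derivation D_{a,b} = [ad a, ad b] + ad [a,b]. *)
Definition Dab a b v := br a (br b v) - br b (br a v) + br (br a b) v.

(** Both identities are linear consequences of the polarised Malcev identity on a, b, c, d: the
    twelve instances below are the choices of the polarised pair and of the order of the other
    two. *)
Lemma Dab_facts a b c d :
  Dab a b (br c d) = br (Dab a b c) d + br c (Dab a b d) /\
  Dab (br a b) c d + Dab (br b c) a d + Dab (br c a) b d = 0.
Proof.
suff H : forall i, crd i (Dab a b (br c d)) = crd i (br (Dab a b c) d + br c (Dab a b d)) /\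
  crd i (Dab (br a b) c d + Dab (br b c) a d + Dab (br c a) b d) = crd i 0.
  by split; apply: crd_inj => i; have [] := H i.
move=> i.
move: (mal_lin i a b c d).
move: (mal_lin i a b d c).
move: (mal_lin i a c b d).
move: (mal_lin i a c d b).
move: (mal_lin i a d b c).
move: (mal_lin i a d c b).
move: (mal_lin i b c a d).
move: (mal_lin i b c d a).
move: (mal_lin i b d a c).
move: (mal_lin i b d c a).
move: (mal_lin i c d a b).
move: (mal_lin i c d b a).
rewrite /jac /Dab !(br_lin bil).
(* Every bracket monomial is brought to one orientation, so that [lra] sees monomials equal up to
   sign as the same atom. *)
pose rules := (mal_anti b a,
  mal_anti c a,
  mal_anti d a,
  mal_anti c b,
  mal_anti d b,
  mal_anti d c,
  mal_anti c (br a b),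
  mal_anti d (br a b),
  mal_anti b (br a c),
  mal_anti d (br a c),
  mal_anti b (br a d),
  mal_anti c (br a d),
  mal_anti a (br b c),
  mal_anti d (br b c),
  mal_anti a (br b d),
  mal_anti c (br b d),
  mal_anti a (br c d),
  mal_anti b (br c d),
  mal_anti d (br (br a b) c),
  mal_anti c (br (br a b) d),
  mal_anti d (br (br a c) b),
  mal_anti b (br (br a c) d),
  mal_anti c (br (br a d) b),
  mal_anti b (br (br a d) c),
  mal_anti d (br (br b c) a),
  mal_anti a (br (br b c) d),
  mal_anti c (br (br b d) a),
  mal_anti a (br (br b d) c),
  mal_anti b (br (br c d) a),
  mal_anti a (br (br c d) b),
  mal_anti (br c d) (br a b),
  mal_anti (br b d) (br a c),
  mal_anti (br b c) (br a d)).
rewrite !(rules, brNl bil, brNr bil, opprK).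
rewrite !(crdD, crdN, crd0).
move=> *; split; lra.
Qed.

End Malcev.

Section LinearHelpers.
Variable R : realType.

Definition mklin (U V : lmodType R) (f : U -> V) (fl : linear f) : {linear U -> V} :=
  HB.pack f (GRing.isLinear.Build R U V *:%R f fl).

Lemma mklinE (U V : lmodType R) (f : U -> V) (fl : linear f) x : mklin fl x = f x.
Proof. by []. Qed.

(** A subspace contained in [P] of maximal dimension is all of [P]: adding the line of an element of
    [P] cannot enlarge it. *)
Lemma pred_vspace (W : vectType R) (P : W -> Prop) : P 0 ->
  (forall k u v, P u -> P v -> P (k *: u + v)) ->
  exists U : {vspace W}, forall u, u \in U <-> P u.
Proof.
move=> P0 PL.
pose Q n := `[< exists U : {vspace W}, (\dim U = n) /\ forall u, u \in U -> P u >].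
have exQ : exists n, Q n.
  exists 0%N; apply/asboolP; exists 0%VS; split; first exact: dimv0.
  by move=> u; rewrite memv0 => /eqP ->.
have bQ n : Q n -> (n <= dim W)%N.
  by move=> /asboolP[U [<- _]]; rewrite -dimvf dimvS// subvf.
case: (ex_maxnP exQ bQ) => n /asboolP[U [dU UP]] nmax.
exists U => u; split=> [/UP//|Pu].
have : Q (\dim (U + <[u]>)).
  apply/asboolP; exists (U + <[u]>)%VS; split=> // v /memv_addP[x xU [y /vlineP[k ->] ->]].
  by rewrite addrC; apply: PL => //; exact: UP.
move=> /nmax; rewrite -dU => dle.
have : (U == U + <[u]>)%VS by rewrite eqEdim addvSl dle.
by move=> /eqP ->; apply: (subvP (addvSr U <[u]>)); exact: memv_line.
Qed.

(* A linear predicate is the kernel of an idempotent. *)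
Lemma pred_projection (W : vectType R) (P : W -> Prop) : P 0 ->
  (forall k u v, P u -> P v -> P (k *: u + v)) ->
  exists pi : {linear W -> W}, (forall u, pi u = 0 <-> P u) /\ forall u, pi (pi u) = pi u.
Proof.
move=> P0 PL; have [U UP] := pred_vspace P0 PL.
pose q := daddv_pi U^C U.
have dx : (U^C :&: U = 0)%VS by rewrite capvC capv_compl.
have qU u : q u \in (U^C)%VS by exact: memv_pi.
exists (q : {linear W -> W}); split=> [u|u]; last exact: daddv_pi_proj.
have dec : u = q u + daddv_pi U U^C u.
  have := daddv_pi_add (U := U^C) (V := U) dx (w := u).
  by rewrite addvC addv_complf memvf => ->.
split=> [qu0|/UP uU].
  by apply/UP; rewrite dec qu0 add0r memv_pi.
have : q u \in (U^C :&: U)%VS.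
  rewrite memv_cap qU /=; have -> : q u = u - daddv_pi U U^C u by rewrite {2}dec addrK.
  by rewrite rpredB// memv_pi.
by rewrite dx memv0 => /eqP.
Qed.

End LinearHelpers.

(** * The Lie algebra with triality of a Malcev algebra *)

Section Triality.
Variables (R : realType) (A : vectType R) (br : A -> A -> A).
Hypothesis mal : is_malcev br.
Let bil : is_algebra br. Proof. by case: mal. Qed.
Notation Dab := (Dab br).

Definition is_der (f : 'End(A)) := forall u v, f (br u v) = br (f u) v + br u (f v).

Lemma der_vspace : exists U : {vspace 'End(A)}, forall f, f \in U <-> is_der f.
Proof.
apply: pred_vspace => [u v|k f h hf hh u v].
  by rewrite !lfunE /= br0l// br0r// addr0.
rewrite !add_lfunE !scale_lfunE hf hh !(br_lin bil); lmod_over R A.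
Qed.

Definition Der : {vspace 'End(A)} := projT1 (cid der_vspace).
Lemma DerP f : f \in Der <-> is_der f.
Proof. exact: (projT2 (cid der_vspace)). Qed.

Lemma Dab_linear a b : linear (Dab a b).
Proof. by move=> k u v; rewrite /Submission.Dab !(br_lin bil); lmod_over R A. Qed.
Definition Dl a b : 'End(A) := linfun (mklin (Dab_linear a b)).
Lemma DlE a b v : Dl a b v = Dab a b v. Proof. by rewrite lfunE. Qed.
Lemma Dl_der a b : Dl a b \in Der.
Proof. by apply/DerP => u v; rewrite !DlE; have [] := Dab_facts mal a b u v. Qed.

Definition tri := (subvs_of Der * (A * A))%type.

Definition der_of (X : tri) : A -> A := vsval X.1.
Definition mkt (f : 'End(A)) (b a : A) : tri := (vsproj Der f, (b, a)).

Lemma tri_der (X : tri) u v : der_of X (br u v) = br (der_of X u) v + br u (der_of X v).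
Proof. by have /DerP := subvsP X.1; apply. Qed.

Lemma comm_der (f h : 'End(A)) : f \in Der -> h \in Der -> ((f \o h) - (h \o f))%VF \in Der.
Proof.
move=> /DerP hf /DerP hh; apply/DerP => u v.
rewrite !add_lfunE !opp_lfunE !comp_lfunE.
rewrite (hf u v) (hh u v) !(linearD f) !(linearD h) /=.
rewrite (hf (h u) v) (hf u (h v)) (hh (f u) v) (hh u (f v)).
rewrite !(br_lin bil); lmod_over R A.
Qed.

Definition tbder (X Y : tri) : 'End(A) :=
  ((vsval X.1 \o vsval Y.1) - (vsval Y.1 \o vsval X.1))%VF + Dl X.2.1 Y.2.1 +
  3^-1 *: Dl X.2.2 Y.2.2.

Lemma tbder_der X Y : tbder X Y \in Der.
Proof.
apply: rpredD; last by apply: rpredZ; exact: Dl_der.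
by apply: rpredD; [apply: comm_der; exact: subvsP|exact: Dl_der].
Qed.

(* The element (D, b, a) stands for D + b_+ + a_-, where, for the three copies
   a_1 + a_2 + a_3 = 0 of A permuted by the triality automorphisms,
   a_- = a_1 and b_+ = b_2 - b_3. *)
Definition tb (X Y : tri) : tri := mkt (tbder X Y)
  (der_of X Y.2.1 - der_of Y X.2.1 - br X.2.1 Y.2.1 + 3^-1 *: br X.2.2 Y.2.2)
  (der_of X Y.2.2 - der_of Y X.2.2 + br X.2.1 Y.2.2 - br Y.2.1 X.2.2).

Lemma der_tb X Y v : der_of (tb X Y) v = der_of X (der_of Y v) - der_of Y (der_of X v) +
  Dab X.2.1 Y.2.1 v + 3^-1 *: Dab X.2.2 Y.2.2 v.
Proof.
rewrite /der_of /tb /mkt /= vsprojK ?tbder_der// /tbder.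
by rewrite !add_lfunE opp_lfunE !comp_lfunE scale_lfunE !DlE.
Qed.

Lemma tb_b X Y : (tb X Y).2.1 =
  der_of X Y.2.1 - der_of Y X.2.1 - br X.2.1 Y.2.1 + 3^-1 *: br X.2.2 Y.2.2.
Proof. by []. Qed.

Lemma tb_a X Y : (tb X Y).2.2 =
  der_of X Y.2.2 - der_of Y X.2.2 + br X.2.1 Y.2.2 - br Y.2.1 X.2.2.
Proof. by []. Qed.

Lemma tri_eq (X Y : tri) : (forall v, der_of X v = der_of Y v) ->
  X.2.1 = Y.2.1 -> X.2.2 = Y.2.2 -> X = Y.
Proof.
case: X => f [b a]; case: Y => f' [b' a'] /= h -> ->; congr pair.
by apply/val_inj/lfunP => v; exact: h.
Qed.

Lemma der_lin k X Y v : der_of (k *: X + Y) v = k *: der_of X v + der_of Y v.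
Proof.
rewrite /der_of -[(k *: X + Y).1]/(k *: X.1 + Y.1).
by rewrite -[vsval _]/(k *: vsval X.1 + vsval Y.1) add_lfunE scale_lfunE.
Qed.
Lemma der_ofD (X : tri) u v : der_of X (u + v) = der_of X u + der_of X v.
Proof. exact: linearD. Qed.
Lemma der_ofZ (X : tri) k u : der_of X (k *: u) = k *: der_of X u.
Proof. exact: linearZ. Qed.
Lemma der_ofN (X : tri) u : der_of X (- u) = - der_of X u.
Proof. exact: linearN. Qed.
Definition derE := (der_ofD, der_ofZ, der_ofN).

Lemma DabD2 a b c v : Dab a (b + c) v = Dab a b v + Dab a c v.
Proof. by rewrite /Submission.Dab !(br_lin bil); lmod_over R A. Qed.
Lemma DabZ2 k a b v : Dab a (k *: b) v = k *: Dab a b v.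
Proof. by rewrite /Submission.Dab !(br_lin bil); lmod_over R A. Qed.
Lemma Dab_anti a b v : Dab a b v = - Dab b a v.
Proof. by rewrite /Submission.Dab (mal_anti mal b a) !(br_lin bil); lmod_over R A. Qed.
Lemma DabN2 a b v : Dab a (- b) v = - Dab a b v.
Proof. by rewrite -scaleN1r DabZ2 scaleN1r. Qed.
Lemma DabD1 a b c v : Dab (a + b) c v = Dab a c v + Dab b c v.
Proof. by rewrite /Submission.Dab !(br_lin bil); lmod_over R A. Qed.
Lemma DabZ1 k a b v : Dab (k *: a) b v = k *: Dab a b v.
Proof. by rewrite /Submission.Dab !(br_lin bil); lmod_over R A. Qed.
Lemma DabN1 a b v : Dab (- a) b v = - Dab a b v.
Proof. by rewrite -scaleN1r DabZ1 scaleN1r. Qed.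
Definition DabE := (DabD1, DabD2, DabZ1, DabZ2, DabN1, DabN2).

Lemma der_Dab (X : tri) a b v : der_of X (Dab a b v) =
  Dab (der_of X a) b v + Dab a (der_of X b) v + Dab a b (der_of X v).
Proof.
rewrite /Submission.Dab !(derE, tri_der) !(br_lin bil); lmod_over R A.
Qed.

Lemma Dab_cyc x y z v : Dab x (br y z) v = Dab (br x y) z v + Dab y (br x z) v.
Proof.
have [_ h] := Dab_facts mal x y z v; move: h.
rewrite (Dab_anti (br y z)) (mal_anti mal z x) DabN1 (Dab_anti (br x z)) opprK => h.
apply/eqP; rewrite -subr_eq0 -[X in X == _]opprK oppr_eq0; apply/eqP; rewrite -[RHS]h.
lmod_over R A.
Qed.

Lemma tb_bil : is_algebra tb.
Proof.
have lin k X X' Y : tb (k *: X + X') Y = k *: tb X Y + tb X' Y.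
  apply: tri_eq => [v||].
  - rewrite der_lin !der_tb !der_lin /= !(derE, DabE); lmod_over R A.
  - rewrite /= !der_lin !derE !(br_lin bil); lmod_over R A.
  - rewrite /= !der_lin !derE !(br_lin bil); lmod_over R A.
have lin' k X Y Y' : tb X (k *: Y + Y') = k *: tb X Y + tb X Y'.
  apply: tri_eq => [v||].
  - rewrite der_lin !der_tb !der_lin /= !(derE, DabE); lmod_over R A.
  - rewrite /= !der_lin !derE !(br_lin bil); lmod_over R A.
  - rewrite /= !der_lin !derE !(br_lin bil); lmod_over R A.
by split=> X k Y Z; [exact: lin'|exact: lin].
Qed.

Lemma tb_anti X Y : tb X Y = - tb Y X.
Proof.
have dN Z v : der_of (- Z) v = - der_of Z v by rewrite -scaleN1r -[-1 *: Z]addr0 der_lin scaleN1r /der_of lfunE /= addr0.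
apply: tri_eq => [v||].
- rewrite dN !der_tb (Dab_anti X.2.1) (Dab_anti X.2.2); lmod_over R A.
- rewrite /= (mal_anti mal X.2.1) (mal_anti mal X.2.2); lmod_over R A.
- rewrite /=; lmod_over R A.
Qed.

(** In the derivation component, derivations act on D_{a,b} through [der_Dab] and the rest is the
    cyclic identity [Dab_cyc]. In the two copies of A, expanding D_{a,b} and the derivation property
    leaves an identity modulo antisymmetry. *)
Lemma tb_leib X Y Z : tb X (tb Y Z) = tb (tb X Y) Z + tb Y (tb X Z).
Proof.
have dD U V v : der_of (U + V) v = der_of U v + der_of V v.
  by rewrite -[U in LHS]scale1r der_lin scale1r.
have dB (U V : tri) : (U + V).2.1 = U.2.1 + V.2.1 by [].
have dA (U V : tri) : (U + V).2.2 = U.2.2 + V.2.2 by [].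
have r3 (u w v : A) : br u (br w v) = - br (br w v) u by exact: mal_anti.
have r4 (u : A) (W : tri) (w : A) : br u (der_of W w) = - br (der_of W w) u by exact: mal_anti.
pose o := (mal_anti mal Y.2.1 X.2.1, mal_anti mal Y.2.2 X.2.1, mal_anti mal Y.2.1 X.2.2,
  mal_anti mal Y.2.2 X.2.2, mal_anti mal Z.2.1 X.2.1, mal_anti mal Z.2.2 X.2.1,
  mal_anti mal Z.2.1 X.2.2, mal_anti mal Z.2.2 X.2.2, mal_anti mal Z.2.1 Y.2.1,
  mal_anti mal Z.2.2 Y.2.1, mal_anti mal Z.2.1 Y.2.2, mal_anti mal Z.2.2 Y.2.2).
apply: tri_eq => [v||].
- rewrite dD !der_tb /= !(derE, DabE, der_Dab).
  rewrite (Dab_cyc X.2.1 Y.2.1 Z.2.1) (Dab_cyc X.2.1 Y.2.2 Z.2.2).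
  rewrite (Dab_cyc X.2.2 Y.2.1 Z.2.2) (Dab_cyc X.2.2 Z.2.1 Y.2.2).
  rewrite !o !DabE.
  have rd (u : A) (W : tri) (w t : A) : Dab u (der_of W w) t = - Dab (der_of W w) u t.
    exact: Dab_anti.
  rewrite !rd (Dab_anti (br X.2.2 Z.2.1) Y.2.2) (Dab_anti Z.2.1 (br X.2.2 Y.2.2)).
  lmod_over R A.
- rewrite dB !(tb_a, tb_b) !der_tb !(derE, tri_der) /Submission.Dab !(br_lin bil) !o.
  rewrite !(br_lin bil) !(r3, r4) ?opprK ?scalerN.
  lmod_over R A.
- rewrite dA !(tb_a, tb_b) !der_tb !(derE, tri_der) /Submission.Dab !(br_lin bil) !o.
  rewrite !(br_lin bil) !(r3, r4) ?opprK ?scalerN.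
  lmod_over R A.
Qed.

Lemma tb_lie : is_lie tb.
Proof. by split; [exact: tb_bil|exact: tb_anti|exact: tb_leib]. Qed.

End Triality.

Section TrialityAutomorphisms.
Variables (R : realType) (A : vectType R) (br : A -> A -> A).
Hypothesis mal : is_malcev br.
Let bil : is_algebra br. Proof. by case: mal. Qed.
Notation Dab := (Dab br).
Notation tri := (tri mal).
Notation tb := (@tb R A br mal).
Implicit Types X Y : tri.

(** The rotation a_1 -> a_2 -> a_3 -> a_1 in the basis a_- = a_1, b_+ = b_2 - b_3. For instance a_2
    is half of a_+ minus half of a_-. The companion [sig] negates a_1 and exchanges a_2 with -
    a_3. *)
Definition rho_fun X : tri :=
  (X.1, (- 2^-1 *: X.2.1 + 2^-1 *: X.2.2, - 2^-1 *: X.2.2 - (3%:R / 2) *: X.2.1)).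
Definition sig_fun X : tri := (X.1, (X.2.1, - X.2.2)).
Definition am_fun (a : A) : tri := (0, (0, a)).
Definition ac_fun X : A := X.2.2.

Lemma rho_linear : linear rho_fun.
Proof.
move=> k X Y; apply: tri_eq => [v||].
- by rewrite der_lin [LHS](der_lin (mal := mal) k (X.1, (0, 0)) (Y.1, (0, 0))).
- by rewrite /=; lmod_over R A.
- by rewrite /=; lmod_over R A.
Qed.
Lemma sig_linear : linear sig_fun.
Proof.
move=> k X Y; apply: tri_eq => [v||].
- by rewrite der_lin [LHS](der_lin (mal := mal) k (X.1, (0, 0)) (Y.1, (0, 0))).
- by [].
- by rewrite /=; lmod_over R A.
Qed.
Lemma der_of0 b a v : der_of ((0, (b, a)) : tri) v = 0.
Proof. by rewrite /der_of /= lfunE. Qed.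
Lemma am_linear : linear am_fun.
Proof.
move=> k a b; apply: tri_eq => [v||].
- by rewrite der_lin !der_of0 scaler0 addr0.
- by rewrite /= scaler0 addr0.
- by [].
Qed.
Lemma ac_linear : linear ac_fun. Proof. by []. Qed.

Definition rho : {linear tri -> tri} := mklin rho_linear.
Definition sig : {linear tri -> tri} := mklin sig_linear.
Definition am : {linear A -> tri} := mklin am_linear.
Definition ac : {linear tri -> A} := mklin ac_linear.

Lemma der_rho X v : der_of (rho X) v = der_of X v. Proof. by []. Qed.
Lemma der_sig X v : der_of (sig X) v = der_of X v. Proof. by []. Qed.

Lemma rho_b X : (rho X).2.1 = - 2^-1 *: X.2.1 + 2^-1 *: X.2.2. Proof. by []. Qed.
Lemma rho_a X : (rho X).2.2 = - 2^-1 *: X.2.2 - (3%:R / 2) *: X.2.1. Proof. by []. Qed.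
Lemma sig_b X : (sig X).2.1 = X.2.1. Proof. by []. Qed.
Lemma sig_a X : (sig X).2.2 = - X.2.2. Proof. by []. Qed.

Lemma rho_hom X Y : rho (tb X Y) = tb (rho X) (rho Y).
Proof.
pose o := (mal_anti mal Y.2.1 X.2.1, mal_anti mal Y.2.2 X.2.1, mal_anti mal Y.2.1 X.2.2,
  mal_anti mal Y.2.2 X.2.2).
apply: tri_eq => [v||].
- rewrite der_rho !der_tb !(rho_a, rho_b) !der_rho !DabE //.
  lmod_over R A.
- rewrite rho_b !tb_b !tb_a !(rho_a, rho_b) !(derE, der_rho) !(br_lin bil) !o.
  lmod_over R A.
- rewrite rho_a !tb_b !tb_a !(rho_a, rho_b) !(derE, der_rho) !(br_lin bil) !o.
  lmod_over R A.
Qed.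

Lemma sig_hom X Y : sig (tb X Y) = tb (sig X) (sig Y).
Proof.
apply: tri_eq => [v||].
- rewrite der_sig !der_tb !(sig_a, sig_b) !der_sig !DabE //.
  lmod_over R A.
- rewrite sig_b !tb_b !(sig_a, sig_b) !(derE, der_sig) !(br_lin bil).
  lmod_over R A.
- rewrite sig_a !tb_a !(sig_a, sig_b) !(derE, der_sig) !(br_lin bil).
  lmod_over R A.
Qed.

Lemma rho3 X : rho (rho (rho X)) = X.
Proof.
apply: tri_eq => [v||].
- by rewrite !der_rho.
- by rewrite /=; lmod_over R A.
- by rewrite /=; lmod_over R A.
Qed.

Lemma sig_rho X : sig (rho X) = rho (rho (sig X)).
Proof.
apply: tri_eq => [v||].
- by rewrite !(der_rho, der_sig).
- by rewrite /=; lmod_over R A.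
- by rewrite /=; lmod_over R A.
Qed.

Lemma sigK X : sig (sig X) = X.
Proof. by case: X => D [b a] /=; rewrite /sig_fun /= opprK. Qed.

Lemma sig_am a : sig (am a) = - am a.
Proof.
congr pair => /=; first by rewrite oppr0.
by congr pair; rewrite oppr0.
Qed.

Lemma amK a : ac (am a) = a. Proof. by []. Qed.
(** [sig] fixes Der A and A_+, so a vector that it negates has zero components there. This is how a
    product of group elements is recognised as an element of A. *)
Lemma acK X : sig X = - X -> am (ac X) = X.
Proof.
have z (V : lmodType R) (v : V) : v = - v -> v = 0.
  move=> /eqP; rewrite -addr_eq0 -mulr2n -scaler_nat scaler_eq0 pnatr_eq0 /=.
  by move=> /eqP.
case: X => D [b a] /= [/z -> /z ->]; by [].
Qed.

Lemma rho_am_sum a : am a + rho (am a) + rho (rho (am a)) = 0.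
Proof.
apply: tri_eq => [v||].
- by rewrite /der_of /= !addr0 lfunE.
- by rewrite /=; lmod_over R A.
- by rewrite /=; lmod_over R A.
Qed.

Lemma rho_am_comm a : tb (am a) (rho (am a)) = 0.
Proof.
have m0 := mal_alt mal.
apply: tri_eq => [v||].
- rewrite der_tb !der_of0 /= !DabE //.
  rewrite /Submission.Dab !m0 !(br_lin bil) ?(br0l bil) ?(br0r bil); lmod_over R A.
- rewrite tb_b !der_of0 /= !(br_lin bil) ?(br0l bil) ?(br0r bil) ?m0; lmod_over R A.
- rewrite tb_a !der_of0 /= !(br_lin bil) ?(br0l bil) ?(br0r bil) ?m0; lmod_over R A.
Qed.

(* [a_2, a'_3] in terms of the bracket *)
Lemma tb_am a b : tb (am a) (am b) = mkt mal (3^-1 *: Dl mal a b) (3^-1 *: br a b) 0.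
Proof.
apply: tri_eq => [v||].
- rewrite der_tb !der_of0 /= /der_of /mkt /= vsprojK ?rpredZ ?Dl_der// scale_lfunE DlE.
  rewrite /Submission.Dab !(br_lin bil) ?(br0l bil) ?(br0r bil); lmod_over R A.
- rewrite tb_b !der_of0 /= !(br_lin bil) ?(br0l bil) ?(br0r bil); lmod_over R A.
- rewrite tb_a !der_of0 /= !(br_lin bil) ?(br0l bil) ?(br0r bil); lmod_over R A.
Qed.
End TrialityAutomorphisms.

(** * Short products of tiny elements in the local Lie group *)

Section LocalGroup.
Variables (R : realType) (g : vectType R) (br : g -> g -> g).
Hypothesis lie : is_lie br.
Let bil : is_algebra br. Proof. by case: lie. Qed.
Notation gn := (gn br).
Notation bch := (bch br).
Implicit Types (u x y p q : g) (s t : seq g).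

Lemma eta_exists (N : nat) : exists e : R, 0 < e /\
  forall n, (n <= N)%N -> 5%:R ^+ n * e <= 1000%:R^-1.
Proof.
have p5 m : 0 < (5%:R : R) ^+ m by apply: exprn_gt0; rewrite ltr0n.
have p1 : 0 < (1000%:R : R) by rewrite ltr0n.
exists (1000%:R * 5%:R ^+ N)^-1; split=> [|n nN].
  by rewrite invr_gt0; apply: mulr_gt0.
rewrite invfM mulrA mulrC mulrA -[leRHS]mul1r ler_pM2r ?invr_gt0//.
rewrite mulrC ler_pdivrMr// mul1r; apply: ler_weXn2l => //.
by rewrite (ler_nat R 1 5).
Qed.
Definition eta0 : R := projT1 (cid (eta_exists 40)).
Notation eta := eta0.
Lemma eta_gt0 : 0 < eta.
Proof. by rewrite /eta0; case: cid => e []. Qed.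
Lemma eta_bound n : (n <= 40)%N -> 5%:R ^+ n * eta <= 1000%:R^-1.
Proof. by rewrite /eta0; case: cid => e [/= _ h]; exact: h. Qed.

(** Lists whose products, and those of all their segments, stay where [bchA] applies; the length 40
    exceeds that of every word used below. *)
Definition tl s := all (fun u => gn u <= eta) s && (size s <= 40)%N.
Definition gprod s := foldr bch 0 s.

Lemma tl_cat s t : tl (s ++ t) -> tl s /\ tl t.
Proof.
rewrite /tl all_cat size_cat => /andP[/andP[-> ->] h].
by rewrite (leq_trans (leq_addr _ _) h) (leq_trans (leq_addl _ _) h).
Qed.
Lemma tl_cons u s : tl (u :: s) -> gn u <= eta /\ tl s.
Proof. by rewrite /tl /= => /andP[/andP[-> ->] h]; rewrite (ltnW h). Qed.

Lemma tl_small (a b : R) : 0 <= a -> 0 <= b -> a <= 1000%:R^-1 -> b <= 1000%:R^-1 -> small a b.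
Proof.
move=> a0 b0 a1 b1; split; first by apply: le_trans a1 _; lra.
have := lerD a1 (ler_wpM2l (ler0n R 2) b1); move/le_trans; apply; lra.
Qed.

(** One more factor turns a bound s into 2 (e + 2 s), and 2 (1 + 2 (5^n - 1)) <= 5^(n+1) - 1. *)
Lemma gn_gprod_aux (e : R) s : 0 <= e -> e <= eta -> (size s <= 40)%N ->
  (forall u, u \in s -> gn u <= e) -> gn (gprod s) <= (5%:R ^+ size s - 1) * e.
Proof.
move=> e0 ee; elim: s => [|u s IH] /= h hs; first by rewrite gn0 expr0 subrr mul0r.
have {IH}IH := IH (ltnW h) (fun v vs => hs v (@mem_behead _ (u :: s) v vs)).
have ue : gn u <= e by apply: hs; rewrite mem_head.
have b40 := eta_bound (ltnW h); have p5 : 1 <= (5%:R : R) ^+ size s.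
  by apply: exprn_ege1; rewrite (ler_nat R 1 5).
have e1 : gn (gprod s) <= 1000%:R^-1.
  apply: le_trans IH _; apply: le_trans b40; rewrite mulrBl mul1r.
  by apply: le_trans (ler_wpM2l (le_trans ler01 p5) ee); rewrite gerBl.
have eta1 := eta_bound (n := 0) isT; rewrite expr0 mul1r in eta1.
have sm : small (gn u) (gn (gprod s)).
  by apply: tl_small; rewrite ?gn_ge0//; apply: le_trans eta1; apply: le_trans ue ee.
apply: le_trans (gn_bch lie sm) _.
rewrite exprS; nra.
Qed.

Lemma tlP s u : tl s -> u \in s -> gn u <= eta.
Proof. by move=> /andP[/allP h _] /h. Qed.

Lemma gn_gprod s : tl s -> gn (gprod s) <= 1000%:R^-1.
Proof.
move=> ts; have /andP[_ h] := ts.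
apply: le_trans (gn_gprod_aux (ltW eta_gt0) (lexx _) h (fun u => tlP ts)) _.
apply: le_trans (eta_bound h); rewrite mulrBl mul1r gerBl.
exact: ltW eta_gt0.
Qed.

Lemma tl_gn u s : tl (u :: s) -> gn u <= 1000%:R^-1.
Proof.
move=> /tl_cons[h _]; apply: le_trans h _.
by have := eta_bound (n := 0) isT; rewrite expr0 mul1r.
Qed.

Lemma gprod_cat s t : tl (s ++ t) -> gprod (s ++ t) = bch (gprod s) (gprod t).
Proof.
elim: s => [|u s IH] ts /=; first by rewrite (bch0x lie).
have [_ tst] := tl_cons ts; have [h1 h2] := tl_cat tst.
by rewrite IH// (bchA lie)// ?gn_gprod// (tl_gn ts).
Qed.

Lemma gprod1 u : gprod [:: u] = u. Proof. exact: bchx0. Qed.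

Lemma gprod_rep s1 a b s2 : gprod a = gprod b -> tl (s1 ++ a ++ s2) -> tl (s1 ++ b ++ s2) ->
  gprod (s1 ++ a ++ s2) = gprod (s1 ++ b ++ s2).
Proof.
move=> ab ta tb.
rewrite (gprod_cat ta) (gprod_cat tb).
have [_ {}ta] := tl_cat ta; have [_ {}tb] := tl_cat tb.
by rewrite (gprod_cat ta) (gprod_cat tb) ab.
Qed.

Lemma gprod_xN s1 u s2 : tl (s1 ++ [:: u; - u] ++ s2) ->
  gprod (s1 ++ [:: u; - u] ++ s2) = gprod (s1 ++ s2).
Proof.
move=> ta; have [h1 h2] := tl_cat ta; have [_ h3] := tl_cat h2.
have t12 : tl (s1 ++ s2).
  move: ta; rewrite /tl !all_cat !size_cat => /andP[/and3P[-> _ ->] /=].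
  by move=> ?; lia.
by rewrite (gprod_cat ta) (gprod_cat h2) /= bchx0// (bchxN lie) (bch0x lie) (gprod_cat t12).
Qed.

Lemma gprod_Nx s1 u s2 : tl (s1 ++ [:: - u; u] ++ s2) ->
  gprod (s1 ++ [:: - u; u] ++ s2) = gprod (s1 ++ s2).
Proof. by move=> h; have := @gprod_xN s1 (- u) s2; rewrite opprK; apply. Qed.

Lemma bch_inv_uniq x y : gn x <= 1000%:R^-1 -> gn y <= 1000%:R^-1 -> bch x y = 0 -> y = - x.
Proof.
move=> gx gy xy; have := bchA lie (x := - x) (y := x) (w := y).
by rewrite gnN (bchNx lie) (bch0x lie) xy (bchx0 lie); apply.
Qed.

Lemma gprod_rev s : tl (s ++ s) -> gprod (rev (map -%R s)) = - gprod s.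
Proof.
move=> ts; have [t1 _] := tl_cat ts.
have t2 : tl (rev (map -%R s)).
  move: t1; rewrite /tl all_rev all_map size_rev size_map.
  by under eq_all => u do rewrite -gnN.
have t12 : tl (s ++ rev (map -%R s)).
  move: ts; rewrite /tl !all_cat !size_cat size_rev size_map => /andP[/andP[-> _] ->].
  by rewrite andbT; move/andP: t2 => [].
apply: bch_inv_uniq; rewrite ?gn_gprod// -gprod_cat//.
elim/last_ind: s {ts t1 t2} t12 => [//|s u IH].
rewrite map_rcons rev_rcons -cats1 -catA => h.
rewrite [gprod _](gprod_xN h); apply: IH.
move: h; rewrite /tl !all_cat !size_cat /= => /andP[/andP[-> /and3P[_ _ ->]]] /=.
by move=> ?; lia.
Qed.

Lemma gprod_map (h : vectType R) (brh : h -> h -> h) (f : {linear g -> h}) s :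
  (forall u v, f (br u v) = brh (f u) (f v)) -> tl s ->
  f (gprod s) = foldr (Submission.bch brh) 0 (map f s).
Proof.
move=> fm; elim: s => [|u s IH] ts /=; first exact: linear0.
have [hu hs] := tl_cons ts; rewrite (bch_morph lie fm) ?IH//.
by apply: tl_small; rewrite ?gn_ge0 ?gn_gprod ?(tl_gn ts).
Qed.

End LocalGroup.

Section LinearBound.
Variables (R : realType) (g h : vectType R) (br : g -> g -> g) (brh : h -> h -> h).
Lemma linear_bound (f : {linear g -> h}) :
  exists2 c, 0 <= c & forall u, gn brh (f u) <= c * gn br u.
Proof.
exists (\sum_i gn brh (f (ei i))); first by apply: sumr_ge0 => i _; exact: gn_ge0.
move=> u; rewrite {1}(crd_ei u) linear_sum; apply: le_trans (gn_sum _ _ _ _) _.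
rewrite mulr_suml; apply: ler_sum => i _.
by rewrite linearZ gnZ mulrC ler_wpM2l ?gn_ge0// crd_gn.
Qed.
End LinearBound.

Arguments Submission.gprod : simpl never.
Arguments Submission.tb : simpl never.

(** * The local Moufang loop inside the local group with triality *)

Section LocalMoufang.
Variables (R : realType) (A : vectType R) (br : A -> A -> A).
Hypothesis mal : is_malcev br.
Let bil : is_algebra br. Proof. by case: mal. Qed.
Notation tri := (tri mal).
Notation tb := (@tb R A br mal).
Notation lie := (tb_lie mal).
Notation gn := (gn tb).
Notation bch := (bch tb).
Notation gprod := (gprod tb).
Notation tl := (tl tb).
Notation eta := (eta0 R).
Notation rho := (rho mal).
Notation sig := (sig mal).
Notation am := (am mal).
Notation ac := (ac mal).
Implicit Types (x y z w : A) (s t : seq tri).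

(** The three conjugate copies of x; locking keeps them as atoms in the words handled below. *)
Definition m1 x : tri := locked (am x).
Definition m2 x : tri := locked (rho (am x)).
Definition m3 x : tri := locked (rho (rho (am x))).
Definition nA x := gn (m1 x) + gn (m2 x) + gn (m3 x).
(** The product of the Moufang loop of a group with triality, x_3^-1 y_1 x_2^-1 read back in A; the
    opposite of an element is its group inverse. *)
Definition mulA x y : A := locked (ac (gprod [:: - m3 x; m1 y; - m2 x])).
Lemma m1E x : m1 x = am x. Proof. by rewrite /m1 -lock. Qed.
Lemma m2E x : m2 x = rho (am x). Proof. by rewrite /m2 -lock. Qed.
Lemma m3E x : m3 x = rho (rho (am x)). Proof. by rewrite /m3 -lock. Qed.
Lemma mulAE x y : mulA x y = ac (gprod [:: - m3 x; m1 y; - m2 x]). Proof. by rewrite /mulA -lock. Qed.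

Definition tA x := nA x <= eta.
Lemma tAP x : tA x -> [/\ gn (m1 x) <= eta, gn (m2 x) <= eta & gn (m3 x) <= eta].
Proof.
rewrite /tA /nA => h; have := gn_ge0 tb (m1 x); have := gn_ge0 tb (m2 x).
by have := gn_ge0 tb (m3 x); split; lra.
Qed.

Lemma gnN_le (u : tri) (e : R) : gn u <= e -> gn (- u) <= e.
Proof. by rewrite gnN. Qed.
Ltac tt := rewrite /Submission.tl /=; repeat (apply/andP; split);
  repeat lazymatch goal with |- is_true (Submission.gn _ (- _) <= _) => refine (gnN_le _) end;
  match goal with
  | H : is_true (Submission.gn _ ?u <= _) |- is_true (Submission.gn _ ?t <= _) => constr_eq u t; exact H
  | |- _ => exact isT
  end.
Ltac tiny := repeat match goal with H : is_true (tA _) |- _ =>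
   let h := fresh "h" in have h := tAP H; clear H; case: h => ? ? ? end.

Ltac rw h := rewrite h; [|solve [tiny; tt] ..].

Ltac lw h := refine (etrans (h _ _) _); [solve [tiny; tt]|solve [tiny; tt]|].
Ltac lw1 h := refine (etrans (h _) _); [solve [tiny; tt]|].

Lemma m1N x : m1 (- x) = - m1 x. Proof. by rewrite !m1E linearN. Qed.
Lemma m2N x : m2 (- x) = - m2 x. Proof. by rewrite !m2E !linearN. Qed.
Lemma m3N x : m3 (- x) = - m3 x. Proof. by rewrite !m3E !linearN. Qed.
Lemma nAN x : nA (- x) = nA x.
Proof. by rewrite /nA m1N m2N m3N !gnN. Qed.
Lemma nA_ge0 x : 0 <= nA x.
Proof. by rewrite !addr_ge0// gn_ge0. Qed.
Lemma tAN x : tA x -> tA (- x). Proof. by rewrite /tA nAN. Qed.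

Lemma bch_m12 x : bch (m1 x) (m2 x) = - m3 x.
Proof.
rewrite (bch_comm lie); last by rewrite m1E m2E; exact: rho_am_comm.
by apply/eqP; rewrite -addr_eq0 m1E m2E m3E; apply/eqP; exact: rho_am_sum.
Qed.
Lemma rho_m1 x : rho (m1 x) = m2 x. Proof. by rewrite m1E m2E. Qed.
Lemma rho_m2 x : rho (m2 x) = m3 x. Proof. by rewrite m2E m3E. Qed.
Lemma rho_m3 x : rho (m3 x) = m1 x. Proof. by rewrite m3E m1E; exact: rho3. Qed.
Lemma sig_m1 x : sig (m1 x) = - m1 x. Proof. by rewrite m1E; exact: sig_am. Qed.
Lemma sig_m2 x : sig (m2 x) = - m3 x.
Proof. by rewrite m2E m3E sig_rho sig_am !linearN. Qed.
Lemma sig_m3 x : sig (m3 x) = - m2 x.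
Proof. by rewrite -(sigK (m2 x)) sig_m2 linearN opprK. Qed.

Lemma msum x : m1 x + m2 x + m3 x = 0. Proof. by rewrite m1E m2E m3E; exact: rho_am_sum. Qed.

Lemma tb_m12 x : tb (m1 x) (m2 x) = 0. Proof. by rewrite m1E m2E rho_am_comm. Qed.
Lemma tb_m23 x : tb (m2 x) (m3 x) = 0.
Proof. by rewrite -rho_m1 -rho_m2 -rho_m1 -rho_hom rho_m1 tb_m12 linear0. Qed.
Lemma tb_m31 x : tb (m3 x) (m1 x) = 0.
Proof. by rewrite -rho_m3 -rho_m2 -rho_hom rho_m2 tb_m23 linear0. Qed.

Lemma bchN (u v p : tri) : u + v + p = 0 -> tb u v = 0 -> bch (- u) (- v) = p.
Proof.
move=> uvp uv; rewrite (bch_comm lie).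
  by rewrite -opprD; apply/esym/eqP; rewrite -addr_eq0 addrC uvp.
by rewrite (brNl (tb_bil mal)) (brNr (tb_bil mal)) uv !oppr0.
Qed.

Lemma bchN23 x : bch (- m2 x) (- m3 x) = m1 x.
Proof. by apply: bchN; rewrite ?tb_m23// addrC addrA msum. Qed.
Lemma bchN32 x : bch (- m3 x) (- m2 x) = m1 x.
Proof.
apply: bchN; last by rewrite tb_anti tb_m23 oppr0.
by rewrite addrC (addrC (m3 x)) addrA msum.
Qed.
Lemma bchN13 x : bch (- m1 x) (- m3 x) = m2 x.
Proof.
apply: bchN; last by rewrite tb_anti tb_m31 oppr0.
by rewrite addrAC msum.
Qed.

(** [sig] sends the word to its reversed word of inverses, that is to the inverse element; [acK]
    then places the product in the first copy of A. *)
Lemma mulA1 x y : tA x -> tA y -> m1 (mulA x y) = gprod [:: - m3 x; m1 y; - m2 x].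
Proof.
move=> tx ty; rewrite mulAE m1E; apply: acK.
have tl3 : tl [:: - m3 x; m1 y; - m2 x] by tiny; tt.
have tl6 : tl ([:: - m3 x; m1 y; - m2 x] ++ [:: - m3 x; m1 y; - m2 x]) by tiny; tt.
rewrite (gprod_map lie (@sig_hom _ _ _ mal) tl3) -(gprod_rev lie tl6).
by rewrite !map_cons (linearN sig) (linearN sig (m2 x)) sig_m3 sig_m1 sig_m2 /= !opprK.
Qed.

Lemma mulA2 x y : tA x -> tA y -> m2 (mulA x y) = gprod [:: - m1 x; m2 y; - m3 x].
Proof.
move=> tx ty; have tl3 : tl [:: - m3 x; m1 y; - m2 x] by tiny; tt.
rewrite -rho_m1 mulA1// (gprod_map lie (@rho_hom _ _ _ mal) tl3).
by rewrite !map_cons !(linearN rho) rho_m1 rho_m2 rho_m3.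
Qed.

Lemma mulA3 x y : tA x -> tA y -> m3 (mulA x y) = gprod [:: - m2 x; m3 y; - m1 x].
Proof.
move=> tx ty; have tl3 : tl [:: - m1 x; m2 y; - m3 x] by tiny; tt.
rewrite -rho_m2 mulA2// (gprod_map lie (@rho_hom _ _ _ mal) tl3).
by rewrite !map_cons !(linearN rho) rho_m1 rho_m2 rho_m3.
Qed.

Lemma gprod_pair (u v p : tri) s t : bch u v = p -> tl (s ++ [:: u; v] ++ t) -> tl (s ++ [:: p] ++ t) ->
  gprod (s ++ [:: u; v] ++ t) = gprod (s ++ [:: p] ++ t).
Proof. by move=> h; apply: (gprod_rep lie); rewrite /Submission.gprod /= !(bchx0 lie). Qed.

(* The elements p, rho p, rho^2 p of the local group commute and have sum 0;
   their product is 0. *)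
Lemma gprodQ x y : tA x -> tA y ->
  gprod [:: - m1 x; m2 y; m1 x; m3 y; m2 x; m1 y; - m2 x] = 0.
Proof.
move=> tx ty.
have e1 : tl [:: - m1 x; m2 y; - m3 x] by tiny; tt.
have e2 : tl [:: - m2 x; m3 y; - m1 x] by tiny; tt.
have -> : gprod [:: - m1 x; m2 y; m1 x; m3 y; m2 x; m1 y; - m2 x] =
  gprod ([:: - m1 x; m2 y; - m3 x] ++ [:: - m2 x; m3 y; - m1 x] ++ [:: - m3 x; m1 y; - m2 x]).
  have h1 := @gprod_pair _ _ _ [:: - m1 x; m2 y] [:: m3 y; - m1 x; - m3 x; m1 y; - m2 x] (bchN32 x).
  have h2 := @gprod_pair _ _ _ [:: - m1 x; m2 y; m1 x; m3 y] [:: m1 y; - m2 x] (bchN13 x).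
  rewrite /= in h1 h2 *; rw h1; rw h2; reflexivity.
rewrite (gprod_cat lie); last by tiny; tt.
rewrite (gprod_cat lie (s := [:: - m2 x; _; _])); last by tiny; tt.
rewrite -mulA2// -mulA3// -mulA1//.
set p := mulA x y.
have -> : bch (m3 p) (m1 p) = - m2 p.
  rewrite (bch_comm lie) ?tb_m31//; apply/eqP; rewrite -addr_eq0; apply/eqP.
  by rewrite (addrC (m3 p)) addrAC msum.
exact: (bchxN lie).
Qed.

(** The second formula for the product, in which x and y exchange roles. It is [gprodQ] at x and -y,
    inserted as a trivial factor between cancelling pairs. *)
Lemma mulF2 x y : tA x -> tA y ->
  gprod [:: - m3 x; m1 y; - m2 x] = gprod [:: - m2 y; m1 x; - m3 y].
Proof.
move=> tx ty; have tNy := tAN ty.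
have Q := gprodQ tx tNy; rewrite m1N m2N m3N in Q.
(* The middle block is the relation [Q]; the outer factors cancel against it to leave the left side,
   and without it they multiply to the desired word. *)
have -> : gprod [:: - m2 y; m1 x; - m3 y] =
  gprod ([:: m1 x] ++ [:: - m1 x; - m2 y; m1 x; - m3 y; m2 x; - m1 y; - m2 x] ++ [:: m2 x; m1 y; - m2 x]).
  have h1 := @gprod_xN _ _ _ lie [::] (m1 x) [:: - m2 y; m1 x; - m3 y; m2 x; - m1 y; - m2 x; m2 x; m1 y; - m2 x].
  have h2 := @gprod_Nx _ _ _ lie [:: - m2 y; m1 x; - m3 y; m2 x; - m1 y] (m2 x) [:: m1 y; - m2 x].
  have h3 := @gprod_Nx _ _ _ lie [:: - m2 y; m1 x; - m3 y; m2 x] (m1 y) [:: - m2 x].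
  have h4 := @gprod_xN _ _ _ lie [:: - m2 y; m1 x; - m3 y] (m2 x) [::].
  rewrite /= in h1 h2 h3 h4 *; rw h1; rw h2; rw h3; rw h4; reflexivity.
rewrite (gprod_rep lie (s1 := [:: m1 x]) (b := [::]) (s2 := [:: m2 x; m1 y; - m2 x]) Q); last 2 first.
- by tiny; tt.
- by tiny; tt.
have h := @gprod_pair _ _ (- m3 x) [::] [:: m1 y; - m2 x] (bch_m12 x).
by rewrite /= in h; rw h.
Qed.

Lemma m1_inj : injective m1. Proof. by move=> x y; rewrite !m1E; exact: can_inj (@amK R A br mal) x y. Qed.
Lemma m1_0 : m1 0 = 0. Proof. by rewrite m1E linear0. Qed.
Lemma m2_0 : m2 0 = 0. Proof. by rewrite m2E !linear0. Qed.
Lemma m3_0 : m3 0 = 0. Proof. by rewrite m3E !linear0. Qed.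
Lemma nA0 : nA 0 = 0.
Proof. by rewrite /nA m1_0 m2_0 m3_0 gn0 !addr0. Qed.
Lemma tA0 : tA 0. Proof. by rewrite /tA nA0 (ltW (eta_gt0 R)). Qed.

Lemma mul0A y : tA y -> mulA 0 y = y.
Proof.
move=> ty; apply: m1_inj; rewrite (mulA1 tA0 ty) m3_0 m2_0 oppr0.
by rewrite /Submission.gprod /= (bch0x lie) !(bchx0 lie).
Qed.

Lemma mulA0 x : tA x -> mulA x 0 = x.
Proof.
move=> tx; apply: m1_inj; rewrite (mulA1 tx tA0) (mulF2 tx tA0) m3_0 m2_0 oppr0.
by rewrite /Submission.gprod /= (bch0x lie) !(bchx0 lie).
Qed.

Lemma mulAF x y : tA x -> tA y ->
  [/\ m1 (mulA x y) = gprod [:: - m2 y; m1 x; - m3 y],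
      m2 (mulA x y) = gprod [:: - m3 y; m2 x; - m1 y] &
      m3 (mulA x y) = gprod [:: - m1 y; m3 x; - m2 y]].
Proof.
move=> tx ty.
have rm (u v w : tri) : tl [:: - u; v; - w] -> rho (gprod [:: - u; v; - w]) = gprod [:: - rho u; rho v; - rho w].
  by move=> tl3; rewrite (gprod_map lie (@rho_hom _ _ _ mal) tl3) !map_cons !(linearN rho).
have h1 := mulA1 tx ty; rewrite (mulF2 tx ty) in h1.
have h2 : m2 (mulA x y) = gprod [:: - m3 y; m2 x; - m1 y].
  by rewrite -rho_m1 h1 rm ?rho_m1 ?rho_m2 ?rho_m3; [reflexivity|tiny; tt].
split; [exact: h1|exact: h2|].
by rewrite -rho_m2 h2 rm ?rho_m1 ?rho_m2 ?rho_m3; [reflexivity|tiny; tt].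
Qed.

Lemma gprod_sub s1 (p : tri) s s2 : p = gprod s -> tl (s1 ++ [:: p] ++ s2) -> tl (s1 ++ s ++ s2) ->
  gprod (s1 ++ [:: p] ++ s2) = gprod (s1 ++ s ++ s2).
Proof. by move=> ps; apply: (gprod_rep lie); rewrite (gprod1 lie). Qed.

(** The inverse property: multiplication by -x wraps y between m3 x and m2 x, and multiplication by
    x cancels both. *)
Lemma mulAK x y : tA x -> tA y -> tA (mulA (- x) y) -> mulA x (mulA (- x) y) = y.
Proof.
move=> tx ty txy; apply: m1_inj; rewrite (mulA1 tx txy).
have := mulA1 (tAN tx) ty; rewrite m3N m2N !opprK => h.
have h1 := @gprod_sub [:: - m3 x] _ _ [:: - m2 x] h.
have h2 := @gprod_Nx _ _ _ lie [::] (m3 x) [:: m1 y; m2 x; - m2 x].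
have h3 := @gprod_xN _ _ _ lie [:: m1 y] (m2 x) [::].
by rewrite /= in h1 h2 h3 *; rw h1; rw h2; rw h3; exact: (gprod1 lie).
Qed.

Lemma mulKA x y : tA x -> tA y -> tA (mulA y (- x)) -> mulA (mulA y (- x)) x = y.
Proof.
move=> tx ty txy; apply: m1_inj; have [-> _ _] := mulAF txy tx.
have [h _ _] := mulAF ty (tAN tx); rewrite m3N m2N !opprK in h.
have h1 := @gprod_sub [:: - m2 x] _ _ [:: - m3 x] h.
have h2 := @gprod_Nx _ _ _ lie [::] (m2 x) [:: m1 y; m3 x; - m3 x].
have h3 := @gprod_xN _ _ _ lie [:: m1 y] (m3 x) [::].
by rewrite /= in h1 h2 h3 *; rw h1; rw h2; rw h3; exact: (gprod1 lie).
Qed.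

Lemma tl_rev s : tl s -> tl (rev (map -%R s)).
Proof.
rewrite /Submission.tl all_rev all_map size_rev size_map.
by under eq_all => u do rewrite -(gnN tb).
Qed.

Lemma gprod_opp (u v w s : tri) : tl ([:: - u; v; - w] ++ [:: - u; v; - w]) ->
  s = gprod [:: - u; v; - w] -> - s = gprod [:: w; - v; u].
Proof.
move=> h ->; rewrite -(gprod_rev lie h).
rewrite [map _ _]/= [rev _]/=.
rewrite (opprK u).
rewrite (opprK w).
reflexivity.
Qed.

(** Both sides are rewritten as words in the local group by the two formulas for the product and
    reduce to one common word. *)
Lemma moufangA x y z : tA x -> tA y -> tA z -> tA (mulA x y) -> tA (mulA z x) ->
  tA (mulA y z) -> tA (mulA x (mulA y z)) ->
  mulA (mulA x y) (mulA z x) = mulA (mulA x (mulA y z)) x.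
Proof.
move=> tx ty tz txy tzx tyz txyz; apply: m1_inj.
have [p1 p2 p3] := mulAF tx ty; have q1 := mulA1 tz tx; rewrite (mulF2 tz tx) in q1.
apply: etrans (mulA1 txy tzx) _; have [r1 _ _] := mulAF txyz tx.
apply: etrans _ (esym r1) => {r1}.
have u1 := mulA1 ty tz; have v1 := mulA1 tx tyz.
have e3 : - m3 (mulA x y) = gprod [:: m2 y; - m3 x; m1 y].
  by apply: (gprod_opp _ p3); tiny; tt.
have e2 : - m2 (mulA x y) = gprod [:: m1 y; - m2 x; m3 y].
  by apply: (gprod_opp _ p2); tiny; tt.
have F := mulF2 tx ty.
have h1 := @gprod_sub [::] _ _ [:: m1 (mulA z x); - m2 (mulA x y)] e3.
have h2 := @gprod_sub [:: m2 y; - m3 x; m1 y] _ _ [:: - m2 (mulA x y)] q1.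
have h3 := @gprod_sub [:: m2 y; - m3 x; m1 y; - m2 x; m1 z; - m3 x] _ _ [::] e2.
have h4 := @gprod_rep _ _ _ lie [:: m2 y] _ _ [:: m1 z; - m3 x; m1 y; - m2 x; m3 y] F.
have h5 := @gprod_rep _ _ _ lie [:: m2 y; - m2 y; m1 x; - m3 y; m1 z] _ _ [:: m3 y] F.
have h6 := @gprod_xN _ _ _ lie [::] (m2 y) [:: m1 x; - m3 y; m1 z; - m2 y; m1 x; - m3 y; m3 y].
have h7 := @gprod_Nx _ _ _ lie [:: m1 x; - m3 y; m1 z; - m2 y; m1 x] (m3 y) [::].
rewrite /= in h1 h2 h3 h4 h5 h6 h7.
(* The common reduced word: [mulF2] used twice brings the left side to it, and x_2^-1 x_3^-1 = x_1
   the right side. *)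
pose mid := gprod [:: m1 x; - m3 y; m1 z; - m2 y; m1 x].
apply: (@etrans _ _ mid).
  lw h1; lw h2; lw h3; lw h4; lw h5; lw1 h6; lw1 h7; reflexivity.
have k1 := @gprod_sub [:: - m2 x] _ _ [:: - m3 x] v1.
have k2 := @gprod_sub [:: - m2 x; - m3 x] _ _ [:: - m2 x; - m3 x] u1.
have k3 := @gprod_pair _ _ _ [::] [:: - m3 y; m1 z; - m2 y; - m2 x; - m3 x] (bchN23 x).
have k4 := @gprod_pair _ _ _ [:: m1 x; - m3 y; m1 z; - m2 y] [::] (bchN23 x).
rewrite /= in k1 k2 k3 k4.
apply: esym; lw k1; lw k2; lw k3; lw k4; reflexivity.
Qed.

(** A word of three factors grows by at most 5^3 - 1 = 124, and [nA] adds up three such words. *)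
Lemma nA_mul x y : tA x -> tA y -> nA (mulA x y) <= 372%:R * (nA x + nA y).
Proof.
move=> tx ty; pose e := Num.max (nA x) (nA y).
have e0 : 0 <= e by rewrite le_max nA_ge0.
have ee : e <= eta by rewrite ge_max; apply/andP.
have nx : nA x <= e by rewrite le_max lexx.
have ny : nA y <= e by rewrite le_max lexx orbT.
have comp u : [/\ gn (m1 u) <= nA u, gn (m2 u) <= nA u & gn (m3 u) <= nA u].
  rewrite /nA; have := gn_ge0 tb (m1 u); have := gn_ge0 tb (m2 u).
  by have := gn_ge0 tb (m3 u); split; lra.
have [x1 x2 x3] := comp x; have [y1 y2 y3] := comp y.
have B (u v w : tri) : gn u <= e -> gn v <= e -> gn w <= e ->
    gn (gprod [:: - u; v; - w]) <= 124%:R * e.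
  move=> hu hv hw; have := @gn_gprod_aux R _ _ lie e [:: - u; v; - w] e0 ee isT.
  have -> : (5%:R ^+ size [:: - u; v; - w] - 1 : R) = 124%:R by rewrite /=; lra.
  by apply=> p; rewrite !inE => /or3P[] /eqP ->; rewrite ?gnN.
have em : e <= nA x + nA y.
  by rewrite ge_max lerDl lerDr !nA_ge0.
have b1 : gn (m1 (mulA x y)) <= 124%:R * e.
  by rewrite mulA1//; apply: B; [apply: le_trans nx|apply: le_trans ny|apply: le_trans nx].
have b2 : gn (m2 (mulA x y)) <= 124%:R * e.
  by rewrite mulA2//; apply: B; [apply: le_trans nx|apply: le_trans ny|apply: le_trans nx].
have b3 : gn (m3 (mulA x y)) <= 124%:R * e.
  by rewrite mulA3//; apply: B; [apply: le_trans nx|apply: le_trans ny|apply: le_trans nx].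
rewrite {1}/nA; lra.
Qed.
End LocalMoufang.

(** * Euclidean space as an analytic manifold with one chart *)

Section EuclideanManifold.
Variables (R : realType) (n : nat).

Lemma rV_second_countable : @second_countable 'rV[R]_n.
Proof.
pose B (p : 'rV[rat]_n * nat) : set 'rV[R]_n := ball (map_mx ratr p.1 : 'rV[R]_n) (p.2.+1%:R^-1 : R).
exists (range B); first exact: card_le_trans (card_image_le _ _) (countableP _).
split=> [_ [p _ <-]|x U]; first exact: ball_open.
move=> /nbhs_ballP[e /= e0 xU].
have e20 : 0 < e / 2 by rewrite divr_gt0.
pose k := Num.truncn (e / 2)^-1; pose c : R := k.+1%:R^-1.
have ke : c < e / 2.
  rewrite /c -[ltRHS]invrK ltf_pV2 ?posrE ?invr_gt0//.
  by rewrite truncnS_gt.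
have k0 : 0 < c by rewrite invr_gt0.
have qex j : exists q : rat, x 0 j - c < ratr q < x 0 j + c.
  have h : x 0 j - c < x 0 j + c by lra.
  by have [q] := rat_in_itvoo h; rewrite in_itv /=; exists q.
pose q : 'rV[rat]_n := \row_j projT1 (cid (qex j)).
have qx : `|map_mx ratr q - x| < c.
  apply/rv_norm_lt => // j; rewrite !mxE; case: cid => r /= /andP[h1 h2].
  by rewrite ltr_norml; apply/andP; split; lra.
exists (B (q, k)); last first.
  move=> y; rewrite /B -ball_normE /= -/c => yq; apply: xU; rewrite -ball_normE /=.
  have -> : x - y = - (map_mx ratr q - x) + (map_mx ratr q - y).
    by rewrite opprB addrA subrK.
  apply: le_lt_trans (ler_normD _ _) _; rewrite normrN; lra.
by split; [exists (q, k)|rewrite /B -ball_normE].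
Qed.

Definition id_chart : chart R 'rV[R]_n n.
refine (@Chart R 'rV[R]_n n setT setT id id openT openT _ _ _ _ _ _) => //.
- by move=> x _; exact: cvg_id.
- by move=> x _; exact: cvg_id.
Defined.

Lemma id_analytic a : analytic_at (@id 'rV[R]_n) a.
Proof.
apply: (@Hs_analytic _ _ _ _ _ 1) => // j; exists (`|a 0 j| + 1).
apply: (Hs_ext (f := fun v => a 0 j + v j)) => [v _|]; first by rewrite !mxE.
apply: (HsD ler01); [exact: (Hs_const _ ler01 (a 0 j))|exact: (Hs_var ler01 j)].
Qed.

Lemma id_transition : @analytic_transition R 'rV[R]_n n id_chart id_chart.
Proof. by move=> x _ _; exact: id_analytic. Qed.

Definition rV_manifold : manifold R n.
refine (@Manifold R n 'rV[R]_n (@norm_hausdorff _ _) rV_second_countable [set id_chart] _ _).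
- by move=> x; exists id_chart.
- by move=> c d -> ->; exact: id_transition.
Defined.
End EuclideanManifold.

(** * Analyticity of the loop operations *)

Section AnalyticBch.
Variables (R : realType) (g : vectType R) (br : g -> g -> g).
Hypothesis lie : is_lie br.
Notation bch := (bch br).
Notation NH := (NH br).
Notation d := (dim g).

Lemma NH_linear m (L : {linear 'rV[R]_m -> g}) : exists2 M, 0 <= M &
  forall (c : 'rV[R]_m) r, 0 <= r ->
    NH r (fun v : 'I_m -> R => L (c + \row_i v i)) (M * (`|c| + r)).
Proof.
pose l i j := crd i (L (delta_mx 0 j)).
exists (C0 br * \sum_(i < d) \sum_(j < m) `|l i j|).
  by rewrite mulr_ge0 ?C0_ge0//; apply: sumr_ge0 => i _; apply: sumr_ge0.
move=> c r r0; exists (fun i => \sum_j `|l i j| * (`|c 0 j| + r)); split=> [i|].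
  apply: (Hs_ext (f := fun v => \sum_j l i j * (c 0 j + v j))) => [v _|].
    rewrite [c + _]row_sum_delta linear_sum crd_sum; apply: eq_bigr => j _.
    by rewrite linearZ crdZ !mxE mulrC.
  apply: (Hs_bigsum r0) => j _; apply: (HsZ r0); apply: (HsD r0).
    exact: (Hs_const _ r0).
  exact: (Hs_var r0).
rewrite -mulrA ler_wpM2l ?C0_ge0// mulr_suml; apply: ler_sum => i _.
rewrite mulr_suml; apply: ler_sum => j _; rewrite ler_wpM2l// lerD2r.
exact: rv_coord_le.
Qed.

Lemma NH_bch : exists2 M, 0 <= M & forall (X : finType) r (f h : (X -> R) -> g) a b,
  0 <= r -> NH r f a -> NH r h b -> small a b ->
  NH r (fun v => bch (f v) (h v)) (M * (a + 2 * b)).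
Proof.
exists (C0 br * (2 *+ d)); first by rewrite mulr_ge0 ?C0_ge0// mulrn_wge0.
move=> X r f h a b r0 fa hb s.
have -> : C0 br * (2 *+ d) * (a + 2 * b) = C0 br * ((2 * (a + 2 * b)) *+ d).
  by rewrite -mulrA mulrnAl.
apply: NH_of => i; exact: (Hs_bch lie r0 i fa hb s).
Qed.

Lemma NH_lin_coord (h : vectType R) (f : {linear g -> h}) (X : finType) r (F : (X -> R) -> g) K i :
  0 <= r -> NH r F K -> exists K', Hs r (fun v => crd i (f (F v))) K'.
Proof.
move=> r0 FK; exists (\sum_j `|crd i (f (ei j))| * K).
apply: (Hs_ext (f := fun v => \sum_j crd i (f (ei j)) * crd j (F v))) => [v _|].
  rewrite [in RHS](crd_ei (F v)) linear_sum crd_sum; apply: eq_bigr => j _.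
  by rewrite linearZ crdZ mulrC.
by apply: (Hs_bigsum r0) => j _; apply: (HsZ r0); exact: NH_crd FK.
Qed.
End AnalyticBch.

Section AnalyticMoufang.
Variables (R : realType) (A : vectType R) (br : A -> A -> A).
Hypothesis mal : is_malcev br.
Notation tri := (tri mal).
Notation tb := (@tb R A br mal).
Notation lie := (tb_lie mal).
Notation mulA := (mulA mal).

Lemma mulA_analytic m (P Q : {linear 'rV[R]_m -> A}) : exists2 e, 0 < e &
  forall c, `|c| <= e -> analytic_at (fun v => v2r (mulA (P v) (Q v))) c.
Proof.
pose L1 : {linear 'rV[R]_m -> tri} := - (rho mal \o rho mal \o am mal \o P).
pose L2 : {linear 'rV[R]_m -> tri} := am mal \o Q.
pose L3 : {linear 'rV[R]_m -> tri} := - (rho mal \o am mal \o P).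
have [M1 M10 H1] := NH_linear tb L1; have [M2 M20 H2] := NH_linear tb L2.
have [M3 M30 H3] := NH_linear tb L3; have [M M0 HM] := NH_bch lie.
pose S := M1 + M2 + M3 + M * (M2 + 2 * M3) + 1.
have MM : 0 <= M * (M2 + 2 * M3) by rewrite mulr_ge0// addr_ge0// mulr_ge0.
have S0 : 0 < S by rewrite /S; lra.
(* For |c| <= e and polydisc radius e, the three linear arguments and the inner product are bounded
   by 2 e S = 1/50, small enough for both BCH products. *)
pose e := (100%:R * S)^-1.
have e0 : 0 < e by rewrite invr_gt0 mulr_gt0.
exists e => // c ce; apply: (Hs_analytic e0) => j.
have K M' : 0 <= M' -> M' <= S -> M' * (`|c| + e) <= 50%:R^-1.
  move=> M'0 M'S; have : M' * (`|c| + e) <= S * (e + e).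
    by apply: ler_pM => //; rewrite ?addr_ge0// ?(ltW e0)// lerD2r.
  have -> : S * (e + e) = 50%:R^-1.
    by rewrite /e; field; rewrite gt_eqF.
  by [].
set N := `|c| + e in K; have N0 : 0 <= N by rewrite addr_ge0// ltW.
have h23 := HM _ _ _ _ _ _ (ltW e0) (H2 c _ (ltW e0)) (H3 c _ (ltW e0)).
have k2 := K M2 M20; have k3 := K M3 M30; have k1 := K M1 M10.
have kM := K (M * (M2 + 2 * M3)) MM.
have {}k2 : M2 * N <= 50%:R^-1 by apply: k2; rewrite /S; lra.
have {}k3 : M3 * N <= 50%:R^-1 by apply: k3; rewrite /S; lra.
have {}k1 : M1 * N <= 50%:R^-1 by apply: k1; rewrite /S; lra.
have {}kM : M * (M2 * N + 2 * (M3 * N)) <= 50%:R^-1.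
  have -> : M * (M2 * N + 2 * (M3 * N)) = M * (M2 + 2 * M3) * N by ring.
  by apply: kM; rewrite /S; lra.
have s23 : small (M2 * N) (M3 * N) by split; lra.
have s123 : small (M1 * N) (M * (M2 * N + 2 * (M3 * N))) by split; lra.
have {}h23 := h23 s23.
have h123 := HM _ _ _ _ _ _ (ltW e0) (H1 c _ (ltW e0)) h23 s123.
have [K' hK] := NH_lin_coord (ac mal) j (ltW e0) h123.
exists K'; apply: Hs_ext hK => v _; rewrite mulAE /crd /Submission.gprod [foldr _ _ _]/=.
by rewrite (bchx0 lie) m1E m2E m3E.
Qed.
End AnalyticMoufang.

(** * Second-order expansion of the loop product *)

Section TripleProduct.
Variables (R : realType) (g : vectType R) (br : g -> g -> g).
Hypothesis lie : is_lie br.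
Let bil : is_algebra br. Proof. by case: lie. Qed.
Notation gn := (gn br).
Notation bch := (bch br).

(** [bch_second_order] is used twice: the inner product is at most 6s, so the outer error is at most
    128 (13 s)^3 and the inner one 128 (3 s)^3; the cubic rest of the bracket adds 2 s^3. *)
Lemma bch3_second_order (s : R) u v w : gn u <= s -> gn v <= s -> gn w <= s ->
  s <= 1000%:R^-1 ->
  gn (bch u (bch v w) - (u + v + w + 2^-1 *: (br v w + br u v + br u w))) <= 1000%:R * 300%:R * s ^+ 3.
Proof.
move=> us vs ws s1.
have gu := gn_ge0 br u; have gv := gn_ge0 br v; have gw := gn_ge0 br w.
have s0 : 0 <= s by exact: le_trans us.
set q := bch v w.
have qs : gn q <= 6%:R * s.
  have sm : small (gn v) (gn w) by split; lra.
  by have := gn_bch lie sm; rewrite -/q; lra.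
have gq := gn_ge0 br q.
have E1 : gn (q - (v + w + 2^-1 *: br v w)) <= 128%:R * 27%:R * s ^+ 3.
  have h : gn v + 2 * gn w <= 8^-1 by lra.
  apply: le_trans (bch_second_order lie h) _.
  have : (gn v + 2 * gn w) ^+ 3 <= (3%:R * s) ^+ 3.
    by apply: lerXn2r; rewrite ?nnegrE; lra.
  have -> : (3%:R * s) ^+ 3 = 27%:R * s ^+ 3 by ring.
  by lra.
have E2 : gn (bch u q - (u + q + 2^-1 *: br u q)) <= 128%:R * 2197%:R * s ^+ 3.
  have h : gn u + 2 * gn q <= 8^-1 by lra.
  apply: le_trans (bch_second_order lie h) _.
  have : (gn u + 2 * gn q) ^+ 3 <= (13%:R * s) ^+ 3.
    by apply: lerXn2r; rewrite ?nnegrE; lra.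
  have -> : (13%:R * s) ^+ 3 = 2197%:R * s ^+ 3 by ring.
  by lra.
set e1 := q - _ in E1; set e2 := bch u q - _ in E2.
have -> : bch u q - (u + v + w + 2^-1 *: (br v w + br u v + br u w)) =
    e2 + e1 + 2^-1 *: br u (2^-1 *: br v w + e1).
  have -> : br u (2^-1 *: br v w + e1) = br u q - br u v - br u w.
    rewrite -(brNr bil) -(brDr bil) -(brNr bil) -(brDr bil); congr br.
    by rewrite /e1; lmod_over R g.
  by rewrite /e1 /e2; lmod_over R g.
have s3 : 0 <= s ^+ 3 by apply: exprn_ge0.
have B1 : gn (br v w) <= s ^+ 2.
  by apply: le_trans (gn_br lie _ _) _; rewrite expr2; apply: ler_pM.
have B2 : gn (2^-1 *: br v w + e1) <= 4%:R * s ^+ 2.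
  apply: le_trans (gnD _ _ _) _; rewrite gnZ ger0_norm ?invr_ge0//.
  have : s ^+ 3 <= 1000%:R^-1 * s ^+ 2 by rewrite exprS ler_wpM2r// exprn_ge0.
  have := exprn_ge0 2 s0; lra.
have B3 : gn (br u (2^-1 *: br v w + e1)) <= 4%:R * s ^+ 3.
  apply: le_trans (gn_br lie _ _) _.
  apply: le_trans (ler_pM gu (gn_ge0 _ _) us B2) _.
  by rewrite [s ^+ 3]exprS; lra.
apply: le_trans (gnD _ _ _) _; rewrite gnZ ger0_norm ?invr_ge0//.
have := gnD br e2 e1; lra.
Qed.
End TripleProduct.

Section LoopOfMalcev.
Variables (R : realType) (A : vectType R) (br : A -> A -> A).
Hypothesis mal : is_malcev br.
Let bil : is_algebra br. Proof. by case: mal. Qed.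
Notation tri := (tri mal).
Notation tb := (@tb R A br mal).
Notation lie := (tb_lie mal).
Notation mulA := (mulA mal).
Notation nA := (nA mal).
Notation n := (dim A).

(** The linear part is y_1 - x_2 - x_3 = (x + y)_1. As x_2 and x_3 commute, the brackets combine to
    [y_1, x_3 - x_2] with x_3 - x_2 = - x_+, whose A_- component is [x,y]. *)
Lemma ac_second (x y : A) (u := - m3 mal x) (v := m1 mal y) (w := - m2 mal x) :
  ac mal (u + v + w + 2^-1 *: (tb v w + tb u v + tb u w)) = x + y + 2^-1 *: br x y.
Proof.
have b := tb_bil mal.
have -> : u + v + w = am mal (x + y).
  rewrite /u /v /w linearD -!m1E.
  have -> : m1 mal x = - (m2 mal x + m3 mal x).
    by apply/eqP; rewrite -addr_eq0 addrA msum.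
  by rewrite opprD addrAC addrC [- m3 _ _ - _]addrC addrC.
have -> : tb v w + tb u v + tb u w = tb (am mal y) (rho mal (rho mal (am mal x)) - rho mal (am mal x)).
  rewrite /u /v /w -m2E rho_m2 -m1E.
  rewrite (brNl b) [X in _ + X](brNl b) (brNr b (m3 mal x)) opprK.
  rewrite (tb_anti (m3 mal x) (m2 mal x)) tb_m23 oppr0 addr0.
  by rewrite (tb_anti (m3 mal x)) opprK (brNr b) (brDr b) (brNr b) addrC.
have -> : rho mal (rho mal (am mal x)) - rho mal (am mal x) = (0, (- x, 0)).
  have dB (U V : tri) z : der_of (U - V) z = der_of U z - der_of V z.
    by rewrite -scaleN1r addrC der_lin scaleN1r addrC.
  apply: tri_eq => [z||].
  - by rewrite dB !der_rho subrr der_of0.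
  - by rewrite /=; lmod_over R A.
  - by rewrite /=; lmod_over R A.
have acE (X : tri) : ac mal X = X.2.2 by [].
rewrite linearD linearZZ amK acE tb_a !der_of0 /=. congr (_ + _ *: _).
by rewrite (br0l bil) (brNl bil) subr0 !add0r opprK.
Qed.
End LoopOfMalcev.

(** * The local analytic loop of a Malcev algebra and its tangent algebra *)

Section LoopOfMalcev.
Variables (R : realType) (A : vectType R) (br : A -> A -> A).
Hypothesis mal : is_malcev br.
Let bil : is_algebra br. Proof. by case: mal. Qed.
Notation tri := (tri mal).
Notation tb := (@tb R A br mal).
Notation lie := (tb_lie mal).
Notation mulA := (mulA mal).
Notation nA := (nA mal).
Notation n := (dim A).

(** The inverse of a is -a, so by the inverse property the divisions are products with -a. *)
Definition opsA : loop_ops A :=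
  LoopOps mulA (fun a b => mulA (- a) b) (fun b a => mulA b (- a)) 0.

Definition opsV : loop_ops 'rV[R]_n :=
  LoopOps (fun x y => v2r (mulA (r2v x) (r2v y)))
    (fun a b => v2r (mulA (- r2v a) (r2v b)))
    (fun b a => v2r (mulA (r2v b) (- r2v a))) 0.

Lemma eval_ops rho w : eval opsV rho w = v2r (eval opsA (r2v \o rho) w).
Proof.
elim: w => [i||u IHu v IHv|u IHu v IHv|u IHu v IHv].
- by rewrite /= r2vK.
- by rewrite /= linear0.
- by rewrite [LHS]/= IHu IHv !v2rK.
- by rewrite [LHS]/= IHu IHv !v2rK.
- by rewrite [LHS]/= IHu IHv !v2rK.
Qed.

Definition rvL : {linear 'rV[R]_n -> A} := r2v.

Lemma linear_norm_bound (g : vectType R) (brg : g -> g -> g) m (L : {linear 'rV[R]_m -> g}) :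
  exists2 M, 0 <= M & forall x, gn brg (L x) <= M * `|x|.
Proof.
have [M M0 HM] := NH_linear brg L; exists M => // x.
have := @NH_gn R g brg 'I_m 0 (lexx _) _ _ (fun=> 0) (HM x 0 (lexx _)).
have -> : x + \row_i 0 = x by apply/rowP => i; rewrite !mxE addr0.
by rewrite addr0; apply => j; rewrite normr0.
Qed.

Lemma nA_bound : exists2 M, 0 <= M & forall x : 'rV[R]_n, nA (r2v x) <= M * `|x|.
Proof.
have [a a0 ha] := linear_norm_bound tb (am mal \o rvL).
have [b b0 hb] := linear_norm_bound tb (rho mal \o am mal \o rvL).
have [c c0 hc] := linear_norm_bound tb (rho mal \o rho mal \o am mal \o rvL).
exists (a + b + c) => [|x]; first by rewrite !addr_ge0.
rewrite /Submission.nA m1E m2E m3E.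
by have /= := ha x; have /= := hb x; have /= := hc x; lra.
Qed.

Lemma near_nA (e : R) : 0 < e -> exists2 U : set 'rV[R]_n, nbhs (0 : 'rV[R]_n) U & forall x, U x -> nA (r2v x) <= e.
Proof.
move=> e0; have [M M0 HM] := nA_bound.
have d0 : 0 < e / (M + 1) by rewrite divr_gt0// ltr_pwDr.
exists (ball (0 : 'rV[R]_n) (e / (M + 1))); first exact: nbhsx_ballx.
move=> x; rewrite -ball_normE /= sub0r normrN => xe; apply: le_trans (HM x) _.
apply: (@le_trans _ _ ((M + 1) * `|x|)); first by rewrite ler_wpM2r// lerDl.
by rewrite mulrC -ler_pdivlMr ?ltr_pwDr// ltW.
Qed.

(** Each word grows linearly in the size of its arguments, as long as the bound itself stays within
    the domain [eta0 R] of the product. *)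
Lemma nA_eval w : exists2 C, 1 <= C & forall (e : R) rho, C * e <= eta0 R ->
  (forall i, nA (rho i) <= e) -> nA (eval opsA rho w) <= C * e.
Proof.
have step op u v : (forall x y, tA mal x -> tA mal y -> nA (op x y) <= 372%:R * (nA x + nA y)) ->
  (exists2 C, 1 <= C & forall (e : R) rho, C * e <= eta0 R ->
    (forall i, nA (rho i) <= e) -> nA (eval opsA rho u) <= C * e) ->
  (exists2 C, 1 <= C & forall (e : R) rho, C * e <= eta0 R ->
    (forall i, nA (rho i) <= e) -> nA (eval opsA rho v) <= C * e) ->
  exists2 C, 1 <= C & forall (e : R) rho, C * e <= eta0 R ->
    (forall i, nA (rho i) <= e) -> nA (op (eval opsA rho u) (eval opsA rho v)) <= C * e.
  move=> hop [C C1 HC] [D D1 HD]; exists (372%:R * (C + D)) => [|e rho Ce re]; first lra.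
  have e0 : 0 <= e by apply: le_trans (nA_ge0 _ _) (re 0%N).
  have hC : C * e <= eta0 R by apply: le_trans Ce; rewrite ler_wpM2r//; lra.
  have hD : D * e <= eta0 R by apply: le_trans Ce; rewrite ler_wpM2r//; lra.
  have hu := HC _ _ hC re; have hv := HD _ _ hD re.
  apply: le_trans (hop _ _ (le_trans hu hC) (le_trans hv hD)) _.
  by rewrite -mulrA; apply: ler_wpM2l => //; rewrite mulrDl lerD.
elim: w => [i||u IHu v IHv|u IHu v IHv|u IHu v IHv].
- by exists 1 => // e rho _ re; rewrite mul1r; exact: re.
- exists 1 => // e rho _ re; rewrite mul1r nA0; apply: le_trans (nA_ge0 _ _) (re 0%N).
- apply: (step _ _ _ _ IHu IHv) => x y; exact: nA_mul.
- apply: (step (ldiv opsA) _ _ _ IHu IHv) => x y tx ty /=; rewrite -(nAN mal x).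
  by apply: nA_mul => //; exact: tAN.
- apply: (step (rdiv opsA) _ _ _ IHu IHv) => x y tx ty /=; rewrite -(nAN mal y).
  by apply: nA_mul => //; exact: tAN.
Qed.

Lemma small_words (s : seq word) (d : R) : 0 < d -> exists2 e : R, 0 < e & forall rho,
  (forall i, nA (rho i) <= e) -> forall w, w \in s -> nA (eval opsA rho w) <= d.
Proof.
move=> d0; pose d' := Num.min d (eta0 R).
have d'0 : 0 < d' by rewrite lt_min d0 eta_gt0.
elim: s => [|w s [e e0 he]]; first by exists 1.
have [C C1 HC] := nA_eval w.
have C0 : 0 < C by apply: lt_le_trans C1.
exists (Num.min e (d' / C)) => [|rho re].
  by rewrite lt_min e0 divr_gt0.
move=> w'; rewrite inE => /predU1P[->|ws].
  have CE : C * (d' / C) = d' by rewrite mulrC divrK ?unitfE ?gt_eqF.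
  have re' k : nA (rho k) <= d' / C.
    by apply: le_trans (re k) _; rewrite ge_min lexx orbT.
  apply: le_trans (HC _ _ _ re') _; rewrite CE /d' ge_min lexx ?orbT//.
by apply: he ws => i; apply: le_trans (re i) _; rewrite ge_min lexx.
Qed.

Lemma tA_words (s : seq word) : exists2 e : R, 0 < e & forall rho,
  (forall i, nA (rho i) <= e) -> forall w, w \in s -> tA mal (eval opsA rho w).
Proof. exact: small_words (eta_gt0 R). Qed.

Lemma holds_small u v : (exists2 e : R, 0 < e & forall rho, (forall i, nA (rho i) <= e) ->
  eval opsA rho u = eval opsA rho v) -> holds_near (opsV : loop_ops (rV_manifold R n)) u v.
Proof.
move=> [e e0 he]; have [U nU HU] := near_nA e0.
by exists U => // rho hrho; rewrite !eval_ops he// => i; exact: HU.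
Qed.

End LoopOfMalcev.

Section LocalLoopOfMalcev.
Variables (R : realType) (A : vectType R) (br : A -> A -> A).
Hypothesis mal : is_malcev br.
Let bil : is_algebra br. Proof. by case: mal. Qed.
Notation tri := (tri mal).
Notation tb := (@tb R A br mal).
Notation lie := (tb_lie mal).
Notation mulA := (mulA mal).
Notation nA := (nA mal).
Notation n := (dim A).
Notation opsA := (opsA mal).
Notation opsV := (opsV mal).

Lemma ops_loop u v : loop_law u v -> exists2 e : R, 0 < e & forall rho,
  (forall i, nA (rho i) <= e) -> eval opsA rho u = eval opsA rho v.
Proof.
move=> luv.
have [e e0 he] := tA_words mal [:: WVar 0; WVar 1; WMul (WVar 0) (WVar 1);
  WMul (WVar 1) (WVar 0); WLdiv (WVar 0) (WVar 1); WRdiv (WVar 1) (WVar 0)].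
exists e => // rho /he {}he.
have t0 : tA mal (rho 0%N) by apply: (he (WVar 0)); rewrite !inE eqxx.
have t1 : tA mal (rho 1%N) by apply: (he (WVar 1)); rewrite !inE eqxx ?orbT.
have t2 : tA mal (mulA (rho 0%N) (rho 1%N)).
  by apply: (he (WMul (WVar 0) (WVar 1))); rewrite !inE eqxx ?orbT.
have t3 : tA mal (mulA (rho 1%N) (rho 0%N)).
  by apply: (he (WMul (WVar 1) (WVar 0))); rewrite !inE eqxx ?orbT.
have t4 : tA mal (mulA (- rho 0%N) (rho 1%N)).
  by apply: (he (WLdiv (WVar 0) (WVar 1))); rewrite !inE eqxx ?orbT.
have t5 : tA mal (mulA (rho 1%N) (- rho 0%N)).
  by apply: (he (WRdiv (WVar 1) (WVar 0))); rewrite !inE eqxx ?orbT.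
case: luv => /=.
- exact: mul0A.
- exact: mulA0.
- exact: mulAK.
- by have := mulAK (tAN t0) t1; rewrite opprK; apply.
- exact: mulKA.
- by have := mulKA (tAN t0) t1; rewrite opprK; apply.
Qed.

Lemma ops_law u v : loop_law u v -> holds_near (opsV : loop_ops (rV_manifold R n)) u v.
Proof. by move=> luv; apply: holds_small; exact: ops_loop. Qed.

Lemma ops_moufang u v : moufang_law u v -> exists2 e : R, 0 < e & forall rho,
  (forall i, nA (rho i) <= e) -> eval opsA rho u = eval opsA rho v.
Proof.
case; pose x := WVar 0; pose y := WVar 1; pose z := WVar 2.
pose ws := [:: x; y; z; WMul x y; WMul z x; WMul y z; WMul x (WMul y z)].
have [e e0 he] := tA_words mal ws.
exists e; [exact: e0|move=> rho /he {}he].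
have m k : (k < size ws)%N -> tA mal (eval opsA rho (nth WOne ws k)).
  by move=> h; apply: he; exact: mem_nth.
have tx := m 0%N isT; have ty := m 1%N isT; have tz := m 2 isT.
have txy := m 3 isT; have tzx := m 4 isT; have tyz := m 5 isT; have txyz := m 6 isT.
exact: (moufangA tx ty tz txy tzx tyz txyz).
Qed.

Lemma row_mx_norm m1 m2 (x : 'rV[R]_m1) (y : 'rV[R]_m2) e : 0 <= e -> `|x| <= e -> `|y| <= e ->
  `|row_mx x y| <= e.
Proof.
move=> e0 xe ye; apply: (rv_norm_le (row_mx x y) e0).2 => i; rewrite mxE; case: (fintype.split i) => j.
  exact: le_trans (rv_coord_le _ _) xe.
exact: le_trans (rv_coord_le _ _) ye.
Qed.

Lemma ops_analytic (op : 'rV[R]_n -> 'rV[R]_n -> 'rV[R]_n) :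
  op = mul opsV \/ op = ldiv opsV \/ op = rdiv opsV ->
  \forall x \near (0 : 'rV[R]_n) & y \near (0 : 'rV[R]_n),
    @analytic_op_at R n (rV_manifold R n) op x y.
Proof.
move=> hop.
have [P [Q opE]] : exists P Q : {linear 'rV[R]_(n + n) -> A},
    forall v, op (lsubmx v) (rsubmx v) = v2r (mulA (P v) (Q v)).
  pose l : {linear 'rV[R]_(n + n) -> A} := rvL A \o lsubmx.
  pose r : {linear 'rV[R]_(n + n) -> A} := rvL A \o rsubmx.
  pose l' : {linear 'rV[R]_(n + n) -> A} := - (rvL A \o lsubmx).
  pose r' : {linear 'rV[R]_(n + n) -> A} := - (rvL A \o rsubmx).
  case: hop => [->|[->|->]].
  - by exists l, r.
  - by exists l', r.
  - by exists l, r'.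
have [e e0 he] := mulA_analytic mal P Q.
exists (ball (0 : 'rV[R]_n) e, ball (0 : 'rV[R]_n) e); first by split; exact: nbhsx_ballx.
move=> [x y] [/= hx hy]; rewrite -!ball_normE /= !sub0r !normrN in hx hy.
exists (id_chart R n), (id_chart R n), (id_chart R n); split=> //.
  exact: filterT.
have := he (row_mx x y) (row_mx_norm (ltW e0) (ltW hx) (ltW hy)).
by congr (analytic_at _ _); apply/funext => v; rewrite /coord_op /= opE.
Qed.

Definition malcev_loop : local_loop R :=
  @LocalLoop R n (rV_manifold R n) opsV ops_analytic ops_law.

Lemma mulA_second_order : exists2 e : R, 0 < e & exists C, forall x y : 'rV[R]_n,
  `|x| < e -> `|y| < e ->
  `|v2r (mulA (r2v x) (r2v y)) - (x + y + v2r (2^-1 *: br (r2v x) (r2v y)))| <=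
    C * `|(x, y)| ^+ 3.
Proof.
have [M1 M10 H1] := linear_norm_bound tb (am mal \o rvL A).
have [M2 M20 H2] := linear_norm_bound tb (rho mal \o am mal \o rvL A).
have [M3 M30 H3] := linear_norm_bound tb (rho mal \o rho mal \o am mal \o rvL A).
have [M4 M40 H4] := linear_bound tb br (ac mal).
pose M := M1 + M2 + M3 + 1.
have M0 : 0 < M by rewrite /M; lra.
pose e : R := (1000%:R * M)^-1.
have e0 : 0 < e by rewrite invr_gt0; apply: (mulr_gt0 _ M0); rewrite ltr0n.
exists e; first exact: e0.
exists (M4 * (1000%:R * 300%:R * M ^+ 3)) => x y hx hy.
set p := (x, y); have xp : `|x| <= `|p| by rewrite prod_normE /= le_max lexx.
have yp : `|y| <= `|p| by rewrite prod_normE /= le_max lexx orbT.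
have pe : `|p| < e by rewrite prod_normE /= gt_max hx.
pose s := M * `|p|.
have sb (z : 'rV[R]_n) M' : 0 <= M' -> M' <= M -> `|z| <= `|p| -> M' * `|z| <= s.
  by move=> *; apply: ler_pM.
have s1 : s <= 1000%:R^-1.
  have -> : 1000%:R^-1 = M * e by rewrite /e; field; rewrite gt_eqF.
  by rewrite /s ler_pM2l// ltW.
have hu : Submission.gn tb (- m3 mal (r2v x)) <= s.
  by rewrite gnN m3E; apply: le_trans (H3 x) _; apply: sb => //; rewrite /M; lra.
have hv : Submission.gn tb (m1 mal (r2v y)) <= s.
  by rewrite m1E; apply: le_trans (H1 y) _; apply: sb => //; rewrite /M; lra.
have hw : Submission.gn tb (- m2 mal (r2v x)) <= s.
  by rewrite gnN m2E; apply: le_trans (H2 x) _; apply: sb => //; rewrite /M; lra.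
have := bch3_second_order lie hu hv hw s1.
set E := (X in Submission.gn tb X); move=> hE.
have acE : ac mal E = mulA (r2v x) (r2v y) - (r2v x + r2v y + 2^-1 *: br (r2v x) (r2v y)).
  rewrite /E linearB ac_second; congr (_ - _).
  by rewrite mulAE /Submission.gprod [foldr _ _ _]/= (bchx0 lie).
have -> : v2r (mulA (r2v x) (r2v y)) - (x + y + v2r (2^-1 *: br (r2v x) (r2v y))) = v2r (ac mal E).
  by rewrite acE linearB !linearD /= !r2vK.
apply: (@le_trans _ _ (Submission.gn br (ac mal E))).
  by apply: (rv_norm_le _ (gn_ge0 br _)).2 => i; exact: crd_gn.
apply: le_trans (H4 _) _; apply: le_trans (ler_wpM2l M40 hE) _.
by rewrite /s exprMn !mulrA.
Qed.

(** The second-order form is half the bracket, so antisymmetrising it gives back the bracket. *)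
Lemma malcev_loop_tangent : is_tangent_algebra malcev_loop br.
Proof.
pose T : {linear A -> 'rV[R]_n} := v2r.
exists (id_chart R n), (fun x y : 'rV[R]_n => T (2^-1 *: br (r2v x) (r2v y))), T; split.
- by split=> //; move=> d ->; split; exact: id_transition.
- split.
    split=> x k y z; rewrite linearP /=; [rewrite (brDr bil) (brZr bil)|rewrite (brDl bil) (brZl bil)];
      by rewrite scalerDr linearD scalerA mulrC -scalerA linearZ.
  have [e e0 [C hC]] := mulA_second_order.
  exists C; exists (ball (0 : 'rV[R]_n) e, ball (0 : 'rV[R]_n) e).
    by split; exact: nbhsx_ballx.
  move=> [x y] [/= hx hy]; rewrite -!ball_normE /= !sub0r !normrN in hx hy.
  exact: hC hx hy.
- by exists r2v => x; [exact: v2rK|exact: r2vK].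
- move=> x y; rewrite !v2rK -linearB (mal_anti mal y) scalerN opprK -scalerDl.
  by congr (v2r _); rewrite -[LHS]scale1r; congr (_ *: _); lra.
Qed.
End LocalLoopOfMalcev.

(** * Powers of a Malcev algebra and the attached ideals of [tri] *)

Section Powers.
Variables (R : realType) (A : vectType R) (br : A -> A -> A).
Hypothesis mal : is_malcev br.
Let bil : is_algebra br. Proof. by case: mal. Qed.
Notation Dab := (Dab br).
Notation tri := (tri mal).
Notation tb := (@tb R A br mal).
Notation lie := (tb_lie mal).

(** A^m, the span of all bracket products of m elements; A^1 is everything, and index 0 yields the
    zero space only ([Pow_zero]). *)
Inductive Pow : nat -> A -> Prop :=
  | Pow1 a : Pow 1 a
  | Pow0 m : Pow m 0
  | PowB i j a b : Pow i a -> Pow j b -> Pow (i + j) (br a b)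
  | PowL m k a b : Pow m a -> Pow m b -> Pow m (k *: a + b).

Lemma PowD m a b : Pow m a -> Pow m b -> Pow m (a + b).
Proof. by move=> ha hb; rewrite -[a]scale1r; exact: PowL. Qed.
Lemma PowZ m k a : Pow m a -> Pow m (k *: a).
Proof. by move=> ha; rewrite -[_ *: _]addr0; apply: PowL => //; exact: Pow0. Qed.
Lemma PowN m a : Pow m a -> Pow m (- a).
Proof. by rewrite -scaleN1r; exact: PowZ. Qed.
Lemma PowBB m a b : Pow m a -> Pow m b -> Pow m (a - b).
Proof. by move=> ha hb; apply: PowD => //; exact: PowN. Qed.

Lemma Pow_zero a m : Pow m a -> m = 0%N -> a = 0.
Proof.
elim=> {m a} // [i j a b _ IHa _ _ /eqP|m k a b _ IHa _ IHb /[dup] /IHa -> /IHb ->].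
  by rewrite addn_eq0 => /andP[/eqP/IHa -> _]; rewrite (br0l bil).
by rewrite scaler0 addr0.
Qed.

(** In a bracket of at least three factors one side has at least two and can be lowered by
    induction; a bracket of two factors lies in A^1. *)
Lemma Pow_pred m a : Pow m a -> forall m', m = m'.+1 -> (0 < m')%N -> Pow m' a.
Proof.
elim=> {m a} [a|m|i j a b ha IHa hb IHb|m k a b ha IHa hb IHb] m'.
- by case=> <-.
- by move=> *; exact: Pow0.
- case: i ha IHa => [|[|i]] ha IHa e m'0.
  + by rewrite (Pow_zero ha erefl) (br0l bil); exact: Pow0.
  + case: j hb IHb e => [|[|j]] hb IHb e.
    * by rewrite (Pow_zero hb erefl) (br0r bil); exact: Pow0.
    * by case: e => <-; exact: Pow1.
    * have -> : m' = (1 + j.+1)%N by lia.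
      by apply: PowB; [exact: Pow1|exact: IHb].
  + have -> : m' = (i.+1 + j)%N by lia.
    by apply: PowB => //; exact: IHa.
- by move=> e m'0; apply: PowL; [exact: IHa|exact: IHb].
Qed.

Lemma Pow_le m m' a : (0 < m')%N -> (m' <= m)%N -> Pow m a -> Pow m' a.
Proof.
move=> m'0; elim: m => [|m IH]; first by rewrite leqn0 => /eqP ->.
rewrite leq_eqVlt => /predU1P[->//|h] /Pow_pred hp.
by apply: IH => //; apply: hp => //; apply: leq_trans m'0 h.
Qed.

Lemma Pow_brr m u a : Pow m a -> Pow m (br u a).
Proof.
case: m => [|m] ha; first by rewrite (Pow_zero ha erefl) (br0r bil); exact: Pow0.
by apply: (@Pow_le (1 + m.+1)) => //; apply: PowB ha; exact: Pow1.
Qed.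
Lemma Pow_brl m u a : Pow m a -> Pow m (br a u).
Proof. by move=> ha; rewrite (mal_anti mal); apply: PowN; exact: Pow_brr. Qed.

Lemma Pow_der m (D : A -> A) a : (forall u v, D (br u v) = br (D u) v + br u (D v)) ->
  linear D -> Pow m a -> Pow m (D a).
Proof.
move=> hD lD; elim=> {m a} [a|m|i j a b ha IHa hb IHb|m k a b _ IHa _ IHb].
- exact: Pow1.
- have -> : D 0 = 0 by have := linear0 (mklin lD).
  exact: Pow0.
- by rewrite hD; apply: PowD; exact: PowB.
- by rewrite lD; exact: PowL.
Qed.

Lemma Pow_derof m (X : tri) a : Pow m a -> Pow m (der_of X a).
Proof. by apply: Pow_der => [u v|k u v]; [exact: tri_der|rewrite !derE]. Qed.

Lemma bracket_ext t (x y : nat -> A) : (forall i, (i < leaves t)%N -> x i = y i) ->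
  bracket br t x = bracket br t y.
Proof.
elim: t x y => [|l IHl r IHr] x y h /=; first exact: h.
by rewrite (IHl x y) ?(IHr _ (fun i => y (leaves l + i)%N)) // => i hi; apply: h => /=; lia.
Qed.

(** Links [Pow] with the trees of [in_NL]: two bracketings are joined by a [Node], and their
    sequences of arguments are concatenated. *)
Lemma Pow_ind_bracket m a : Pow m a -> (0 < m)%N -> forall Q : A -> Prop, Q 0 ->
  (forall k u v, Q u -> Q v -> Q (k *: u + v)) ->
  (forall t x, leaves t = m -> Q (bracket br t x)) -> Q a.
Proof.
elim=> {m a} [a|m|i j a b ha IHa hb IHb|m k a b ha IHa hb IHb] m0 Q Q0 QL Qb.
- exact: (Qb Leaf (fun=> a) erefl).
- exact: Q0.
- have [i0|i0] := posnP i; first by rewrite (Pow_zero ha i0) (br0l bil).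
  have [j0|j0] := posnP j; first by rewrite (Pow_zero hb j0) (br0r bil).
  apply: (IHa i0 (fun u => Q (br u b))) => [|k u v hu hv|t x ht].
  + by rewrite (br0l bil).
  + by rewrite (brDl bil) (brZl bil); exact: QL.
  apply: (IHb j0 (fun v => Q (br (bracket br t x) v))) => [|k u v hu hv|t' x' ht'].
  + by rewrite (br0r bil).
  + by rewrite (brDr bil) (brZr bil); exact: QL.
  pose z l := if (l < leaves t)%N then x l else x' (l - leaves t)%N.
  have e1 : bracket br t z = bracket br t x.
    by apply: bracket_ext => l hl; rewrite /z hl.
  have e2 : bracket br t' (fun l => z (leaves t + l)%N) = bracket br t' x'.
    by apply: bracket_ext => l _; rewrite /z ltnNge leq_addr /= addKn.
  by rewrite -e1 -e2; apply: (Qb (Node t t') z); rewrite /= ht ht'.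
- by apply: (QL); [exact: IHa|exact: IHb].
Qed.

Lemma NL_jac k a y z : (0 < k)%N -> in_NL k br -> Pow k a -> jac br a y z = 0.
Proof.
move=> k0 [_ NL] ha; apply: (Pow_ind_bracket ha k0 (Q := fun a => jac br a y z = 0)).
- by rewrite /jac !(br0l bil, br0r bil) !addr0.
- move=> c u v hu hv.
  have -> : jac br (c *: u + v) y z = c *: jac br u y z + jac br v y z.
    by rewrite /jac !(br_lin bil); lmod_over R A.
  by rewrite hu hv scaler0 addr0.
- by move=> t x ht; exact: NL.
Qed.

Section Ideal.
Variable m : nat.

(** The ideal of [tri] used to calculate modulo A^m; it is stable under [rho], so it contains all
    three copies of A^m. *)
Definition inI (X : tri) :=
  (forall v, Pow m (der_of X v)) /\ Pow m X.2.1 /\ Pow m X.2.2.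

Lemma inI0 : inI 0.
Proof.
by split=> [v|]; [rewrite [der_of _ _](der_of0 mal 0 0 v)|split]; exact: Pow0.
Qed.
Lemma inIL k X Y : inI X -> inI Y -> inI (k *: X + Y).
Proof.
move=> [hD [hb ha]] [hD' [hb' ha']]; split=> [v|]; first by rewrite der_lin; exact: PowL.
by split; exact: PowL.
Qed.

Lemma Pow_Dab1 a b v : Pow m a -> Pow m (Dab a b v).
Proof.
move=> ha; rewrite /Submission.Dab; apply: PowD; last by apply: Pow_brl; exact: Pow_brl.
by apply: PowBB; [exact: Pow_brl|apply: Pow_brr; exact: Pow_brl].
Qed.

Lemma inI_ideal X Y : inI X -> inI (tb X Y).
Proof.
move=> [hD [hb ha]]; split=> [v|]; last split.
- rewrite der_tb; apply: PowD; last by apply: PowZ; exact: Pow_Dab1.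
  by apply: PowD; [apply: PowBB; [|exact: Pow_derof]|exact: Pow_Dab1].
- rewrite tb_b; apply: PowD; last by apply: PowZ; exact: Pow_brl.
  by apply: PowBB; [apply: PowBB; [|exact: Pow_derof]|exact: Pow_brl].
- rewrite tb_a; apply: PowBB; last exact: Pow_brr.
  by apply: PowD; [apply: PowBB; [|exact: Pow_derof]|exact: Pow_brl].
Qed.

Lemma inI_am a : Pow m a -> inI (am mal a).
Proof.
by move=> ha; split=> [v|]; [rewrite der_of0; exact: Pow0|split; [exact: Pow0|]].
Qed.
Lemma inI_rho X : inI X -> inI (rho mal X).
Proof.
move=> [hD [hb ha]]; split=> [v|]; first by rewrite der_rho.
by rewrite rho_a rho_b; split; [apply: PowD|apply: PowBB]; exact: PowZ.
Qed.
End Ideal.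

Section NuclearIdeal.
Variable k : nat.
Hypothesis k0 : (0 < k)%N.
Hypothesis NL : in_NL k br.

(** The elements b_+ - ad b with b in A^k. Under the NL identities ad b is a derivation and these
    form an ideal. It meets A_- in 0, so a congruence modulo it between two elements of A_- is an
    equality. *)
Definition inJ (X : tri) := [/\ X.2.2 = 0, Pow k X.2.1 &
  forall v, der_of X v = - br X.2.1 v].

(** As J(a,c,v) = 0 for a in A^k, [ad a, ad c] equals ad [a,c]. *)
Lemma Dab_nuc a c v : Pow k a -> Dab a c v = 2%:R *: br (br a c) v.
Proof.
move=> ha; have := NL_jac c v k0 NL ha; rewrite /jac => h.
rewrite /Submission.Dab (mal_anti mal a (br c v)) (mal_anti mal c (br a v)) (mal_anti mal a v) (brNl bil).
have -> : br (br c v) a = - br (br a c) v - br (br v a) c.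
  by apply/eqP; rewrite -subr_eq0 -h; apply/eqP; lmod_over R A.
lmod_over R A.
Qed.

Lemma inJ0 : inJ 0.
Proof.
split=> [//||v]; first exact: Pow0.
by rewrite [der_of _ _](der_of0 mal 0 0 v) (br0l bil) oppr0.
Qed.
Lemma inJL c X Y : inJ X -> inJ Y -> inJ (c *: X + Y).
Proof.
move=> [ha hb hD] [ha' hb' hD']; split=> [||v].
- have -> : (c *: X + Y).2.2 = c *: X.2.2 + Y.2.2 by [].
  by rewrite ha ha' scaler0 addr0.
- exact: PowL.
- have -> : (c *: X + Y).2.1 = c *: X.2.1 + Y.2.1 by [].
  rewrite der_lin hD hD' (brDl bil) (brZl bil).
  by rewrite scalerN opprD.
Qed.

Lemma der_of_zero (X : tri) : der_of X 0 = 0.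
Proof. exact: linear0. Qed.

Lemma inJ_ideal X Y : inJ X -> inJ (tb X Y).
Proof.
move=> [ha hb hD]; split=> [||v].
- by rewrite tb_a ha !hD der_of_zero (br0r bil); lmod_over R A.
- rewrite tb_b ha hD (br0l bil) scaler0 addr0.
  by apply: PowBB; [apply: PowBB; [apply: PowN; exact: Pow_brl|exact: Pow_derof]|exact: Pow_brl].
- rewrite der_tb tb_b ha !hD (br0l bil) Dab_nuc// !derE tri_der.
  rewrite /Submission.Dab !(br0l bil) !(br0r bil) !(br_lin bil).
  lmod_over R A.
Qed.

Lemma inJ_23 a z : Pow k a -> inJ (tb (rho mal (am mal a)) (rho mal (rho mal (am mal z)))).
Proof.
move=> ha.
have bE : (tb (rho mal (am mal a)) (rho mal (rho mal (am mal z)))).2.1 = 3%:R^-1 *: br a z.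
  rewrite tb_b !der_rho !der_of0 /= !(br_lin bil, br0l bil, br0r bil); lmod_over R A.
split=> [||v].
- rewrite tb_a !der_rho !der_of0 /= !(br_lin bil, br0l bil, br0r bil) (mal_anti mal z a).
  lmod_over R A.
- by rewrite bE; apply: PowZ; exact: Pow_brl.
- rewrite bE der_tb !der_rho !der_of0 /= !DabE//.
  rewrite !(Dab_nuc _ _ ha) /Submission.Dab !(br_lin bil, br0l bil, br0r bil); lmod_over R A.
Qed.

Lemma inJ_32 a z : Pow k a -> inJ (tb (rho mal (rho mal (am mal a))) (rho mal (am mal z))).
Proof.
move=> ha.
have bE : (tb (rho mal (rho mal (am mal a))) (rho mal (am mal z))).2.1 = 3%:R^-1 *: br a z.
  rewrite tb_b !der_rho !der_of0 /= !(br_lin bil, br0l bil, br0r bil); lmod_over R A.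
split=> [||v].
- rewrite tb_a !der_rho !der_of0 /= !(br_lin bil, br0l bil, br0r bil) (mal_anti mal z a).
  lmod_over R A.
- by rewrite bE; apply: PowZ; exact: Pow_brl.
- rewrite bE der_tb !der_rho !der_of0 /= !DabE//.
  rewrite !(Dab_nuc _ _ ha) /Submission.Dab !(br_lin bil, br0l bil, br0r bil); lmod_over R A.
Qed.
End NuclearIdeal.
End Powers.

(** The class of 1 under a congruence is a normal subloop: each inclusion between cosets is
    witnessed by a quotient, which the congruence relates to 1. *)
Lemma congr_normal (L : loop) (E : L -> L -> Prop) :
  (forall x, E x x) -> (forall x y, E x y -> E y x) ->
  (forall x y z, E x y -> E y z -> E x z) ->
  (forall x x' y y', E x x' -> E y y' ->
    [/\ E (mul (lops L) x y) (mul (lops L) x' y'),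
        E (ldiv (lops L) x y) (ldiv (lops L) x' y') &
        E (rdiv (lops L) x y) (rdiv (lops L) x' y')]) ->
  normal_subloop [set a | E a (one (lops L))].
Proof.
move=> Er Es Et Ec; set o := lops L; set e := one o.
have Em x x' y y' : E x x' -> E y y' -> E (mul o x y) (mul o x' y').
  by move=> h1 h2; have [] := Ec _ _ _ _ h1 h2.
have El x x' y y' : E x x' -> E y y' -> E (ldiv o x y) (ldiv o x' y').
  by move=> h1 h2; have [] := Ec _ _ _ _ h1 h2.
have Err x x' y y' : E x x' -> E y y' -> E (rdiv o x y) (rdiv o x' y').
  by move=> h1 h2; have [] := Ec _ _ _ _ h1 h2.
have lxx x : ldiv o x x = e by apply/esym/ldivP; exact: mul_one.
have rxx x : rdiv o x x = e by apply/esym/rdivP; exact: one_mul.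
have lm a b : ldiv o a (mul o a b) = b by apply/esym/ldivP.
have ml a b : mul o a (ldiv o a b) = b by apply/ldivP.
have rm b a : rdiv o (mul o b a) a = b by apply/esym/rdivP.
have mr b a : mul o (rdiv o b a) a = b by apply/rdivP.
split; first split => /= [|x y hx hy|x y hx hy|x y hx hy].
- exact: Er.
- by have := Em _ _ _ _ hx hy; rewrite one_mul.
- by have := El _ _ _ _ hx hy; rewrite lxx.
- by have := Err _ _ _ _ hx hy; rewrite rxx.
move=> x y; split; apply/seteqP; split=> [z|z].
- move=> [h hN <-]; exists (rdiv o (mul o x h) x); last exact: mr.
  by have /= := Err _ _ _ _ (Em _ _ _ _ (Er x) hN) (Er x); rewrite mul_one rxx.
- move=> [h hN <-]; exists (ldiv o x (mul o h x)); last exact: ml.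
  by have /= := El _ _ _ _ (Er x) (Em _ _ _ _ hN (Er x)); rewrite one_mul lxx.
- move=> [_ [h hN <-] <-]; exists (ldiv o (mul o x y) (mul o x (mul o y h))); last exact: ml.
  have /= := El _ _ _ _ (Er (mul o x y)) (Em _ _ _ _ (Er x) (Em _ _ _ _ (Er y) hN)).
  by rewrite mul_one lxx.
- move=> [h hN <-]; exists (ldiv o x (mul o (mul o x y) h)); last exact: ml.
  exists (ldiv o y (ldiv o x (mul o (mul o x y) h))); last exact: ml.
  have /= := El _ _ _ _ (Er y) (El _ _ _ _ (Er x) (Em _ _ _ _ (Er (mul o x y)) hN)).
  by rewrite mul_one lm lxx.
- move=> [_ [h hN <-] <-]; exists (rdiv o (mul o (mul o h x) y) (mul o x y)); last exact: mr.
  have /= := Err _ _ _ _ (Em _ _ _ _ (Em _ _ _ _ hN (Er x)) (Er y)) (Er (mul o x y)).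
  by rewrite one_mul rxx.
- move=> [h hN <-]; exists (rdiv o (mul o h (mul o x y)) y); last exact: mr.
  exists (rdiv o (rdiv o (mul o h (mul o x y)) y) x); last exact: mr.
  have /= := Err _ _ _ _ (Err _ _ _ _ (Em _ _ _ _ hN (Er (mul o x y))) (Er y)) (Er x).
  by rewrite one_mul rm rxx.
Qed.

(** * The local loop modulo powers, commutators and nuclear elements *)

Section Congruence.
Variables (R : realType) (A : vectType R) (br : A -> A -> A).
Hypothesis mal : is_malcev br.
Let bil : is_algebra br. Proof. by case: mal. Qed.
Notation tri := (tri mal).
Notation tb := (@tb R A br mal).
Notation lie := (tb_lie mal).
Notation mulA := (mulA mal).
Notation nA := (nA mal).
Notation gn := (Submission.gn tb).
Notation bch := (Submission.bch tb).
Notation gprod := (Submission.gprod tb).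
Notation tl := (Submission.tl tb).
Notation Pow := (Pow br).
Notation tA := (tA mal).
Notation m1 := (m1 mal).
Notation m2 := (m2 mal).
Notation m3 := (m3 mal).

Lemma ideal_projection (P : tri -> Prop) : P 0 ->
  (forall k u v, P u -> P v -> P (k *: u + v)) -> (forall X Y, P X -> P (tb X Y)) ->
  exists pi : {linear tri -> tri}, [/\ forall X, pi X = 0 <-> P X,
    forall X, pi (pi X) = pi X & forall X Y, pi X = 0 -> pi (tb X Y) = 0].
Proof.
move=> P0 PL PI; have [pi [h1 h2]] := pred_projection P0 PL; exists pi; split=> //.
by move=> X Y /h1 hX; apply/h1; exact: PI.
Qed.

Section ModPi.
Variable pi : {linear tri -> tri}.
Hypotheses (pi2 : forall X, pi (pi X) = pi X)
  (pil : forall X Y, pi X = 0 -> pi (tb X Y) = 0).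

Lemma tl_gn_small u v : gn u <= 1000%:R^-1 -> gn v <= 1000%:R^-1 -> small (gn u) (gn v).
Proof. by move=> hu hv; apply: tl_small => //; exact: gn_ge0. Qed.

Lemma pi_bch u u' v v' : pi u = pi u' -> pi v = pi v' ->
  gn u <= 1000%:R^-1 -> gn v <= 1000%:R^-1 -> gn u' <= 1000%:R^-1 -> gn v' <= 1000%:R^-1 ->
  pi (bch u v) = pi (bch u' v').
Proof.
by move=> hu hv *; apply: (bch_congr lie pil hu hv); exact: tl_gn_small.
Qed.

Lemma pi_gprod s t : tl s -> tl t -> map pi s = map pi t -> pi (gprod s) = pi (gprod t).
Proof.
elim: s t => [|u s IH] [|v t] hs ht; [move=> _; reflexivity|by case|by case|].
case=> uv st; have [_ hs'] := tl_cons hs; have [_ ht'] := tl_cons ht.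
change (pi (bch u (gprod s)) = pi (bch v (gprod t))).
exact (pi_bch uv (IH _ hs' ht' st) (tl_gn hs) (gn_gprod lie hs') (tl_gn ht)
  (gn_gprod lie ht')).
Qed.

Lemma pi_cat_congr s1 s2 t1 t2 : tl (s1 ++ s2) -> tl (t1 ++ t2) ->
  pi (gprod s1) = pi (gprod t1) -> pi (gprod s2) = pi (gprod t2) ->
  pi (gprod (s1 ++ s2)) = pi (gprod (t1 ++ t2)).
Proof.
move=> hs ht h1 h2; rewrite (gprod_cat lie hs) (gprod_cat lie ht).
have [s1t s2t] := tl_cat hs; have [t1t t2t] := tl_cat ht.
exact: (pi_bch h1 h2 (gn_gprod lie s1t) (gn_gprod lie s2t) (gn_gprod lie t1t) (gn_gprod lie t2t)).
Qed.

Lemma pi_swap u v : tl [:: u; v] -> pi (tb u v) = 0 ->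
  pi (gprod [:: u; v]) = pi (gprod [:: v; u]).
Proof.
move=> huv uv.
have [hu hv'] := tl_cons huv; have [hv _] := tl_cons hv'.
have su := tl_gn huv; have sv := tl_gn hv'.
rewrite /Submission.gprod /= !(bchx0 lie).
apply: etrans (bch_comm_mod lie pil pi2 uv (tl_gn_small su sv)) _.
have vu : pi (tb v u) = 0 by rewrite tb_anti linearN uv oppr0.
apply: etrans _ (esym (bch_comm_mod lie pil pi2 vu (tl_gn_small sv su))).
by rewrite addrC.
Qed.

Lemma pi_swapN u v : tl [:: u; v] -> pi (tb u v) = 0 ->
  pi (gprod [:: - u; - v]) = pi (gprod [:: - v; - u]).
Proof.
move=> huv uv; apply: pi_swap; first by move: huv; rewrite /Submission.tl /= !gnN.
by rewrite (brNl (tb_bil mal)) (brNr (tb_bil mal)) opprK uv.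
Qed.
End ModPi.

Ltac tt := rewrite /Submission.tl /=; repeat (apply/andP; split);
  repeat lazymatch goal with |- is_true (Submission.gn _ (- _) <= _) => refine (gnN_le _) end;
  match goal with
  | H : is_true (Submission.gn _ ?u <= _) |- is_true (Submission.gn _ ?t <= _) => constr_eq u t; exact H
  | |- _ => exact isT
  end.
Ltac tiny := repeat match goal with H : is_true (Submission.tA _ _) |- _ =>
   let h := fresh "h" in have h := tAP H; clear H; case: h => ? ? ? end.

Lemma pi_am_sub (pi : {linear tri -> tri}) p q : pi (m1 p) = pi (m1 q) ->
  pi (am mal (p - q)) = 0.
Proof. by rewrite !m1E !linearB => ->; rewrite subrr. Qed.

Lemma mulA_congr m x x' y y' : Pow m (x - x') -> Pow m (y - y') ->
  tA x -> tA x' -> tA y -> tA y' -> Pow m (mulA x y - mulA x' y').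
Proof.
move=> hx hy tx tx' ty ty'.
have [pi [piP pi2 pil]] := ideal_projection (inI0 mal m) (@inIL _ _ _ mal m) (@inI_ideal _ _ _ mal m).
have E u v : pi (u - v) = 0 -> pi u = pi v by rewrite linearB => /eqP; rewrite subr_eq0 => /eqP.
have e1 a b : Pow m (a - b) -> pi (m1 a) = pi (m1 b).
  by move=> ab; apply/E/piP; rewrite !m1E -linearB; exact: inI_am.
have e2 a b : Pow m (a - b) -> pi (m2 a) = pi (m2 b).
  by move=> ab; apply/E/piP; rewrite !m2E -!linearB; apply: inI_rho; exact: inI_am.
have e3 a b : Pow m (a - b) -> pi (m3 a) = pi (m3 b).
  by move=> ab; apply/E/piP; rewrite !m3E -!linearB; do 2!apply: inI_rho; exact: inI_am.
have n2 : pi (- m2 x) = pi (- m2 x') by rewrite linearN (e2 _ _ hx) -linearN.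
have n3 : pi (- m3 x) = pi (- m3 x') by rewrite linearN (e3 _ _ hx) -linearN.
have l3 (a b c a' b' c' : tri) : a = a' -> b = b' -> c = c' -> [:: a; b; c] = [:: a'; b'; c'].
  by move=> -> -> ->.
have h : pi (m1 (mulA x y)) = pi (m1 (mulA x' y')).
  apply: etrans (congr1 pi (mulA1 tx ty)) (etrans _ (esym (congr1 pi (mulA1 tx' ty')))).
  apply: (pi_gprod pil); [by tiny; tt|by tiny; tt|].
  exact: (l3 _ _ _ _ _ _ n3 (e1 _ _ hy) n2).
by have /piP [_ []] := pi_am_sub h.
Qed.

(** The three factors of the word commute modulo the ideal, so the product is congruent to their
    sum, which is (u + v)_1. *)
Lemma mulA_comm_mod m u v : inI m (tb (m1 v) (m2 u)) -> inI m (tb (m3 u) (m1 v)) ->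
  tA u -> tA v -> Pow m (mulA u v - (u + v)).
Proof.
move=> h1 h2 tu tv.
have [pi [piP pi2 pil]] := ideal_projection (inI0 mal m) (@inIL _ _ _ mal m) (@inI_ideal _ _ _ mal m).
have {h1}h1 : pi (tb (m1 v) (- m2 u)) = 0.
  by rewrite (brNr (tb_bil mal)) linearN (proj2 (piP _) h1) oppr0.
have t0 : tl [:: - m3 u; m1 v; - m2 u] by tiny; tt.
have [t1 t2] := tl_cons t0; have [t3 t4] := tl_cons t2.
have c1 : pi (bch (m1 v) (- m2 u)) = pi (m1 v - m2 u).
  exact: (bch_comm_mod lie pil pi2 h1 (tl_gn_small (tl_gn t2) (tl_gn t4))).
have c2 : pi (tb (- m3 u) (bch (m1 v) (- m2 u))) = 0.
  rewrite (tb_anti (- m3 u)) linearN.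
  have e : bch (m1 v) (- m2 u) = (bch (m1 v) (- m2 u) - (m1 v - m2 u)) + (m1 v - m2 u).
    by rewrite subrK.
  rewrite e (brDl (tb_bil mal)) linearD pil ?add0r; last by rewrite linearB c1 subrr.
  rewrite (brDl (tb_bil mal)) !(brNr (tb_bil mal)) (brNl (tb_bil mal)) tb_m23.
  rewrite oppr0 subr0 linearN opprK (tb_anti (m1 v)) linearN.
  by rewrite (proj2 (piP _) h2) oppr0.
have c3 : pi (m1 (mulA u v)) = pi (- m3 u + (m1 v - m2 u)).
  rewrite (mulA1 tu tv) /Submission.gprod /= (bchx0 lie).
  have g : gprod [:: m1 v; - m2 u] = bch (m1 v) (- m2 u) by rewrite /Submission.gprod /= (bchx0 lie).
  have sm : small (gn (- m3 u)) (gn (bch (m1 v) (- m2 u))).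
    by apply: tl_gn_small; [exact: tl_gn t0|rewrite -g; exact: (gn_gprod lie t2)].
  apply: etrans (bch_comm_mod lie pil pi2 c2 sm) _.
  apply: etrans (linearD pi _ _) (etrans _ (esym (linearD pi _ _))).
  exact: (congr1 (+%R (pi (- m3 u))) c1).
have E : - m3 u + (m1 v - m2 u) = m1 (u + v).
  rewrite [m1 (u + v)]m1E linearD -!m1E.
  have -> : m1 u = - (m2 u + m3 u) by apply/eqP; rewrite -addr_eq0 addrA msum.
  by rewrite opprD [RHS]addrC [m1 v - _]addrC addrA [- m3 u - _]addrC addrC.
rewrite E in c3.
by have /piP [_ []] := pi_am_sub c3.
Qed.

(** The scalars cover the three copies [m1], [m2], [m3] at once. *)
Lemma inI_tb i j x y (X Y : tri) (p q p' q' : R) : Pow i x -> Pow j y ->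
  X = (0, (p *: x, q *: x)) -> Y = (0, (p' *: y, q' *: y)) -> inI (i + j) (tb X Y).
Proof.
move=> hx hy -> ->.
have hb : Pow (i + j) (br x y) by exact: PowB.
have hD v : Pow (i + j) (Dab br x y v).
  rewrite /Dab; apply: PowD; last exact: Pow_brl.
  apply: PowBB; first by apply: PowB => //; exact: Pow_brl.
  by rewrite addnC; apply: PowB => //; exact: Pow_brl.
split=> [v|]; last split.
- by rewrite der_tb !der_of0 subrr add0r /= !DabE//; apply: PowD; do ?apply: PowZ; exact: hD.
- rewrite tb_b !der_of0 subrr sub0r /= !(br_lin bil).
  by apply: PowD; do ?[apply: PowN|apply: PowZ]; exact: hb.
- rewrite tb_a !der_of0 subrr add0r /= !(br_lin bil) (mal_anti mal y x).
  by apply: PowBB; do ?[apply: PowN|apply: PowZ]; exact: hb.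
Qed.

Lemma m1_form x : m1 x = (0, (0 *: x, 1 *: x)).
Proof. by rewrite m1E scale0r scale1r. Qed.
Lemma m2_form x : m2 x = (0, (2^-1 *: x, - 2^-1 *: x)).
Proof. by rewrite m2E; apply: tri_eq => [v||] //=; lmod_over R A. Qed.
Lemma m3_form x : m3 x = (0, (- 2^-1 *: x, - 2^-1 *: x)).
Proof. by rewrite m3E; apply: tri_eq => [v||] //=; lmod_over R A. Qed.

(** Modulo A^(i+j) the products met here are sums: x^-1 y^-1 is -x - y, times x it is -y, and times
    y it is 0. *)
Lemma commutatorA i j x y : Pow i x -> Pow j y -> tA x -> tA y ->
  tA (mulA (- x) (- y)) -> tA (mulA (mulA (- x) (- y)) x) -> tA (- x - y) ->
  Pow (i + j) (mulA (mulA (mulA (- x) (- y)) x) y).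
Proof.
move=> hx hy tx ty t1 t2 txy.
have h1 : Pow (i + j) (mulA (- x) (- y) - (- x - y)).
  apply: mulA_comm_mod; rewrite ?tAN//.
    by rewrite addnC; apply: inI_tb (m1_form _) (m2_form _); exact: PowN.
  by apply: inI_tb (m3_form _) (m1_form _); exact: PowN.
have mD a b : [/\ m1 (a + b) = m1 a + m1 b, m2 (a + b) = m2 a + m2 b & m3 (a + b) = m3 a + m3 b].
  by rewrite !m1E !m2E !m3E !linearD.
have h2 : Pow (i + j) (mulA (- x - y) x - (- x - y + x)).
  have [_ e2 e3] := mD (- x) (- y).
  apply: mulA_comm_mod => //.
    rewrite e2 m2N (brDr (tb_bil mal)) (brNr (tb_bil mal)) tb_m12 oppr0 add0r.
    by apply: inI_tb hx _ (m1_form _) (m2_form _); exact: PowN.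
  rewrite e3 m3N (brDl (tb_bil mal)) (brNl (tb_bil mal)) tb_m31 oppr0 add0r addnC.
  by apply: inI_tb _ hx (m3_form _) (m1_form _); exact: PowN.
have h3 : Pow (i + j) (mulA (mulA (- x) (- y)) x - (- y)).
  have h := @mulA_congr (i + j) _ (- x - y) x x h1 _ t1 txy tx tx.
  have {}h := h ltac:(rewrite subrr; exact: Pow0).
  have D (P Q : A) : P - - y = (P - Q) + (Q - (- x - y + x)) by lmod_over R A.
  by rewrite (D _ (mulA (- x - y) x)); exact: (PowD h h2).
have h4 : mulA (- y) y = 0.
  have := mulAK (tAN ty) (tA0 mal); rewrite opprK (mulA0 ty); exact.
have := mulA_congr h3 (_ : Pow (i + j) (y - y)) t2 (tAN ty) ty ty.
by rewrite h4 subr0; apply; rewrite subrr; exact: Pow0.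
Qed.

(** As words, (ay)z is z_2^-1 a_3^-1 y_1 a_2^-1 z_3^-1, and a(yz) is the same with both outer pairs
    exchanged. These pairs commute modulo [inJ], and [inJ] has no A_- component, so the two products
    are equal. *)
Lemma nuclearA k a y z : (0 < k)%N -> in_NL k br -> Pow k a -> tA a -> tA y -> tA z ->
  tA (mulA a y) -> tA (mulA y z) -> mulA (mulA a y) z = mulA a (mulA y z).
Proof.
move=> k0 NL ha ta ty tz tay tyz.
have [pi [piP pi2 pil]] := ideal_projection (inJ0 mal k) (@inJL _ _ _ mal k)
  (@inJ_ideal _ _ _ mal k k0 NL).
have e1 : m1 (mulA (mulA a y) z) = gprod [:: - m2 z; - m3 a; m1 y; - m2 a; - m3 z].
  have [l _ _] := mulAF tay tz; apply: etrans l _.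
  have h := @gprod_sub _ _ _ mal [:: - m2 z] _ _ [:: - m3 z] (mulA1 ta ty).
  by apply: h; tiny; tt.
have e2 : m1 (mulA a (mulA y z)) = gprod [:: - m3 a; - m2 z; m1 y; - m3 z; - m2 a].
  have l := mulA1 ta tyz; apply: etrans l _; have [l' _ _] := mulAF ty tz.
  have h := @gprod_sub _ _ _ mal [:: - m3 a] _ _ [:: - m2 a] l'.
  by apply: h; tiny; tt.
have s1 : pi (gprod [:: - m2 z; - m3 a]) = pi (gprod [:: - m3 a; - m2 z]).
  apply: (pi_swapN pi2 pil); first by tiny; tt.
  rewrite tb_anti linearN m3E m2E (proj2 (piP _)) ?oppr0//; exact: inJ_32.
have s2 : pi (gprod [:: - m2 a; - m3 z]) = pi (gprod [:: - m3 z; - m2 a]).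
  apply: (pi_swapN pi2 pil); first by tiny; tt.
  by rewrite m3E m2E; apply/piP; exact: inJ_23.
have E : pi (m1 (mulA (mulA a y) z)) = pi (m1 (mulA a (mulA y z))).
  apply: etrans (congr1 pi e1) (etrans _ (esym (congr1 pi e2))).
  apply: (pi_cat_congr pil (s1 := [:: - m2 z; - m3 a]) (t1 := [:: - m3 a; - m2 z])
    (s2 := [:: m1 y; - m2 a; - m3 z]) (t2 := [:: m1 y; - m3 z; - m2 a])).
  - by tiny; tt.
  - by tiny; tt.
  - exact: s1.
  - apply: (pi_cat_congr pil (s1 := [:: m1 y]) (t1 := [:: m1 y])
      (s2 := [:: - m2 a; - m3 z]) (t2 := [:: - m3 z; - m2 a])).
    + by tiny; tt.
    + by tiny; tt.
    + reflexivity.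
    + exact: s2.
have /piP [h _ _] := pi_am_sub E.
by apply/eqP; rewrite -subr_eq0; apply/eqP.
Qed.
End Congruence.

(** * Evaluation of the free Moufang loop near 0, and membership in G_k *)

Section Membership.
Variables (R : realType) (A : vectType R) (br : A -> A -> A).
Hypothesis mal : is_malcev br.
Notation tb := (@tb R A br mal).
Notation mulA := (mulA mal).
Notation nA := (nA mal).
Notation Pow := (Pow br).
Notation tA := (tA mal).
Notation opsA := (opsA mal).
Implicit Types (P Q : (nat -> A) -> Prop) (u v w : word) (rho : nat -> A).

(** Properties of germs at 0: the product is a loop operation near 0 only, so words have to be
    evaluated at small arguments. *)
Definition ev P := exists2 e : R, 0 < e & forall rho, (forall i, nA (rho i) <= e) -> P rho.

Lemma ev_mono P Q : (forall rho, P rho -> Q rho) -> ev P -> ev Q.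
Proof. by move=> PQ [e e0 h]; exists e => // rho /h /PQ. Qed.
Lemma ev_and P Q : ev P -> ev Q -> ev (fun rho => P rho /\ Q rho).
Proof.
move=> [e e0 h] [d d0 k]; exists (Num.min e d); first by rewrite lt_min e0.
move=> rho hr; split; [apply: h|apply: k] => i; apply: le_trans (hr i) _;
  by rewrite ge_min lexx ?orbT.
Qed.
Lemma ev_all P : (forall rho, P rho) -> ev P.
Proof. by move=> h; exists 1. Qed.

Lemma ev_small w (d : R) : 0 < d -> ev (fun rho => nA (eval opsA rho w) <= d).
Proof.
by move=> /(small_words mal [:: w])[e e0 h]; exists e => // rho /h; apply; rewrite inE eqxx.
Qed.
Lemma ev_tA w : ev (fun rho => tA (eval opsA rho w)).
Proof. exact: ev_small (eta_gt0 R). Qed.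

Lemma eval_subst s rho w :
  eval opsA rho (eval word_ops s w) = eval opsA (fun i => eval opsA rho (s i)) w.
Proof.
elim: w => [i||u IHu v IHv|u IHu v IHv|u IHu v IHv]; first 2 last.
- exact: (f_equal2 (mul opsA) IHu IHv).
- exact: (f_equal2 (ldiv opsA) IHu IHv).
- exact: (f_equal2 (rdiv opsA) IHu IHv).
- by [].
- by [].
Qed.

Lemma law_ev u v s : loop_law u v \/ moufang_law u v ->
  ev (fun rho => eval opsA rho (eval word_ops s u) = eval opsA rho (eval word_ops s v)).
Proof.
move=> luv.
have [e e0 he] : exists2 e : R, 0 < e & forall rho,
    (forall i, nA (rho i) <= e) -> eval opsA rho u = eval opsA rho v.
  by case: luv; [exact: ops_loop|exact: ops_moufang].
have h : ev (fun rho => [/\ nA (eval opsA rho (s 0%N)) <= e, nA (eval opsA rho (s 1%N)) <= e &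
    nA (eval opsA rho (s 2%N)) <= e]).
  apply: ev_mono (ev_and (ev_small (s 0%N) e0) (ev_and (ev_small (s 1%N) e0) (ev_small (s 2%N) e0))).
  by move=> rho [? []].
apply: ev_mono h => rho [h0 h1 h2]; rewrite !eval_subst.
(* The axioms involve the variables 0, 1, 2 only; the others are sent to 0, since infinitely many
   words need not be small simultaneously. *)
pose r i := if i is 0%N then eval opsA rho (s 0%N) else if i is 1%N then eval opsA rho (s 1%N)
  else if i is 2%N then eval opsA rho (s 2%N) else 0.
have : eval opsA r u = eval opsA r v.
  apply: he => -[|[|[|i]]]; [exact: h0|exact: h1|exact: h2|].
  by rewrite /r nA0 ltW.
by case: luv => -[].
Qed.

(** A derivation uses finitely many instances of the axioms, each valid on small arguments. Thus
    elements of the free Moufang loop have well-defined germs. *)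
Lemma meq_ev u v : moufang_eq u v -> ev (fun rho => eval opsA rho u = eval opsA rho v).
Proof.
elim=> {u v} [s u v h|s u v h|u|u v _ IH|u v w _ IH1 _ IH2|u v u' v' _ IH1 _ IH2|
  u v u' v' _ IH1 _ IH2|u v u' v' _ IH1 _ IH2].
- by apply: law_ev; left.
- by apply: law_ev; right.
- exact: ev_all.
- by apply: ev_mono IH => rho ->.
- by apply: ev_mono (ev_and IH1 IH2) => rho [-> ->].
- apply: ev_mono (ev_and IH1 IH2) => rho [h1 h2]; exact: (f_equal2 (mul opsA) h1 h2).
- apply: ev_mono (ev_and IH1 IH2) => rho [h1 h2]; exact: (f_equal2 (ldiv opsA) h1 h2).
- apply: ev_mono (ev_and IH1 IH2) => rho [h1 h2]; exact: (f_equal2 (rdiv opsA) h1 h2).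
Qed.

Lemma ev_repr w : ev (fun rho => eval opsA rho (repr (free_cl w)) = eval opsA rho w).
Proof. by apply: meq_ev; exact: repr_cl. Qed.

(** The pullback to the free loop of congruence modulo A^m of germs; by [congr_normal] the class of
    1 is a normal subloop. *)
Definition rel m (a b : free_moufang) :=
  ev (fun rho => Pow m (eval opsA rho (repr a) - eval opsA rho (repr b))).

Lemma rel_op m op (f : A -> A -> A) a a' b b' :
  (forall rho u v, eval opsA rho (op u v) = f (eval opsA rho u) (eval opsA rho v)) ->
  (forall x x' y y', Pow m (x - x') -> Pow m (y - y') -> tA x -> tA x' -> tA y -> tA y' ->
    Pow m (f x y - f x' y')) ->
  rel m a a' -> rel m b b' -> rel m (free_op op a b) (free_op op a' b').
Proof.
move=> fE hf ha hb.
have t := ev_and (ev_and (ev_tA (repr a)) (ev_tA (repr a'))) (ev_and (ev_tA (repr b)) (ev_tA (repr b'))).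
have r := ev_and (ev_repr (op (repr a) (repr b))) (ev_repr (op (repr a') (repr b'))).
apply: ev_mono (ev_and (ev_and ha hb) (ev_and t r)).
move=> rho [[h1 h2] [[[t1 t2] [t3 t4]] [r1 r2]]].
by rewrite /free_op r1 r2 !fE; exact: hf.
Qed.

Lemma PowN_sub m (x x' : A) : Pow m (x - x') -> Pow m (- x - - x').
Proof. by move=> h; rewrite -opprD; exact: PowN. Qed.

Lemma rel_normal m : normal_subloop [set a : free_moufang | rel m a (one free_ops)].
Proof.
apply: (@congr_normal free_moufang (rel m)).
- by move=> x; apply: ev_all => rho; rewrite subrr; exact: Pow0.
- by move=> x y; apply: ev_mono => rho h; rewrite -opprB; exact: PowN.
- move=> x y z h1 h2; apply: ev_mono (ev_and h1 h2) => rho [k1 k2].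
  by rewrite -(subrK (eval opsA rho (repr y)) (eval opsA rho (repr x))) -addrA; exact: PowD.
- move=> x x' y y' hx hy; split.
  + apply: (rel_op (op := WMul) (f := mulA)) hx hy => [//|*]; exact: mulA_congr.
  + apply: (rel_op (op := WLdiv) (f := ldiv opsA)) hx hy => [//|a a' b b' *].
    by apply: (mulA_congr (x := - a) (x' := - a')); rewrite ?tAN//; exact: PowN_sub.
  + apply: (rel_op (op := WRdiv) (f := rdiv opsA)) hx hy => [//|b b' a a' *].
    by apply: (mulA_congr (y := - a) (y' := - a')); rewrite ?tAN//; exact: PowN_sub.
Qed.

Lemma nAD x y : nA (x + y) <= nA x + nA y.
Proof.
rewrite /Submission.nA !m1E !m2E !m3E !linearD.
have := gnD tb (am mal x) (am mal y).
have := gnD tb (rho mal (am mal x)) (rho mal (am mal y)).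
have := gnD tb (rho mal (rho mal (am mal x))) (rho mal (rho mal (am mal y))).
lra.
Qed.

Lemma rel_one m a : rel m a (one free_ops) -> ev (fun rho => Pow m (eval opsA rho (repr a))).
Proof.
move=> h; apply: ev_mono (ev_and h (ev_repr WOne)) => rho [+ e].
by rewrite [one free_ops]/(free_cl WOne) e /= subr0.
Qed.

Lemma free_commutator a b :
  commutator free_ops a b = free_cl (commutator word_ops (repr a) (repr b)).
Proof.
rewrite -{1}(free_clK a) -{1}(free_clK b) /commutator /inv.
by rewrite [one free_ops]/(free_cl WOne) !free_ldivE !free_mulE.
Qed.

Lemma rel_commutator i j a b : rel i a (one free_ops) -> rel j b (one free_ops) ->
  rel (i + j) (commutator free_ops a b) (one free_ops).
Proof.
move=> /rel_one ha /rel_one hb.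
pose u := repr a; pose v := repr b.
pose w1 := WMul (WLdiv u WOne) (WLdiv v WOne); pose w2 := WMul w1 u.
(* Half of the threshold, so that - x - y is still tiny. *)
have d0 : 0 < eta0 R / 2 by rewrite divr_gt0// eta_gt0.
have t := ev_and (ev_and (ev_small u d0) (ev_small v d0)) (ev_and (ev_tA w1) (ev_tA w2)).
have r := ev_and (ev_repr WOne) (ev_repr (commutator word_ops u v)).
apply: ev_mono (ev_and (ev_and ha hb) (ev_and t r)).
move=> rho [[h1 h2] [[[s1 s2] [t1 t2]] [r1 r2]]].
rewrite free_commutator r2 [one free_ops]/(free_cl WOne) r1.
set x := eval opsA rho u in h1 s1; set y := eval opsA rho v in h2 s2.
have tx : tA x by apply: le_trans s1 _; have := eta_gt0 R; lra.
have ty : tA y by apply: le_trans s2 _; have := eta_gt0 R; lra.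
have e1 : eval opsA rho (WLdiv u WOne) = - x by exact: (mulA0 (tAN tx)).
have e2 : eval opsA rho (WLdiv v WOne) = - y by exact: (mulA0 (tAN ty)).
have e3 : eval opsA rho w1 = mulA (- x) (- y) by exact: (f_equal2 mulA e1 e2).
have e4 : eval opsA rho w2 = mulA (mulA (- x) (- y)) x by exact: (f_equal2 mulA e3 erefl).
have e5 : eval opsA rho (commutator word_ops u v) = mulA (mulA (mulA (- x) (- y)) x) y.
  exact: (f_equal2 mulA e4 erefl).
rewrite e5 [eval opsA rho WOne]/(0 : A) subr0.
rewrite e3 in t1; rewrite e4 in t2.
refine (commutatorA h1 h2 tx ty t1 t2 _).
apply: le_trans (nAD _ _) _; rewrite !nAN; lra.
Qed.

(** By strong induction: the class of 1 is normal and contains every commutator that generates F^k,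
    by [rel_commutator]. *)
Lemma series_rel k : (0 < k)%N ->
  series free_moufang k `<=` [set a | rel k a (one free_ops)].
Proof.
elim/ltn_ind: k => -[//|[|k]] IH _.
  by move=> a _; apply: ev_all => rho; exact: Pow1.
rewrite seriesE// => a; apply; first exact: rel_normal.
move=> c [i /= /andP[i0 ik] [x hx [y hy <-]]].
have -> : k.+2 = (i + (k.+2 - i))%N by lia.
by apply: rel_commutator; [apply: (IH i)|apply: (IH (k.+2 - i)%N)] => //; lia.
Qed.

Lemma malcev_loop_in_G k : (0 < k)%N -> in_NL k br -> in_G k (malcev_loop mal).
Proof.
move=> k0 NL u v [{}u {}v h|w i j hw].
  exact: holds_small (ops_moufang mal h).
rewrite eval_free_gen in hw.
have {hw}hw := ev_and (rel_one (series_rel k0 hw)) (ev_repr w).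
apply: (holds_small (mal := mal)).
pose y := WVar i; pose z := WVar j.
have t := ev_and (ev_and (ev_tA w) (ev_and (ev_tA y) (ev_tA z)))
  (ev_and (ev_and (ev_tA (WMul w y)) (ev_tA (WMul y z))) (ev_tA (WMul w (WMul y z)))).
apply: ev_mono (ev_and hw t) => rho [[hP e] [[t1 [t2 t3]] [[t4 t5] t6]]].
rewrite e in hP.
have E := nuclearA k0 NL hP t1 t2 t3 t4 t5.
have i1 : eval opsA rho (inv word_ops (WMul w (WMul y z))) = - mulA (eval opsA rho w) (mulA (rho i) (rho j)).
  exact: (mulA0 (tAN t6)).
have e1 : eval opsA rho (WMul (WMul w y) z) = mulA (eval opsA rho w) (mulA (rho i) (rho j)).
  exact: E.
apply: etrans (f_equal2 mulA e1 i1) _.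
have := mulAK t6 (tA0 mal).
by rewrite (mulA0 (tAN t6)); apply; exact: tAN.
Qed.

End Membership.

Theorem part_ii (R : realType) k (A : vectType R) (br : A -> A -> A) : (2 <= k)%N ->
  in_NL k br -> exists L : local_loop R, in_G k L /\ is_tangent_algebra L br.
Proof.
move=> k2 NL; have [mal _] := NL; exists (malcev_loop mal).
by split; [apply: malcev_loop_in_G NL; exact: ltnW|exact: malcev_loop_tangent].
Qed.

(** * Multilinear leading terms of analytic functions *)

Section LeadingTerm.
Variables (R : realType) (p n : nat).

Lemma absumZ (I : choiceType) (a : I -> R) K c : absum a K -> absum (fun i => c * a i) (`|c| * K).
Proof.
move=> aK t ut; under eq_bigr do rewrite normrM.
by rewrite -mulr_sumr ler_wpM2l//; exact: aK.
Qed.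

Notation X := ('I_p * 'I_n)%type.
Implicit Types (w : seq X) (u v : X -> R) (l : 'I_p).

Definition meets w l := has (fun x : X => x.1 == l) w.
Definition covers w := all (meets w) (enum 'I_p).

Lemma meetsE w l : meets w l = (l \in map fst w).
Proof.
elim: w => //= x w IH; rewrite /meets /= inE -IH eq_sym; reflexivity.
Qed.

Lemma mon_meets v l w :
  mon (fun x => if x.1 == l then 0 else v x) w = if meets w l then 0 else mon v w.
Proof.
rewrite /mon; elim: w => [|x w IH]; first by rewrite !big_nil.
rewrite !big_cons IH /meets /= -/(meets w l).
by case: eqP => //= _; rewrite ?mul0r//; case: meets; rewrite ?mulr0.
Qed.

(** One factor is taken out for each index of [ls], and the remaining ones are bounded by M. *)
Lemma prod_cover (N : 'I_p -> R) M (ls s : seq 'I_p) : (forall l, 0 <= N l) ->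
  (forall l, N l <= M) -> uniq ls -> {subset ls <= s} ->
  \prod_(l <- s) N l <= \prod_(l <- ls) N l * M ^+ (size s - size ls).
Proof.
move=> N0 NM; elim: ls s => [|l ls IH] s /=.
  move=> _ _; rewrite big_nil mul1r subn0; elim: s => [|l s IH]; first by rewrite big_nil.
  rewrite big_cons exprS; apply: ler_pM => //.
  by apply: prodr_ge0.
move=> /andP[lls uls] sub; have ls_ : l \in s by apply: sub; rewrite mem_head.
rewrite (perm_big _ (perm_to_rem ls_)) /= !big_cons -mulrA ler_wpM2l//.
have := IH (rem l s) uls; rewrite size_rem//.
have -> : ((size s).-1 - size ls = size s - (size ls).+1)%N by lia.
apply=> x xls; have xs : x \in s by apply: sub; rewrite inE xls orbT.
have := perm_mem (perm_to_rem ls_) x; rewrite xs inE => /esym/predU1P[xl|//].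
by rewrite -xl xls in lls.
Qed.

Lemma mon_cover u (N : 'I_p -> R) M w : (forall l, 0 <= N l) -> (forall l, N l <= M) ->
  (forall x, `|u x| <= N x.1) -> covers w ->
  `|mon u w| <= \prod_l N l * M ^+ (size w - p).
Proof.
move=> N0 NM uN /allP cw.
have h : `|mon u w| <= \prod_(l <- map fst w) N l.
  rewrite big_map /mon; elim: (w) => [|x w' IH]; first by rewrite !big_nil normr1.
  by rewrite !big_cons normrM ler_pM.
apply: le_trans h _.
have sub : {subset enum 'I_p <= map fst w} by move=> l lp; rewrite -meetsE; exact: cw.
have := prod_cover N0 NM (enum_uniq _) sub.
by rewrite size_map size_enum_ord big_enum.
Qed.

Lemma covers_size w : covers w -> (p <= size w)%N.
Proof.
move=> /allP cw; have h : (size (enum 'I_p) <= size (map fst w))%N.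
  by apply: uniq_leq_size (enum_uniq _) _ => l lp; rewrite -meetsE; exact: cw.
by move: h; rewrite size_map size_enum_ord.
Qed.

Lemma covers_uniq w : covers w -> size w = p -> uniq (map fst w).
Proof.
move=> /allP cw wp; apply: (@leq_size_uniq _ (enum 'I_p)).
- exact: enum_uniq.
- by move=> l lp; rewrite -meetsE; exact: cw.
- exact: eq_leq (etrans (size_map _ _) (etrans wp (esym (size_enum_ord p)))).
Qed.

Lemma mon_linear u u' u'' l a w : (forall x, x.1 != l -> u x = u' x /\ u x = u'' x) ->
  (forall x, x.1 = l -> u x = a * u' x + u'' x) -> uniq (map fst w) ->
  (l \notin map fst w -> mon u w = mon u' w /\ mon u w = mon u'' w) /\
  (l \in map fst w -> mon u w = a * mon u' w + mon u'' w).
Proof.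
move=> off on; rewrite /mon; elim: w => [|x w IH] /=; first by rewrite !big_nil.
move=> /andP[xw uw]; have [IH1 IH2] := IH uw; rewrite !big_cons !inE; split.
  rewrite negb_or eq_sym => /andP[/off[e1 e2] /IH1[e3 e4]].
  by rewrite -e1 -e2 -e3 -e4.
move=> /predU1P[xl|lw].
  rewrite (on x)//; move: xw; rewrite -xl => /IH1[e1 e2].
  by rewrite -e1 -e2 mulrDl mulrA.
have xl : x.1 != l by apply/eqP => xl; rewrite xl lw in xw.
by have [e1 e2] := off _ xl; rewrite (IH2 lw) -e1 -e2 mulrDr mulrCA.
Qed.

(** The variables come in p blocks and F vanishes with any block, so only monomials meeting every
    block matter. Those of degree p meet each block once and form the p-linear part; a longer one
    contains a further factor, bounded by the sum of the sizes of the blocks. *)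
Lemma leading_term (F : (X -> R) -> R) r K : 0 < r -> Hs r F K ->
  (forall u l, (forall x, `|u x| <= r) -> (forall x, x.1 = l -> u x = 0) -> F u = 0) ->
  exists (Lam : (X -> R) -> R) (C : R),
  [/\ 0 <= C,
    forall u u' u'' l a, (forall x, x.1 != l -> u x = u' x /\ u x = u'' x) ->
      (forall x, x.1 = l -> u x = a * u' x + u'' x) -> Lam u = a * Lam u' + Lam u'',
    forall u (N : 'I_p -> R), (forall x, `|u x| <= N x.1) -> (forall l, 0 <= N l) ->
      \sum_l N l <= r -> `|Lam u| <= C * \prod_l N l &
    forall u (N : 'I_p -> R), (forall x, `|u x| <= N x.1) -> (forall l, 0 <= N l) ->
      \sum_l N l <= r -> `|F u - Lam u| <= C * (\prod_l N l * \sum_l N l)].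
Proof.
move=> r0 [c [w [cK cF]]] F0; have r0' := ltW r0.
(* One block at a time: the series at [u] with block [l] set to zero has sum 0, and subtracting it
   removes exactly the monomials that miss block [l]. *)
have cov u (ls : seq 'I_p) : (forall x, `|u x| <= r) ->
    hasum (fun i => if all (meets (w i)) ls then c i * mon u (w i) else 0) (F u).
  move=> ur; elim: ls u ur => [|l ls IH] u ur /=; first exact: cF.
  pose u0 x := if x.1 == l then 0 else u x.
  have u0r x : `|u0 x| <= r by rewrite /u0; case: ifP; rewrite ?normr0.
  have Fu0 : F u0 = 0 by apply: (F0 _ l) => // x xl; rewrite /u0 xl eqxx.
  have := hasumB (IH u ur) (IH u0 u0r); rewrite Fu0 subr0; apply: eq_hasum => // i.
  rewrite mon_meets; case: (all _ _); case: (meets _ _) => /=;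
    by rewrite ?mulr0 ?subr0 ?subrr.
pose lead u i := if covers (w i) && (size (w i) == p) then c i * mon u (w i) else 0.
have K0 : 0 <= K := absum_ge0 cK.
have leadK u q : 0 <= q -> (forall x, `|u x| <= q) -> absum (lead u) (`|(q / r) ^+ p| * K).
  move=> q0 uq; apply: absum_le (absumZ ((q / r) ^+ p) cK) => // i.
  rewrite /lead; case: ifP => [/andP[_ /eqP wp]|_]; last by rewrite normr0.
  rewrite [leLHS]normrM; apply: (le_trans (ler_wpM2l (normr_ge0 (c i)) (mon_le (w i) uq))).
  rewrite wp mulrCA expr_div_n divfK; last by rewrite expf_neq0 ?gt_eqF.
  by rewrite [leRHS]normrM (ger0_norm (exprn_ge0 p q0)).
have ex u : exists s, hasum (lead u) s.
  pose q := \sum_x `|u x|; have q0 : 0 <= q by apply: sumr_ge0.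
  apply: hasum_ex (leadK u q q0 _) => x.
  by rewrite /q (bigD1 x)//= lerDl sumr_ge0.
pose Lam u := xget 0 [set s | hasum (lead u) s].
have LamP u : hasum (lead u) (Lam u).
  by rewrite /Lam; case: xgetP => [s _ //|no]; have [s hs] := ex u; case: (no s).
have rp m : 0 < r ^+ m by rewrite exprn_gt0.
exists Lam, (K / r ^+ p + K / r ^+ p.+1); split.
- by rewrite addr_ge0// divr_ge0// ltW.
- move=> u u' u'' l a off on.
  apply: hasum_uniq (LamP u) _; apply: eq_hasum (hasumD (hasumZ a (LamP u')) (LamP u'')) => // i.
  rewrite /lead; case: ifP => [/andP[cw /eqP wp]|_]; last by rewrite mulr0 addr0.
  have [_ ->] := mon_linear off on (covers_uniq cw wp); first by ring.
  by rewrite -meetsE; apply: (allP cw); rewrite mem_enum.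
- move=> u N uN N0 NM; set M := \sum_l N l in NM *.
  have NleM l : N l <= M by rewrite /M (bigD1 l)//= lerDl sumr_ge0.
  have P0 : 0 <= \prod_l N l by apply: prodr_ge0.
  apply: (@le_trans _ _ (K / r ^+ p * \prod_l N l)); last first.
    by rewrite ler_wpM2r// lerDl divr_ge0// ltW.
  apply: hasum_le (LamP u) _; apply: absum_le (absumZ (\prod_l N l / r ^+ p) cK).
    move=> i; rewrite /lead; case: ifP => [/andP[cw /eqP wp]|_]; last by rewrite normr0.
    have := mon_cover N0 NleM uN cw; rewrite wp subnn expr0 mulr1 => h.
    rewrite mulrCA divfK ?gt_eqF// !normrM (ger0_norm P0) ler_wpM2l//.
  by rewrite ger0_norm ?divr_ge0 ?(ltW (rp _))// mulrAC [leRHS]mulrC mulrA.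
- move=> u N uN N0 NM; set M := \sum_l N l in NM *.
  have M0 : 0 <= M by apply: sumr_ge0.
  have NleM l : N l <= M by rewrite /M (bigD1 l)//= lerDl sumr_ge0.
  have P0 : 0 <= \prod_l N l by apply: prodr_ge0.
  have ur x : `|u x| <= r by apply: le_trans (uN x) (le_trans (NleM _) NM).
  have PM : 0 <= \prod_l N l * M by rewrite mulr_ge0.
  apply: (@le_trans _ _ (K / r ^+ p.+1 * (\prod_l N l * M))); last first.
    by rewrite ler_wpM2r// lerDr divr_ge0// ltW.
  have h := hasumB (cov u (enum 'I_p) ur) (LamP u).
  apply: hasum_le h _; apply: absum_le (absumZ (\prod_l N l * M / r ^+ p.+1) cK).
    move=> i; rewrite /lead -/(covers (w i)).
    have [cw|_] /= := boolP (covers (w i)); last by rewrite subrr normr0.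
    case: eqP => [_|wp]; first by rewrite subrr normr0.
    rewrite subr0 mulrCA [leLHS]normrM [leRHS]normrM ler_wpM2l//.
    apply: le_trans (mon_cover N0 NleM uN cw) _.
    have pw : (p < size (w i))%N by rewrite ltn_neqAle covers_size// andbT; apply/eqP => /esym.
    have e : size (w i) = (p.+1 + (size (w i) - p.+1))%N by rewrite subnKC.
    have e' : (size (w i) - p = (size (w i) - p.+1).+1)%N by lia.
    rewrite e'; move: (size (w i) - p.+1)%N e => d e.
    rewrite e exprD mulrA divfK ?gt_eqF// ger0_norm; last first.
      by rewrite mulr_ge0// exprn_ge0.
    rewrite exprS mulrA ler_wpM2l//.
    by rewrite lerXn2r// nnegrE.
  by rewrite ger0_norm ?divr_ge0 ?(ltW (rp _))// mulrAC [leRHS]mulrC mulrA.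
Qed.
End LeadingTerm.

(** * Expressions in the loop operations and their leading terms along curves *)

Section Expressions.
Variables (R : realType) (n : nat).
Notation V := 'rV[R]_n.
Variables (f g : V -> V -> V).

Definition op_analytic (op : V -> V -> V) := op 0 0 = 0 /\ exists2 r, 0 < r & exists K, forall j,
  Hs r (fun v : 'I_(n + n) -> R => op (lsubmx (\row_i v i)) (rsubmx (\row_i v i)) 0 j) K.

Hypotheses (fan : op_analytic f) (gan : op_analytic g).

(** A syntax in which analyticity and smallness of all expressions below are proved by one
    induction. *)
Inductive ex := EV of nat | E0 | EA of ex & ex | ES of ex & ex | EF of ex & ex | EG of ex & ex.

Fixpoint evx (rho : nat -> V) e : V :=
  match e with
  | EV i => rho i
  | E0 => 0
  | EA a b => evx rho a + evx rho b
  | ES a b => evx rho a - evx rho b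
  | EF a b => f (evx rho a) (evx rho b)
  | EG a b => g (evx rho a) (evx rho b)
  end.

Definition ext p (u : 'I_p * 'I_n -> R) (k : nat) : V :=
  if insub k is Some l then \row_i u (l, i) else 0.

Definition HsV p r (F : ('I_p * 'I_n -> R) -> V) K := forall j, Hs r (fun u => F u 0 j) K.

Lemma Hs_minl (X : finType) (r s : R) (F : (X -> R) -> R) K : 0 < r -> 0 < s ->
  Hs r F K -> Hs (Num.min r s) F K.
Proof.
move=> r0 s0 h; have m0 : 0 <= Num.min r s by rewrite ltW// lt_min r0.
have mr : Num.min r s <= r by rewrite ge_min lexx.
first [exact: (Hs_shrink (ltW r0) m0 mr h) | exact: (Hs_shrink m0 mr h)].
Qed.
Lemma Hs_minr (X : finType) (r s : R) (F : (X -> R) -> R) K : 0 < r -> 0 < s ->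
  Hs s F K -> Hs (Num.min r s) F K.
Proof. by move=> r0 s0 h; rewrite minC; exact: Hs_minl. Qed.

(** As [op 0 0 = 0], [Hs_shrink0] makes the outer norm at most [e] on a small polydisc, and the
    inner functions are made to fit into that polydisc. *)
Lemma HsV_op (op : V -> V -> V) p (F G : ('I_p * 'I_n -> R) -> V) : op_analytic op ->
  (forall e, 0 < e -> exists2 r, 0 < r & HsV r F e) ->
  (forall e, 0 < e -> exists2 r, 0 < r & HsV r G e) ->
  forall e, 0 < e -> exists2 r, 0 < r & HsV r (fun u => op (F u) (G u)) e.
Proof.
move=> [op0 [r1 r10 [K HK]]] hF hG e e0.
pose K1 := `|K| + 1; have K10 : 0 < K1 by rewrite ltr_wpDl.
pose r' := Num.min r1 (e * r1 / K1).
have r'0 : 0 < r' by rewrite lt_min r10 divr_gt0// mulr_gt0.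
have r'1 : r' <= r1 by rewrite ge_min lexx.
have [ra ra0 Ha] := hF _ r'0; have [rb rb0 Hb] := hG _ r'0.
pose r := Num.min ra rb; have r0 : 0 < r by rewrite lt_min ra0.
exists r => // j.
have z : (\row_i 0 : 'rV[R]_(n + n)) = 0 by apply/rowP => i; rewrite !mxE.
have H1 : Hs r' (fun v : 'I_(n + n) -> R => op (lsubmx (\row_i v i)) (rsubmx (\row_i v i)) 0 j) e.
  have := Hs_shrink0 (ltW r10) r10 (ltW r'0) r'1 _ (HK j).
  rewrite z !linear0 op0 mxE => /(_ erefl); apply: Hs_mono.
  apply: (@le_trans _ _ (K1 * (r' / r1))).
    by rewrite ler_wpM2r ?divr_ge0 ?(ltW r'0) ?(ltW r10)//; have := ler_norm K; rewrite /K1; lra.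
  rewrite mulrA ler_pdivrMr// mulrC -ler_pdivlMr//.
  by rewrite /r' ge_min lexx orbT.
have phi y : Hs r (fun u => (row_mx (F u) (G u)) 0 y) r'.
  case: (fintype.splitP y) => i yi.
    have -> : y = lshift n i by apply: val_inj.
    apply: (Hs_ext (f := fun u => F u 0 i)) => [u _|]; first by rewrite row_mxEl.
    exact: Hs_minl (Ha i).
  have -> : y = rshift n i by apply: val_inj.
  apply: (Hs_ext (f := fun u => G u 0 i)) => [u _|]; first by rewrite row_mxEr.
  exact: Hs_minr (Hb i).
have := Hs_comp (ltW r0) (ltW r'0) H1 phi; apply: Hs_ext => u _.
have -> : \row_i (row_mx (F u) (G u)) 0 i = row_mx (F u) (G u) by apply/rowP => i; rewrite mxE.
by rewrite row_mxKl row_mxKr.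
Qed.

Lemma HsV_add p (F G : ('I_p * 'I_n -> R) -> V) s :
  (forall e, 0 < e -> exists2 r, 0 < r & HsV r F e) ->
  (forall e, 0 < e -> exists2 r, 0 < r & HsV r G e) ->
  forall e, 0 < e -> exists2 r, 0 < r & HsV r (fun u => if s then F u + G u else F u - G u) e.
Proof.
move=> hF hG e e0; have e20 : 0 < e / 2 by rewrite divr_gt0.
have [ra ra0 Ha] := hF _ e20; have [rb rb0 Hb] := hG _ e20.
pose r := Num.min ra rb; have r0 : 0 < r by rewrite lt_min ra0.
exists r => // j.
have ha : Hs r (fun u => F u 0 j) (e / 2).
  exact: Hs_minl (Ha j).
have hb : Hs r (fun u => G u 0 j) (e / 2).
  exact: Hs_minr (Hb j).
have ee : e / 2 + e / 2 = e by lra.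
rewrite -ee; case: s.
  by apply: Hs_ext (HsD (ltW r0) ha hb) => u _; rewrite mxE.
by apply: Hs_ext (HsB (ltW r0) ha hb) => u _; rewrite !mxE.
Qed.

Lemma HsV_ex p e : forall eps : R, 0 < eps -> exists2 r, 0 < r & HsV r (fun u => evx (@ext p u) e) eps.
Proof.
elim: e => [i||a IHa b IHb|a IHa b IHb|a IHa b IHb|a IHa b IHb] eps e0 /=.
- exists eps => // j; rewrite /ext; case: insubP => [l _ _|_].
    by apply: Hs_ext (Hs_var (ltW e0) (l, j)) => u _; rewrite mxE.
  have := Hs_const ('I_p * 'I_n)%type (ltW e0) 0; rewrite normr0 => /(Hs_mono (ltW e0)).
  by apply: Hs_ext => u _; rewrite mxE.
- exists eps => // j.
  have := Hs_const ('I_p * 'I_n)%type (ltW e0) 0; rewrite normr0 => /(Hs_mono (ltW e0)).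
  by apply: Hs_ext => u _; rewrite mxE.
- exact: (HsV_add true IHa IHb).
- exact: (HsV_add false IHa IHb).
- exact: HsV_op.
- exact: HsV_op.
Qed.

(** O(t^m) for t tending to 0 from the right. *)
Definition O (m : nat) (phi : R -> V) :=
  exists C, exists2 d, 0 < d & forall t, 0 < t -> t <= d -> `|phi t| <= C * t ^+ m.

Fixpoint Os (s : seq (nat * (R -> V))) : Prop :=
  if s is q :: s' then [/\ (0 < q.1)%N, O q.1 q.2 & Os s'] else True.
Definition at_ (s : seq (nat * (R -> V))) (t : R) : seq V := map (fun q => q.2 t) s.
Definition deg (s : seq (nat * (R -> V))) : nat := sumn (map fst s).

Lemma Os_bound s : Os s -> exists C, exists2 d, 0 < d & [/\ 1 <= C & forall t, 0 < t -> t <= d ->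
  \prod_(x <- at_ s t) `|x| <= C * t ^+ deg s /\ forall x, x \in at_ s t -> `|x| <= C * t].
Proof.
elim: s => [|[m phi] s IH] /=.
  exists 1; exists 1 => //; split=> // t _ _; rewrite /at_ /= big_nil expr0 mulr1; split=> //.
move=> [m0 [C [d d0 hC]] /IH [D [e e0 [D1 hD]]]].
pose C' := `|C| + 1; have C'1 : 1 <= C' by rewrite lerDr.
have CC' : C <= C' by have := ler_norm C; rewrite /C'; lra.
exists (C' * D); exists (Num.min 1 (Num.min d e)); first by rewrite !lt_min ltr01 d0.
have CD1 : 1 <= C' * D by rewrite -[1]mulr1 ler_pM.
split=> // t t0; rewrite !le_min => /and3P[t1 td te].
have [hp hx] := hD t t0 te; have tm k : 0 <= t ^+ k by rewrite exprn_ge0// ltW.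
have h1 : `|phi t| <= C' * t ^+ m.
  by apply: le_trans (hC t t0 td) _; rewrite ler_wpM2r.
split.
  rewrite /at_ /= big_cons /deg /= exprD mulrACA; apply: ler_pM => //.
  by apply: prodr_ge0.
move=> x; rewrite /at_ /= inE => /predU1P[->|/hx h].
  apply: le_trans h1 _; apply: ler_pM => //; first by lra.
    by rewrite ler_peMr//; lra.
  by rewrite -[leRHS]expr1; apply: ler_wiXn2l => //; rewrite ltW.
apply: le_trans h _; rewrite ler_wpM2r ?(ltW t0)// ler_peMl//; lra.
Qed.

(** L is p-linear and, on curves of positive orders a_1, ..., a_p, has order a_1 + ... + a_p, while
    E - L has one order more. *)
Definition isLT p (E L : seq V -> V) := [/\
  forall s1 s2 a x y, (size s1 + size s2).+1 = p ->
    L (s1 ++ (a *: x + y) :: s2) = a *: L (s1 ++ x :: s2) + L (s1 ++ y :: s2),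
  forall s, size s = p -> Os s -> O (deg s) (fun t => L (at_ s t)) &
  forall s, size s = p -> Os s -> O (deg s).+1 (fun t => E (at_ s t) - L (at_ s t))].

Lemma LTex p e : (0 < p)%N -> (exists2 d : R, 0 < d & forall s : seq V, size s = p ->
    (forall x, x \in s -> `|x| <= d) -> 0 \in s -> evx (nth 0 s) e = 0) ->
  exists L, isLT p (fun s => evx (nth 0 s) e) L.
Proof.
move=> p0 [d d0 vanish].
have [r r0 Hr] := HsV_ex p e ltr01.
pose r1 := Num.min r d; have r10 : 0 < r1 by rewrite lt_min r0.
have Hr1 j : Hs r1 (fun u => evx (@ext p u) e 0 j) 1.
  exact: Hs_minl (Hr j).
pose sq (u : 'I_p * 'I_n -> R) := mkseq (@ext p u) p.
have extE u : evx (@ext p u) e = evx (nth 0 (sq u)) e.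
  congr (evx _ e); apply/funext => k; have [kp|kp] := ltnP k p; first by rewrite nth_mkseq.
  by rewrite nth_default ?size_mkseq// /ext insubF// ltnNge kp.
have van u l : (forall x, `|u x| <= r1) -> (forall x, x.1 = l -> u x = 0) ->
    evx (@ext p u) e = 0.
  move=> ur ul; rewrite extE; apply: vanish; first by rewrite size_mkseq.
    move=> x /mapP[k]; rewrite mem_iota => /andP[_ kp] ->.
    apply: (rv_norm_le _ (ltW d0)).2 => i; rewrite /ext; case: insubP => [l' _ _|_]; rewrite mxE.
      by apply: le_trans (ur _) _; rewrite ge_min lexx orbT.
    by rewrite normr0 ltW.
  apply/mapP; exists (l : nat); first by rewrite mem_iota /=.
  rewrite /ext; case: insubP => [l' _ ll'|_ //]; apply/rowP => i; rewrite !mxE ul//.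
  exact: val_inj.
have /choice[LC LCP] j : exists LC : (('I_p * 'I_n -> R) -> R) * R,
  [/\ 0 <= LC.2,
    forall u u' u'' l a, (forall x, x.1 != l -> u x = u' x /\ u x = u'' x) ->
      (forall x, x.1 = l -> u x = a * u' x + u'' x) -> LC.1 u = a * LC.1 u' + LC.1 u'',
    forall u (N : 'I_p -> R), (forall x, `|u x| <= N x.1) -> (forall l, 0 <= N l) ->
      \sum_l N l <= r1 -> `|LC.1 u| <= LC.2 * \prod_l N l &
    forall u (N : 'I_p -> R), (forall x, `|u x| <= N x.1) -> (forall l, 0 <= N l) ->
      \sum_l N l <= r1 -> `|evx (@ext p u) e 0 j - LC.1 u| <= LC.2 * (\prod_l N l * \sum_l N l)].
  have vj u l : (forall x, `|u x| <= r1) -> (forall x, x.1 = l -> u x = 0) ->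
      evx (@ext p u) e 0 j = 0.
    by move=> h1 h2; rewrite (van u l h1 h2) mxE.
  by have [L [C h]] := leading_term r10 (Hr1 j) vj; exists (L, C).
pose us (s : seq V) (x : 'I_p * 'I_n) := nth 0 s x.1 0 x.2.
pose L (s : seq V) : V := \row_j (LC j).1 (us s).
pose C := \sum_j (LC j).2.
have LCj0 j : 0 <= (LC j).2 by have [] := LCP j.
have CC j : (LC j).2 <= C by rewrite /C (bigD1 j)//= lerDl sumr_ge0.
have C0 : 0 <= C by apply: sumr_ge0.
pose N (s : seq V) (l : 'I_p) := `|nth 0 s l|.
have N0 s l : 0 <= N s l by rewrite normr_ge0.
have usN s x : `|us s x| <= N s x.1 by exact: rv_coord_le.
have extus s : size s = p -> evx (@ext p (us s)) e = evx (nth 0 s) e.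
  move=> sp; congr (evx _ e); apply/funext => k; rewrite /ext.
  case: insubP => [l _ lk|kp]; first by apply/rowP => i; rewrite mxE /us /= lk.
  by rewrite nth_default// sp leqNgt.
have prodN s : size s = p -> \prod_l N s l = \prod_(x <- s) `|x|.
  by move=> sp; rewrite (big_nth 0) big_mkord sp.
have sumN s : size s = p -> \sum_l N s l = \sum_(x <- s) `|x|.
  by move=> sp; rewrite (big_nth 0) big_mkord sp.
have key s : size s = p -> Os s -> exists D, exists2 d1, 0 < d1 & [/\ 0 <= D & forall t, 0 < t -> t <= d1 ->
    \sum_l N (at_ s t) l <= r1 /\ \prod_l N (at_ s t) l <= D * t ^+ deg s /\
    \sum_l N (at_ s t) l <= D * t].
  move=> sp /Os_bound[D [d1 d10 [D1 hD]]].
  have D0 : 0 < D by apply: lt_le_trans D1.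
  have pD : 0 < p%:R * D by rewrite mulr_gt0// ltr0n.
  have D'0 : 0 <= D + p%:R * D by rewrite addr_ge0// ltW.
  exists (D + p%:R * D); exists (Num.min d1 (r1 / (p%:R * D))).
    by rewrite lt_min d10 divr_gt0.
  split=> // t t0; rewrite le_min => /andP[td tr].
  have [hp hx] := hD t t0 td.
  have sz : size (at_ s t) = p by rewrite size_map.
  have hs : \sum_l N (at_ s t) l <= p%:R * D * t.
    rewrite sumN// big_seq; apply: (@le_trans _ _ (\sum_(x <- at_ s t | x \in at_ s t) D * t)).
      by apply: ler_sum => x xs; exact: hx.
    by rewrite -big_seq big_const_seq count_predT iter_addr_0 sz -[p%:R * D * t]mulrA mulr_natl.
  split; first by apply: le_trans hs _; rewrite mulrC -ler_pdivlMr.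
  split; last by apply: le_trans hs _; apply: ler_wpM2r; rewrite ?(ltW t0)// lerDr ltW.
  rewrite prodN//; apply: le_trans hp _; apply: ler_wpM2r; first by rewrite exprn_ge0// ltW.
  by rewrite lerDl ltW.
exists L; split.
- move=> s1 s2 a x y sp; apply/rowP => j; rewrite !mxE; have [_ lin _ _] := LCP j.
  have s1p : (size s1 < p)%N by rewrite -sp ltnS leq_addr.
  apply: (lin _ _ _ (Ordinal s1p) a) => [[k i] /= kl|[k i] /= ->].
    rewrite /us /= !nth_cat; case: ltnP => // ks1.
    have : (k - size s1)%N != 0%N.
      rewrite subn_eq0 -ltnNge ltn_neqAle ks1 andbT eq_sym.
      by apply: contra kl => /eqP e1; apply/eqP/val_inj.
    by case: (k - size s1)%N.
  by rewrite /us /= !nth_cat ltnn subnn /= !mxE.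
- move=> s sp /(key s sp)[D [d1 d10 [D0 hD]]]; exists (C * D); exists d1 => // t t0 td.
  have [h1 [h2 h3]] := hD t t0 td.
  have tm k : 0 <= t ^+ k by rewrite exprn_ge0// ltW.
  apply: (rv_norm_le _ (mulr_ge0 (mulr_ge0 C0 D0) (tm _))).2 => j; rewrite mxE.
  have [_ _ b _] := LCP j; apply: le_trans (b _ _ (usN _) (N0 _) h1) _.
  by rewrite -mulrA; apply: ler_pM => //; apply: prodr_ge0.
- move=> s sp /(key s sp)[D [d1 d10 [D0 hD]]]; exists (C * (D * D)); exists d1 => // t t0 td.
  have [h1 [h2 h3]] := hD t t0 td.
  have tm k : 0 <= t ^+ k by rewrite exprn_ge0// ltW.
  apply: (rv_norm_le _ (mulr_ge0 (mulr_ge0 C0 (mulr_ge0 D0 D0)) (tm _))).2 => j; rewrite !mxE.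
  have [_ _ _ b] := LCP j; have := b _ _ (usN (at_ s t)) (N0 _) h1.
  rewrite extus ?size_map// => /le_trans; apply.
  rewrite -mulrA; apply: ler_pM => //.
    by rewrite mulr_ge0 ?prodr_ge0 ?sumr_ge0.
  have -> : D * D * t ^+ (deg s).+1 = (D * t ^+ deg s) * (D * t) by rewrite exprS; ring.
  by apply: ler_pM => //; [apply: prodr_ge0|apply: sumr_ge0].
Qed.
End Expressions.

(** * Calculus of orders along curves *)

Section Curves.
Variables (R : realType) (n : nat).
Notation V := 'rV[R]_n.
Notation O := (@O R n).
Implicit Types (P Q S : R -> V) (a b c m : nat).

Definition evt (Q : R -> Prop) := exists2 d, 0 < d & forall t, 0 < t -> t <= d -> Q t.
Lemma evt_and (Q Q' : R -> Prop) : evt Q -> evt Q' -> evt (fun t => Q t /\ Q' t).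
Proof.
move=> [d d0 h] [e e0 k]; exists (Num.min d e); first by rewrite lt_min d0.
by move=> t t0; rewrite le_min => /andP[td te]; split; [exact: h|exact: k].
Qed.
Lemma evt_mono (Q Q' : R -> Prop) : (forall t, Q t -> Q' t) -> evt Q -> evt Q'.
Proof. by move=> h [d d0 k]; exists d => // t t0 td; apply: h; exact: k. Qed.

Lemma O_evt m P Q : evt (fun t => P t = Q t) -> O m P -> O m Q.
Proof.
move=> hPQ [C hC]; exists C; have [d d0 h] := evt_and hPQ hC.
by exists d => // t t0 td; have [<-] := h t t0 td.
Qed.
Lemma O_ext m P Q : (forall t, P t = Q t) -> O m P -> O m Q.
Proof. by move=> h; apply: O_evt; exists 1. Qed.
Lemma OD m P Q : O m P -> O m Q -> O m (fun t => P t + Q t).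
Proof.
move=> [C hC] [D hD]; exists (C + D); have [d d0 h] := evt_and hC hD.
exists d => // t t0 td; have [h1 h2] := h t t0 td.
by rewrite mulrDl; apply: le_trans (ler_normD _ _) (lerD h1 h2).
Qed.
Lemma ON m P : O m P -> O m (fun t => - P t).
Proof. by move=> [C [d d0 h]]; exists C; exists d => // t t0 td; rewrite normrN; exact: h. Qed.
Lemma OB m P Q : O m P -> O m Q -> O m (fun t => P t - Q t).
Proof. by move=> hP hQ; apply: OD => //; exact: ON. Qed.
Lemma O_le m m' P : (m <= m')%N -> O m' P -> O m P.
Proof.
move=> mm [C [d d0 h]]; exists `|C|; exists (Num.min 1 d); first by rewrite lt_min ltr01.
move=> t t0; rewrite le_min => /andP[t1 td]; apply: le_trans (h t t0 td) _.
have t00 := ltW t0.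
apply: (@le_trans _ _ (`|C| * t ^+ m')); first by rewrite ler_wpM2r ?exprn_ge0// ler_norm.
by rewrite ler_wpM2l//; apply: ler_wiXn2l.
Qed.
Lemma O_scal (x : V) : O 1 (fun t => t *: x).
Proof.
exists `|x|; exists 1 => // t t0 _; rewrite normrZ ger0_norm ?(ltW t0)//.
by rewrite expr1 mulrC.
Qed.
Lemma O_mono m (x : V) : O m (fun t => t ^+ m *: x).
Proof.
exists `|x|; exists 1 => // t t0 _; rewrite normrZ ger0_norm ?exprn_ge0 ?(ltW t0)//.
by rewrite mulrC.
Qed.
(** The tool for comparing coefficients: an identity between leading terms holds once its
    homogeneous form along curves t x has one order too many. *)
Lemma O_lead m (x : V) : O m.+1 (fun t => t ^+ m *: x) -> x = 0.
Proof.
move=> [C [d d0 h]]; apply/eqP; rewrite -normr_le0; apply/ler_addgt0Pl => e e0; rewrite addr0.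
pose t := Num.min d (e / (`|C| + 1)).
have C1 : 0 < `|C| + 1 by rewrite ltr_wpDl.
have t0 : 0 < t by rewrite lt_min d0 divr_gt0.
have td : t <= d by rewrite ge_min lexx.
have te : t <= e / (`|C| + 1) by rewrite ge_min lexx orbT.
have := h t t0 td; rewrite normrZ ger0_norm ?exprn_ge0 ?(ltW t0)// exprSr mulrCA.
rewrite ler_pM2l ?exprn_gt0// => /le_trans; apply.
apply: (@le_trans _ _ ((`|C| + 1) * t)).
  by apply: ler_wpM2r; [exact: ltW|have := ler_norm C; lra].
by rewrite mulrC -ler_pdivlMr.
Qed.
Lemma O_small P (e : R) : 0 < e -> O 1 P -> evt (fun t => `|P t| <= e).
Proof.
move=> e0 [C [d d0 h]]; have C1 : 0 < `|C| + 1 by rewrite ltr_wpDl.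
exists (Num.min d (e / (`|C| + 1))); first by rewrite lt_min d0 divr_gt0.
move=> t t0; rewrite le_min => /andP[td te]; apply: le_trans (h t t0 td) _; rewrite expr1.
apply: (@le_trans _ _ ((`|C| + 1) * t)).
  by apply: ler_wpM2r; [exact: ltW|have := ler_norm C; lra].
by rewrite mulrC -ler_pdivlMr.
Qed.

Section LT.
Variables (E L : seq V -> V).
Lemma LT2 : isLT 2 E L -> [/\
  forall k x x' y, L [:: k *: x + x'; y] = k *: L [:: x; y] + L [:: x'; y],
  forall k x y y', L [:: x; k *: y + y'] = k *: L [:: x; y] + L [:: x; y'] &
  forall a b P Q, (0 < a)%N -> (0 < b)%N -> O a P -> O b Q ->
    O (a + b) (fun t => L [:: P t; Q t]) /\
    O (a + b).+1 (fun t => E [:: P t; Q t] - L [:: P t; Q t])].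
Proof.
move=> [lin h1 h2]; split.
- by move=> k x x' y; exact: (lin [::] [:: y]).
- by move=> k x y y'; exact: (lin [:: x] [::]).
move=> a b P Q a0 b0 hP hQ; have s : Os [:: (a, P); (b, Q)] by [].
have e : deg [:: (a, P); (b, Q)] = (a + b)%N by rewrite /deg /= addn0.
by rewrite -e; split; [exact: (h1 [:: (a, P); (b, Q)] erefl s)|exact: (h2 [:: (a, P); (b, Q)] erefl s)].
Qed.
Lemma LT3 : isLT 3 E L -> [/\
  forall k x x' y z, L [:: k *: x + x'; y; z] = k *: L [:: x; y; z] + L [:: x'; y; z],
  forall k x y y' z, L [:: x; k *: y + y'; z] = k *: L [:: x; y; z] + L [:: x; y'; z],
  forall k x y z z', L [:: x; y; k *: z + z'] = k *: L [:: x; y; z] + L [:: x; y; z'] &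
  forall a b c P Q S, (0 < a)%N -> (0 < b)%N -> (0 < c)%N -> O a P -> O b Q -> O c S ->
    O (a + b + c) (fun t => L [:: P t; Q t; S t]) /\
    O (a + b + c).+1 (fun t => E [:: P t; Q t; S t] - L [:: P t; Q t; S t])].
Proof.
move=> [lin h1 h2]; split.
- by move=> k x x' y z; exact: (lin [::] [:: y; z]).
- by move=> k x y y' z; exact: (lin [:: x] [:: z]).
- by move=> k x y z z'; exact: (lin [:: x; y] [::]).
move=> a b c P Q S a0 b0 c0 hP hQ hS; have s : Os [:: (a, P); (b, Q); (c, S)] by [].
have e : deg [:: (a, P); (b, Q); (c, S)] = (a + b + c)%N by rewrite /deg /= addn0 addnA.
by rewrite -e; split; [exact: (h1 [:: (a, P); (b, Q); (c, S)] erefl s)|exact: (h2 [:: (a, P); (b, Q); (c, S)] erefl s)].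
Qed.
Lemma LT4 : isLT 4 E L -> [/\
  forall k x x' y z w, L [:: k *: x + x'; y; z; w] = k *: L [:: x; y; z; w] + L [:: x'; y; z; w],
  forall k x y y' z w, L [:: x; k *: y + y'; z; w] = k *: L [:: x; y; z; w] + L [:: x; y'; z; w],
  forall k x y z z' w, L [:: x; y; k *: z + z'; w] = k *: L [:: x; y; z; w] + L [:: x; y; z'; w],
  forall k x y z w w', L [:: x; y; z; k *: w + w'] = k *: L [:: x; y; z; w] + L [:: x; y; z; w'] &
  forall a b c d P Q S T, (0 < a)%N -> (0 < b)%N -> (0 < c)%N -> (0 < d)%N ->
    O a P -> O b Q -> O c S -> O d T ->
    O (a + b + c + d) (fun t => L [:: P t; Q t; S t; T t]) /\
    O (a + b + c + d).+1 (fun t => E [:: P t; Q t; S t; T t] - L [:: P t; Q t; S t; T t])].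
Proof.
move=> [lin h1 h2]; split.
- by move=> k x x' y z w; exact: (lin [::] [:: y; z; w]).
- by move=> k x y y' z w; exact: (lin [:: x] [:: z; w]).
- by move=> k x y z z' w; exact: (lin [:: x; y] [:: w]).
- by move=> k x y z w w'; exact: (lin [:: x; y; z] [::]).
move=> a b c d P Q S T a0 b0 c0 d0 hP hQ hS hT.
have s : Os [:: (a, P); (b, Q); (c, S); (d, T)] by [].
have e : deg [:: (a, P); (b, Q); (c, S); (d, T)] = (a + b + c + d)%N by rewrite /deg /= addn0 !addnA.
by rewrite -e; split; [exact: (h1 [:: (a, P); (b, Q); (c, S); (d, T)] erefl s)|exact: (h2 [:: (a, P); (b, Q); (c, S); (d, T)] erefl s)].
Qed.
End LT.
End Curves.

(** * The tangent bracket of a local Moufang loop and its identities *)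

Section LeadingTerms.
Variables (R : realType) (n : nat).
Notation V := 'rV[R]_n.
Notation O := (@O R n).
Variables (f g : V -> V -> V) (B : V -> V -> V).
Hypotheses (fan : op_analytic f) (gan : op_analytic g) (Bal : is_algebra B).
Hypothesis laws : exists2 d : R, 0 < d & forall x y z : V, `|x| <= d -> `|y| <= d -> `|z| <= d ->
  [/\ f 0 x = x, f x 0 = x, f x (g x y) = y & f (f x y) (f z x) = f (f x (f y z)) x] /\
  (f x y = f x z -> y = z) /\ (f y x = f z x -> y = z).
Hypothesis fB : exists C, exists2 d : R, 0 < d & forall x y : V, `|x| <= d -> `|y| <= d ->
  `|f x y - (x + y + B x y)| <= C * `|(x, y)| ^+ 3.

Notation evx := (evx f g).
Lemma ex_small p e (eps : R) : 0 < eps -> exists2 d, 0 < d & forall s : seq V, size s = p ->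
  (forall x, x \in s -> `|x| <= d) -> `|evx (nth 0 s) e| <= eps.
Proof.
move=> e0; have [r r0 Hr] := HsV_ex fan gan p e e0; exists r => // s sp hs.
pose us (x : 'I_p * 'I_n) := nth 0 s x.1 0 x.2.
have -> : evx (nth 0 s) e = evx (@ext R n p us) e.
  congr (Submission.evx _ _ _ e); apply/funext => k; rewrite /ext.
  case: insubP => [l _ lk|kp]; first by apply/rowP => i; rewrite mxE /us /= lk.
  by rewrite nth_default// sp leqNgt.
apply: (rv_norm_le _ (ltW e0)).2 => j; apply: (Hs_bound (ltW r0) (Hr j)) => x.
by apply: le_trans (rv_coord_le _ _) _; apply: hs; rewrite mem_nth// sp.
Qed.

Lemma sm_step (d : R) : 0 < d -> exists2 e : R, 0 < e & e <= d /\ forall x y, `|x| <= e -> `|y| <= e ->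
  [/\ `|f x y| <= d, `|g x y| <= d & `|x + y| <= d].
Proof.
move=> d0; have [e1 e10 h1] := ex_small 2 (EF (EV 0) (EV 1)) d0.
have [e2 e20 h2] := ex_small 2 (EG (EV 0) (EV 1)) d0.
exists (Num.min (Num.min e1 e2) (d / 2)); first by rewrite !lt_min e10 e20 divr_gt0.
split; first by rewrite ge_min; apply/orP; right; lra.
move=> x y; rewrite !le_min => /andP[/andP[x1 x2] x3] /andP[/andP[y1 y2] y3]; split.
- by apply: (h1 [:: x; y] erefl) => z; rewrite !inE => /orP[] /eqP ->.
- by apply: (h2 [:: x; y] erefl) => z; rewrite !inE => /orP[] /eqP ->.
- by apply: le_trans (ler_normD _ _) _; lra.
Qed.

(** A ladder of radii: each operation lowers the level by one, and the loop laws hold at level 0. *)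
Lemma sm_exists : exists dl : nat -> R, [/\ forall i, 0 < dl i, forall i, dl i.+1 <= dl i,
  forall i x y, `|x| <= dl i.+1 -> `|y| <= dl i.+1 ->
    [/\ `|f x y| <= dl i, `|g x y| <= dl i & `|x + y| <= dl i] &
  forall x y z : V, `|x| <= dl 0%N -> `|y| <= dl 0%N -> `|z| <= dl 0%N ->
  [/\ f 0 x = x, f x 0 = x, f x (g x y) = y & f (f x y) (f z x) = f (f x (f y z)) x] /\
  (f x y = f x z -> y = z) /\ (f y x = f z x -> y = z)].
Proof.
have [d d0 hd] := laws.
have /choice[st stP] (d' : R) : exists e : R, 0 < d' -> [/\ 0 < e, e <= d' &
    forall x y, `|x| <= e -> `|y| <= e -> [/\ `|f x y| <= d', `|g x y| <= d' & `|x + y| <= d']].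
  have [d'0|_] := ltP 0 d'; last by exists 0.
  by have [e e0 [h1 h2]] := sm_step d'0; exists e.
have pos i : 0 < iter i st d by elim: i => //= i /stP[].
exists (fun i => iter i st d); split=> // i; by have [] := stP _ (pos i).
Qed.
Definition dl := projT1 (cid sm_exists).
(* An inductive wrapper, opaque to [done]. *)
Inductive sm i (x : V) : Prop := Sm of `|x| <= dl i.
Lemma smE i x : sm i x -> `|x| <= dl i. Proof. by case. Qed.
Lemma dl0 i : 0 < dl i. Proof. by rewrite /dl; case: cid => /= ? []. Qed.
Lemma sm_S i x : sm i.+1 x -> sm i x.
Proof.
move=> /smE h; split; apply: le_trans h _.
by rewrite /dl; case: cid => /= ? [_ k _ _]; exact: k.
Qed.
Lemma sm_le i j x : (i <= j)%N -> sm j x -> sm i x.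
Proof.
elim: j => [|j IH]; first by rewrite leqn0 => /eqP ->.
by rewrite leq_eqVlt => /predU1P[->//|ij] /sm_S; exact: IH.
Qed.
Lemma sm_ops i x y : sm i.+1 x -> sm i.+1 y -> [/\ sm i (f x y), sm i (g x y) & sm i (x + y)].
Proof.
move=> /smE hx /smE hy.
suff [h1 h2 h3] : [/\ `|f x y| <= dl i, `|g x y| <= dl i & `|x + y| <= dl i] by split; split.
by move: hx hy; rewrite /dl; case: cid => /= ? [_ _ k _]; exact: k.
Qed.
Lemma smF i x y : sm i.+1 x -> sm i.+1 y -> sm i (f x y). Proof. by move=> hx /(sm_ops hx)[]. Qed.
Lemma smG i x y : sm i.+1 x -> sm i.+1 y -> sm i (g x y). Proof. by move=> hx /(sm_ops hx)[]. Qed.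
Lemma smA i x y : sm i.+1 x -> sm i.+1 y -> sm i (x + y). Proof. by move=> hx /(sm_ops hx)[]. Qed.
Lemma sm0 i : sm i 0. Proof. by split; rewrite normr0 ltW// dl0. Qed.
Lemma lawsP x y z : sm 0 x -> sm 0 y -> sm 0 z ->
  [/\ f 0 x = x, f x 0 = x, f x (g x y) = y & f (f x y) (f z x) = f (f x (f y z)) x] /\
  (f x y = f x z -> y = z) /\ (f y x = f z x -> y = z).
Proof.
move=> /smE hx /smE hy /smE hz.
by move: hx hy hz; rewrite /dl; case: cid => /= ? [_ _ _ h]; exact: h.
Qed.
Lemma f0x x : sm 0 x -> f 0 x = x. Proof. by move=> h; have [[]] := lawsP h h h. Qed.
Lemma fx0 x : sm 0 x -> f x 0 = x. Proof. by move=> h; have [[]] := lawsP h h h. Qed.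
Lemma fg x y : sm 0 x -> sm 0 y -> f x (g x y) = y. Proof. by move=> h k; have [[]] := lawsP h k k. Qed.
Lemma fmoufang x y z : sm 0 x -> sm 0 y -> sm 0 z -> f (f x y) (f z x) = f (f x (f y z)) x.
Proof. by move=> h k l; have [[]] := lawsP h k l. Qed.
Lemma fcanl x y z : sm 0 x -> sm 0 y -> sm 0 z -> f x y = f x z -> y = z.
Proof. by move=> h k l; have [_ []] := lawsP h k l. Qed.
Lemma fcanr x y z : sm 0 x -> sm 0 y -> sm 0 z -> f y x = f z x -> y = z.
Proof. by move=> h k l; have [_ []] := lawsP h k l. Qed.

Ltac vring := apply/rowP => ?; rewrite !mxE; ring.
Ltac smt := repeat first [apply: sm0 | apply: smF | apply: smG | apply: smA];
  match goal with H : sm _ ?u |- sm _ ?v =>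
    constr_eq u v; exact: (sm_le (leq0n _) H) | H : sm _ ?u |- sm _ ?v =>
    constr_eq u v; refine (sm_le _ H); exact: isT end.

(** The Moufang identity with its middle variable y equal to 0. *)
Lemma fflex x z : sm 2 x -> sm 2 z -> f (f x z) x = f x (f z x).
Proof.
move=> hx hz; have h := @fmoufang x 0 z; rewrite fx0 ?f0x in h; try smt.
by rewrite h; try smt.
Qed.

(** For the right inverse y of x, the Moufang identity gives xx = (x(yx))x; cancelling on both sides
    leaves yx = 0. *)
Lemma finv x : sm 5 x -> f (g x 0) x = 0.
Proof.
move=> hx; set y := g x 0; have hy : sm 4 y by rewrite /y; smt.
have xy : f x y = 0 by apply: fg; smt.
have h : f x (f y x) = x.
  have := @fmoufang x y x; rewrite xy f0x; try smt.
  move=> h; apply: (@fcanr x); try smt.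
  by rewrite -h; try smt.
by apply: (@fcanl x); try smt; rewrite h fx0//; smt.
Qed.

Definition dE a b c := ES (EF (EF a b) c) (EF a (EF b c)).
Definition dd x y z := f (f x y) z - f x (f y z).

Lemma dd0 x y z : sm 2 x -> sm 2 y -> sm 2 z -> (x = 0 \/ y = 0 \/ z = 0) -> dd x y z = 0.
Proof.
move=> hx hy hz; rewrite /dd; case=> [->|[->|->]].
- by rewrite !f0x ?subrr//; smt.
- by rewrite fx0 ?f0x ?subrr//; smt.
- by rewrite !fx0 ?subrr//; smt.
Qed.

Lemma LTsm p e : (0 < p)%N -> (forall s, size s = p -> (forall x, x \in s -> sm 6 x) -> 0 \in s ->
  evx (nth 0 s) e = 0) -> exists L, isLT p (fun s => evx (nth 0 s) e) L.
Proof. by move=> p0 h; apply: (LTex fan gan p0); exists (dl 6); [exact: dl0|move=> s sp hs; apply: h sp _ => x /hs k; split]. Qed.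

(** Expressions corrected so as to vanish with any argument. [eGl] and [eGr] measure how far the
    product is from additive in one factor; [eU] and [eW] are (xy)z and x(yz) without their lower
    terms; [eD1] to [eD3] compare (xy)z - x(yz) with a product in one slot, [eD4] with a sum; [eK]
    is the commutator and [eI] the inverse. *)
Definition eB := ES (EF (EV 0) (EV 1)) (EA (EV 0) (EV 1)).
Definition eGl := EA (ES (ES (EF (EA (EV 0) (EV 1)) (EV 2)) (EF (EV 0) (EV 2))) (EF (EV 1) (EV 2))) (EV 2).
Definition eGr := EA (ES (ES (EF (EV 0) (EA (EV 1) (EV 2))) (EF (EV 0) (EV 1))) (EF (EV 0) (EV 2))) (EV 0).
Definition eU := EA (ES (EA (ES (ES (EF (EF (EV 0) (EV 1)) (EV 2)) (EF (EV 0) (EV 2))) (EF (EV 1) (EV 2))) (EV 2))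
  (EF (EV 0) (EV 1))) (EA (EV 0) (EV 1)).
Definition eW := EA (ES (EA (ES (ES (EF (EV 0) (EF (EV 1) (EV 2))) (EF (EV 0) (EV 1))) (EF (EV 0) (EV 2))) (EV 0))
  (EF (EV 1) (EV 2))) (EA (EV 1) (EV 2)).
Definition eD1 := ES (ES (dE (EF (EV 0) (EV 1)) (EV 2) (EV 3)) (dE (EV 0) (EV 2) (EV 3))) (dE (EV 1) (EV 2) (EV 3)).
Definition eD2 := ES (ES (dE (EV 0) (EF (EV 1) (EV 2)) (EV 3)) (dE (EV 0) (EV 1) (EV 3))) (dE (EV 0) (EV 2) (EV 3)).
Definition eD3 := ES (ES (dE (EV 0) (EV 1) (EF (EV 2) (EV 3))) (dE (EV 0) (EV 1) (EV 2))) (dE (EV 0) (EV 1) (EV 3)).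
Definition eD4 := ES (ES (dE (EA (EV 0) (EV 1)) (EV 2) (EV 3)) (dE (EV 0) (EV 2) (EV 3))) (dE (EV 1) (EV 2) (EV 3)).
Definition eK := EF (EF (EF (EG (EV 0) E0) (EG (EV 1) E0)) (EV 0)) (EV 1).
Definition eI := EG (EV 0) E0.

Lemma list2 (Q : seq V -> Prop) : (forall x y, sm 6 x -> sm 6 y -> (x = 0 \/ y = 0) -> Q [:: x; y]) ->
  forall s, size s = 2 -> (forall x, x \in s -> sm 6 x) -> 0 \in s -> Q s.
Proof.
move=> h [|x [|y [|]]]//= _ hs z; apply: h; try by apply: hs; rewrite !inE eqxx ?orbT.
by move: z; rewrite !inE ![0 == _]eq_sym => /orP[] /eqP; tauto.
Qed.
Lemma list3 (Q : seq V -> Prop) : (forall x y z, sm 6 x -> sm 6 y -> sm 6 z ->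
    (x = 0 \/ y = 0 \/ z = 0) -> Q [:: x; y; z]) ->
  forall s, size s = 3 -> (forall x, x \in s -> sm 6 x) -> 0 \in s -> Q s.
Proof.
move=> h [|x [|y [|z [|]]]]//= _ hs zz; apply: h; try by apply: hs; rewrite !inE eqxx ?orbT.
by move: zz; rewrite !inE ![0 == _]eq_sym => /or3P[] /eqP; tauto.
Qed.
Lemma list4 (Q : seq V -> Prop) : (forall x y z w, sm 6 x -> sm 6 y -> sm 6 z -> sm 6 w ->
    (x = 0 \/ y = 0 \/ z = 0 \/ w = 0) -> Q [:: x; y; z; w]) ->
  forall s, size s = 4 -> (forall x, x \in s -> sm 6 x) -> 0 \in s -> Q s.
Proof.
move=> h [|x [|y [|z [|w [|]]]]]//= _ hs zz; apply: h; try by apply: hs; rewrite !inE eqxx ?orbT.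
by move: zz; rewrite !inE ![0 == _]eq_sym => /or4P[] /eqP; tauto.
Qed.

Lemma LB_ex : exists L, isLT 2 (fun s => evx (nth 0 s) eB) L.
Proof.
apply: LTsm => //; apply: list2 => x y hx hy h /=; case: h => ->.
  by rewrite f0x ?add0r ?subrr//; smt.
by rewrite fx0 ?addr0 ?subrr//; smt.
Qed.
Lemma LGl_ex : exists L, isLT 3 (fun s => evx (nth 0 s) eGl) L.
Proof.
apply: LTsm => //; apply: list3 => x y z hx hy hz h /=; case: h => [->|[->|->]].
- by rewrite add0r f0x ?opprB; try smt; rewrite addrAC subrK subrr.
- by rewrite addr0 f0x ?subrr ?sub0r ?addNr//; smt.
- by rewrite !fx0 ?addr0; try smt; vring.
Qed.
Lemma LGr_ex : exists L, isLT 3 (fun s => evx (nth 0 s) eGr) L.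
Proof.
apply: LTsm => //; apply: list3 => x y z hx hy hz h /=; case: h => [->|[->|->]].
- by rewrite !f0x ?addr0; try smt; vring.
- by rewrite add0r fx0; try smt; rewrite addrAC subrK subrr.
- by rewrite addr0 fx0 ?subrr ?sub0r ?addNr//; smt.
Qed.
Lemma LU_ex : exists L, isLT 3 (fun s => evx (nth 0 s) eU) L.
Proof.
apply: LTsm => //; apply: list3 => x y z hx hy hz h /=; case: h => [->|[->|->]].
- by rewrite !f0x ?add0r; try smt; vring.
- by rewrite !fx0 ?f0x ?addr0; try smt; vring.
- by rewrite !fx0 ?addr0; try smt; vring.
Qed.
Lemma LW_ex : exists L, isLT 3 (fun s => evx (nth 0 s) eW) L.
Proof.
apply: LTsm => //; apply: list3 => x y z hx hy hz h /=; case: h => [->|[->|->]].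
- by rewrite !f0x ?add0r; try smt; vring.
- by rewrite !fx0 ?f0x ?add0r; try smt; vring.
- by rewrite !fx0 ?addr0; try smt; vring.
Qed.

Ltac ddz := repeat (rewrite (@dd0 _ _ _); [|by smt|by smt|by smt|by tauto]).

Lemma LD_ex e : e = eD1 \/ e = eD2 \/ e = eD3 \/ e = eD4 ->
  exists L, isLT 4 (fun s => evx (nth 0 s) e) L.
Proof.
move=> he; apply: LTsm => //; apply: list4 => x y z w hx hy hz hw h.
case: he => [->|[->|[->|->]]].
- change (dd (f x y) z w - dd x z w - dd y z w = 0); case: h => [->|[->|[->|->]]].
  + by rewrite f0x ?(@dd0 0) ?subr0 ?subrr//; try smt; tauto.
  + by rewrite fx0 ?(@dd0 0) ?subr0 ?subrr//; try smt; tauto.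
  + by rewrite !(@dd0 _ 0) ?subr0//; try smt; tauto.
  + by rewrite !(@dd0 _ _ 0) ?subr0//; try smt; tauto.
- change (dd x (f y z) w - dd x y w - dd x z w = 0); case: h => [->|[->|[->|->]]].
  + by rewrite !(@dd0 0) ?subr0//; try smt; tauto.
  + by rewrite f0x ?(@dd0 _ 0) ?subr0 ?subrr//; try smt; tauto.
  + by rewrite fx0 ?(@dd0 _ 0) ?subr0 ?subrr//; try smt; tauto.
  + by rewrite !(@dd0 _ _ 0) ?subr0//; try smt; tauto.
- change (dd x y (f z w) - dd x y z - dd x y w = 0); case: h => [->|[->|[->|->]]].
  + by rewrite !(@dd0 0) ?subr0//; try smt; tauto.
  + by rewrite !(@dd0 _ 0) ?subr0//; try smt; tauto.
  + by rewrite f0x ?(@dd0 _ _ 0) ?subr0 ?subrr//; try smt; tauto.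
  + by rewrite fx0 ?(@dd0 _ _ 0) ?subr0 ?subrr//; try smt; tauto.
- change (dd (x + y) z w - dd x z w - dd y z w = 0); case: h => [->|[->|[->|->]]].
  + by rewrite add0r ?(@dd0 0) ?subr0 ?subrr//; try smt; tauto.
  + by rewrite addr0 ?(@dd0 0) ?subr0 ?subrr//; try smt; tauto.
  + by rewrite !(@dd0 _ 0) ?subr0//; try smt; tauto.
  + by rewrite !(@dd0 _ _ 0) ?subr0//; try smt; tauto.
Qed.

Lemma g00 : g 0 0 = 0. Proof. by case: gan. Qed.
Lemma LK_ex : exists L, isLT 2 (fun s => evx (nth 0 s) eK) L.
Proof.
apply: LTsm => //; apply: list2 => x y hx hy h /=; case: h => ->.
  by rewrite g00 f0x ?fx0 ?finv//; smt.
by rewrite g00 !fx0 ?finv//; smt.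
Qed.
Lemma LI_ex : exists L, isLT 1 (fun s => evx (nth 0 s) eI) L.
Proof.
apply: LTsm => // -[|x [|]]//= _ _; rewrite inE => /eqP <-; exact: g00.
Qed.

Lemma lin0 (F : V -> V) : (forall k x x', F (k *: x + x') = k *: F x + F x') -> F 0 = 0.
Proof. by move=> h; have := linear0 (mklin h). Qed.
Lemma linZ (F : V -> V) : (forall k x x', F (k *: x + x') = k *: F x + F x') ->
  forall k x, F (k *: x) = k *: F x.
Proof. by move=> h k x; have := linearZZ (mklin h) k x. Qed.
Lemma linB (F : V -> V) : (forall k x x', F (k *: x + x') = k *: F x + F x') ->
  forall x y, F (x - y) = F x - F y.
Proof. by move=> h x y; have := linearB (mklin h) x y. Qed.
Lemma lead_eq m (phi : R -> V) v : O m.+1 phi -> (forall t, phi t = t ^+ m *: v) -> v = 0.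
Proof. by move=> h e; apply: (@O_lead R n m); apply: O_ext h. Qed.
Lemma O_sm i P : O 1 P -> evt (fun t => sm i (P t)).
Proof. by move=> h; apply: evt_mono (O_small (dl0 i) h) => t k; split. Qed.

Definition LB := projT1 (cid LB_ex).
Lemma LBP : isLT 2 (fun s => evx (nth 0 s) eB) LB. Proof. exact: projT2 (cid LB_ex). Qed.

Lemma LB_B x y : LB [:: x; y] = B x y.
Proof.
have [l1 l2 h] := LT2 LBP.
have [_ H1] := h 1%N 1%N _ _ isT isT (O_scal x) (O_scal y).
have H2 : O 3 (fun t => f (t *: x) (t *: y) - (t *: x + t *: y + B (t *: x) (t *: y))).
  have [C [d d0 hC]] := fB.
  have [e e0 he] := evt_and (O_small d0 (O_scal x)) (O_small d0 (O_scal y)).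
  exists (C * `|(x, y)| ^+ 3); exists e => // t t0 te; have [hx hy] := he t t0 te.
  apply: le_trans (hC _ _ hx hy) _.
  have -> : (t *: x, t *: y) = t *: (x, y) by [].
  by rewrite normrZ exprMn (ger0_norm (ltW t0)) mulrCA mulrC mulrA.
apply/eqP; rewrite -subr_eq0; apply/eqP; apply: (lead_eq (m := 2) (OB H2 H1)) => t.
rewrite /= (linZ (fun k a b => l1 k a b _)) (linZ (fun k a b => l2 k _ a b)).
rewrite (brZl Bal) (brZr Bal); vring.
Qed.

Lemma O_B a b P Q : O a P -> O b Q -> (0 < a)%N -> (0 < b)%N -> O (a + b) (fun t => B (P t) (Q t)).
Proof.
move=> hP hQ a0 b0; have [_ _ h] := LT2 LBP; have [h1 _] := h a b P Q a0 b0 hP hQ.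
by apply: O_ext h1 => t; rewrite LB_B.
Qed.

Lemma fexp a b P Q : O a P -> O b Q -> (0 < a)%N -> (0 < b)%N ->
  O (a + b).+1 (fun t => f (P t) (Q t) - (P t + Q t) - B (P t) (Q t)).
Proof.
move=> hP hQ a0 b0; have [_ _ h] := LT2 LBP; have [_ h1] := h a b P Q a0 b0 hP hQ.
by apply: O_ext h1 => t; rewrite LB_B.
Qed.

Lemma O_f P Q : O 1 P -> O 1 Q -> O 1 (fun t => f (P t) (Q t)).
Proof.
move=> hP hQ; have h := fexp hP hQ isT isT; have hB := O_B hP hQ isT isT.
have := OD (OD (O_le (isT : (1 <= 3)%N) h) (O_le (isT : (1 <= 2)%N) hB)) (OD hP hQ).
by apply: O_ext => t; vring.
Qed.

(** The defect of additivity [eGl] has order 1 + a + 1 here, and the product of D and Z is expanded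
    by [fexp]. *)
Lemma f_left a P D Z : O 1 P -> O a D -> O 1 Z -> (0 < a)%N ->
  O a.+2 (fun t => f (P t + D t) (Z t) - f (P t) (Z t) - D t - B (D t) (Z t)).
Proof.
move=> hP hD hZ a0; have [L hL] := LGl_ex; have [_ _ _ h] := LT3 hL.
have [h1 h2] := h 1%N a 1%N P D Z isT a0 isT hP hD hZ.
have e : (1 + a + 1 = a.+2)%N by lia.
rewrite e in h1 h2; have h3 := fexp hD hZ a0 isT; rewrite addn1 in h3.
have := OD (OD (O_le (leqnSn _) h2) h1) h3.
by apply: O_ext => t; rewrite /=; vring.
Qed.
Lemma f_right a P D Z : O 1 P -> O a D -> O 1 Z -> (0 < a)%N ->
  O a.+2 (fun t => f (Z t) (P t + D t) - f (Z t) (P t) - D t - B (Z t) (D t)).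
Proof.
move=> hP hD hZ a0; have [L hL] := LGr_ex; have [_ _ _ h] := LT3 hL.
have [h1 h2] := h 1%N 1%N a Z P D isT isT a0 hZ hP hD.
have e : (1 + 1 + a = a.+2)%N by lia.
rewrite e in h1 h2; have h3 := fexp hZ hD isT a0; rewrite add1n in h3.
have := OD (OD (O_le (leqnSn _) h2) h1) h3.
by apply: O_ext => t; rewrite /=; vring.
Qed.

Definition LU := projT1 (cid LU_ex).
Lemma LUP : isLT 3 (fun s => evx (nth 0 s) eU) LU. Proof. exact: projT2 (cid LU_ex). Qed.
Definition LW := projT1 (cid LW_ex).
Lemma LWP : isLT 3 (fun s => evx (nth 0 s) eW) LW. Proof. exact: projT2 (cid LW_ex). Qed.

Lemma hom3 (E L : seq V -> V) : isLT 3 E L -> forall t x y z,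
  L [:: t *: x; t *: y; t *: z] = t ^+ 3 *: L [:: x; y; z].
Proof.
move=> /LT3[l1 l2 l3 _] t x y z; rewrite (linZ (fun k a b => l1 k a b _ _)).
rewrite (linZ (fun k a b => l2 k _ a b _)) (linZ (fun k a b => l3 k _ _ a b)); vring.
Qed.
Lemma hom4 (E L : seq V -> V) : isLT 4 E L -> forall t x y z w,
  L [:: t *: x; t *: y; t *: z; t *: w] = t ^+ 4 *: L [:: x; y; z; w].
Proof.
move=> /LT4[l1 l2 l3 l4 _] t x y z w; rewrite (linZ (fun k a b => l1 k a b _ _ _)).
rewrite (linZ (fun k a b => l2 k _ a b _ _)) (linZ (fun k a b => l3 k _ _ a b _)).
rewrite (linZ (fun k a b => l4 k _ _ _ a b)); vring.
Qed.

Lemma kappa P Q : O 1 P -> O 1 Q ->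
  O 2 (fun t => f (P t) (Q t) - f (Q t) (P t)) /\
  O 3 (fun t => f (P t) (Q t) - f (Q t) (P t) - (B (P t) (Q t) - B (Q t) (P t))).
Proof.
move=> hP hQ.
have h3 : O 3 (fun t => f (P t) (Q t) - f (Q t) (P t) - (B (P t) (Q t) - B (Q t) (P t))).
  by apply: O_ext (OB (fexp hP hQ isT isT) (fexp hQ hP isT isT)) => t; vring.
split=> //; have := OD (O_le (isT : (2 <= 3)%N) h3) (OB (O_B hP hQ isT isT) (O_B hQ hP isT isT)).
by apply: O_ext => t; vring.
Qed.

(** Exchanging x and y alters the left factor of (xy)z by xy - yx, of order 2, whose effect is given
    by [f_left]. *)
Lemma LU_sym x y z : LU [:: x; y; z] - LU [:: y; x; z] = B (B x y - B y x) z.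
Proof.
have [_ _ _ h] := LT3 LUP; pose X t := t *: x; pose Y t := t *: y; pose Z t := t *: z.
have hX : O 1 X := O_scal x; have hY : O 1 Y := O_scal y; have hZ : O 1 Z := O_scal z.
have [_ u1] := h 1%N 1%N 1%N X Y Z isT isT isT hX hY hZ.
have [_ u2] := h 1%N 1%N 1%N Y X Z isT isT isT hY hX hZ.
have [k2 k3] := kappa hX hY.
have fl := f_left (O_f hY hX) k2 hZ isT.
have b := O_B k3 hZ isT isT.
apply/eqP; rewrite -subr_eq0; apply/eqP.
apply: (lead_eq (m := 3) (OD (OD (OB u2 u1) fl) b)) => t.
rewrite /= (addrC (f (Y t) (X t))) subrK /X /Y /Z !(hom3 LUP).
rewrite !(br_lin Bal); vring.
Qed.
Lemma LW_sym x y z : LW [:: x; y; z] - LW [:: x; z; y] = B x (B y z - B z y).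
Proof.
have [_ _ _ h] := LT3 LWP; pose X t := t *: x; pose Y t := t *: y; pose Z t := t *: z.
have hX : O 1 X := O_scal x; have hY : O 1 Y := O_scal y; have hZ : O 1 Z := O_scal z.
have [_ u1] := h 1%N 1%N 1%N X Y Z isT isT isT hX hY hZ.
have [_ u2] := h 1%N 1%N 1%N X Z Y isT isT isT hX hZ hY.
have [k2 k3] := kappa hY hZ.
have fl := f_right (O_f hZ hY) k2 hX isT.
have b := O_B hX k3 isT isT.
apply/eqP; rewrite -subr_eq0; apply/eqP.
apply: (lead_eq (m := 3) (OD (OD (OB u2 u1) fl) b)) => t.
rewrite /= (addrC (f (Z t) (Y t))) subrK /X /Y /Z !(hom3 LWP).
rewrite !(br_lin Bal); vring.
Qed.

(** The trilinear leading term of (xy)z - x(yz), the ternary operation of the tangent Akivis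
    algebra. *)
Definition A x y z := LU [:: x; y; z] - LW [:: x; y; z].
Lemma A1 k x x' y z : A (k *: x + x') y z = k *: A x y z + A x' y z.
Proof.
have [l _ _ _] := LT3 LUP; have [l' _ _ _] := LT3 LWP.
by rewrite /A l l' scalerBr opprD addrACA.
Qed.
Lemma A2 k x y y' z : A x (k *: y + y') z = k *: A x y z + A x y' z.
Proof.
have [_ l _ _] := LT3 LUP; have [_ l' _ _] := LT3 LWP.
by rewrite /A l l' scalerBr opprD addrACA.
Qed.
Lemma A3 k x y z z' : A x y (k *: z + z') = k *: A x y z + A x y z'.
Proof.
have [_ _ l _] := LT3 LUP; have [_ _ l' _] := LT3 LWP.
by rewrite /A l l' scalerBr opprD addrACA.
Qed.
Lemma A_hom t x y z : A (t *: x) (t *: y) (t *: z) = t ^+ 3 *: A x y z.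
Proof. by rewrite /A (hom3 LUP) (hom3 LWP) scalerBr. Qed.

Lemma O_A a b c P Q S : O a P -> O b Q -> O c S -> (0 < a)%N -> (0 < b)%N -> (0 < c)%N ->
  O (a + b + c) (fun t => A (P t) (Q t) (S t)) /\
  O (a + b + c).+1 (fun t => dd (P t) (Q t) (S t) - A (P t) (Q t) (S t)).
Proof.
move=> hP hQ hS a0 b0 c0; have [_ _ _ hU] := LT3 LUP; have [_ _ _ hW] := LT3 LWP.
have [u1 u2] := hU a b c P Q S a0 b0 c0 hP hQ hS; have [w1 w2] := hW a b c P Q S a0 b0 c0 hP hQ hS.
split; first exact: OB u1 w1.
by apply: O_ext (OB u2 w2) => t; rewrite /A /dd /=; vring.
Qed.
Lemma O_dd P Q S : O 1 P -> O 1 Q -> O 1 S -> O 3 (fun t => dd (P t) (Q t) (S t)).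
Proof.
move=> hP hQ hS; have [h1 h2] := O_A hP hQ hS isT isT isT.
by apply: O_ext (OD h1 (O_le (isT : (3 <= 4)%N) h2)) => t; rewrite addrC subrK.
Qed.

Definition L1 := projT1 (cid (LD_ex (or_introl (erefl eD1)))).
Lemma L1P : isLT 4 (fun s => evx (nth 0 s) eD1) L1. Proof. exact: projT2 (cid _). Qed.
Definition L2 := projT1 (cid (LD_ex (or_intror (or_introl (erefl eD2))))).
Lemma L2P : isLT 4 (fun s => evx (nth 0 s) eD2) L2. Proof. exact: projT2 (cid _). Qed.
Definition L3 := projT1 (cid (LD_ex (or_intror (or_intror (or_introl (erefl eD3)))))).
Lemma L3P : isLT 4 (fun s => evx (nth 0 s) eD3) L3. Proof. exact: projT2 (cid _). Qed.
Definition L4 := projT1 (cid (LD_ex (or_intror (or_intror (or_intror (erefl eD4)))))).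
Lemma L4P : isLT 4 (fun s => evx (nth 0 s) eD4) L4. Proof. exact: projT2 (cid _). Qed.

Lemma O4 (E L : seq V -> V) P Q S T : isLT 4 E L -> O 1 P -> O 1 Q -> O 1 S -> O 1 T ->
  O 5 (fun t => E [:: P t; Q t; S t; T t] - L [:: P t; Q t; S t; T t]).
Proof.
move=> /LT4[_ _ _ _ h] hP hQ hS hT.
by have [] := h 1%N 1%N 1%N 1%N P Q S T isT isT isT isT hP hQ hS hT.
Qed.

(** The five bracketings of wxyz form a cycle of reassociations; the two that happen inside a factor
    contribute B(A(w,x,y), z) and B(w, A(x,y,z)) in degree 4. *)
Lemma pentagon w x y z : L1 [:: w; x; y; z] + L3 [:: w; x; y; z] =
  L2 [:: w; x; y; z] + B (A w x y) z + B w (A x y z).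
Proof.
pose W t := t *: w; pose X t := t *: x; pose Y t := t *: y; pose Z t := t *: z.
have hW : O 1 W := O_scal w; have hX : O 1 X := O_scal x.
have hY : O 1 Y := O_scal y; have hZ : O 1 Z := O_scal z.
have d1 := O_dd hW hX hY; have d2 := O_dd hX hY hZ.
have [_ a1] := O_A hW hX hY isT isT isT; have [_ a2] := O_A hX hY hZ isT isT isT.
have e1 := f_left (O_f hW (O_f hX hY)) d1 hZ isT.
have e2 := f_right (O_f hX (O_f hY hZ)) d2 hW isT.
have b1 := O_B a1 hZ isT isT; have b2 := O_B hW a2 isT isT.
have g1 := O4 L1P hW hX hY hZ; have g2 := O4 L2P hW hX hY hZ; have g3 := O4 L3P hW hX hY hZ.
apply/eqP; rewrite -subr_eq0; apply/eqP.
apply: (lead_eq (m := 4) (OD (OD (OD e1 e2) (OD b1 b2)) (OB (OB g2 g1) g3))) => t.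
have s1 : f (W t) (f (X t) (Y t)) + dd (W t) (X t) (Y t) = f (f (W t) (X t)) (Y t).
  by rewrite /dd addrC subrK.
have s2 : f (X t) (f (Y t) (Z t)) + dd (X t) (Y t) (Z t) = f (f (X t) (Y t)) (Z t).
  by rewrite /dd addrC subrK.
rewrite s1 s2 /= /dd /W /X /Y /Z !(hom4 L1P, hom4 L2P, hom4 L3P) !A_hom.
rewrite !(br_lin Bal); vring.
Qed.

Lemma dd_flex x y : sm 4 x -> sm 4 y -> dd x y x = 0.
Proof. by move=> hx hy; rewrite /dd fflex ?subrr//; smt. Qed.

(** The Moufang identity with flexibility reads (xy)(zx) = x((yz)x), and (yz)x is y(zx) plus an
    associator of order 3 that [f_right] moves out. *)
Lemma M1 P Q S : O 1 P -> O 1 Q -> O 1 S ->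
  O 5 (fun t => dd (P t) (Q t) (S t) - dd (Q t) (S t) (P t) +
    (L3 [:: P t; Q t; S t; P t] - B (P t) (A (Q t) (S t) (P t)))).
Proof.
move=> hP hQ hS.
have d := O_dd hQ hS hP; have [_ a] := O_A hQ hS hP isT isT isT.
have e := f_right (O_f hQ (O_f hS hP)) d hP isT; have b := O_B hP a isT isT.
have gg := O4 L3P hP hQ hS hP.
apply: O_evt (OB (OD e b) gg).
apply: evt_mono (evt_and (O_sm 4 hP) (evt_and (O_sm 4 hQ) (O_sm 4 hS))) => t [sP [sQ sS]].
have s1 : f (Q t) (f (S t) (P t)) + dd (Q t) (S t) (P t) = f (f (Q t) (S t)) (P t).
  by rewrite /dd addrC subrK.
have s2 : f (f (P t) (Q t)) (f (S t) (P t)) = f (P t) (f (f (Q t) (S t)) (P t)).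
  by rewrite fmoufang ?fflex//; smt.
have s3 := dd_flex sP sQ; rewrite /dd in s3.
rewrite s1 /= s2 s3 /dd !(br_lin Bal); vring.
Qed.

Lemma A_cyc x y z : A x y z = A y z x.
Proof.
pose X t := t *: x; pose Y t := t *: y; pose Z t := t *: z.
have hX : O 1 X := O_scal x; have hY : O 1 Y := O_scal y; have hZ : O 1 Z := O_scal z.
have [_ u1] := O_A hX hY hZ isT isT isT; have [_ u2] := O_A hY hZ hX isT isT isT.
have m := O_le (isT : (4 <= 5)%N) (M1 hX hY hZ).
have v := O_mono 4 (L3 [:: x; y; z; x] - B x (A y z x)).
apply/eqP; rewrite -subr_eq0; apply/eqP.
apply: (lead_eq (m := 3) (OB (OD (OB u2 u1) m) v)) => t.
rewrite /X /Y /Z (hom4 L3P) !A_hom !(br_lin Bal); vring.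
Qed.

(** The degree 4 obstruction in [M1] to cyclic symmetry. *)
Definition Qf x y z := L3 [:: x; y; z; x] - B x (A y z x).
Lemma Q_sum x y z : Qf x y z + Qf y z x + Qf z x y = 0.
Proof.
pose X t := t *: x; pose Y t := t *: y; pose Z t := t *: z.
have hX : O 1 X := O_scal x; have hY : O 1 Y := O_scal y; have hZ : O 1 Z := O_scal z.
apply: (lead_eq (m := 4) (OD (OD (M1 hX hY hZ) (M1 hY hZ hX)) (M1 hZ hX hY))) => t.
rewrite /Qf /X /Y /Z !(hom4 L3P) !A_hom !(br_lin Bal); vring.
Qed.
Lemma AZ1 k x y z : A (k *: x) y z = k *: A x y z.
Proof. exact: (linZ (fun k a b => A1 k a b y z)). Qed.
Lemma AZ2 k x y z : A x (k *: y) z = k *: A x y z.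
Proof. exact: (linZ (fun k a b => A2 k x a b z)). Qed.
Lemma AZ3 k x y z : A x y (k *: z) = k *: A x y z.
Proof. exact: (linZ (fun k a b => A3 k x y a b)). Qed.
Lemma AB1 x x' y z : A (x - x') y z = A x y z - A x' y z.
Proof. exact: (linB (fun k a b => A1 k a b y z)). Qed.

(** Adding [M1] over the three rotations shows that the cyclic sum of [Qf] is 0, and [Qf] is
    quadratic in its first argument but linear in the others. *)
Lemma Q0 x y z : Qf x y z = 0.
Proof.
have [l1 l2 l3 l4 _] := LT4 L3P.
(* Doubling x weights the three terms by 4, 2, 2; twice the unweighted relation subtracted leaves 2
   [Qf x y z]. *)
have e : Qf (2%:R *: x) y z + Qf y z (2%:R *: x) + Qf z (2%:R *: x) y =
    4%:R *: Qf x y z + 2%:R *: Qf y z x + 2%:R *: Qf z x y.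
  rewrite /Qf (linZ (fun k a b => l1 k a b _ _ _)) (linZ (fun k a b => l4 k _ _ _ a b)).
  rewrite (linZ (fun k a b => l3 k _ _ a b _)) (linZ (fun k a b => l2 k _ a b _ _)).
  rewrite AZ1 AZ2 AZ3 !(br_lin Bal); vring.
rewrite Q_sum in e; have h := Q_sum x y z.
have e2 : 2%:R *: Qf x y z = 4%:R *: Qf x y z + 2%:R *: Qf y z x + 2%:R *: Qf z x y -
    2%:R *: (Qf x y z + Qf y z x + Qf z x y) by vring.
move: e2; rewrite -e h scaler0 subrr => /eqP; rewrite scaler_eq0 pnatr_eq0 /=.
by move=> /eqP.
Qed.
Lemma L3_Q x y z : L3 [:: x; y; z; x] = B x (A y z x).
Proof. by apply/eqP; rewrite -subr_eq0; apply/eqP; exact: Q0. Qed.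

Lemma dd_cyc P Q S : O 1 P -> O 1 Q -> O 1 S ->
  O 5 (fun t => dd (P t) (Q t) (S t) - dd (Q t) (S t) (P t)).
Proof. by move=> hP hQ hS; apply: O_ext (M1 hP hQ hS) => t; rewrite L3_Q subrr addr0. Qed.

Lemma A_flex x y : A x y x = 0.
Proof.
pose X t := t *: x; pose Y t := t *: y.
have hX : O 1 X := O_scal x; have hY : O 1 Y := O_scal y.
have [_ u] := O_A hX hY hX isT isT isT.
have {}u : O 4 (fun t => - A (X t) (Y t) (X t)).
  apply: O_evt u; apply: evt_mono (evt_and (O_sm 4 hX) (O_sm 4 hY)) => t [sX sY].
  by rewrite dd_flex// sub0r.
by apply: (lead_eq (m := 3) (ON u)) => t; rewrite /X /Y A_hom opprK.
Qed.

(** Rotating the three arguments of the associator costs only order 5 by [dd_cyc], so the defects in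
    different slots have the same leading terms. *)
Lemma L3_L2 x y z u : L3 [:: x; y; z; u] = L2 [:: y; z; u; x].
Proof.
pose X t := t *: x; pose Y t := t *: y; pose Z t := t *: z; pose U t := t *: u.
have hX : O 1 X := O_scal x; have hY : O 1 Y := O_scal y.
have hZ : O 1 Z := O_scal z; have hU : O 1 U := O_scal u; have hF := O_f hZ hU.
have c := OB (OB (dd_cyc hX hY hF) (dd_cyc hX hY hZ)) (dd_cyc hX hY hU).
have g3 := O4 L3P hX hY hZ hU; have g2 := O4 L2P hY hZ hU hX.
apply/eqP; rewrite -subr_eq0; apply/eqP.
apply: (lead_eq (m := 4) (OD (OB g2 g3) c)) => t.
rewrite /= -!/(dd _ _ _) /X /Y /Z /U (hom4 L3P) (hom4 L2P); vring.
Qed.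
Lemma L2_L1 x y z u : L2 [:: y; z; u; x] = L1 [:: z; u; x; y].
Proof.
pose X t := t *: x; pose Y t := t *: y; pose Z t := t *: z; pose U t := t *: u.
have hX : O 1 X := O_scal x; have hY : O 1 Y := O_scal y.
have hZ : O 1 Z := O_scal z; have hU : O 1 U := O_scal u; have hF := O_f hZ hU.
have c := OB (OB (dd_cyc hY hF hX) (dd_cyc hY hZ hX)) (dd_cyc hY hU hX).
have g2 := O4 L2P hY hZ hU hX; have g1 := O4 L1P hZ hU hX hY.
apply/eqP; rewrite -subr_eq0; apply/eqP.
apply: (lead_eq (m := 4) (OD (OB g1 g2) c)) => t.
rewrite /= -!/(dd _ _ _) /X /Y /Z /U (hom4 L1P) (hom4 L2P); vring.
Qed.
Lemma L2_flex x y z : L2 [:: x; y; z; x] = 0.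
Proof.
pose X t := t *: x; pose Y t := t *: y; pose Z t := t *: z.
have hX : O 1 X := O_scal x; have hY : O 1 Y := O_scal y; have hZ : O 1 Z := O_scal z.
have u : O 5 (fun t => - L2 [:: X t; Y t; Z t; X t]).
  apply: O_evt (O4 L2P hX hY hZ hX).
  apply: evt_mono (evt_and (O_sm 5 hX) (evt_and (O_sm 5 hY) (O_sm 5 hZ))) => t [sX [sY sZ]].
  have s4 v : sm 5 v -> sm 4 v by exact: sm_S.
  by rewrite /= -!/(dd _ _ _) !dd_flex ?subr0 ?sub0r//; try (exact: s4); smt.
by apply: (lead_eq (m := 4) (ON u)) => t; rewrite /X /Y /Z (hom4 L2P) opprK.
Qed.

(** The first arguments wx and xw of the associator differ by a curve of order 2, and [eD4] bounds
    the failure of additivity by order 5. *)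
Lemma L1_anti w x y z : L1 [:: w; x; y; z] - L1 [:: x; w; y; z] = A (B w x - B x w) y z.
Proof.
pose W t := t *: w; pose X t := t *: x; pose Y t := t *: y; pose Z t := t *: z.
have hW : O 1 W := O_scal w; have hX : O 1 X := O_scal x.
have hY : O 1 Y := O_scal y; have hZ : O 1 Z := O_scal z.
have [k2 k3] := kappa hW hX; have hP := O_f hX hW.
have [_ _ _ _ h4] := LT4 L4P.
have [e1 e2] := h4 1%N 2 1%N 1%N _ _ _ _ isT isT isT isT hP k2 hY hZ.
have [_ a1] := O_A k2 hY hZ isT isT isT; have [a2 _] := O_A k3 hY hZ isT isT isT.
have g1 := O4 L1P hW hX hY hZ; have g2 := O4 L1P hX hW hY hZ.
apply/eqP; rewrite -subr_eq0; apply/eqP.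
apply: (lead_eq (m := 4) (OD (OB g2 g1) (OD (OD (O_le (isT : (5 <= 6)%N) e2) e1) (OD a1 a2)))) => t.
rewrite /= /dd (addrC (f (X t) (W t))) !(subrK (f (X t) (W t))).
rewrite !AB1 /W /X /Y /Z !(hom4 L1P) !(br_lin Bal).
rewrite !AZ1 !AZ2 !AZ3; vring.
Qed.

Lemma linD (F : V -> V) : (forall k x x', F (k *: x + x') = k *: F x + F x') ->
  forall x y, F (x + y) = F x + F y.
Proof. by move=> h x y; have := linearD (mklin h) x y. Qed.

Lemma A_swap x y z : A x z y = - A x y z.
Proof.
have d u v : A u v v = 0 by rewrite (A_cyc u v v) (A_cyc v v u) A_flex.
have := d x (y + z); rewrite (linD (fun k a b => A2 k _ a b _)) !(linD (fun k a b => A3 k _ _ a b)).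
by rewrite !d add0r addr0 addrC => /eqP; rewrite addr_eq0 => /eqP.
Qed.

Definition bb x y := B x y - B y x.

(** By [L1_anti] the right side is a difference of two values of [L1]. They are found from the
    rotations, flexibility and the pentagon, and are the two halves of the bracket on the left. *)
Lemma bb_A x y z : bb (A x y z) x = A x y (bb x z).
Proof.
have [l1 l2 l3 l4 _] := LT4 L2P.
have e0 : A x y (bb x z) = L1 [:: x; z; x; y] - L1 [:: z; x; x; y].
  by rewrite L1_anti -A_cyc -/(bb x z) A_cyc A_cyc.
have e1 : L1 [:: z; x; x; y] = B x (A x y z) by rewrite -L2_L1 -L3_L2 L3_Q -A_cyc.
(* Polarisation of [L2_flex] in the repeated argument. *)
have pol : L2 [:: y; x; z; x] = - L2 [:: x; x; z; y].
  have := L2_flex (x + y) x z; rewrite (linD (fun k a b => l1 k a b _ _ _)).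
  rewrite !(linD (fun k a b => l4 k _ _ _ a b)) !L2_flex add0r addr0 addrC.
  by move=> /eqP; rewrite addr_eq0 => /eqP.
(* With equal outer arguments the [L2] term vanishes and the [L3] term is one of the two bracket
   terms, so [L1] is the other. *)
have p := pentagon x z y x; rewrite L2_flex add0r L3_Q in p.
have e2 : L1 [:: x; z; y; x] = B (A x z y) x by apply: (addIr (B x (A z y x))); rewrite p.
have e3 : L1 [:: x; z; x; y] = B (A x y z) x.
  rewrite -L2_L1 pol -[L2 [:: x; x; z; y]]L3_L2 L3_L2 L2_L1 e2 A_swap (brNl Bal) opprK.
  by [].
by rewrite e0 e1 e3.
Qed.

(** The Akivis identity: by [LU_sym] and [LW_sym] the Jacobian is the alternating sum of [A] over
    all six permutations, and [A] is alternating. *)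
Lemma jac_A x y z : jac bb x y z = 6%:R *: A x y z.
Proof.
have U a b c : LU [:: a; b; c] = A a b c + LW [:: a; b; c] by rewrite /A subrK.
have s a b c : bb (bb a b) c = LU [:: a; b; c] - LU [:: b; a; c] - (LW [:: c; a; b] - LW [:: c; b; a]).
  by rewrite LU_sym LW_sym.
have p1 : A y z x = A x y z by rewrite -A_cyc.
have p2 : A z x y = A x y z by rewrite (A_cyc x) (A_cyc y).
have p3 : A x z y = - A x y z by exact: A_swap.
have p4 : A z y x = - A x y z by rewrite -p3 (A_cyc x).
have p5 : A y x z = - A x y z by rewrite -p4 -A_cyc.
rewrite /jac !s !U p1 p2 p3 p4 p5; vring.
Qed.

Lemma bb_malcev : is_malcev bb.
Proof.
split.
- split=> x k y z; rewrite /bb !(br_lin Bal); vring.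
- by move=> x; rewrite /bb subrr.
- move=> x y z; rewrite !jac_A -bb_A /bb !(br_lin Bal); vring.
Qed.

Definition K x y := f (f (f (g x 0) (g y 0)) x) y.
Definition LK := projT1 (cid LK_ex).
Lemma LKP : isLT 2 (fun s => evx (nth 0 s) eK) LK. Proof. exact: projT2 (cid LK_ex). Qed.

Lemma O_inv P : O 1 P -> O 1 (fun t => g (P t) 0) /\
  O 3 (fun t => g (P t) 0 + P t - B (P t) (P t)).
Proof.
move=> hP; have [L [_ h1 h2]] := LI_ex.
have s : Os [:: (1%N, P)] by [].
have hi : O 1 (fun t => g (P t) 0).
  have := OD (h1 [:: (1%N, P)] erefl s) (O_le (isT : (1 <= 2)%N) (h2 [:: (1%N, P)] erefl s)).
  by apply: O_ext => t; rewrite addrC subrK.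
split=> //; have e := fexp hP hi isT isT.
have {}e : O 3 (fun t => - (P t + g (P t) 0) - B (P t) (g (P t) 0)).
  apply: O_evt e; apply: evt_mono (O_sm 1 hP) => t sP.
  by rewrite fg ?sub0r//; smt.
have s2 : O 2 (fun t => g (P t) 0 + P t).
  have := OB (ON (O_le (isT : (2 <= 3)%N) e)) (O_B hP hi isT isT).
  by apply: O_ext => t; vring.
have := OB (ON e) (O_B hP s2 isT isT).
by apply: O_ext => t; rewrite !(br_lin Bal); vring.
Qed.

(** The four products in the commutator are expanded to second order, using x^-1 = -x + B(x,x) +
    O(3). *)
Lemma LK_bb x y : LK [:: x; y] = bb x y.
Proof.
have [l1 l2 h] := LT2 LKP.
pose X t := t *: x; pose Y t := t *: y.
have hX : O 1 X := O_scal x; have hY : O 1 Y := O_scal y.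
have [_ k3] := h 1%N 1%N X Y isT isT hX hY.
have [hi ci] := O_inv hX; have [hj cj] := O_inv hY.
pose i t := g (X t) 0; pose j t := g (Y t) 0.
pose P1 t := f (i t) (j t); pose P2 t := f (P1 t) (X t).
have hP1 : O 1 P1 := O_f hi hj; have hP2 : O 1 P2 := O_f hP1 hX.
have e1 := fexp hi hj isT isT; have e2 := fexp hP1 hX isT isT; have e3 := fexp hP2 hY isT isT.
have w23 := isT : (2 <= 3)%N.
have iX : O 2 (fun t => i t + X t).
  by apply: O_ext (OD (O_le w23 ci) (O_B hX hX isT isT)) => t; rewrite subrK.
have jY : O 2 (fun t => j t + Y t).
  by apply: O_ext (OD (O_le w23 cj) (O_B hY hY isT isT)) => t; rewrite subrK.
have P1s : O 2 (fun t => P1 t + X t + Y t).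
  apply: O_ext (OD (OD (O_le w23 e1) (O_B hi hj isT isT)) (OD iX jY)) => t.
  by rewrite /P1 /i /j; vring.
have P2s : O 2 (fun t => P2 t + Y t).
  apply: O_ext (OD (OD (O_le w23 e2) (O_B hP1 hX isT isT)) P1s) => t.
  by rewrite /P2; vring.
have b1 := O_B iX hj isT isT; have b2 := O_B hX jY isT isT.
have b3 := O_B P1s hX isT isT; have b4 := O_B P2s hY isT isT.
apply/eqP; rewrite -subr_eq0; apply/eqP.
apply: (lead_eq (m := 2) (OB (OD (OD (OD e1 e2) (OD e3 (OD ci cj))) (OD (OB b1 b2) (OD b3 b4))) k3)) => t.
rewrite /= -/(i t) -/(j t) -/(P1 t) -/(P2 t) /bb !(br_lin Bal).
rewrite /X /Y (linZ (fun k a b => l1 k a b _)) (linZ (fun k a b => l2 k _ a b)); vring.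
Qed.

Fixpoint Wc t (x : nat -> V) (tau : R) : V :=
  if t is Node l r then K (Wc l x tau) (Wc r (fun i => x (leaves l + i)%N) tau) else tau *: x 0%N.

Lemma leaves_gt0 t : (0 < leaves t)%N.
Proof. by elim: t => //= l hl r hr; rewrite addn_gt0 hl. Qed.

(** By induction on the tree: the commutator of curves of orders i and j has order i + j and the
    bracket of their leading coefficients as leading coefficient. *)
Lemma O_Wc t x : O (leaves t) (Wc t x) /\
  O (leaves t).+1 (fun tau => Wc t x tau - tau ^+ leaves t *: bracket bb t x).
Proof.
elim: t x => [|l IHl r IHr] x /=.
  split; first exact: O_scal.
  by exists 0; exists 1 => // t _ _; rewrite expr1 subrr normr0 mul0r.
set xr := fun i => x (leaves l + i)%N.
have [l1 l2] := IHl x; have [r1 r2] := IHr xr.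
have l0 := leaves_gt0 l; have r0 := leaves_gt0 r.
have [_ _ h] := LT2 LKP; have [h1 h2] := h _ _ _ _ l0 r0 l1 r1.
split.
  apply: O_ext (OD h1 (O_le (leqnSn _) h2)) => t.
  by rewrite addrC subrK.
have m := O_mono (leaves l) (bracket bb l x).
have c1 := O_B l2 r1 isT r0; have c2 := O_B r1 l2 r0 isT.
have c3 := O_B m r2 l0 isT; have c4 := O_B r2 m isT l0.
rewrite addSn in c1; rewrite addnS addnC in c2; rewrite addnS in c3; rewrite addSn addnC in c4.
have := OD h2 (OD (OB c1 c2) (OB c3 c4)); apply: O_ext => t.
rewrite LK_bb /= -/(K _ _) /bb !(br_lin Bal) exprD; vring.
Qed.

(** The order k + 2 coefficient of the vanishing associator is [A] at the bracket, y and z, and six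
    times it is the Jacobian. *)
Lemma A_NL k : (forall t x y z, leaves t = k ->
    evt (fun tau => dd (Wc t x tau) (tau *: y) (tau *: z) = 0)) -> in_NL k bb.
Proof.
move=> hk; split; first exact: bb_malcev.
move=> t tk x y z; rewrite jac_A.
suff -> : A (bracket bb t x) y z = 0 by rewrite scaler0.
have [w1 w2] := O_Wc t x; have t0 := leaves_gt0 t.
have hy : O 1 (fun tau => tau *: y) := O_scal y.
have hz : O 1 (fun tau => tau *: z) := O_scal z.
have [_ a1] := O_A w1 hy hz t0 isT isT.
have [a2 _] := O_A w2 hy hz isT isT isT.
have {}a1 : O (leaves t + 1 + 1).+1 (fun tau => - A (Wc t x tau) (tau *: y) (tau *: z)).
  by apply: O_evt a1; apply: evt_mono (hk t x y z tk) => tau ->; rewrite sub0r.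
have e : ((leaves t).+1 + 1 + 1 = (leaves t + 1 + 1).+1)%N by lia.
rewrite e in a2.
apply: (lead_eq (ON (OD a1 a2))) => tau.
rewrite AB1 !AZ1 !AZ2 !AZ3 !exprD !expr1; vring.
Qed.
End LeadingTerms.

(** * Transfer of the loop operations and laws to a chart at e *)

Section ChartTransfer.
Variables (R : realType) (L : local_loop R).
Notation n := (ldim L).
Notation V := 'rV[R]_n.
Notation e := (one (llops L)).
Variable c : chart R (lman L) n.
Hypotheses (cA : analytic_chart c) (ce : dom c e) (c0 : fwd c e = 0).

(** G is analytic near 0 with value a there, in a form stable under composition: the norm of G - a
    is arbitrarily small on small polydiscs. *)
Definition SV (X : finType) m (G : (X -> R) -> 'rV[R]_m) (a : 'rV[R]_m) :=
  forall eps : R, 0 < eps -> exists2 r, 0 < r & forall j, Hs r (fun u => G u 0 j - a 0 j) eps.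

Lemma SV_comp (X : finType) m l (G : (X -> R) -> 'rV[R]_m) a (F : 'rV[R]_m -> 'rV[R]_l) :
  analytic_at F a -> SV G a -> SV (fun u => F (G u)) (F a).
Proof.
move=> /analytic_Hs[r1 r10 [K HK]] hG eps e0.
pose K1 := `|K| + \sum_j `|F a 0 j| + 1.
have S0 : 0 <= \sum_j `|F a 0 j| by apply: sumr_ge0.
have K10 : 0 < K1 by rewrite /K1; have := normr_ge0 K; lra.
pose r' := Num.min r1 (eps * r1 / K1).
have r'0 : 0 < r' by rewrite lt_min r10 divr_gt0// mulr_gt0.
have r'1 : r' <= r1 by rewrite ge_min lexx.
have [r r0 Hr] := hG _ r'0; exists r => // j.
have z : a + \row_i 0 = a by apply/rowP => i; rewrite !mxE addr0.
have H0 := HsB (ltW r10) (HK j) (Hs_const 'I_m (ltW r10) (F a 0 j)).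
have H1 : Hs r' (fun v : 'I_m -> R => F (a + \row_i v i) 0 j - F a 0 j) eps.
  have := Hs_shrink0 (ltW r10) r10 (ltW r'0) r'1 _ H0.
  rewrite z subrr => /(_ erefl); apply: Hs_mono.
  apply: (@le_trans _ _ (K1 * (r' / r1))).
    apply: ler_wpM2r; first by rewrite divr_ge0 ?(ltW r'0) ?(ltW r10).
    have : `|F a 0 j| <= \sum_j `|F a 0 j| by rewrite (bigD1 j)//= lerDl sumr_ge0.
    have := ler_norm K; rewrite /K1; lra.
  rewrite mulrA ler_pdivrMr// mulrC -ler_pdivlMr//.
  by rewrite /r' ge_min lexx orbT.
have := Hs_comp (ltW r0) (ltW r'0) H1 Hr; apply: Hs_ext => u _.
by congr (F _ 0 j - _); apply/rowP => i; rewrite !mxE addrC subrK.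
Qed.

Lemma SV_row (X : finType) m l (G : (X -> R) -> 'rV[R]_m) (H : (X -> R) -> 'rV[R]_l) a b :
  SV G a -> SV H b -> SV (fun u => row_mx (G u) (H u)) (row_mx a b).
Proof.
move=> hG hH eps e0; have [r r0 Hr] := hG _ e0; have [s s0 Hs'] := hH _ e0.
exists (Num.min r s) => [|y]; first by rewrite lt_min r0.
case: (fintype.splitP y) => i yi.
  have -> : y = lshift l i by apply: val_inj.
  apply: (Hs_ext (f := fun u => G u 0 i - a 0 i)) => [u _|]; first by rewrite !row_mxEl.
  exact: Hs_minl (Hr i).
have -> : y = rshift m i by apply: val_inj.
apply: (Hs_ext (f := fun u => H u 0 i - b 0 i)) => [u _|]; first by rewrite !row_mxEr.
exact: Hs_minr (Hs' i).
Qed.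

Lemma SV_bound (X : finType) m (G : (X -> R) -> 'rV[R]_m) a : SV G a ->
  forall eps : R, 0 < eps -> exists2 r, 0 < r & forall u, (forall x, `|u x| <= r) -> `|G u - a| <= eps.
Proof.
move=> hG eps e0; have [r r0 Hr] := hG _ e0; exists r => // u ur.
apply: (rv_norm_le _ (ltW e0)).2 => j; have := Hs_bound (ltW r0) (Hr j) ur.
by rewrite !mxE.
Qed.

Lemma bwd0 : bwd c 0 = e. Proof. by rewrite -c0 fwdK. Qed.

Lemma near_cont m (h : 'rV[R]_m -> lman L) a (W : set (lman L)) : {for a, continuous h} ->
  nbhs (h a) W -> exists2 d : R, 0 < d & forall x, `|x - a| <= d -> W (h x).
Proof.
move=> ch /ch /nbhs_ballP[d /= d0 hd]; exists (d / 2); first by rewrite divr_gt0.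
move=> x xa; apply: hd; rewrite -ball_normE /= distrC; lra.
Qed.

Lemma near_bwd (W : set (lman L)) : nbhs e W ->
  exists2 d : R, 0 < d & forall x, `|x| <= d -> W (bwd c x).
Proof.
have h : {for (0 : V), continuous (bwd c)} by apply: bwd_cont; rewrite -c0; exact: fwd_cod.
rewrite -bwd0 => hW; have [d d0 hd] := near_cont h hW.
by exists d => // x xd; apply: hd; rewrite subr0.
Qed.

Lemma ops_e : [/\ mul (llops L) e e = e, ldiv (llops L) e e = e & rdiv (llops L) e e = e].
Proof.
have ev u v : loop_law u v -> eval (llops L) (fun=> e) u = eval (llops L) (fun=> e) v.
  by move=> /(@llops_law R L u v)[U nU hU]; apply: hU => _; exact: nbhs_singleton nU.
have m : mul (llops L) e e = e := ev _ _ Law1x.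
by have := ev _ _ LawlM; have := ev _ _ LawMr; rewrite /= m.
Qed.

Notation cop := (coord_op c c c).

(** Analyticity is given in atlas charts around e and carried to [c] by the analytic transitions.
    The second claim holds because products of points near e stay in the domain of [c]. *)
Lemma cop_facts (op : lman L -> lman L -> lman L) :
  op = mul (llops L) \/ op = ldiv (llops L) \/ op = rdiv (llops L) ->
  op_analytic (cop op) /\ exists2 d : R, 0 < d & forall x y : V, `|x| <= d -> `|y| <= d ->
    bwd c (cop op x y) = op (bwd c x) (bwd c y).
Proof.
move=> hop; have opee : op e e = e.
  by have [h1 h2 h3] := ops_e; case: hop => [->|[->|->]].
have := @llops_analytic R L op hop => -[[U0 V0] [/= nU nV] UV].
have [|c1 [c2 [c3 [[a1 a2 a3] [d1 d2] near3 Fa]]]] := UV (e, e).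
  by split; exact: nbhs_singleton.
rewrite /= in d1 d2.
have d3 : dom c3 e by have := nbhs_singleton near3; rewrite /= opee.
pose t1 := fwd c1 \o bwd c; pose t2 := fwd c2 \o bwd c; pose t3 := fwd c \o bwd c3.
have T1 : analytic_at t1 0 by rewrite -c0; exact: (cA a1).1.
have T2 : analytic_at t2 0 by rewrite -c0; exact: (cA a2).1.
have T3 : analytic_at t3 (fwd c3 e) by exact: (cA a3).2.
pose px (u : 'I_(n + n) -> R) : V := lsubmx (\row_i u i).
pose py (u : 'I_(n + n) -> R) : V := rsubmx (\row_i u i).
have Sx : SV px 0.
  move=> eps e0; exists eps => // j; apply: Hs_ext (Hs_var (ltW e0) (lshift n j)) => u _.
  by rewrite !mxE subr0.
have Sy : SV py 0.
  move=> eps e0; exists eps => // j; apply: Hs_ext (Hs_var (ltW e0) (rshift n j)) => u _.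
  by rewrite !mxE subr0.
pose F (v : 'rV[R]_(n + n)) := coord_op c1 c2 c3 op (lsubmx v) (rsubmx v).
have t10 : t1 0 = fwd c1 e by rewrite /t1 /= bwd0.
have t20 : t2 0 = fwd c2 e by rewrite /t2 /= bwd0.
have SR := SV_row (SV_comp T1 Sx) (SV_comp T2 Sy); rewrite t10 t20 in SR.
have F0 : F (row_mx (fwd c1 e) (fwd c2 e)) = fwd c3 e.
  by rewrite /F /coord_op row_mxKl row_mxKr !fwdK// opee.
have SF : SV (fun u => F (row_mx (t1 (px u)) (t2 (py u)))) (fwd c3 e).
  by rewrite -F0; exact: SV_comp Fa SR.
have ST := SV_comp T3 SF.
have t30 : t3 (fwd c3 e) = 0 by rewrite /t3 /= fwdK.
rewrite t30 in ST.
have [m1 m10 h1] := near_bwd (open_nbhs_nbhs (conj (@dom_open _ _ _ c1) d1)).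
have [m2 m20 h2] := near_bwd (open_nbhs_nbhs (conj (@dom_open _ _ _ c2) d2)).
have [[U3 V3] [/= nU3 nV3] UV3] := near3.
have [m3 m30 h3] := near_bwd nU3; have [m4 m40 h4] := near_bwd nV3.
pose m := Num.min (Num.min m1 m2) (Num.min m3 m4).
have m0 : 0 < m by rewrite !lt_min m10 m20 m30.
have E (x y : V) : `|x| <= m -> `|y| <= m ->
    F (row_mx (t1 x) (t2 y)) = fwd c3 (op (bwd c x) (bwd c y)) /\ dom c3 (op (bwd c x) (bwd c y)).
  rewrite !le_min => /andP[/andP[x1 x2] /andP[x3 x4]] /andP[/andP[y1 y2] /andP[y3 y4]].
  split; last by apply: (UV3 (_, _)); split; [exact: h3|exact: h4].
  by rewrite /F /coord_op row_mxKl row_mxKr /t1 /t2 /= !fwdK//; [exact: h2|exact: h1].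
have uxy (u : 'I_(n + n) -> R) q : 0 <= q -> (forall x, `|u x| <= q) -> `|px u| <= q /\ `|py u| <= q.
  by move=> q0 uq; split; apply: (rv_norm_le _ q0).2 => i; rewrite !mxE.
split.
  split; first by rewrite /coord_op bwd0 opee.
  have [r r0 Hr] := ST 1 ltr01; exists (Num.min r m); first by rewrite lt_min r0.
  exists 1 => j; apply: Hs_ext (Hs_minl r0 m0 (Hr j)) => u ur.
  have um x : `|u x| <= m by apply: le_trans (ur x) _; rewrite ge_min lexx orbT.
  have [ux uy] := uxy u m (ltW m0) um; have [EF dF] := E _ _ ux uy.
  by rewrite EF /t3 /= fwdK// mxE subr0.
have b3 : {for fwd c3 e, continuous (bwd c3)} by apply: bwd_cont; exact: fwd_cod.
have nc : nbhs (bwd c3 (fwd c3 e)) (dom c).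
  by rewrite fwdK//; exact: open_nbhs_nbhs (conj (@dom_open _ _ _ c) ce).
have [eps e0 he] := near_cont b3 nc.
have [r r0 Hr] := SV_bound SF e0.
exists (Num.min r m); first by rewrite lt_min r0.
move=> x y hx hy; have [xr xm] : `|x| <= r /\ `|x| <= m.
  by move: hx; rewrite le_min => /andP.
have [yr ym] : `|y| <= r /\ `|y| <= m by move: hy; rewrite le_min => /andP.
have [EF dF] := E x y xm ym.
pose u i := (row_mx x y) 0 i.
have ur i : `|u i| <= r by apply: le_trans (rv_coord_le _ _) _; exact: row_mx_norm (ltW r0) xr yr.
have := Hr u ur; have -> : px u = x by apply/rowP => i; rewrite !mxE /u row_mxEl.
have -> : py u = y by apply/rowP => i; rewrite !mxE /u row_mxEr.
rewrite EF => /he; rewrite fwdK// => dc.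
by rewrite /coord_op fwdK.
Qed.

Definition copsV : loop_ops V := LoopOps (cop (mul (llops L))) (cop (ldiv (llops L)))
  (cop (rdiv (llops L))) 0.

Lemma op_small (op : V -> V -> V) : op_analytic op -> forall eps : R, 0 < eps ->
  exists2 d, 0 < d & forall x y, `|x| <= d -> `|y| <= d -> `|op x y| <= eps.
Proof.
move=> han eps e0; have [d d0 h] := ex_small han han 2 (EF (EV 0) (EV 1)) e0.
exists d => // x y xd yd; apply: (h [:: x; y] erefl) => z.
by rewrite !inE => /orP[] /eqP ->.
Qed.

Lemma eval_bwd w (eps : R) : 0 < eps -> exists2 d, 0 < d & forall rho : nat -> V,
  (forall i, `|rho i| <= d) -> `|eval copsV rho w| <= eps /\
  bwd c (eval copsV rho w) = eval (llops L) (bwd c \o rho) w.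
Proof.
have step (op : lman L -> lman L -> lman L) (u v : word) :
  op = mul (llops L) \/ op = ldiv (llops L) \/ op = rdiv (llops L) ->
  (forall eps : R, 0 < eps -> exists2 d, 0 < d & forall rho : nat -> V,
    (forall i, `|rho i| <= d) -> `|eval copsV rho u| <= eps /\
    bwd c (eval copsV rho u) = eval (llops L) (bwd c \o rho) u) ->
  (forall eps : R, 0 < eps -> exists2 d, 0 < d & forall rho : nat -> V,
    (forall i, `|rho i| <= d) -> `|eval copsV rho v| <= eps /\
    bwd c (eval copsV rho v) = eval (llops L) (bwd c \o rho) v) ->
  forall eps : R, 0 < eps -> exists2 d, 0 < d & forall rho : nat -> V,
    (forall i, `|rho i| <= d) -> `|cop op (eval copsV rho u) (eval copsV rho v)| <= eps /\
    bwd c (cop op (eval copsV rho u) (eval copsV rho v)) =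
      op (eval (llops L) (bwd c \o rho) u) (eval (llops L) (bwd c \o rho) v).
  move=> /cop_facts[han [d1 d10 h1]] hu hv eps' e0.
  have [d2 d20 h2] := op_small han e0; pose m := Num.min d1 d2.
  have m0 : 0 < m by rewrite lt_min d10.
  have [du du0 Hu] := hu _ m0; have [dv dv0 Hv] := hv _ m0.
  exists (Num.min du dv) => [|rho hr]; first by rewrite lt_min du0.
  have [|u1 u2] := Hu rho; first by move=> i; apply: le_trans (hr i) _; rewrite ge_min lexx.
  have [|v1 v2] := Hv rho; first by move=> i; apply: le_trans (hr i) _; rewrite ge_min lexx orbT.
  move: u1 v1; rewrite !le_min => /andP[u1 u3] /andP[v1 v3].
  by split; [exact: h2|rewrite h1// u2 v2].
elim: w eps => [i||u IHu v IHv|u IHu v IHv|u IHu v IHv] eps e0.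
- by exists eps => // rho h; split; [exact: h|].
- by exists 1 => // rho _; rewrite /= normr0 ltW// bwd0.
- by apply: step IHu IHv _ e0; left.
- by apply: step IHu IHv _ e0; right; left.
- by apply: step IHu IHv _ e0; right; right.
Qed.

(** By [eval_bwd] the map [bwd c] intertwines evaluation in coordinates with evaluation in the loop,
    and it has the left inverse [fwd c] near 0. *)
Lemma law_transfer u v : holds_near (llops L) u v -> exists2 d : R, 0 < d & forall rho : nat -> V,
  (forall i, `|rho i| <= d) -> eval copsV rho u = eval copsV rho v.
Proof.
move=> [U nU hU]; have [d1 d10 h1] := near_bwd nU.
have nc : nbhs (0 : V) (cod c).
  by apply: open_nbhs_nbhs; split; [exact: cod_open|rewrite -c0; exact: fwd_cod].
have /nbhs_ballP[r /= r0 hr] := nc.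
have r20 : 0 < r / 2 by rewrite divr_gt0.
have cK (x : V) : `|x| <= r / 2 -> fwd c (bwd c x) = x.
  by move=> xr; apply: bwdK; apply: hr; rewrite -ball_normE /= sub0r normrN; lra.
have [d2 d20 h2] := eval_bwd u r20; have [d3 d30 h3] := eval_bwd v r20.
exists (Num.min d1 (Num.min d2 d3)) => [|rho]; first by rewrite !lt_min d10 d20.
move=> hrho; have hh i : [/\ `|rho i| <= d1, `|rho i| <= d2 & `|rho i| <= d3].
  by have := hrho i; rewrite !le_min => /and3P[].
have [|u1 u2] := h2 rho; first by move=> i; have [] := hh i.
have [|v1 v2] := h3 rho; first by move=> i; have [] := hh i.
rewrite -(cK _ u1) -(cK _ v1) u2 v2; congr (fwd c _); apply: hU => i.
by apply: h1; have [] := hh i.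
Qed.

End ChartTransfer.

(** * Identities of the tangent algebra of a loop in G_k *)

Section TangentIdentities.
Variables (R : realType) (L : local_loop R) (k : nat).
Hypotheses (k2 : (2 <= k)%N) (LG : in_G k L).
Notation n := (ldim L).
Notation V := 'rV[R]_n.
Notation e := (one (llops L)).
Variables (c : chart R (lman L) n) (B : V -> V -> V).
Hypotheses (cA : analytic_chart c) (ce : dom c e) (c0 : fwd c e = 0).
Hypothesis so : second_order (coord_op c c c (mul (llops L))) B.

Notation ops := (copsV c).
Notation f := (coord_op c c c (mul (llops L))).
Notation g := (coord_op c c c (ldiv (llops L))).

Lemma fan : op_analytic f.
Proof. by have [] := cop_facts cA ce c0 (or_introl (erefl (mul (llops L)))). Qed.
Lemma gan : op_analytic g.
Proof. by have [] := cop_facts cA ce c0 (or_intror (or_introl (erefl (ldiv (llops L))))). Qed.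

Let r3 (x y z : V) (i : nat) : V := if i is 0%N then x else if i is 1%N then y else if i is 2%N then z else 0.

Lemma law3 u v : holds_near (llops L) u v -> exists2 d : R, 0 < d & forall x y z : V,
  `|x| <= d -> `|y| <= d -> `|z| <= d -> eval ops (r3 x y z) u = eval ops (r3 x y z) v.
Proof.
move=> /(law_transfer cA ce c0)[d d0 h]; exists d => // x y z hx hy hz; apply: h.
by move=> [|[|[|i]]] //=; rewrite normr0 ltW.
Qed.

Lemma f_laws : exists2 d : R, 0 < d & forall x y z : V, `|x| <= d -> `|y| <= d -> `|z| <= d ->
  [/\ f 0 x = x, f x 0 = x, f x (g x y) = y & f (f x y) (f z x) = f (f x (f y z)) x] /\
  (f x y = f x z -> y = z) /\ (f y x = f z x -> y = z).
Proof.
have [d1 d10 h1] := law3 (@llops_law R L _ _ Law1x); have [d2 d20 h2] := law3 (@llops_law R L _ _ Lawx1).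
have [d3 d30 h3] := law3 (@llops_law R L _ _ LawMl); have [d4 d40 h4] := law3 (@llops_law R L _ _ LawlM).
have [d5 d50 h5] := law3 (@llops_law R L _ _ LawMr).
have [d6 d60 h6] := law3 (LG (G_moufang k LawMoufang)).
exists (Num.min (Num.min d1 (Num.min d2 d3)) (Num.min d4 (Num.min d5 d6))).
  by rewrite !lt_min d10 d20 d30 d40 d50.
move=> x y z; rewrite !le_min => /andP[/and3P[x1 x2 x3] /and3P[x4 x5 x6]].
move=> /andP[/and3P[y1 y2 y3] /and3P[y4 y5 y6]] /andP[/and3P[z1 z2 z3] /and3P[z4 z5 z6]].
split; first split.
- exact: (h1 x y z).
- exact: (h2 x y z).
- exact: (h3 x y z).
- exact: (h6 x y z).
split=> E.
  have e1 := h4 x y z x4 y4 z4; have e2 := h4 x z y x4 z4 y4; rewrite /= in e1 e2.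
  by rewrite -e1 E e2.
have e1 := h5 x y z x5 y5 z5; have e2 := h5 x z y x5 z5 y5; rewrite /= in e1 e2.
by rewrite -e1 E e2.
Qed.

Lemma f_B : exists C, exists2 d : R, 0 < d & forall x y : V, `|x| <= d -> `|y| <= d ->
  `|f x y - (x + y + B x y)| <= C * `|(x, y)| ^+ 3.
Proof.
have [_ [C [[U W] [/= /nbhs_ballP[a /= a0 ha] /nbhs_ballP[b /= b0 hb]] UW]]] := so.
exists C; exists (Num.min a b / 2); first by rewrite divr_gt0// lt_min a0.
move=> x y hx hy; have m0 : 0 < Num.min a b by rewrite lt_min a0.
have ma : Num.min a b <= a by rewrite ge_min lexx.
have mb : Num.min a b <= b by rewrite ge_min lexx orbT.
apply: (UW (x, y)); split; [apply: ha|apply: hb]; rewrite -ball_normE /= sub0r normrN; lra.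
Qed.

(** The commutator word shaped like the tree; the offset [o] gives its leaves the variables o, o +
    1, and so on. *)
Fixpoint cw t o := if t is Node l r
  then commutator word_ops (cw l o) (cw r (o + leaves l)%N) else WVar o.

Lemma cw_series t o : series free_moufang (leaves t) (eval free_ops free_gen (cw t o)).
Proof.
elim: t o => [|l IHl r IHr] o //.
have l0 := leaves_gt0 l; have r0 := leaves_gt0 r.
rewrite seriesE; last by rewrite /=; lia.
move=> N _; apply; exists (leaves l) => /=; first by lia.
exists (eval free_ops free_gen (cw l o)); first exact: IHl.
exists (eval free_ops free_gen (cw r (o + leaves l)%N)); last by [].
by rewrite addKn; exact: IHr.
Qed.

Lemma cw_Wc t o (rho : nat -> V) x tau : (forall i, (i < leaves t)%N -> rho (o + i)%N = tau *: x i) ->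
  eval ops rho (cw t o) = Wc f g t x tau.
Proof.
elim: t o x => [|l IHl r IHr] o x h /=.
  by have := h 0%N isT; rewrite addn0.
rewrite (IHl o x) => [|i il]; last by apply: h => /=; lia.
rewrite (IHr (o + leaves l)%N (fun i => x (leaves l + i)%N)) => [|i ir]; first by [].
by rewrite -addnA; apply: h => /=; lia.
Qed.

(** The commutator word of [t] lies in F^k, so G_k supplies its associator identity, which is read
    in coordinates along curves. *)
Lemma assoc_law t x y z : leaves t = k ->
  evt (fun tau => dd f (Wc f g t x tau) (tau *: y) (tau *: z) = 0).
Proof.
(* The word uses the variables 0 to k - 1, so k and k + 1 are free for y and z. *)
move=> tk; pose w := cw t 0; pose y' := WVar k; pose z' := WVar k.+1.
have gl : G_law k (associator word_ops w y' z') WOne.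
  by apply: G_assoc; rewrite -{1}tk; exact: cw_series.
have [d1 d10 h1] := law_transfer cA ce c0 (LG gl).
have [d d0 hd] := f_laws.
have [d2 d20 h2] := eval_bwd cA ce c0 (WMul (WMul w y') z') d0.
have [d3 d30 h3] := eval_bwd cA ce c0 (WMul w (WMul y' z')) d0.
have [d4 d40 h4] := eval_bwd cA ce c0 (inv word_ops (WMul w (WMul y' z'))) d0.
pose m := Num.min (Num.min d1 d2) (Num.min d3 d4).
have m0 : 0 < m by rewrite !lt_min d10 d20 d30.
pose X i := if (i < k)%N then x i else if i == k then y else z.
pose M := \sum_(i < k) `|x i| + `|y| + `|z| + 1.
have S0 : 0 <= \sum_(i < k) `|x i| by apply: sumr_ge0.
have M0 : 0 < M by rewrite /M; have := normr_ge0 y; have := normr_ge0 z; lra.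
have XM i : `|X i| <= M.
  rewrite /X; have := normr_ge0 y; have := normr_ge0 z.
  case: ltnP => ik; last by case: ifP; rewrite /M; lra.
  have : `|x (Ordinal ik)| <= \sum_(i < k) `|x i| by rewrite (bigD1 (Ordinal ik))//= lerDl sumr_ge0.
  by rewrite /M /=; lra.
exists (m / M); first by rewrite divr_gt0.
move=> tau t0 tm; pose rho i := tau *: X i.
have rm i : `|rho i| <= m.
  rewrite normrZ ger0_norm ?(ltW t0)//; apply: (@le_trans _ _ (tau * M)).
    by rewrite ler_wpM2l// ltW.
  by rewrite -ler_pdivlMr.
have rd i : [/\ `|rho i| <= d1, `|rho i| <= d2, `|rho i| <= d3 & `|rho i| <= d4].
  by have := rm i; rewrite !le_min => /andP[/andP[] ? ? /andP[]].
have [|p1 _] := h2 rho; first by move=> i; have [] := rd i.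
have [|p2 _] := h3 rho; first by move=> i; have [] := rd i.
have [|p3 _] := h4 rho; first by move=> i; have [] := rd i.
have E : eval ops rho (associator word_ops w y' z') = 0 by apply: h1 => i; have [] := rd i.
have W : eval ops rho w = Wc f g t x tau.
  by apply: cw_Wc => i; rewrite tk add0n /rho /X => ->.
have ry : rho k = tau *: y by rewrite /rho /X ltnn eqxx.
have rz : rho k.+1 = tau *: z.
  by rewrite /rho /X ltnNge leqnSn /= gtn_eqF.
rewrite /= W ry rz in p1 p2 p3 E.
set P := f (f _ _) _ in p1 E; set Q := f _ (f _ _) in p2 p3 E.
rewrite /dd -/P -/Q; apply/eqP; rewrite subr_eq0; apply/eqP.
have n0 : `|(0 : V)| <= d by rewrite normr0 ltW.
(* The law says P Q^-1 = e, and Q Q^-1 = e as well; right cancellation gives P = Q. *)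
have [[_ _ F _] _] := hd Q 0 0 p2 n0 n0.
have [_ [_ can]] := hd (g Q 0) P Q p3 p1 p2.
by apply: can; rewrite E F.
Qed.

Lemma tangent_NL : in_NL k (bb B).
Proof.
have [Bal _] := so.
exact: (A_NL fan gan Bal f_laws f_B assoc_law).
Qed.
End TangentIdentities.

(** The identities hold for the bracket of the coordinate space and are pulled back along the
    injective homomorphism [T]. *)
Theorem part_i (R : realType) k (L : local_loop R) (A : vectType R) (br : A -> A -> A) : (2 <= k)%N ->
  in_G k L -> is_tangent_algebra L br -> in_NL k br.
Proof.
move=> k2 LG [c [B [T [[cA ce c0] so [T' TK _] TB]]]].
have [[Bal Balt Bmal] NL] := tangent_NL k2 LG cA ce c0 so.
have Ti : injective T := can_inj TK.
have TJ x y z : T (jac br x y z) = jac (bb B) (T x) (T y) (T z).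
  by rewrite /jac !linearD /= !TB.
have Tb t x : T (bracket br t x) = bracket (bb B) t (T \o x).
  elim: t x => //= l IHl r IHr x; rewrite TB.
  exact: (f_equal2 (bb B) (IHl x) (IHr _)).
split; last first.
  by move=> t tk x y z; apply: Ti; rewrite TJ Tb linear0 NL.
split.
- split=> x a y z; apply: Ti; rewrite linearP !TB -!/(bb B _ _) linearP.
    by rewrite (brDr Bal) (brZr Bal).
  by rewrite (brDl Bal) (brZl Bal).
- by move=> x; apply: Ti; rewrite TB linear0 subrr.
- move=> x y z; apply: Ti; have eb a b : T (br a b) = bb B (T a) (T b) := TB a b.
  by rewrite eb TJ TJ eb; exact: Bmal.
Qed.

Theorem proposition1 (R : realType) (k : nat) (hk : (2 <= k)%N) :
  (forall (L : local_loop R) (A : vectType R) (br : A -> A -> A),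
     in_G k L -> is_tangent_algebra L br -> in_NL k br)
  /\
  (forall (A : vectType R) (br : A -> A -> A),
     in_NL k br ->
     exists L : local_loop R, in_G k L /\ is_tangent_algebra L br).
Proof.
split=> [L A br|A br]; first exact: part_i.
exact: part_ii.
Qed.
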